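(* Let $T=(V,E,F)$ be a triangulation of a surface. Suppose $\phi:|T|\to\mathbb C$ is a geodesic homeomorphism and $\phi':|T|\to\mathbb C$ is a geodesic embedding, with induced PL metrics $l=l(\phi)$ and $l'=l(\phi')$, such that (a) $l$ and $l'$ are both uniformly nondegenerate; (b) $l$ is uniformly Delaunay and $l'$ is Delaunay; (c) $l'=u*l$ for some $u\in\mathbb R^V$. Then $u$ is constant on $V$, i.e. $l$ and $l'$ differ by a constant scaling.
   Context: $T=(V,E,F)$ is a simplicial triangulation of a surface with vertex set $V$, edge set $E$, face set $F$; $|T|$ is its underlying space. A PL metric on $T$ is a function $l:E\to\mathbb R_{>0}$ such that for every face $\triangle ijk\in F$ the numbers $l_{ij},l_{jk},l_{ik}$ are side lengths of a nondegenerate Euclidean triangle. For $u\in\mathbb R^V$, $u*l$ denotes the function $(u*l)_{ij}=e^{(u_i+u_j)/2}l_{ij}$; two PL metrics $l,l'$ are discretely conformal if $l'=u*l$ for some $u\in\mathbb R^V$. Given a PL metric $l$, $\theta^i_{jk}$ denotes the inner angle at $i$ of the Euclidean triangle $\triangle ijk$ with side lengths given by $l$. The metric $l$ is uniformly nondegenerate (with constant $\epsilon>0$) if $\theta^i_{jk}\ge\epsilon$ for all faces and all corners; Delaunay if $\theta^{k_1}_{ij}+\theta^{k_2}_{ij}\le\pi$ for every pair of adjacent triangles $\triangle ijk_1,\triangle ijk_2\in F$; uniformly Delaunay if there is $\epsilon>0$ with $\theta^{k_1}_{ij}+\theta^{k_2}_{ij}\le\pi-\epsilon$ for every such pair. A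 map $\phi:|T|\to\mathbb C$ is a geodesic embedding if it maps each edge $ij$ to the straight segment between $\phi(i)$ and $\phi(j)$ and maps $|T|$ homeomorphically onto its image; it is a geodesic homeomorphism if moreover it is surjective onto $\mathbb C$. A geodesic embedding $\phi$ induces the PL metric $l(\phi)_{ij}=|\phi(i)-\phi(j)|$. *)

(* Defs.v *)
From Stdlib Require Import Reals List ClassicalEpsilon.
From Coquelicot Require Import Coquelicot.
Open Scope R_scope.

(* Combinatorial data of a 2-dimensional simplicial complex T=(V,E,F). *)
(* F i j k : the triangle {i,j,k} is a face.  Faces are unordered      *)
(* 3-element sets, so F is invariant under permutations and has       *)
(* pairwise distinct vertices.  Edges are the 2-subsets of faces.      *)

Definition is_edge {V : Type} (F : V -> V -> V -> Prop) (i j : V) : Prop :=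
  exists k, F i j k.

Inductive link_path {V : Type} (F : V -> V -> V -> Prop) (i : V) : V -> V -> Prop :=
| link_refl : forall j, link_path F i j j
| link_step : forall j k m, F i j k -> link_path F i k m -> link_path F i j m.

Inductive edge_path {V : Type} (F : V -> V -> V -> Prop) : V -> V -> Prop :=
| epath_refl : forall j, edge_path F j j
| epath_step : forall j k m, is_edge F j k -> edge_path F k m -> edge_path F j m.

(* T is a (simplicial) triangulation of a (connected) surface, possibly
   with boundary: faces are 3-sets, every vertex lies in a face, every
   edge lies in at most two faces, every vertex lies in finitely many
   faces, every vertex link is connected (hence a finite path or cycle),
   and the complex is connected. *)
Definition surface_triangulation {V : Type} (F : V -> V -> V -> Prop) : Prop :=
  (forall i j k, F i j k -> F j i k /\ F i k j) /\
  (forall i j k, F i j k -> i <> j /\ j <> k /\ i <> k) /\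
  (forall i, exists j k, F i j k) /\
  (forall i j k1 k2 k3, F i j k1 -> F i j k2 -> F i j k3 ->
       k1 = k2 \/ k1 = k3 \/ k2 = k3) /\
  (forall i, exists s : list V, forall j k, F i j k -> In j s) /\
  (forall i j m, is_edge F i j -> is_edge F i m -> link_path F i j m) /\
  (forall i j, edge_path F i j).

(* The underlying space |T|, realized by barycentric coordinates:      *)
(* a point is a function x : V -> R supported on (a subset of) a face, *)
(* nonnegative, with coordinates summing to 1.  The topology is the    *)
(* one given by the metric sup_v |x v - y v| (for locally finite       *)
(* complexes this is the usual weak topology).                         *)

Definition in_simplex3 {V : Type} (i j k : V) (x : V -> R) : Prop :=
  (forall v, v <> i -> v <> j -> v <> k -> x v = 0) /\
  0 <= x i /\ 0 <= x j /\ 0 <= x k /\ x i + x j + x k = 1.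

Definition in_realization {V : Type} (F : V -> V -> V -> Prop) (x : V -> R) : Prop :=
  exists i j k, F i j k /\ in_simplex3 i j k x.

Definition on_edge {V : Type} (i j : V) (x : V -> R) : Prop :=
  (forall v, v <> i -> v <> j -> x v = 0) /\
  0 <= x i /\ 0 <= x j /\ x i + x j = 1.

Definition vpt {V : Type} (i : V) : V -> R :=
  fun v => if excluded_middle_informative (v = i) then 1 else 0.

Definition in_segment (p q z : C) : Prop :=
  exists t, 0 <= t <= 1 /\ z = (RtoC t * p + RtoC (1 - t) * q)%C.

(* phi : |T| -> C (given on all of V -> R, only its values on |T| matter) *)
Definition geodesic_embedding {V : Type} (F : V -> V -> V -> Prop)
    (phi : (V -> R) -> C) : Prop :=
  (forall i j, is_edge F i j ->
     (forall x, on_edge i j x -> in_segment (phi (vpt i)) (phi (vpt j)) (phi x)) /\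
     (forall z, in_segment (phi (vpt i)) (phi (vpt j)) z ->
        exists x, on_edge i j x /\ phi x = z)) /\
  (forall x y, in_realization F x -> in_realization F y -> phi x = phi y -> x = y) /\
  (forall x, in_realization F x -> forall eps, 0 < eps -> exists delta, 0 < delta /\
     forall y, in_realization F y -> (forall v, Rabs (x v - y v) < delta) ->
       Cmod (phi x - phi y) < eps) /\
  (forall x, in_realization F x -> forall eps, 0 < eps -> exists delta, 0 < delta /\
     forall y, in_realization F y -> Cmod (phi x - phi y) < delta ->
       forall v, Rabs (x v - y v) < eps).

Definition geodesic_homeomorphism {V : Type} (F : V -> V -> V -> Prop)
    (phi : (V -> R) -> C) : Prop :=
  geodesic_embedding F phi /\
  (forall z : C, exists x, in_realization F x /\ phi x = z).

(* PL metrics (edge lengths are represented by l : V -> V -> R; only   *)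
(* its values on edges are relevant).                                  *)

Definition PL_metric {V : Type} (F : V -> V -> V -> Prop) (l : V -> V -> R) : Prop :=
  (forall i j, is_edge F i j -> 0 < l i j /\ l i j = l j i) /\
  (forall i j k, F i j k -> l i j < l j k + l i k).

Definition induced_metric {V : Type} (phi : (V -> R) -> C) : V -> V -> R :=
  fun i j => Cmod (phi (vpt i) - phi (vpt j)).

Definition conf_change {V : Type} (u : V -> R) (l : V -> V -> R) : V -> V -> R :=
  fun i j => exp ((u i + u j) / 2) * l i j.

(* inner angle at i of the triangle ijk with side lengths from l
   (law of cosines) *)
Definition angle {V : Type} (l : V -> V -> R) (i j k : V) : R :=
  acos ((l i j ^ 2 + l i k ^ 2 - l j k ^ 2) / (2 * l i j * l i k)).

Definition uniformly_nondegenerate {V : Type} (F : V -> V -> V -> Prop)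
    (l : V -> V -> R) : Prop :=
  exists eps, 0 < eps /\ forall i j k, F i j k -> eps <= angle l i j k.

Definition delaunay {V : Type} (F : V -> V -> V -> Prop) (l : V -> V -> R) : Prop :=
  forall i j k1 k2, F i j k1 -> F i j k2 -> k1 <> k2 ->
    angle l k1 i j + angle l k2 i j <= PI.

Definition uniformly_delaunay {V : Type} (F : V -> V -> V -> Prop)
    (l : V -> V -> R) : Prop :=
  exists eps, 0 < eps /\ forall i j k1 k2, F i j k1 -> F i j k2 -> k1 <> k2 ->
    angle l k1 i j + angle l k2 i j <= PI - eps.

(* Main.v *)
Require Import Defs.
From Stdlib Require Import Reals List Lra Lia ClassicalEpsilon Classical FunctionalExtensionality FinFun.
From Coquelicot Require Import Coquelicot.
Open Scope R_scope.

(** Join [l] to [l'] by the path of conformal factors [u(t)] with [e^{-u(t)} = 1 - t + t e^{-u}],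
    along which the triangles stay fat and Delaunay. The angles at a vertex add up to [2 PI] at both
    ends, so integrating their variation gives [sum_j A i j = 0] with antisymmetric edge fluxes [A i j]
    comparable to [u i - u j]: [u] and [- u] solve a uniformly elliptic equation on a fat
    triangulation of the plane.  Caccioppoli's inequality for [e^{u}] and [e^{-u}], combined with a
    length-area argument on circles, bounds [e^{u}] and [e^{-u}] at a vertex by their mean over a disc.
    A second length-area argument (disjoint shells of the image each need a fixed proportion of the
    area of the disc, so there are boundedly many) shows that the vertex map [phi i |-> phi' i] has
    bounded distortion on discs; together these bound [|u|]. Finally the energy [S(r)] of the bounded
    function [u] on the disc of radius [r] is bounded and satisfies [S(r)^2 <= K (S(c r) - S(r))],
    hence vanishes. *)

(** * Finite sums *)

(** The image of [phi'] may be a proper domain, and this shapes the bounds on [u]. An upper bound at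
    a vertex uses discs of the first plane, all of which are covered by triangles; a lower bound is
    the same estimate for [- u] in the second plane, where a disc must first be shown to be covered.
    [dichotomy] settles this: either the triangles near a base vertex fill the image disc, or a
    connected set of vertices with small image leaves the given disc of the first plane, and then
    the length-area bound applies. The path is chosen so that, with [s = e^{-u}] and
    [x = 1 - t + t s], one has [u_i' - u_j' = (s_j - s_i) / (x_i x_j)]: the factor [s_j - s_i]
    leaves the integral over [t], and a symmetric edge weight remains. Uniform Delaunayness at
    [t = 0] alone keeps the integrated weight away from zero. Integrals over discs are finite sums
    over faces; the only integrals taken over families of circles or lines are those of indicators
    of intervals. *)

Definition lsum {A : Type} (L : list A) (f : A -> R) : R :=
  fold_right (fun x s => f x + s) 0 L.

Definition ind (P : Prop) : R := if excluded_middle_informative P then 1 else 0.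

Lemma ind_true (P : Prop) : P -> ind P = 1.
Proof. intros H. unfold ind. destruct (excluded_middle_informative P); tauto. Qed.

Lemma ind_false (P : Prop) : ~ P -> ind P = 0.
Proof. intros H. unfold ind. destruct (excluded_middle_informative P); tauto. Qed.

Lemma ind_bounds (P : Prop) : 0 <= ind P <= 1.
Proof. unfold ind. destruct (excluded_middle_informative P); lra. Qed.

Lemma ind_impl (P Q : Prop) : (P -> Q) -> ind P <= ind Q.
Proof.
  intros H. unfold ind.
  destruct (excluded_middle_informative P), (excluded_middle_informative Q);
    try lra; tauto.
Qed.

Lemma ind_iff (P Q : Prop) : (P <-> Q) -> ind P = ind Q.
Proof. intros H. apply Rle_antisym; apply ind_impl; tauto. Qed.

Section ListSums.
Context {A : Type}.
Implicit Types (L : list A) (f g : A -> R).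

Lemma lsum_cons x L f : lsum (x :: L) f = f x + lsum L f.
Proof. reflexivity. Qed.

Lemma lsum_ext L f g : (forall x, In x L -> f x = g x) -> lsum L f = lsum L g.
Proof.
  induction L as [|x L IH]; intros H; simpl; [reflexivity|].
  rewrite H by (left; reflexivity). f_equal. apply IH. intros y Hy. apply H. now right.
Qed.

Lemma lsum_le L f g : (forall x, In x L -> f x <= g x) -> lsum L f <= lsum L g.
Proof.
  induction L as [|x L IH]; intros H; simpl; [lra|].
  apply Rplus_le_compat; [apply H; now left | apply IH; intros; apply H; now right].
Qed.

Lemma lsum_0 L : lsum L (fun _ => 0) = 0.
Proof. induction L as [|x L IH]; simpl; lra. Qed.

Lemma lsum_nonneg L f : (forall x, In x L -> 0 <= f x) -> 0 <= lsum L f.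
Proof. intros H. rewrite <- (lsum_0 L). now apply lsum_le. Qed.

Lemma lsum_zero L f : (forall x, In x L -> f x = 0) -> lsum L f = 0.
Proof. intros H. rewrite <- (lsum_0 L). now apply lsum_ext. Qed.

Lemma lsum_plus L f g : lsum L (fun x => f x + g x) = lsum L f + lsum L g.
Proof. induction L as [|x L IH]; simpl; lra. Qed.

Lemma lsum_minus L f g : lsum L (fun x => f x - g x) = lsum L f - lsum L g.
Proof. induction L as [|x L IH]; simpl; lra. Qed.

Lemma lsum_scal L f c : lsum L (fun x => c * f x) = c * lsum L f.
Proof. induction L as [|x L IH]; simpl; [ring|]. rewrite IH. ring. Qed.

Lemma lsum_app L L' f : lsum (L ++ L') f = lsum L f + lsum L' f.
Proof. induction L as [|x L IH]; simpl; lra. Qed.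

Lemma lsum_In_le L f x : (forall y, In y L -> 0 <= f y) -> In x L -> f x <= lsum L f.
Proof.
  induction L as [|y L IH]; intros H Hx; [destruct Hx|]. simpl.
  destruct Hx as [->|Hx].
  - assert (0 <= lsum L f) by (apply lsum_nonneg; intros; apply H; now right). lra.
  - assert (0 <= f y) by (apply H; now left).
    assert (f x <= lsum L f) by (apply IH; auto; intros; apply H; now right). lra.
Qed.

Lemma lsum_filter (P : A -> bool) L f :
  lsum (filter P L) f = lsum L (fun x => (if P x then 1 else 0) * f x).
Proof.
  induction L as [|y L IH]; simpl; [reflexivity|].
  destruct (P y); simpl; rewrite IH; ring.
Qed.

Lemma lsum_map {B : Type} (h : B -> A) (L : list B) f :
  lsum (map h L) f = lsum L (fun x => f (h x)).
Proof. induction L as [|y L IH]; simpl; [reflexivity|]. now rewrite IH. Qed.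

Lemma lsum_incl_le L L' f : NoDup L -> incl L L' ->
  (forall y, In y L' -> 0 <= f y) -> lsum L f <= lsum L' f.
Proof.
  revert L'. induction L as [|x L IH]; intros L' HN HI Hf; simpl.
  - now apply lsum_nonneg.
  - inversion HN as [|? ? Hx HN']; subst.
    destruct (in_split x L') as [l1 [l2 ->]]; [apply HI; now left|].
    rewrite lsum_app, lsum_cons.
    assert (lsum L f <= lsum (l1 ++ l2) f).
    { apply IH; auto.
      - intros y Hy. assert (Hy' : In y (l1 ++ x :: l2)) by (apply HI; now right).
        apply in_app_iff in Hy'. apply in_app_iff.
        destruct Hy' as [?|[->|?]]; auto. contradiction.
      - intros y Hy. apply Hf. apply in_app_iff in Hy. apply in_app_iff. simpl. tauto. }
    rewrite lsum_app in H. lra.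
Qed.

Lemma lsum_ind_unique (P : A -> Prop) L : NoDup L ->
  (forall x y, In x L -> In y L -> P x -> P y -> x = y) ->
  lsum L (fun x => ind (P x)) <= 1.
Proof.
  induction L as [|x L IH]; intros HN H; simpl; [lra|].
  inversion HN as [|? ? Hx HN']; subst.
  destruct (excluded_middle_informative (P x)) as [Px|Px].
  - rewrite (ind_true _ Px). rewrite lsum_zero; [lra|].
    intros y Hy. apply ind_false. intros Py.
    assert (x = y) by (apply H; simpl; auto). now subst.
  - rewrite (ind_false _ Px).
    assert (lsum L (fun x => ind (P x)) <= 1); [|lra].
    apply IH; auto. intros; apply H; simpl; auto.
Qed.

Lemma lsum_CS L f g :
  (lsum L (fun x => f x * g x)) ^ 2 <= lsum L (fun x => f x ^ 2) * lsum L (fun x => g x ^ 2).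
Proof.
  induction L as [|x L IH]; simpl; [lra|].
  set (a := f x) in *. set (b := g x) in *.
  assert (H1 : 0 <= lsum L (fun x => f x * (f x * 1))) by (apply lsum_nonneg; intros; nra).
  assert (H2 : 0 <= lsum L (fun x => g x * (g x * 1))) by (apply lsum_nonneg; intros; nra).
  simpl in IH.
  set (p := lsum L (fun x => f x * (f x * 1))) in *.
  set (q := lsum L (fun x => g x * (g x * 1))) in *.
  set (s := lsum L (fun x => f x * g x)) in *.
  (* The cross term: expand [(a * q - b * s)^2 >= 0] and insert [s^2 <= p * q]; if [q = 0] then
     [s = 0]. *)
  assert (H3 : 2 * (a * b) * s <= a * a * q + b * b * p).
  { destruct (Req_dec q 0) as [Hq|Hq].
    - assert (s = 0) by nra. nra.
    - assert (0 < q) by lra.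
      assert (0 <= (a * q - b * s) ^ 2) by apply pow2_ge_0.
      assert (b * b * (s * s) <= b * b * (p * q)) by (apply Rmult_le_compat_l; nra).
      apply Rmult_le_reg_l with q; nra. }
  nra.
Qed.

End ListSums.

Lemma lsum_swap {A B : Type} (L : list A) (L' : list B) (f : A -> B -> R) :
  lsum L (fun x => lsum L' (fun y => f x y)) = lsum L' (fun y => lsum L (fun x => f x y)).
Proof.
  induction L as [|x L IH]; simpl.
  - symmetry. apply lsum_0.
  - rewrite IH, <- lsum_plus. reflexivity.
Qed.

Lemma lsum_list_prod {A B : Type} (L : list A) (L' : list B) (f : A * B -> R) :
  lsum (list_prod L L') f = lsum L (fun x => lsum L' (fun y => f (x, y))).
Proof.
  induction L as [|x L IH]; simpl; [reflexivity|].
  rewrite lsum_app, IH, lsum_map. reflexivity.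
Qed.

Lemma NoDup_list_prod {A B : Type} (L : list A) (L' : list B) :
  NoDup L -> NoDup L' -> NoDup (list_prod L L').
Proof.
  intros HL HL'. induction HL as [|x L Hx HL IH]; simpl; [constructor|].
  apply NoDup_app; auto.
  - apply FinFun.Injective_map_NoDup; auto. intros u v E. now injection E.
  - intros [u v] Hu Hv. apply in_map_iff in Hu. destruct Hu as [w [E _]]. injection E as E _.
    apply in_prod_iff in Hv. subst. tauto.
Qed.

Lemma is_RInt_lsum {A : Type} (L : list A) (f : A -> R -> R) (v : A -> R) a b :
  (forall x, In x L -> is_RInt (f x) a b (v x)) ->
  is_RInt (fun c => lsum L (fun x => f x c)) a b (lsum L v).
Proof.
  induction L as [|x L IH]; intros H; simpl.
  - pose proof (is_RInt_const (V := R_NormedModule) a b 0) as K.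
    unfold scal in K; simpl in K; unfold mult in K; simpl in K.
    now rewrite Rmult_0_r in K.
  - apply (is_RInt_plus (V := R_NormedModule)); [apply H; now left | apply IH; intros; apply H; now right].
Qed.

(** The integral ignores endpoints, so values are prescribed on the open interval only; the
    indicators below may then be open or closed. *)
Lemma is_RInt_const_open (f : R -> R) (o a b : R) : a <= b ->
  (forall c, a < c < b -> f c = o) -> is_RInt f a b (o * (b - a)).
Proof.
  intros Hab H.
  apply (is_RInt_ext (V := R_NormedModule) (fun _ => o)).
  - rewrite Rmin_left, Rmax_right by lra. intros c Hc. symmetry. now apply H.
  - rewrite Rmult_comm. apply (is_RInt_const (V := R_NormedModule)).
Qed.

Lemma is_RInt_interval_indicator (P : R -> Prop) (o a b p q : R) : a <= p <= q -> q <= b ->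
  (forall c, p < c < q -> P c) -> (forall c, a < c < p -> ~ P c) -> (forall c, q < c < b -> ~ P c) ->
  is_RInt (fun c => ind (P c) * o) a b (o * (q - p)).
Proof.
  intros Hp Hq H1 H2 H3.
  replace (o * (q - p)) with (plus (0 * (p - a)) (plus (o * (q - p)) (0 * (b - q))))
    by (unfold plus; simpl; ring).
  apply (is_RInt_Chasles (V := R_NormedModule)) with p.
  - apply is_RInt_const_open; [lra|]. intros c Hc. rewrite ind_false by auto. ring.
  - apply (is_RInt_Chasles (V := R_NormedModule)) with q.
    + apply is_RInt_const_open; [lra|]. intros c Hc. rewrite ind_true by auto. ring.
    + apply is_RInt_const_open; [lra|]. intros c Hc. rewrite ind_false by auto. ring.
Qed.

(** * Weighted families of intervals *)

Section WeightedIntervals.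
Context {A : Type} (L : list A) (lo hi o : A -> R) (a b delta : R).
Hypothesis Hab : a <= b.
Hypothesis Ho : forall x, In x L -> 0 <= o x.

(** Integrate the hypothesis over [c]: the indicator of an interval integrates to its length.
    Applied once in each coordinate, this bounds an area by a multiplicity. *)
Lemma weighted_intervals_high :
  (forall x, In x L -> a <= lo x <= hi x /\ hi x <= b) ->
  (forall c, a < c < b -> lsum L (fun x => ind (lo x < c < hi x) * o x) <= delta) ->
  lsum L (fun x => o x * (hi x - lo x)) <= delta * (b - a).
Proof.
  intros Hlh H.
  assert (H1 : is_RInt (fun c => lsum L (fun x => ind (lo x < c < hi x) * o x)) a b
                 (lsum L (fun x => o x * (hi x - lo x)))).
  { apply is_RInt_lsum. intros x Hx. destruct (Hlh x Hx).
    apply is_RInt_interval_indicator; auto; intros; lra. }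
  assert (H2 : is_RInt (fun _ => delta) a b (delta * (b - a)))
    by (apply is_RInt_const_open; auto).
  now apply (is_RInt_le _ _ _ _ _ _ Hab H1 H2).
Qed.

(** The same integration from below. Here the intervals are closed and may stick out of [[a, b]]. *)
Lemma weighted_intervals_low :
  (forall x, In x L -> lo x <= hi x) ->
  (forall c, a < c < b -> delta <= lsum L (fun x => ind (lo x <= c <= hi x) * o x)) ->
  delta * (b - a) <= lsum L (fun x => o x * (hi x - lo x)).
Proof.
  intros Hlh H.
  (* Truncation to [[a, b]] keeps the part of each interval that the integral sees and can only
     shorten the interval. *)
  set (cl := fun y => Rmax a (Rmin y b)).
  assert (Hcl : forall y, a <= cl y <= b /\ (a <= y <= b -> cl y = y)
      /\ (y < a -> cl y = a) /\ (b < y -> cl y = b)).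
  { intros y. unfold cl, Rmax, Rmin. repeat destruct (Rle_dec _ _); repeat split; intros; lra. }
  assert (H1 : is_RInt (fun c => lsum L (fun x => ind (lo x <= c <= hi x) * o x)) a b
                 (lsum L (fun x => o x * (cl (hi x) - cl (lo x))))).
  { apply is_RInt_lsum. intros x Hx. specialize (Hlh x Hx).
    destruct (Hcl (lo x)) as [E1 [E2 [E3 E4]]]. destruct (Hcl (hi x)) as [F1 [F2 [F3 F4]]].
    destruct (Rlt_dec (lo x) a); destruct (Rlt_dec b (lo x));
    destruct (Rlt_dec (hi x) a); destruct (Rlt_dec b (hi x));
    try rewrite E2 by lra; try rewrite E3 by lra; try rewrite E4 by lra;
    try rewrite F2 by lra; try rewrite F3 by lra; try rewrite F4 by lra; try lra;
    apply is_RInt_interval_indicator; intros; lra. }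
  assert (H2 : is_RInt (fun _ => delta) a b (delta * (b - a)))
    by (apply is_RInt_const_open; auto).
  apply Rle_trans with (lsum L (fun x => o x * (cl (hi x) - cl (lo x)))).
  - now apply (is_RInt_le _ _ _ _ _ _ Hab H2 H1).
  - apply lsum_le. intros x Hx. apply Rmult_le_compat_l; [now apply Ho|].
    specialize (Hlh x Hx). unfold cl, Rmax, Rmin. repeat destruct (Rle_dec _ _); lra.
Qed.

End WeightedIntervals.

(** Covering means multiplicity at least one. Typical use: the jumps of a function along a chain
    cover the interval between two of its values, so they add up to at least the difference. *)
Lemma interval_cover_length {A : Type} (L : list A) (lo hi : A -> R) (a b : R) :
  a <= b -> (forall x, In x L -> lo x <= hi x) ->
  (forall c, a < c < b -> exists x, In x L /\ lo x <= c <= hi x) ->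
  b - a <= lsum L (fun x => hi x - lo x).
Proof.
  intros Hab Hlh H.
  replace (b - a) with (1 * (b - a)) by ring.
  rewrite (lsum_ext L (fun x => hi x - lo x) (fun x => 1 * (hi x - lo x))) by (intros; ring).
  apply (weighted_intervals_low L lo hi (fun _ => 1)); auto.
  - intros; lra.
  - intros c Hc. destruct (H c Hc) as [x [Hx Hx']].
    rewrite <- (ind_true _ Hx') at 1.
    rewrite <- (Rmult_1_r (ind (lo x <= c <= hi x))).
    apply (lsum_In_le L (fun x => ind (lo x <= c <= hi x) * 1)); auto.
    intros y _. destruct (ind_bounds (lo y <= c <= hi y)). lra.
Qed.

(** * Plane geometry *)

Lemma Rabs_le_of_sqr (x d : R) : 0 <= d -> x ^ 2 <= d ^ 2 -> Rabs x <= d.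
Proof.
  intros Hd H. rewrite <- (Rabs_pos_eq d) by auto. apply Rsqr_le_abs_0. unfold Rsqr. lra.
Qed.

Definition dst (p q : C) : R := Cmod (p - q).

Lemma dst_sqr (p q : C) : dst p q ^ 2 = (fst p - fst q) ^ 2 + (snd p - snd q) ^ 2.
Proof.
  unfold dst, Cmod. rewrite pow2_sqrt; [|nra].
  destruct p, q; simpl; ring.
Qed.

Lemma dst_nonneg (p q : C) : 0 <= dst p q.
Proof. apply Cmod_ge_0. Qed.

Lemma dst_sym (p q : C) : dst p q = dst q p.
Proof. unfold dst. rewrite <- Cmod_opp. f_equal. ring. Qed.

Lemma dst_refl (p : C) : dst p p = 0.
Proof. unfold dst. replace (p - p)%C with (RtoC 0) by ring. apply Cmod_0. Qed.

Lemma dst_tri (p q r : C) : dst p r <= dst p q + dst q r.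
Proof. unfold dst. replace (p - r)%C with ((p - q) + (q - r))%C by ring. apply Cmod_triangle. Qed.

Lemma dst_pos (p q : C) : p <> q -> 0 < dst p q.
Proof.
  intros H. apply Cmod_gt_0. intros E. apply H.
  replace p with ((p - q) + q)%C by ring. rewrite E. ring.
Qed.

Lemma dst_le_iff (p q : C) (c : R) : 0 <= c ->
  dst p q <= c <-> (fst p - fst q) ^ 2 + (snd p - snd q) ^ 2 <= c ^ 2.
Proof. intros Hc. rewrite <- dst_sqr. pose proof (dst_nonneg p q). split; nra. Qed.

Lemma dst_fst (p q : C) : Rabs (fst p - fst q) <= dst p q.
Proof. apply Rabs_le_of_sqr; [apply dst_nonneg|]. rewrite dst_sqr.
  pose proof (pow2_ge_0 (fst p - fst q)). pose proof (pow2_ge_0 (snd p - snd q)). lra.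
Qed.

Lemma dst_snd (p q : C) : Rabs (snd p - snd q) <= dst p q.
Proof. apply Rabs_le_of_sqr; [apply dst_nonneg|]. rewrite dst_sqr.
  pose proof (pow2_ge_0 (fst p - fst q)). pose proof (pow2_ge_0 (snd p - snd q)). lra.
Qed.

Lemma dst_le_sum (p q : C) : dst p q <= Rabs (fst p - fst q) + Rabs (snd p - snd q).
Proof.
  pose proof (Rabs_pos (fst p - fst q)). pose proof (Rabs_pos (snd p - snd q)).
  apply dst_le_iff; [lra|].
  rewrite <- (pow2_abs (fst p - fst q)), <- (pow2_abs (snd p - snd q)). nra.
Qed.

(** Twice the signed area of the triangle [pqr]. *)
Definition crs (p q r : C) : R :=
  (fst q - fst p) * (snd r - snd p) - (snd q - snd p) * (fst r - fst p).

Lemma crs_cyc (p q r : C) : crs q r p = crs p q r.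
Proof. unfold crs; ring. Qed.

Lemma crs_swap (p q r : C) : crs p r q = - crs p q r.
Proof. unfold crs; ring. Qed.

(** Lagrange's identity: the squares of the cross and dot products add up to the product of the
    squared lengths. *)
Lemma crs_abs_le (p q r : C) : Rabs (crs p q r) <= dst p q * dst p r.
Proof.
  pose proof (dst_nonneg p q). pose proof (dst_nonneg p r).
  pose proof (dst_sqr p q). pose proof (dst_sqr p r).
  assert (H3 : Rsqr (crs p q r) <= Rsqr (dst p q * dst p r)).
  { unfold Rsqr.
    replace (dst p q * dst p r * (dst p q * dst p r)) with (dst p q ^ 2 * dst p r ^ 2) by ring.
    rewrite H1, H2. unfold crs.
    set (a := fst p). set (b := snd p). set (c := fst q). set (d := snd q).
    set (e := fst r). set (f := snd r).
    assert (0 <= ((c - a) * (e - a) + (d - b) * (f - b)) ^ 2) by apply pow2_ge_0. nra. }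
  apply Rsqr_le_abs_0 in H3. rewrite (Rabs_pos_eq (dst p q * dst p r)) in H3; [auto|nra].
Qed.

(* The barycentric coordinate of [z] at the vertex [p] of the triangle [pqr]. *)
Definition bc (p q r z : C) : R := crs z q r / crs p q r.

Lemma bc_swap (p q r z : C) : bc p r q z = bc p q r z.
Proof.
  unfold bc. rewrite (crs_swap z), (crs_swap p).
  destruct (Req_dec (crs p q r) 0) as [E|E].
  - rewrite E. rewrite Ropp_0. unfold Rdiv. rewrite Rinv_0. ring.
  - field. auto.
Qed.

Section Barycentric.
Context (p q r : C) (Hne : crs p q r <> 0).

Lemma bc_sum (z : C) : bc p q r z + bc q r p z + bc r p q z = 1.
Proof.
  unfold bc. rewrite (crs_cyc p q r), <- (crs_cyc r p q).
  unfold crs in *. field. auto.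
Qed.

Lemma bc_fst (z : C) : fst z = bc p q r z * fst p + bc q r p z * fst q + bc r p q z * fst r.
Proof.
  unfold bc. rewrite (crs_cyc p q r), <- (crs_cyc r p q).
  unfold crs in *. field. auto.
Qed.

Lemma bc_snd (z : C) : snd z = bc p q r z * snd p + bc q r p z * snd q + bc r p q z * snd r.
Proof.
  unfold bc. rewrite (crs_cyc p q r), <- (crs_cyc r p q).
  unfold crs in *. field. auto.
Qed.

Lemma bc_affine (a b c : R) (x y w z : C) : a + b + c = 1 ->
  fst z = a * fst x + b * fst y + c * fst w ->
  snd z = a * snd x + b * snd y + c * snd w ->
  bc p q r z = a * bc p q r x + b * bc p q r y + c * bc p q r w.
Proof.
  intros H H1 H2. unfold bc.
  replace (crs z q r) with (a * crs x q r + b * crs y q r + c * crs w q r).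
  - field. auto.
  - unfold crs. rewrite H1, H2. replace a with (1 - b - c) by lra. ring.
Qed.

Lemma bc_self : bc p q r p = 1.
Proof. unfold bc. field. auto. Qed.

Lemma bc_other1 : bc p q r q = 0.
Proof. unfold bc. replace (crs q q r) with 0 by (unfold crs; ring). unfold Rdiv; ring. Qed.

Lemma bc_other2 : bc p q r r = 0.
Proof. unfold bc. replace (crs r q r) with 0 by (unfold crs; ring). unfold Rdiv; ring. Qed.

(** [bc p q r] is the signed distance to the line [qr] divided by the height over [qr], so its
    Lipschitz constant is the inverse of that height. *)
Lemma bc_lip (z z' : C) :
  Rabs (bc p q r z - bc p q r z') <= dst z z' * dst q r / Rabs (crs p q r).
Proof.
  assert (Hp : 0 < Rabs (crs p q r)) by now apply Rabs_pos_lt.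
  unfold bc. replace (crs z q r / crs p q r - crs z' q r / crs p q r)
    with ((crs z q r - crs z' q r) / crs p q r) by (field; auto).
  unfold Rdiv at 1. rewrite Rabs_mult, Rabs_inv.
  apply Rmult_le_compat_r; [left; now apply Rinv_0_lt_compat|].
  pose proof (dst_nonneg z z'). pose proof (dst_nonneg q r).
  pose proof (dst_sqr z z'). pose proof (dst_sqr q r).
  assert (H3 : Rsqr (crs z q r - crs z' q r) <= Rsqr (dst z z' * dst q r)).
  { unfold Rsqr.
    replace (dst z z' * dst q r * (dst z z' * dst q r)) with (dst z z' ^ 2 * dst q r ^ 2) by ring.
    rewrite H1, H2.
    replace (crs z q r - crs z' q r) with
      ((fst z - fst z') * (snd q - snd r) - (snd z - snd z') * (fst q - fst r))
      by (unfold crs; ring).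
    set (a := fst z - fst z'). set (b := snd z - snd z').
    set (c := fst q - fst r). set (d := snd q - snd r).
    assert (0 <= (a * c + b * d) ^ 2) by apply pow2_ge_0. nra. }
  apply Rsqr_le_abs_0 in H3. rewrite (Rabs_pos_eq (dst z z' * dst q r)) in H3; [auto|nra].
Qed.

End Barycentric.

Definition pt3 (p q r : C) (a b c : R) : C :=
  (a * fst p + b * fst q + c * fst r, a * snd p + b * snd q + c * snd r).

Lemma bc_pt3 (p q r : C) (a b c : R) : crs p q r <> 0 -> a + b + c = 1 ->
  bc p q r (pt3 p q r a b c) = a /\ bc q r p (pt3 p q r a b c) = b /\
  bc r p q (pt3 p q r a b c) = c.
Proof.
  intros H H1.
  assert (H' : crs q r p <> 0) by now rewrite crs_cyc.
  assert (H'' : crs r p q <> 0) by now rewrite <- crs_cyc.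
  repeat split.
  - rewrite (bc_affine p q r H a b c p q r) by auto.
    rewrite bc_self, bc_other1, bc_other2 by auto. ring.
  - rewrite (bc_affine q r p H' a b c p q r) by auto.
    rewrite bc_self, bc_other1, bc_other2 by auto. ring.
  - rewrite (bc_affine r p q H'' a b c p q r) by auto.
    rewrite bc_self, bc_other1, bc_other2 by auto. ring.
Qed.

Lemma pt3_bc (p q r z : C) : crs p q r <> 0 ->
  z = pt3 p q r (bc p q r z) (bc q r p z) (bc r p q z).
Proof.
  intros H. rewrite (surjective_pairing z) at 1. unfold pt3.
  now rewrite <- bc_fst, <- bc_snd.
Qed.

Definition inT (p q r z : C) : Prop := 0 <= bc p q r z /\ 0 <= bc q r p z /\ 0 <= bc r p q z.

Lemma inT_cyc (p q r z : C) : inT p q r z -> inT q r p z.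
Proof. unfold inT. tauto. Qed.

Lemma inT_swap (p q r z : C) : inT p q r z -> inT p r q z.
Proof.
  unfold inT. rewrite (bc_swap p q r), (bc_swap r p q), (bc_swap q r p). tauto.
Qed.

Lemma inT_vertex (p q r : C) : crs p q r <> 0 -> inT p q r p.
Proof.
  intros H.
  assert (H' : crs q r p <> 0) by now rewrite crs_cyc.
  assert (H'' : crs r p q <> 0) by now rewrite <- crs_cyc.
  unfold inT. rewrite bc_self, bc_other2, bc_other1 by auto. lra.
Qed.

Lemma dst_pt3_le (p q r z : C) (a b c M : R) :
  0 <= a -> 0 <= b -> 0 <= c -> a + b + c = 1 ->
  dst z p <= M -> dst z q <= M -> dst z r <= M -> dst z (pt3 p q r a b c) <= M.
Proof.
  intros Ha Hb Hc Hs Hp Hq Hr.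
  assert (E : (z - pt3 p q r a b c)%C =
     (RtoC a * (z - p) + (RtoC b * (z - q) + RtoC c * (z - r)))%C).
  { replace c with (1 - a - b) by lra. unfold pt3.
    destruct z, p, q, r. unfold RtoC, Cminus, Cplus, Copp, Cmult. simpl. f_equal; ring. }
  unfold dst in *. rewrite E.
  eapply Rle_trans; [apply Cmod_triangle|].
  eapply Rle_trans; [apply Rplus_le_compat_l, Cmod_triangle|].
  rewrite !Cmod_mult, !Cmod_R, !Rabs_pos_eq by auto. nra.
Qed.

Lemma inT_dst_le (p q r z w : C) (M : R) : crs p q r <> 0 -> inT p q r w ->
  dst z p <= M -> dst z q <= M -> dst z r <= M -> dst z w <= M.
Proof.
  intros H (H1 & H2 & H3) Hp Hq Hr.
  rewrite (pt3_bc p q r w) by auto. apply dst_pt3_le; auto. now apply bc_sum.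
Qed.

(** * Continuous functions and paths *)

Lemma continuity_Rmax (f g : R -> R) : continuity f -> continuity g ->
  continuity (fun t => Rmax (f t) (g t)).
Proof.
  intros Hf Hg.
  assert (H : continuity ((f + g + comp Rabs (f - g)) * (fct_cte (/ 2)))%F).
  { apply continuity_mult; [|apply continuity_const; intros x y; reflexivity].
    apply continuity_plus; [now apply continuity_plus|].
    apply continuity_comp; [now apply continuity_minus | apply Rcontinuity_abs]. }
  intros x. apply continuity_pt_ext with (2 := H x).
  intros t. unfold mult_fct, plus_fct, comp, minus_fct, fct_cte.
  unfold Rmax, Rabs. destruct (Rle_dec _ _), (Rcase_abs _); lra.
Qed.

Lemma continuity_Rmin (f g : R -> R) : continuity f -> continuity g ->
  continuity (fun t => Rmin (f t) (g t)).
Proof.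
  intros Hf Hg.
  assert (H : continuity (- (fun t => Rmax ((- f)%F t) ((- g)%F t)))%F).
  { apply continuity_opp. apply continuity_Rmax; now apply continuity_opp. }
  intros x. apply continuity_pt_ext with (2 := H x).
  intros t. unfold opp_fct. unfold Rmin, Rmax. repeat destruct (Rle_dec _ _); lra.
Qed.

(** The value [-1] on the empty list only has to be negative, so that [0 <= lmax] always has a
    witness in the list. The maximum turns a finite union of sets [0 <= g x] into one such set. *)
Definition lmax {A : Type} (L : list A) (g : A -> R) : R :=
  fold_right (fun x m => Rmax (g x) m) (-1) L.

Lemma lmax_nonneg {A : Type} (L : list A) (g : A -> R) :
  0 <= lmax L g <-> exists x, In x L /\ 0 <= g x.
Proof.
  induction L as [|x L IH]; simpl.
  - split; [lra | intros [x [[] _]]].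
  - split.
    + intros H. unfold Rmax in H. destruct (Rle_dec (g x) (lmax L g)).
      * apply IH in H. destruct H as [y [Hy Hy']]. exists y. auto.
      * exists x. auto.
    + intros [y [[->|Hy] Hy']].
      * eapply Rle_trans; [apply Hy' | apply Rmax_l].
      * eapply Rle_trans; [|apply Rmax_r]. apply IH. eauto.
Qed.

Lemma continuity_lmax {A : Type} (L : list A) (g : A -> R -> R) :
  (forall x, In x L -> continuity (g x)) -> continuity (fun t => lmax L (fun x => g x t)).
Proof.
  induction L as [|x L IH]; intros H; simpl.
  - apply continuity_const. intros u v. reflexivity.
  - apply continuity_Rmax; [apply H; now left | apply IH; intros; apply H; now right].
Qed.

(** Connectedness of [[a, b]]. At a zero of the difference of the two maxima both have the same
    sign, and one of them is nonnegative because the sets cover. *)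
Lemma closed_cover_meet {A : Type} (U1 U2 : list A) (g : A -> R -> R) (a b : R) :
  a <= b -> (forall x, continuity (g x)) ->
  (forall t, a <= t <= b -> exists x, (In x U1 \/ In x U2) /\ 0 <= g x t) ->
  (exists x, In x U1 /\ 0 <= g x a) -> (exists x, In x U2 /\ 0 <= g x b) ->
  exists t x y, a <= t <= b /\ In x U1 /\ In y U2 /\ 0 <= g x t /\ 0 <= g y t.
Proof.
  intros Hab Hg Hcov Ha Hb.
  set (G1 := fun t => lmax U1 (fun x => g x t)).
  set (G2 := fun t => lmax U2 (fun x => g x t)).
  assert (HG : forall t, a <= t <= b -> 0 <= G1 t \/ 0 <= G2 t).
  { intros t Ht. destruct (Hcov t Ht) as [x [[Hx|Hx] Hx']].
    - left. apply lmax_nonneg. eauto.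
    - right. apply lmax_nonneg. eauto. }
  assert (Hfin : forall t, a <= t <= b -> 0 <= G1 t -> 0 <= G2 t ->
    exists t x y, a <= t <= b /\ In x U1 /\ In y U2 /\ 0 <= g x t /\ 0 <= g y t).
  { intros t Ht H1 H2. apply lmax_nonneg in H1, H2.
    destruct H1 as [x [? ?]], H2 as [y [? ?]]. exists t, x, y. auto. }
  apply lmax_nonneg in Ha. apply lmax_nonneg in Hb. fold (G1 a) in Ha. fold (G2 b) in Hb.
  destruct (Rle_lt_dec 0 (G2 a)) as [Ha2|Ha2]; [apply (Hfin a); auto; lra|].
  destruct (Rle_lt_dec 0 (G1 b)) as [Hb1|Hb1]; [apply (Hfin b); auto; lra|].
  assert (Hlt : a < b) by (destruct Hab; auto; subst; lra).
  assert (Hc : continuity (G2 - G1)%F).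
  { apply continuity_minus; apply continuity_lmax; auto. }
  destruct (IVT (G2 - G1)%F a b Hc Hlt) as [t [Ht Et]]; unfold minus_fct in *; try lra.
  destruct (HG t Ht); apply (Hfin t); auto; lra.
Qed.

(** The supremum of the times where [f] is nonnegative; it serves as the last exit time from a
    closed set. *)
Lemma last_nonneg (f : R -> R) (a b : R) : continuity f -> a < b -> 0 <= f a -> f b < 0 ->
  exists c, a <= c < b /\ 0 <= f c /\ forall x, c < x <= b -> f x < 0.
Proof.
  intros Hf Hab Ha Hb.
  destruct (completeness (fun x => a <= x <= b /\ 0 <= f x)) as [c [Hc1 Hc2]].
  - exists b. intros x [Hx _]. lra.
  - exists a. split; [lra|auto].
  - assert (Hca : a <= c) by (apply Hc1; split; [lra|auto]).
    assert (Hcb : c <= b) by (apply Hc2; intros x [Hx _]; lra).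
    assert (Hfc : 0 <= f c).
    { destruct (Rle_lt_dec 0 (f c)) as [H|H]; auto. exfalso.
      destruct (Hf c (- f c)) as [d [Hd Hd']]; [lra|].
      assert (c <= c - d / 2 \/ c = a) as [H1|H1].
      { destruct (Req_dec c a) as [|Hne]; [now right|]. left.
        apply Hc2. intros x [Hx Hx'].
        destruct (Rle_lt_dec x (c - d / 2)); auto. exfalso.
        assert (x <= c) by (apply Hc1; split; auto).
        destruct (Req_dec x c) as [->|Hxc]; [lra|].
        assert (Hdx : R_dist (f x) (f c) < - f c).
        { apply Hd'. split; [split; [exact I|lra]|].
          simpl. unfold R_dist. rewrite Rabs_left; lra. }
        unfold R_dist in Hdx. apply Rabs_def2 in Hdx. lra. }
      - lra.
      - subst. lra. }
    exists c. split.
    + split; auto. destruct Hcb as [H|H]; auto. subst. lra.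
    + split; auto. intros x Hx. destruct (Rle_lt_dec 0 (f x)); auto.
      assert (x <= c) by (apply Hc1; split; [lra|auto]). lra.
Qed.

Definition cpath (g : R -> C) : Prop :=
  continuity (fun t => fst (g t)) /\ continuity (fun t => snd (g t)).

Lemma continuity_bc (p q r : C) (g : R -> C) : cpath g -> continuity (fun t => bc p q r (g t)).
Proof.
  intros [H1 H2].
  assert (H : continuity
    ((((fct_cte (fst q) - (fun t => fst (g t))) * (fct_cte (snd r) - (fun t => snd (g t)))
     - (fct_cte (snd q) - (fun t => snd (g t))) * (fct_cte (fst r) - (fun t => fst (g t))))
     * fct_cte (/ crs p q r))%F)).
  { assert (Hk : forall k, continuity (fct_cte k))
      by (intros k; apply continuity_const; intros u v; reflexivity).
    apply continuity_mult; auto.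
    apply continuity_minus; apply continuity_mult; apply continuity_minus; auto. }
  intros x. apply continuity_pt_ext with (2 := H x). intros t. reflexivity.
Qed.

(** Nonnegative exactly on the closed triangle, which puts membership in the form needed by [lmax]
    and [last_nonneg]. *)
Definition mb (p q r z : C) : R := Rmin (bc p q r z) (Rmin (bc q r p z) (bc r p q z)).

Lemma mb_nonneg (p q r z : C) : 0 <= mb p q r z <-> inT p q r z.
Proof.
  unfold mb, inT, Rmin. repeat destruct (Rle_dec _ _); split; intros; repeat split; lra.
Qed.

Lemma continuity_mb (p q r : C) (g : R -> C) : cpath g -> continuity (fun t => mb p q r (g t)).
Proof.
  intros H. unfold mb. repeat apply continuity_Rmin; now apply continuity_bc.
Qed.

Lemma cpath_line (p q : C) :
  cpath (fun t => ((1 - t) * fst p + t * fst q, (1 - t) * snd p + t * snd q)).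
Proof.
  split; simpl; intros t; apply derivable_continuous_pt; reg.
Qed.

Lemma cpath_circle (p : C) (r : R) : cpath (fun t => (fst p + r * cos t, snd p + r * sin t)).
Proof.
  split; simpl; intros t; apply derivable_continuous_pt; reg.
Qed.

(** * Sperner's lemma *)

(* Signed crossing number of an oriented edge with labels [x], [y] over the edge [01];
   its circulation around a triangle is nonzero only if all three labels occur. *)
Definition e01 (x y : nat) : Z :=
  match x, y with
  | 0%nat, 1%nat => 1%Z
  | 1%nat, 0%nat => (-1)%Z
  | _, _ => 0%Z
  end.

Lemma e01_anti (x y : nat) : e01 y x = (- e01 x y)%Z.
Proof. destruct x as [|[|x]], y as [|[|y]]; reflexivity. Qed.

Lemma e01_circ (x y z : nat) : (x < 3 -> y < 3 -> z < 3 ->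
  ~ (exists s t w, (s = x \/ s = y \/ s = z) /\ (t = x \/ t = y \/ t = z) /\
       (w = x \/ w = y \/ w = z) /\ s = 0 /\ t = 1 /\ w = 2) ->
  (e01 x y + e01 y z + e01 z x)%Z = 0%Z)%nat.
Proof.
  intros Hx Hy Hz H.
  destruct x as [|[|[|x]]], y as [|[|[|y]]], z as [|[|[|z]]]; try lia; try reflexivity;
    exfalso; apply H; exists 0%nat, 1%nat, 2%nat; tauto.
Qed.

Fixpoint zsum (f : nat -> Z) (n : nat) : Z :=
  match n with O => 0%Z | S m => (zsum f m + f m)%Z end.

(** The three labels are asked to occur in one unit square of the grid rather than at the corners of
    one small triangle: only their closeness is used. *)
Definition full_cell (n : nat) (L : nat -> nat -> nat) (a b : nat) : Prop :=
  (exists a0 b0 a1 b1 a2 b2,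
    (a <= a0 <= a + 1 /\ b <= b0 <= b + 1) /\
    (a <= a1 <= a + 1 /\ b <= b1 <= b + 1) /\
    (a <= a2 <= a + 1 /\ b <= b2 <= b + 1) /\
    a0 + b0 <= n /\ a1 + b1 <= n /\ a2 + b2 <= n /\
    L a0 b0 = 0 /\ L a1 b1 = 1 /\ L a2 b2 = 2)%nat.

(** If no cell is full, the circulation of [e01] vanishes around every small triangle, hence around
    the large one. The left side lacks label 0 and the bottom side lacks label 1, so they contribute
    nothing. The diagonal carries only the labels 0 and 1; there [e01] telescopes, from label 0 at
    [(n, 0)] to label 1 at [(0, n)], so the total is not zero. *)
Lemma sperner (n : nat) (L : nat -> nat -> nat) : (0 < n)%nat ->
  (forall a b, a + b <= n ->
     L a b = 0 /\ 0 < a \/ L a b = 1 /\ 0 < b \/ L a b = 2 /\ a + b < n)%nat ->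
  exists a b, full_cell n L a b.
Proof.
  intros Hn HL.
  destruct (excluded_middle_informative (exists a b, full_cell n L a b)) as [|Hno]; auto.
  exfalso.
  assert (Hlt : forall a b, (a + b <= n -> L a b < 3)%nat).
  { intros a b H. destruct (HL a b H) as [[E _]|[[E _]|[E _]]]; lia. }
  assert (Hcirc : forall a b a0 b0 a1 b1 a2 b2,
    (a <= a0 <= a + 1 -> b <= b0 <= b + 1 -> a <= a1 <= a + 1 -> b <= b1 <= b + 1 ->
     a <= a2 <= a + 1 -> b <= b2 <= b + 1 ->
     a0 + b0 <= n -> a1 + b1 <= n -> a2 + b2 <= n ->
     (e01 (L a0 b0) (L a1 b1) + e01 (L a1 b1) (L a2 b2) + e01 (L a2 b2) (L a0 b0))%Z = 0%Z)%nat).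
  { intros a b a0 b0 a1 b1 a2 b2 H1 H2 H3 H4 H5 H6 H7 H8 H9.
    apply e01_circ; auto.
    intros (s & t & w & Hs & Ht & Hw & Es & Et & Ew).
    apply Hno. exists a, b.
    assert (Hp : forall c, (c = L a0 b0 \/ c = L a1 b1 \/ c = L a2 b2 ->
      exists a' b', a <= a' <= a + 1 /\ b <= b' <= b + 1 /\ a' + b' <= n /\ L a' b' = c)%nat).
    { intros c [E|[E|E]]; [exists a0, b0|exists a1, b1|exists a2, b2]; repeat split; lia. }
    destruct (Hp s Hs) as (x0 & y0 & ? & ? & ? & ?).
    destruct (Hp t Ht) as (x1 & y1 & ? & ? & ? & ?).
    destruct (Hp w Hw) as (x2 & y2 & ? & ? & ? & ?).
    exists x0, y0, x1, y1, x2, y2. repeat split; lia. }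
  set (bot := fun b a => e01 (L a b) (L (S a) b)).
  (* Circulation around the part of the strip between rows [b] and [b + 1] that lies left of column
     [a]. *)
  assert (Hstrip : forall b a, (a + b + 1 <= n)%nat ->
    (zsum (bot b) a + e01 (L a b) (L a (S b)) - zsum (bot (S b)) a
       + e01 (L 0%nat (S b)) (L 0%nat b) = 0)%Z).
  { intros b a. induction a as [|a IH]; intros Ha.
    - simpl. rewrite (e01_anti (L 0%nat b)). lia.
    - simpl. specialize (IH ltac:(lia)).
      pose proof (Hcirc a b a b (S a) b a (S b)) as H1.
      pose proof (Hcirc a b (S a) b (S a) (S b) a (S b)) as H2.
      specialize (H1 ltac:(lia) ltac:(lia) ltac:(lia) ltac:(lia) ltac:(lia) ltac:(lia)
        ltac:(lia) ltac:(lia) ltac:(lia)).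
      specialize (H2 ltac:(lia) ltac:(lia) ltac:(lia) ltac:(lia) ltac:(lia) ltac:(lia)
        ltac:(lia) ltac:(lia) ltac:(lia)).
      unfold bot in *.
      rewrite (e01_anti (L a b) (L a (S b))) in H1.
      rewrite (e01_anti (L (S a) b) (L a (S b))) in H2.
      rewrite (e01_anti (L a (S b)) (L (S a) (S b))) in H2. lia. }
  assert (Hleft : forall b, (b + 1 <= n)%nat -> e01 (L 0%nat (S b)) (L 0%nat b) = 0%Z).
  { intros b Hb.
    destruct (HL 0%nat b ltac:(lia)) as [[E H]|[[E H]|[E H]]]; try lia; rewrite E;
    destruct (HL 0%nat (S b) ltac:(lia)) as [[E' H']|[[E' H']|[E' H']]]; try lia; rewrite E';
    reflexivity. }
  (* One more triangle, at the diagonal, closes the strip. *)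
  assert (Hrow : forall b, (b + 1 <= n)%nat ->
    (zsum (bot b) (n - b)%nat = zsum (bot (S b)) (n - S b)%nat
       - e01 (L (n - b)%nat b) (L (n - S b)%nat (S b)))%Z).
  { intros b Hb. pose proof (Hstrip b (n - S b)%nat ltac:(lia)) as H.
    rewrite (Hleft b Hb) in H.
    pose proof (Hcirc (n - S b)%nat b (n - S b)%nat b (S (n - S b)) b (n - S b)%nat (S b)) as H1.
    specialize (H1 ltac:(lia) ltac:(lia) ltac:(lia) ltac:(lia) ltac:(lia) ltac:(lia)
        ltac:(lia) ltac:(lia) ltac:(lia)).
    replace (n - b)%nat with (S (n - S b)) by lia. simpl. unfold bot in *.
    rewrite (e01_anti (L (n - S b)%nat b) (L (n - S b)%nat (S b))) in H1. lia. }
  assert (Hdiag : forall b, (b <= n)%nat ->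
    (L (n - b) b < 2)%nat).
  { intros b Hb. destruct (HL (n - b)%nat b ltac:(lia)) as [[E H]|[[E H]|[E H]]]; lia. }
  assert (Htot : forall b, (b <= n)%nat ->
    (zsum (bot 0%nat) n = zsum (bot b) (n - b)%nat
       - (Z.of_nat (L (n - b)%nat b) - Z.of_nat (L n 0%nat)))%Z).
  { induction b as [|b IH]; intros Hb.
    - replace (n - 0)%nat with n by lia. lia.
    - rewrite IH by lia. rewrite Hrow by lia.
      pose proof (Hdiag b ltac:(lia)). pose proof (Hdiag (S b) ltac:(lia)).
      destruct (L (n - b)%nat b) as [|[|x]], (L (n - S b)%nat (S b)) as [|[|y]];
        simpl e01; lia. }
  assert (Hbot : forall a, (a <= n)%nat -> zsum (bot 0%nat) a = 0%Z).
  { induction a as [|a IH]; intros Ha; simpl; auto.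
    rewrite IH by lia. unfold bot.
    destruct (HL a 0%nat ltac:(lia)) as [[E H]|[[E H]|[E H]]]; try lia; rewrite E;
    destruct (HL (S a) 0%nat ltac:(lia)) as [[E' H']|[[E' H']|[E' H']]]; try lia; rewrite E';
    reflexivity. }
  specialize (Htot n ltac:(lia)). rewrite Hbot in Htot by lia.
  replace (n - n)%nat with 0%nat in Htot by lia. simpl in Htot.
  destruct (HL 0%nat n ltac:(lia)) as [[E H]|[[E H]|[E H]]]; try lia.
  destruct (HL n 0%nat ltac:(lia)) as [[E' H']|[[E' H']|[E' H']]]; lia.
Qed.

(** * Face images of geodesic embeddings *)

Definition simp2 (a b : R) : Prop := 0 <= a /\ 0 <= b /\ a + b <= 1.

Section TriangleCover.
Context (p q r : C) (Hne : crs p q r <> 0) (f : R -> R -> C).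
Hypothesis Hcont : forall a b, simp2 a b -> forall eps, 0 < eps -> exists d, 0 < d /\
  forall a' b', simp2 a' b' -> Rabs (a - a') < d -> Rabs (b - b') < d -> dst (f a b) (f a' b') < eps.
Hypothesis Hp : forall b, simp2 0 b -> bc p q r (f 0 b) = 0.
Hypothesis Hq : forall a, simp2 a 0 -> bc q r p (f a 0) = 0.
Hypothesis Hr : forall a, simp2 a (1 - a) -> bc r p q (f a (1 - a)) = 0.

Lemma bc_neg_nbhd (p' q' r' : C) (beta a b : R) : crs p' q' r' <> 0 -> simp2 a b ->
  bc p' q' r' (f a b) < beta -> exists d, 0 < d /\
  forall a' b', simp2 a' b' -> Rabs (a - a') < d -> Rabs (b - b') < d ->
    bc p' q' r' (f a' b') < beta.
Proof.
  intros Hn Hs Hlt.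
  assert (Hcp : 0 < Rabs (crs p' q' r')) by now apply Rabs_pos_lt.
  set (K := (dst q' r' + 1) / Rabs (crs p' q' r')).
  pose proof (dst_nonneg q' r').
  assert (HK : 0 < K) by (apply Rdiv_lt_0_compat; lra).
  destruct (Hcont a b Hs ((beta - bc p' q' r' (f a b)) / K)) as [d [Hd Hd']].
  { apply Rdiv_lt_0_compat; lra. }
  exists d. split; auto. intros a' b' Hs' Ha Hb.
  specialize (Hd' a' b' Hs' Ha Hb).
  pose proof (bc_lip p' q' r' Hn (f a' b') (f a b)) as Hl.
  rewrite dst_sym in Hl.
  assert (dst (f a b) (f a' b') * dst q' r' / Rabs (crs p' q' r') <= dst (f a b) (f a' b') * K).
  { unfold K, Rdiv. rewrite Rmult_assoc. apply Rmult_le_compat_l; [apply dst_nonneg|].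
    apply Rmult_le_compat_r; [left; now apply Rinv_0_lt_compat|lra]. }
  assert (dst (f a b) (f a' b') * K < beta - bc p' q' r' (f a b)).
  { apply Rmult_lt_reg_r with (/ K); [now apply Rinv_0_lt_compat|].
    rewrite Rmult_assoc, Rinv_r, Rmult_1_r by lra. exact Hd'. }
  assert (bc p' q' r' (f a' b') - bc p' q' r' (f a b) <= Rabs (bc p' q' r' (f a' b') - bc p' q' r' (f a b)))
    by apply Rle_abs. lra.
Qed.

(** If [z] is missed, then at every point of the simplex some coordinate of [f] is strictly below
    that of [z], because coordinates sum to 1, and the same coordinate works nearby. Label the
    points of a fine grid by a coordinate in which the image is at least that of [z]. Sperner's
    lemma yields a small cell with all three labels, where no single coordinate can be below that of
    [z] throughout. The sides only have to be mapped into the lines that carry them. *)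
Lemma triangle_covered (z : C) : inT p q r z -> exists a b, simp2 a b /\ f a b = z.
Proof.
  intros Hz.
  destruct (excluded_middle_informative (exists a b, simp2 a b /\ f a b = z)) as [|Hno]; auto.
  exfalso. destruct Hz as (Z0 & Z1 & Z2).
  assert (Hne1 : crs q r p <> 0) by now rewrite crs_cyc.
  assert (Hne2 : crs r p q <> 0) by now rewrite <- crs_cyc.
  set (B := fun (m : nat) (w : C) => match m with
     0%nat => bc p q r w | 1%nat => bc q r p w | _ => bc r p q w end).
  assert (HBs : forall w, B 0%nat w + B 1%nat w + B 2%nat w = 1) by (intros w; now apply bc_sum).
  assert (Hneg : forall a b, simp2 a b -> exists m, (m < 3)%nat /\ B m (f a b) < B m z).
  { intros a b Hs.
    destruct (Rlt_dec (B 0%nat (f a b)) (B 0%nat z)); [exists 0%nat; auto|].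
    destruct (Rlt_dec (B 1%nat (f a b)) (B 1%nat z)); [exists 1%nat; auto|].
    destruct (Rlt_dec (B 2%nat (f a b)) (B 2%nat z)); [exists 2%nat; auto|].
    exfalso. apply Hno. exists a, b. split; auto.
    pose proof (HBs z). pose proof (HBs (f a b)). simpl in *.
    rewrite (pt3_bc p q r z), (pt3_bc p q r (f a b)) by auto.
    f_equal; lra. }
  (* The radius is doubled to absorb the mesh: a cell point lies within [d] of a point that is
     itself within the radius of a centre, and [d] is at most that radius. *)
  assert (Hloc : forall a b, exists d : posreal, simp2 a b -> exists m, (m < 3)%nat /\
     forall a' b', simp2 a' b' -> Rabs (a - a') < 2 * d -> Rabs (b - b') < 2 * d ->
       B m (f a' b') < B m z).
  { intros a b. destruct (excluded_middle_informative (simp2 a b)) as [Hs|Hs].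
    - destruct (Hneg a b Hs) as [m [Hm Hlt]].
      assert (exists d, 0 < d /\ forall a' b', simp2 a' b' ->
        Rabs (a - a') < d -> Rabs (b - b') < d -> B m (f a' b') < B m z) as [d [Hd Hd']].
      { destruct m as [|[|m]]; apply bc_neg_nbhd; auto. }
      assert (Hd2 : 0 < d / 2) by lra.
      exists (mkposreal _ Hd2). intros _. exists m. split; auto. simpl.
      intros a' b' Hs' H1 H2. apply Hd'; auto; lra.
    - exists (mkposreal 1 Rlt_0_1). tauto. }
  set (dl := fun a b => proj1_sig (constructive_indefinite_description _ (Hloc a b))).
  assert (Hdl : forall a b, simp2 a b -> exists m, (m < 3)%nat /\
     forall a' b', simp2 a' b' -> Rabs (a - a') < 2 * dl a b -> Rabs (b - b') < 2 * dl a b ->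
       B m (f a' b') < B m z).
  { intros a b. unfold dl. destruct (constructive_indefinite_description _ (Hloc a b)); auto. }
  (* outside the closed simplex the radius is taken small enough to avoid it *)
  assert (Hdp : forall a b, 0 < if Rlt_dec 1 (a + b) then (a + b - 1) / 2 else dl a b).
  { intros a b. destruct (Rlt_dec 1 (a + b)); [lra | apply cond_pos]. }
  set (delta := fun a b => mkposreal _ (Hdp a b)).
  destruct (compactness_value_2d 0 1 0 1 delta) as [d Hd].
  destruct (archimed_cor1 d (cond_pos d)) as [n [Hn Hn0]].
  assert (HnR : 0 < INR n) by (apply lt_0_INR; lia).
  set (X := fun a : nat => INR a / INR n).
  assert (HX0 : forall a, 0 <= X a) by (intros a; apply Rmult_le_pos; [apply pos_INR | left; now apply Rinv_0_lt_compat]).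
  assert (HX1 : forall a b, (a + b <= n)%nat -> simp2 (X a) (X b)).
  { intros a b H. repeat split; auto. unfold X.
    replace (INR a / INR n + INR b / INR n) with (INR (a + b) / INR n)
      by (rewrite plus_INR; field; lra).
    apply Rmult_le_reg_r with (INR n); auto. unfold Rdiv. rewrite Rmult_assoc, Rinv_l, Rmult_1_r, Rmult_1_l by lra.
    now apply le_INR. }
  (* Labels 0 and 1 are allowed only off the sides on which their coordinate vanishes; label 2 is
     the default and is justified afterwards by the sum of the coordinates. *)
  set (Lb := fun a b : nat =>
    if excluded_middle_informative ((0 < a)%nat /\ B 0%nat z <= B 0%nat (f (X a) (X b))) then 0%nat
    else if excluded_middle_informative ((0 < b)%nat /\ B 1%nat z <= B 1%nat (f (X a) (X b))) then 1%nat
    else 2%nat).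
  destruct (sperner n Lb Hn0) as [a [b (a0 & b0 & a1 & b1 & a2 & b2 & H0 & H1 & H2 & S0 & S1 & S2 & L0 & L1 & L2)]].
  { intros a b Hab. unfold Lb.
    destruct (excluded_middle_informative _) as [[E _]|E0]; [left; auto|right].
    destruct (excluded_middle_informative _) as [[E _]|E1]; [left; auto|right].
    split; auto.
    destruct (Nat.eq_dec (a + b) n) as [E|E]; [|lia]. exfalso.
    assert (HXb : X b = 1 - X a) by (unfold X; rewrite <- E, plus_INR; field; rewrite <- plus_INR, E; lra).
    assert (E2 : B 2%nat (f (X a) (X b)) = 0).
    { rewrite HXb. simpl. apply Hr. rewrite <- HXb. auto. }
    pose proof (HBs z). pose proof (HBs (f (X a) (X b))).
    assert (Ea : a = 0%nat -> B 0%nat (f (X a) (X b)) = 0).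
    { intros ->. assert (EX : X 0%nat = 0) by (unfold X; simpl; unfold Rdiv; ring).
      rewrite EX. simpl. apply Hp. rewrite <- EX. auto. }
    assert (Eb : b = 0%nat -> B 1%nat (f (X a) (X b)) = 0).
    { intros ->. assert (EX : X 0%nat = 0) by (unfold X; simpl; unfold Rdiv; ring).
      rewrite EX. simpl. apply Hq. rewrite <- EX. auto. }
    assert (F0 : a <> 0%nat -> B 0%nat (f (X a) (X b)) < B 0%nat z).
    { intros H3. apply Rnot_le_lt. intros H4. apply E0. split; [lia|auto]. }
    assert (F1 : b <> 0%nat -> B 1%nat (f (X a) (X b)) < B 1%nat z).
    { intros H3. apply Rnot_le_lt. intros H4. apply E1. split; [lia|auto]. }
    simpl in *.
    destruct (Nat.eq_dec a 0), (Nat.eq_dec b 0);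
      repeat match goal with
      | H : ?P -> _, H' : ?P |- _ => specialize (H H')
      end; try lia; lra. }
  assert (G0 : B 0%nat z <= B 0%nat (f (X a0) (X b0))).
  { unfold Lb in L0. destruct (excluded_middle_informative _) as [[_ E]|E0]; auto.
    destruct (excluded_middle_informative _); discriminate. }
  assert (G1 : B 1%nat z <= B 1%nat (f (X a1) (X b1))).
  { unfold Lb in L1. destruct (excluded_middle_informative _) as [[_ E]|E0]; [discriminate|].
    destruct (excluded_middle_informative _) as [[_ E]|E1]; [auto|discriminate]. }
  assert (G2 : B 2%nat z <= B 2%nat (f (X a2) (X b2))).
  { unfold Lb in L2. destruct (excluded_middle_informative _) as [[_ E]|E0]; [discriminate|].
    destruct (excluded_middle_informative _) as [[_ E]|E1]; [discriminate|].
    pose proof (HBs z). pose proof (HBs (f (X a2) (X b2))).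
    assert (F0 : B 0%nat (f (X a2) (X b2)) <= B 0%nat z).
    { destruct (Nat.eq_dec a2 0) as [->|Ha].
      - assert (E : X 0%nat = 0) by (unfold X; simpl; unfold Rdiv; ring).
        rewrite E. simpl. rewrite Hp; auto. rewrite <- E. auto.
      - left. apply Rnot_le_lt. intros H5. apply E0. split; [lia|auto]. }
    assert (F1 : B 1%nat (f (X a2) (X b2)) <= B 1%nat z).
    { destruct (Nat.eq_dec b2 0) as [->|Ha].
      - assert (E : X 0%nat = 0) by (unfold X; simpl; unfold Rdiv; ring).
        rewrite E. simpl. rewrite Hq; auto. rewrite <- E. auto.
      - left. apply Rnot_le_lt. intros H5. apply E1. split; [lia|auto]. }
    lra. }
  assert (HS0 : simp2 (X a0) (X b0)) by auto.
  apply (Hd (X a0) (X b0)); [destruct HS0 as (?&?&?); lra | destruct HS0 as (?&?&?); lra |].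
  intros (u & v & Hu & Hv & Hxu & Hyv & Hdd). simpl in Hxu, Hyv, Hdd.
  destruct (Rlt_dec 1 (u + v)) as [Huv|Huv].
  - apply Rabs_def2 in Hxu, Hyv. destruct HS0 as (?&?&?). lra.
  - destruct (Hdl u v) as [m [Hm Hlt]]; [repeat split; lra|].
    assert (Hnear : forall c c' : nat, (c' <= c + 1)%nat -> (c <= c' + 1)%nat -> Rabs (X c - X c') < d).
    { intros c c' Hc Hc'. unfold X.
      replace (INR c / INR n - INR c' / INR n) with ((INR c - INR c') * / INR n) by (field; lra).
      rewrite Rabs_mult, (Rabs_pos_eq (/ INR n)) by (left; now apply Rinv_0_lt_compat).
      apply Rle_lt_trans with (1 * / INR n); [|lra].
      apply Rmult_le_compat_r; [left; now apply Rinv_0_lt_compat|].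
      apply le_INR in Hc, Hc'. rewrite plus_INR in Hc, Hc'. simpl in Hc, Hc'. apply Rabs_le. lra. }
    assert (Huse : forall a' b', (a' + b' <= n)%nat -> (a <= a' <= a + 1)%nat ->
       (b <= b' <= b + 1)%nat -> B m (f (X a') (X b')) < B m z).
    { intros a' b' Hs Ha Hb. apply Hlt; auto.
      - pose proof (Hnear a0 a' ltac:(lia) ltac:(lia)) as H5.
        apply Rabs_def2 in H5. apply Rabs_def2 in Hxu. apply Rabs_def1; lra.
      - pose proof (Hnear b0 b' ltac:(lia) ltac:(lia)) as H5.
        apply Rabs_def2 in H5. apply Rabs_def2 in Hyv. apply Rabs_def1; lra. }
    destruct m as [|[|[|m]]]; [| | |lia].
    + specialize (Huse a0 b0 S0 ltac:(lia) ltac:(lia)). lra.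
    + specialize (Huse a1 b1 S1 ltac:(lia) ltac:(lia)). lra.
    + specialize (Huse a2 b2 S2 ltac:(lia) ltac:(lia)). lra.
Qed.

End TriangleCover.

Section FaceImages.
Context {V : Type} (F : V -> V -> V -> Prop) (phi : (V -> R) -> C).
Implicit Types (i j k : V) (x y : V -> R).
Hypothesis HS : surface_triangulation F.
Hypothesis HE : geodesic_embedding F phi.
Hypothesis Hnd : forall i j k, F i j k -> crs (phi (vpt i)) (phi (vpt j)) (phi (vpt k)) <> 0.

Notation psi i := (phi (vpt i)).

Definition sx (i j k : V) (a b : R) : V -> R := fun v =>
  if excluded_middle_informative (v = i) then a else
  if excluded_middle_informative (v = j) then b else
  if excluded_middle_informative (v = k) then 1 - a - b else 0.

Lemma F_swap12 i j k : F i j k -> F j i k.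
Proof. apply HS. Qed.

Lemma F_swap23 i j k : F i j k -> F i k j.
Proof. apply HS. Qed.

Lemma F_cyc i j k : F i j k -> F j k i.
Proof. intros H. apply F_swap23, F_swap12, H. Qed.

Lemma F_neq i j k : F i j k -> i <> j /\ j <> k /\ i <> k.
Proof. apply HS. Qed.

Lemma sx_simplex i j k a b : F i j k -> simp2 a b -> in_simplex3 i j k (sx i j k a b).
Proof.
  intros Hf (H1 & H2 & H3). destruct (F_neq i j k Hf) as (N1 & N2 & N3).
  unfold in_simplex3, sx.
  repeat split; intros; repeat destruct (excluded_middle_informative _); subst; try tauto; lra.
Qed.

Lemma sx_eta i j k x : in_simplex3 i j k x -> x = sx i j k (x i) (x j).
Proof.
  intros (H0 & H1 & H2 & H3 & H4). extensionality v. unfold sx.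
  repeat destruct (excluded_middle_informative _); subst; auto. lra.
Qed.

Lemma simplex_real i j k x : F i j k -> in_simplex3 i j k x -> in_realization F x.
Proof. intros. exists i, j, k. auto. Qed.

Lemma simplex_swap12 i j k x : in_simplex3 i j k x -> in_simplex3 j i k x.
Proof. intros (H0 & H1 & H2 & H3 & H4). repeat split; auto; lra. Qed.

Lemma simplex_swap23 i j k x : in_simplex3 i j k x -> in_simplex3 i k j x.
Proof. intros (H0 & H1 & H2 & H3 & H4). repeat split; auto; lra. Qed.

Lemma simplex_cyc i j k x : in_simplex3 i j k x -> in_simplex3 j k i x.
Proof. intros. now apply simplex_swap23, simplex_swap12. Qed.

Lemma phi_inj x y : in_realization F x -> in_realization F y -> phi x = phi y -> x = y.
Proof. apply HE. Qed.

Lemma face_map_continuous i j k : F i j k ->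
  forall a b, simp2 a b -> forall eps, 0 < eps -> exists d, 0 < d /\
  forall a' b', simp2 a' b' -> Rabs (a - a') < d -> Rabs (b - b') < d ->
    dst (phi (sx i j k a b)) (phi (sx i j k a' b')) < eps.
Proof.
  intros Hf a b Hs eps Heps. destruct HE as (_ & _ & Hc & _).
  destruct (Hc (sx i j k a b) (simplex_real _ _ _ _ Hf (sx_simplex _ _ _ _ _ Hf Hs)) eps Heps)
    as [d [Hd Hd']].
  exists (d / 2). split; [lra|]. intros a' b' Hs' Ha Hb.
  apply Hd'; [apply (simplex_real i j k); auto; now apply sx_simplex|].
  intros v. apply Rabs_def2 in Ha, Hb. unfold sx.
  repeat destruct (excluded_middle_informative _); apply Rabs_def1; lra.
Qed.

Lemma segment_bc (p q r z : C) : crs p q r <> 0 -> in_segment q r z ->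
  bc p q r z = 0 /\ inT p q r z.
Proof.
  intros Hn (t & Ht & ->).
  assert (E : (RtoC t * q + RtoC (1 - t) * r)%C = pt3 p q r 0 t (1 - t)).
  { unfold pt3, RtoC, Cplus, Cmult. destruct q, r. simpl. f_equal; ring. }
  rewrite E. destruct (bc_pt3 p q r 0 t (1 - t) Hn ltac:(ring)) as (E1 & E2 & E3).
  unfold inT. rewrite E1, E2, E3. lra.
Qed.

Lemma bc0_segment (p q r z : C) : crs p q r <> 0 -> inT p q r z -> bc p q r z = 0 ->
  in_segment q r z.
Proof.
  intros Hn (H1 & H2 & H3) H0. pose proof (bc_sum p q r Hn z).
  exists (bc q r p z). split; [lra|].
  rewrite (pt3_bc p q r z) at 1 by auto. rewrite H0.
  replace (bc r p q z) with (1 - bc q r p z) by lra.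
  unfold pt3, RtoC, Cplus, Cmult. destruct q, r. simpl. f_equal; ring.
Qed.

Lemma simplex_zero_edge i j k x : F i j k -> in_simplex3 i j k x -> x i = 0 -> on_edge j k x.
Proof.
  intros Hf (H0 & H1 & H2 & H3 & H4) E. repeat split; auto; try lra.
  intros v N1 N2. destruct (classic (v = i)) as [->|N]; auto.
Qed.

Lemma edge_simplex i j k x : F i j k -> on_edge j k x -> in_simplex3 i j k x /\ x i = 0.
Proof.
  intros Hf (H0 & H1 & H2 & H3). destruct (F_neq i j k Hf) as (N1 & N2 & N3).
  assert (x i = 0) by (apply H0; auto). repeat split; auto; lra.
Qed.

Lemma zero_coord_image i j k x : F i j k -> in_simplex3 i j k x -> x i = 0 ->
  bc (psi i) (psi j) (psi k) (phi x) = 0 /\ inT (psi i) (psi j) (psi k) (phi x).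
Proof.
  intros Hf Hx E. apply segment_bc; auto.
  destruct HE as (He & _). apply (He j k); [exists i; now apply F_cyc|].
  now apply (simplex_zero_edge i).
Qed.

(** The edge [jk] already fills the segment between its ends, so injectivity forces the point onto
    that edge. *)
Lemma zero_bc_coord i j k x : F i j k -> in_simplex3 i j k x ->
  inT (psi i) (psi j) (psi k) (phi x) -> bc (psi i) (psi j) (psi k) (phi x) = 0 -> x i = 0.
Proof.
  intros Hf Hx HT E.
  apply bc0_segment in E; auto.
  destruct HE as (He & _). destruct (He j k) as [_ He2]; [exists i; now apply F_cyc|].
  destruct (He2 _ E) as [y [Hy Ey]].
  destruct (edge_simplex i j k y Hf Hy) as [Hy1 Hy2].
  assert (x = y) by (apply phi_inj; auto; eapply simplex_real; eauto). now subst.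
Qed.

(** The edge clause of a geodesic embedding supplies the three side conditions of
    [triangle_covered]. *)
Lemma face_image_sup i j k z : F i j k -> inT (psi i) (psi j) (psi k) z ->
  exists x, in_simplex3 i j k x /\ phi x = z.
Proof.
  intros Hf Hz. destruct (F_neq i j k Hf) as (N1 & N2 & N3).
  destruct (triangle_covered (psi i) (psi j) (psi k) (Hnd _ _ _ Hf)
    (fun a b => phi (sx i j k a b))) with (z := z) as (a & b & Hs & E); auto.
  - now apply face_map_continuous.
  - intros b Hb. apply zero_coord_image; auto; [now apply sx_simplex|].
    unfold sx. destruct (excluded_middle_informative _); tauto.
  - intros a Ha. apply (zero_coord_image j k i); [now apply F_cyc | now apply simplex_cyc, sx_simplex |].
    unfold sx. destruct (excluded_middle_informative (j = i)); [subst; tauto|].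
    destruct (excluded_middle_informative _); tauto.
  - intros a Ha. apply (zero_coord_image k i j); [now apply F_cyc, F_cyc | now apply simplex_cyc, simplex_cyc, sx_simplex |].
    unfold sx. destruct (excluded_middle_informative (k = i)); [subst; tauto|].
    destruct (excluded_middle_informative (k = j)); [subst; tauto|].
    destruct (excluded_middle_informative _); [lra|tauto].
  - exists (sx i j k a b). split; auto. now apply sx_simplex.
Qed.

Lemma coord_zero_inT i j k x : F i j k -> in_simplex3 i j k x ->
  x i = 0 \/ x j = 0 \/ x k = 0 -> inT (psi i) (psi j) (psi k) (phi x).
Proof.
  intros Hf Hx [E|[E|E]].
  - now apply zero_coord_image.
  - do 2 apply inT_cyc. apply (zero_coord_image j k i); auto; [now apply F_cyc | now apply simplex_cyc].
  - apply inT_cyc. apply (zero_coord_image k i j); auto; [now apply F_cyc, F_cyc | now apply simplex_cyc, simplex_cyc].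
Qed.

(** Suppose an interior point of the face is mapped outside the triangle. Join it, inside the open
    face, to a point mapped to the centroid. At the last time in the closed triangle the image lies
    on a side, hence is the image of a point of an edge, contrary to injectivity. *)
Lemma face_image_sub i j k x : F i j k -> in_simplex3 i j k x ->
  inT (psi i) (psi j) (psi k) (phi x).
Proof.
  intros Hf Hx.
  destruct (Rle_lt_dec 0 (mb (psi i) (psi j) (psi k) (phi x))) as [H|Hneg];
    [now apply mb_nonneg|]. exfalso.
  assert (Hnx : ~ inT (psi i) (psi j) (psi k) (phi x)) by (rewrite <- mb_nonneg; lra).
  assert (Hpos : 0 < x i /\ 0 < x j /\ 0 < x k).
  { destruct Hx as (H0 & H1 & H2 & H3 & H4).
    assert (~ (x i = 0 \/ x j = 0 \/ x k = 0))
      by (intros Hc; apply Hnx, coord_zero_inT; auto; repeat split; auto).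
    repeat split; apply Rnot_le_lt; intros Hc; apply H; lra. }
  set (z0 := pt3 (psi i) (psi j) (psi k) (1/3) (1/3) (1/3)).
  destruct (bc_pt3 (psi i) (psi j) (psi k) (1/3) (1/3) (1/3) (Hnd _ _ _ Hf) ltac:(lra)) as (E1 & E2 & E3).
  fold z0 in E1, E2, E3.
  assert (Hz0 : inT (psi i) (psi j) (psi k) z0) by (unfold inT; rewrite E1, E2, E3; lra).
  destruct (face_image_sup i j k z0 Hf Hz0) as [x0 [Hx0 Ex0]].
  assert (Hpos0 : 0 < x0 i /\ 0 < x0 j /\ 0 < x0 k).
  { assert (P1 : x0 i <> 0).
    { intros E. destruct (zero_coord_image i j k x0) as [H _]; auto. rewrite Ex0 in H. lra. }
    assert (P2 : x0 j <> 0).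
    { intros E. destruct (zero_coord_image j k i x0) as [H _]; auto using F_cyc, simplex_cyc. rewrite Ex0 in H. lra. }
    assert (P3 : x0 k <> 0).
    { intros E. destruct (zero_coord_image k i j x0) as [H _]; auto using F_cyc, simplex_cyc. rewrite Ex0 in H. lra. }
    destruct Hx0 as (H0 & H1 & H2 & H3 & H4). repeat split; lra. }
  (* Time is clamped to [[0, 1]] so that the path is defined and continuous on all of [R]. *)
  set (cl := fun t => Rmax 0 (Rmin t 1)).
  assert (Hcl : forall t, 0 <= cl t <= 1).
  { intros t. unfold cl, Rmax, Rmin. repeat destruct (Rle_dec _ _); lra. }
  assert (Hcl2 : forall t t', Rabs (cl t - cl t') <= Rabs (t - t')).
  { intros t t'. unfold cl, Rmax, Rmin, Rabs.
    repeat destruct (Rle_dec _ _); repeat destruct (Rcase_abs _); lra. }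
  set (al := fun t => (1 - cl t) * x0 i + cl t * x i).
  set (be := fun t => (1 - cl t) * x0 j + cl t * x j).
  assert (Hab : forall t, simp2 (al t) (be t) /\ 0 < al t /\ 0 < be t /\ 0 < 1 - al t - be t).
  { intros t. specialize (Hcl t). unfold al, be, simp2.
    destruct Hx as (H0 & H1 & H2 & H3 & H4). destruct Hx0 as (H0' & H1' & H2' & H3' & H4').
    assert (0 < (1 - cl t) * x0 i + cl t * x i) by nra.
    assert (0 < (1 - cl t) * x0 j + cl t * x j) by nra.
    assert (0 < (1 - cl t) * x0 k + cl t * x k) by nra.
    repeat split; nra. }
  set (g := fun t => phi (sx i j k (al t) (be t))).
  assert (Hg : cpath g).
  { assert (Hgc : forall t eps, 0 < eps -> exists d, 0 < d /\
      forall t', Rabs (t' - t) < d -> dst (g t') (g t) < eps).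
    { intros t eps Heps. destruct (Hab t) as [Hst _].
      destruct (face_map_continuous i j k Hf (al t) (be t) Hst eps Heps) as [d [Hd Hd']].
      exists d. split; auto. intros t' Ht'. rewrite dst_sym. apply Hd'; [apply Hab| |].
      - apply Rle_lt_trans with (Rabs (t' - t)); auto.
        replace (al t - al t') with ((cl t - cl t') * (x i - x0 i)) by (unfold al; ring).
        rewrite Rabs_mult, Rabs_minus_sym.
        assert (Rabs (x i - x0 i) <= 1).
        { apply Rabs_le. destruct Hx as (?&?&?&?&?), Hx0 as (?&?&?&?&?). lra. }
        specialize (Hcl2 t' t). pose proof (Rabs_pos (cl t' - cl t)).
        pose proof (Rabs_pos (x i - x0 i)). nra.
      - apply Rle_lt_trans with (Rabs (t' - t)); auto.
        replace (be t - be t') with ((cl t - cl t') * (x j - x0 j)) by (unfold be; ring).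
        rewrite Rabs_mult, Rabs_minus_sym.
        assert (Rabs (x j - x0 j) <= 1).
        { apply Rabs_le. destruct Hx as (?&?&?&?&?), Hx0 as (?&?&?&?&?). lra. }
        specialize (Hcl2 t' t). pose proof (Rabs_pos (cl t' - cl t)).
        pose proof (Rabs_pos (x j - x0 j)). nra. }
    split; intros t; apply continuity_pt_locally; intros eps;
      destruct (Hgc t eps (cond_pos eps)) as [d [Hd Hd']];
      exists (mkposreal d Hd); intros t' Ht';
      (eapply Rle_lt_trans; [|apply (Hd' t' Ht')]); [apply dst_fst | apply dst_snd]. }
  pose proof (continuity_mb (psi i) (psi j) (psi k) g Hg) as Hm.
  assert (Hg0 : g 0 = z0).
  { unfold g, al, be. replace (cl 0) with 0.
    - rewrite <- Ex0. f_equal. etransitivity; [|symmetry; apply (sx_eta i j k x0 Hx0)].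
      f_equal; ring.
    - unfold cl, Rmax, Rmin. repeat destruct (Rle_dec _ _); lra. }
  assert (Hg1 : g 1 = phi x).
  { unfold g, al, be. replace (cl 1) with 1.
    - f_equal. etransitivity; [|symmetry; apply (sx_eta i j k x Hx)]. f_equal; ring.
    - unfold cl, Rmax, Rmin. repeat destruct (Rle_dec _ _); lra. }
  destruct (last_nonneg _ 0 1 Hm Rlt_0_1) as (c & Hc & Hc0 & Hc1).
  { rewrite Hg0. now apply mb_nonneg. }
  { now rewrite Hg1. }
  assert (Hz : mb (psi i) (psi j) (psi k) (g c) <= 0).
  { destruct (Rle_lt_dec (mb (psi i) (psi j) (psi k) (g c)) 0); auto. exfalso.
    destruct (proj1 (continuity_pt_locally _ _) (Hm c) (mkposreal _ r)) as [d Hd].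
    pose proof (cond_pos d). simpl in Hd.
    set (t := Rmin 1 (c + d / 2)).
    assert (Ht : c < t <= 1 /\ t <= c + d / 2) by (unfold t, Rmin; destruct (Rle_dec _ _); lra).
    assert (Hb : Rabs (mb (psi i) (psi j) (psi k) (g t) - mb (psi i) (psi j) (psi k) (g c))
       < mb (psi i) (psi j) (psi k) (g c)).
    { apply Hd. unfold ball; simpl; unfold AbsRing_ball, abs, minus, plus, opp; simpl.
      apply Rabs_def1; lra. }
    specialize (Hc1 t ltac:(lra)). apply Rabs_def2 in Hb. lra. }
  destruct (Hab c) as (Hs & P1 & P2 & P3).
  set (y := sx i j k (al c) (be c)) in *.
  assert (Hy : in_simplex3 i j k y) by now apply sx_simplex.
  assert (HyT : inT (psi i) (psi j) (psi k) (phi y)) by now apply mb_nonneg.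
  destruct (F_neq i j k Hf) as (N1 & N2 & N3).
  assert (Yi : y i = al c).
  { unfold y, sx. destruct (excluded_middle_informative (i = i)); [reflexivity|tauto]. }
  assert (Yj : y j = be c).
  { unfold y, sx. destruct (excluded_middle_informative _); [subst; tauto|].
    destruct (excluded_middle_informative (j = j)); [reflexivity|tauto]. }
  assert (Yk : 0 < y k) by (destruct Hy as (_&_&_&_&Hsum); lra).
  assert (Hor : bc (psi i) (psi j) (psi k) (phi y) = 0 \/ bc (psi j) (psi k) (psi i) (phi y) = 0
     \/ bc (psi k) (psi i) (psi j) (phi y) = 0).
  { destruct HyT as (T1 & T2 & T3). change (g c) with (phi y) in Hz. unfold mb, Rmin in Hz.
    repeat destruct (Rle_dec _ _) in Hz; lra. }
  destruct Hor as [E|[E|E]].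
  - apply zero_bc_coord in E; auto. lra.
  - apply zero_bc_coord in E; auto using F_cyc, simplex_cyc, inT_cyc. lra.
  - apply zero_bc_coord in E; auto using F_cyc, simplex_cyc, inT_cyc. lra.
Qed.

(** By injectivity [z] has one preimage for both faces. Its coordinate at [i] is not zero, since
    otherwise [z] would lie on the side opposite [i], so [i] belongs to the second face too. *)
Lemma triangles_meet_in_face i j k i' j' k' z : F i j k -> F i' j' k' ->
  inT (psi i) (psi j) (psi k) z -> inT (psi i') (psi j') (psi k') z ->
  0 < bc (psi i) (psi j) (psi k) z -> i = i' \/ i = j' \/ i = k'.
Proof.
  intros Hf Hf' HT HT' Hpos.
  destruct (face_image_sup i j k z Hf HT) as [x [Hx Ex]].
  destruct (face_image_sup i' j' k' z Hf' HT') as [x' [Hx' Ex']].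
  assert (x = x') by (apply phi_inj; [exact (simplex_real i j k x Hf Hx)|exact (simplex_real i' j' k' x' Hf' Hx')|congruence]).
  subst x'. assert (Hxi : x i <> 0).
  { intros E. destruct (zero_coord_image i j k x) as [H _]; auto. rewrite Ex in H. lra. }
  destruct Hx' as (H0 & _).
  destruct (classic (i = i' \/ i = j' \/ i = k')) as [|N]; auto.
  exfalso. apply Hxi, H0; tauto.
Qed.

End FaceImages.

Lemma vertex_in_realization {V : Type} (F : V -> V -> V -> Prop) (p : V) :
  surface_triangulation F -> in_realization F (vpt p).
Proof.
  intros (_ & HN & Hv & _). destruct (Hv p) as (j & k & Hf). destruct (HN _ _ _ Hf) as (N1 & N2 & N3).
  exists p, j, k. split; auto. unfold in_simplex3, vpt.
  repeat split; intros; repeat destruct (excluded_middle_informative _); subst; try tauto; try lra.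
Qed.

(** * Consequences of surjectivity onto the plane *)

Section Homeomorphism.
Context {V : Type} (F : V -> V -> V -> Prop) (phi : (V -> R) -> C).
Implicit Types (i j k p q : V) (x y : V -> R).
Hypothesis HS : surface_triangulation F.
Hypothesis HH : geodesic_homeomorphism F phi.
Hypothesis Hnd : forall i j k, F i j k -> crs (phi (vpt i)) (phi (vpt j)) (phi (vpt k)) <> 0.

Notation psi i := (phi (vpt i)).

Lemma triangles_cover z : exists i j k, F i j k /\ inT (psi i) (psi j) (psi k) z.
Proof.
  destruct HH as [HE Hsurj]. destruct (Hsurj z) as [x [(i & j & k & Hf & Hx) <-]].
  exists i, j, k. split; auto. now apply (face_image_sub F phi HS HE Hnd).
Qed.

(** Push the image of the midpoint of [ij] slightly across the edge, away from [k]. By continuity of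
    the inverse the preimage is close to the midpoint, so its face contains [i] and [j]; it is not
    [ijk], because the coordinate at [k] has become negative. *)
Lemma edge_second_face i j k : F i j k -> exists m, m <> k /\ F i j m.
Proof.
  intros Hf. destruct HH as [HE Hsurj].
  destruct (F_neq F HS i j k Hf) as (N1 & N2 & N3).
  set (x := sx i j k (1/2) (1/2)).
  assert (Hx : in_simplex3 i j k x) by (apply (sx_simplex F HS); auto; repeat split; lra).
  assert (Xi : x i = 1/2).
  { unfold x, sx. destruct (excluded_middle_informative (i = i)); [reflexivity|tauto]. }
  assert (Xj : x j = 1/2).
  { unfold x, sx. destruct (excluded_middle_informative _); [subst; tauto|].
    destruct (excluded_middle_informative (j = j)); [reflexivity|tauto]. }
  assert (Xk : x k = 0) by (destruct Hx as (_&_&_&_&Hsum); lra).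
  destruct (proj2 (proj2 (proj2 HE)) x (simplex_real F _ _ _ _ Hf Hx) (1/4) ltac:(lra)) as [d [Hd Hd']].
  assert (Hf' : F k i j) by (apply (F_cyc F HS), (F_cyc F HS); auto).
  assert (Hx' : in_simplex3 k i j x) by now apply simplex_cyc, simplex_cyc.
  destruct (zero_coord_image F phi HS HE Hnd k i j x Hf' Hx' Xk) as [E0 HT].
  pose proof (dst_nonneg (phi x) (psi k)) as Hnn.
  (* The displacement is [s] times the distance to [psi k], hence less than [d]; the summand 1
     avoids a separate case for distance 0. *)
  set (s := d / 2 / (1 + dst (phi x) (psi k))).
  assert (Hs : 0 < s) by (apply Rdiv_lt_0_compat; lra).
  set (z := (phi x + RtoC s * (phi x - psi k))%C).
  assert (Hz : Cmod (phi x - z) < d).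
  { replace (phi x - z)%C with (RtoC (- s) * (phi x - psi k))%C
      by (unfold z; rewrite RtoC_opp; ring).
    rewrite Cmod_mult, Cmod_R, Rabs_Ropp, Rabs_pos_eq by lra. fold (dst (phi x) (psi k)).
    assert (s * (1 + dst (phi x) (psi k)) = d / 2) by (unfold s; field; lra). nra. }
  assert (Ebc : bc (psi k) (psi i) (psi j) z = - s).
  { rewrite (bc_affine (psi k) (psi i) (psi j) (Hnd _ _ _ Hf') (1 + s) (- s) 0 (phi x) (psi k) (psi k)).
    - rewrite E0, bc_self by auto. ring.
    - ring.
    - unfold z. destruct (phi x), (psi k). simpl. ring.
    - unfold z. destruct (phi x), (psi k). simpl. ring. }
  destruct (Hsurj z) as [y [(a & b & c & Hg & Hy) Ey]].
  assert (Hxy : forall v, Rabs (x v - y v) < 1/4).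
  { apply Hd'; [now exists a, b, c | now rewrite Ey]. }
  assert (Yi : 0 < y i) by (pose proof (Rabs_def2 _ _ (Hxy i)); lra).
  assert (Yj : 0 < y j) by (pose proof (Rabs_def2 _ _ (Hxy j)); lra).
  assert (Hm : exists m, F i j m /\ in_simplex3 i j m y).
  { assert (Ii : i = a \/ i = b \/ i = c).
    { apply NNPP. intros N. destruct Hy as (H0 & _). rewrite H0 in Yi; [lra|tauto|tauto|tauto]. }
    assert (Ij : j = a \/ j = b \/ j = c).
    { apply NNPP. intros N. destruct Hy as (H0 & _). rewrite H0 in Yj; [lra|tauto|tauto|tauto]. }
    assert (FC := F_cyc F HS). assert (FS := F_swap12 F HS).
    assert (SC := @simplex_cyc V). assert (SS := @simplex_swap12 V).
    destruct Ii as [-> |[-> | ->]], Ij as [-> |[-> | ->]]; try tauto;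
      [exists c|exists b|exists c|exists a|exists b|exists a]; split; auto. }
  destruct Hm as [m [Hm1 Hm2]]. exists m. split; auto. intros ->.
  pose proof (face_image_sub F phi HS HE Hnd i j k y Hf Hm2) as (_ & _ & H3).
  rewrite Ey, Ebc in H3. lra.
Qed.

Lemma simplex_sum_le i j k x p q : F i j k -> in_simplex3 i j k x -> p <> q -> x p + x q <= 1.
Proof.
  intros Hf (H0 & H1 & H2 & H3 & H4) Hpq.
  destruct (F_neq F HS i j k Hf) as (N1 & N2 & N3).
  assert (Hv : forall v, v = i \/ v = j \/ v = k \/ x v = 0).
  { intros v. destruct (classic (v = i)); auto. destruct (classic (v = j)); auto.
    destruct (classic (v = k)); auto. }
  destruct (Hv p) as [-> |[-> |[-> | ->]]], (Hv q) as [-> |[-> |[-> | ->]]]; try tauto; lra.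
Qed.

(** Every point of the plane has a disc with at most one vertex image: a vertex [p] mapped into it
    satisfies [x p > 2/3] for the preimage [x] of the centre, which two distinct vertices cannot
    both do. Compactness of a square finishes. *)
Lemma vertices_locally_finite (R0 : R) : exists L : list V, forall i, dst 0 (psi i) <= R0 -> In i L.
Proof.
  destruct HH as [HE Hsurj].
  assert (Hloc : forall z : C, exists d : posreal, forall p q,
    dst z (psi p) < d -> dst z (psi q) < d -> p = q).
  { intros z. destruct (Hsurj z) as [x [(i & j & k & Hf & Hx) Ex]].
    destruct (proj2 (proj2 (proj2 HE)) x (simplex_real F _ _ _ _ Hf Hx) (1/3) ltac:(lra)) as [d [Hd Hd']].
    assert (Hp : forall p, dst z (psi p) < d -> 2/3 < x p).
    { intros p Hp. subst z.
      pose proof (vertex_in_realization F p HS) as Hr.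
      specialize (Hd' (vpt p) Hr Hp p). apply Rabs_def2 in Hd'.
      unfold vpt in Hd'. destruct (excluded_middle_informative (p = p)); [lra|tauto]. }
    exists (mkposreal d Hd). intros p q H1 H2. apply NNPP. intros N.
    pose proof (simplex_sum_le i j k x p q Hf Hx N). apply Hp in H1, H2. lra. }
  set (dl := fun z => proj1_sig (constructive_indefinite_description _ (Hloc z))).
  assert (Hdl : forall z p q, dst z (psi p) < dl z -> dst z (psi q) < dl z -> p = q).
  { intros z. unfold dl. destruct (constructive_indefinite_description _ (Hloc z)); auto. }
  (* Compactness uses boxes; a box of half-width [dl z / 2] lies in the disc of radius [dl z]. *)
  assert (Hpos : forall z, 0 < dl z / 2) by (intros z; pose proof (cond_pos (dl z)); lra).
  set (pt := fun t : Compactness.Tn 2 R => (fst t, fst (snd t)) : C).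
  apply NNPP. intros Hno.
  apply (compactness_list 2 (- R0, (- R0, tt)) (R0, (R0, tt)) (fun t => mkposreal _ (Hpos (pt t)))).
  intros [l Hl]. apply Hno.
  destruct (classic (exists v0 : V, True)) as [[v0 _]|Hempty].
  2:{ exists nil. intros i. exfalso. apply Hempty. now exists i. }
  set (ch := fun t => match excluded_middle_informative (exists p, dst (pt t) (psi p) < dl (pt t)) with
     | left H => proj1_sig (constructive_indefinite_description _ H) | right _ => v0 end).
  exists (map ch l). intros i Hi.
  destruct (Hl (fst (psi i), (snd (psi i), tt))) as [t [Ht [_ Hc]]].
  - pose proof (dst_fst 0 (psi i)) as H1. pose proof (dst_snd 0 (psi i)) as H2.
    simpl in H1, H2. unfold Rabs in H1, H2.
    simpl. destruct (Rcase_abs _), (Rcase_abs _); repeat split; lra.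
  - apply in_map_iff. exists t. split; auto.
    assert (Hd : dst (pt t) (psi i) < dl (pt t)).
    { destruct t as [t1 [t2 t3]]. simpl in Hc. destruct Hc as (C1 & C2 & _).
      eapply Rle_lt_trans; [apply dst_le_sum|].
      rewrite (Rabs_minus_sym), (Rabs_minus_sym (snd (pt (t1, (t2, t3))))).
      unfold pt in *; simpl in *. lra. }
    unfold ch. destruct (excluded_middle_informative _) as [H|H].
    + destruct (constructive_indefinite_description _ H) as [p Hp]. simpl.
      apply (Hdl (pt t)); auto.
    + exfalso. apply H. now exists i.
Qed.

End Homeomorphism.

(** * Fat straight triangulations *)

(* [te_meet] says that two closed triangles meet only in a common face. *)
Record fat_triangulation {V : Type} (F : V -> V -> V -> Prop) (psi : V -> C) (kappa eps : R) : Prop := {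
  te_surf : surface_triangulation F;
  te_kappa : 0 < kappa;
  te_fat : forall i j k, F i j k ->
    kappa * dst (psi i) (psi j) ^ 2 <= Rabs (crs (psi i) (psi j) (psi k));
  te_pos : forall i j k, F i j k -> 0 < dst (psi i) (psi j);
  te_meet : forall i j k i' j' k' z, F i j k -> F i' j' k' ->
    inT (psi i) (psi j) (psi k) z -> inT (psi i') (psi j') (psi k') z ->
    0 < bc (psi i) (psi j) (psi k) z -> i = i' \/ i = j' \/ i = k';
  te_second : forall i j k, F i j k -> exists m, m <> k /\ F i j m;
  te_eps : 0 < eps;
  te_angle : forall i j k, F i j k -> eps <= angle (fun a b => dst (psi a) (psi b)) i j k
}.

Lemma polar_unit (x y : R) : x ^ 2 + y ^ 2 = 1 -> exists t, 0 <= t < 2 * PI /\ cos t = x /\ sin t = y.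
Proof.
  intros H. assert (Hx : -1 <= x <= 1) by (split; nra).
  pose proof (acos_bound x) as Hb. pose proof PI_RGT_0.
  assert (Hs : sin (acos x) = sqrt (1 - x ^ 2)) by (rewrite sin_acos; auto; f_equal; unfold Rsqr; ring).
  assert (Hy : sqrt (1 - x ^ 2) = Rabs y).
  { replace (1 - x ^ 2) with (Rsqr y) by (unfold Rsqr; nra). apply sqrt_Rsqr_abs. }
  destruct (Rle_lt_dec 0 y) as [Hy0|Hy0].
  - exists (acos x). split; [lra|]. rewrite cos_acos by auto. split; auto.
    rewrite Hs, Hy. now apply Rabs_pos_eq.
  - exists (2 * PI - acos x).
    assert (Hne : acos x <> 0).
    { intros E. rewrite E, sin_0 in Hs. rewrite Hy in Hs. rewrite Rabs_left in Hs; lra. }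
    split; [lra|]. split.
    + rewrite cos_minus, cos_2PI, sin_2PI, cos_acos by auto. ring.
    + rewrite sin_minus, cos_2PI, sin_2PI, Hs, Hy. rewrite Rabs_left by auto. ring.
Qed.

Lemma polar (c z : C) : z <> c -> exists t, 0 <= t < 2 * PI /\
  z = (fst c + dst z c * cos t, snd c + dst z c * sin t).
Proof.
  intros H. pose proof (dst_pos z c H) as Hd. pose proof (dst_sqr z c) as Hs.
  destruct (polar_unit ((fst z - fst c) / dst z c) ((snd z - snd c) / dst z c)) as (t & Ht & E1 & E2).
  - replace (((fst z - fst c) / dst z c) ^ 2 + ((snd z - snd c) / dst z c) ^ 2)
      with (((fst z - fst c) ^ 2 + (snd z - snd c) ^ 2) / dst z c ^ 2) by (field; lra).
    rewrite <- Hs. field. lra.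
  - exists t. split; auto. rewrite E1, E2. rewrite (surjective_pairing z) at 1.
    f_equal; field; lra.
Qed.

Lemma continuity_pos_nbhd (f : R -> R) (c : R) : continuity f -> 0 < f c ->
  exists d, 0 < d /\ forall x, Rabs (x - c) < d -> 0 < f x.
Proof.
  intros Hf Hc.
  destruct (proj1 (continuity_pt_locally _ _) (Hf c) (mkposreal _ Hc)) as [d Hd].
  exists d. split; [apply cond_pos|]. intros x Hx.
  assert (H : Rabs (f x - f c) < f c) by (apply Hd; exact Hx).
  apply Rabs_def2 in H. lra.
Qed.

(** * The star of a vertex *)

Section Star.
Context {V : Type} (F : V -> V -> V -> Prop) (psi : V -> C) (kappa eps : R).
Hypothesis G : fat_triangulation F psi kappa eps.
Implicit Types (i j k m n p q : V).

Notation B i j k z := (bc (psi i) (psi j) (psi k) z).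
Notation T i j k z := (inT (psi i) (psi j) (psi k) z).
Notation len i j := (dst (psi i) (psi j)).
Notation area i j k := (crs (psi i) (psi j) (psi k)).

Let HS := te_surf _ _ _ _ G.
Let Fc i j k : F i j k -> F j k i := F_cyc F HS i j k.
Let Fs i j k : F i j k -> F j i k := F_swap12 F HS i j k.
Let Fr i j k : F i j k -> F i k j := F_swap23 F HS i j k.

Lemma area_nz i j k : F i j k -> area i j k <> 0.
Proof.
  intros H E. pose proof (te_fat _ _ _ _ G i j k H) as H1. rewrite E, Rabs_R0 in H1.
  assert (0 < kappa * len i j ^ 2); [|lra].
  apply Rmult_lt_0_compat; [apply (te_kappa _ _ _ _ G)|].
  apply pow_lt, (te_pos _ _ _ _ G i j k H).
Qed.

(** Twice the area is at least [kappa * len i j ^ 2] and at most [len i j * len i k]. *)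
Lemma len_ratio i j k : F i j k -> kappa * len i j <= len i k.
Proof.
  intros H. pose proof (te_fat _ _ _ _ G i j k H). pose proof (te_pos _ _ _ _ G i j k H).
  pose proof (crs_abs_le (psi i) (psi j) (psi k)).
  apply Rmult_le_reg_l with (len i j); auto. nra.
Qed.

Lemma kappa_le1 i j k : F i j k -> kappa <= 1.
Proof.
  intros H. pose proof (len_ratio i j k H). pose proof (len_ratio i k j (Fr _ _ _ H)).
  pose proof (te_pos _ _ _ _ G i j k H). pose proof (te_kappa _ _ _ _ G).
  apply Rnot_lt_le. intros Hk.
  assert (len i j < kappa * len i j) by nra. assert (len i k < kappa * len i k) by nra. lra.
Qed.

(** By fatness the height over the side [jk] is at least [kappa * len j k]. *)
Lemma bary_lip i j k z z' : F i j k -> kappa * len j k * Rabs (B i j k z - B i j k z') <= dst z z'.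
Proof.
  intros H. pose proof (bc_lip (psi i) (psi j) (psi k) (area_nz _ _ _ H) z z') as H1.
  pose proof (te_fat _ _ _ _ G j k i (Fc _ _ _ H)) as H2. rewrite crs_cyc in H2.
  pose proof (te_pos _ _ _ _ G j k i (Fc _ _ _ H)) as H3.
  pose proof (te_kappa _ _ _ _ G) as H4.
  set (A := Rabs (area i j k)) in *. set (D := Rabs (B i j k z - B i j k z')) in *.
  assert (HA : 0 < A) by (apply Rlt_le_trans with (2 := H2), Rmult_lt_0_compat; [auto|now apply pow_lt]).
  assert (HD : A * D <= dst z z' * len j k).
  { apply Rmult_le_compat_l with (r := A) in H1; [|lra].
    replace (A * (dst z z' * len j k / A)) with (dst z z' * len j k) in H1 by (field; lra). lra. }
  assert (0 <= D) by apply Rabs_pos.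
  apply Rmult_le_reg_l with (len j k); auto.
  apply Rle_trans with (A * D); [|lra].
  replace (len j k * (kappa * len j k * D)) with (kappa * len j k ^ 2 * D) by ring.
  apply Rmult_le_compat_r; auto.
Qed.

Lemma bary_lip2 i j k z z' : F i j k ->
  kappa ^ 2 * len i j * Rabs (B i j k z - B i j k z') <= dst z z'.
Proof.
  intros H. pose proof (bary_lip i j k z z' H). pose proof (len_ratio j i k (Fs _ _ _ H)).
  rewrite (dst_sym (psi i)). pose proof (Rabs_pos (B i j k z - B i j k z')).
  pose proof (te_kappa _ _ _ _ G).
  assert (kappa ^ 2 * len j i * Rabs (B i j k z - B i j k z')
     <= kappa * len j k * Rabs (B i j k z - B i j k z')); [|lra].
  apply Rmult_le_compat_r; auto. nra.
Qed.

Lemma vertex_in_face p i j k : F i j k -> T i j k (psi p) -> p = i \/ p = j \/ p = k.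
Proof.
  intros Hf HT. pose proof HS as (_ & _ & Hv & _). destruct (Hv p) as (q & r & Hp).
  apply (te_meet _ _ _ _ G p q r i j k (psi p) Hp Hf); auto.
  - apply inT_vertex. now apply area_nz.
  - rewrite bc_self by now apply area_nz. lra.
Qed.

Lemma line_bary i j k m z : F i j k -> F i j m -> B k i j z = 0 ->
  B i j m z = B i j k z /\ B j m i z = B j k i z /\ B m i j z = 0.
Proof.
  intros Hk Hm E.
  assert (Hs : B i j k z + B j k i z = 1)
    by (pose proof (bc_sum _ _ _ (area_nz i j k Hk) z); lra).
  assert (Hs0 : B i j k z + B j k i z + 0 = 1) by lra.
  assert (Hx := bc_fst _ _ _ (area_nz i j k Hk) z).
  assert (Hy := bc_snd _ _ _ (area_nz i j k Hk) z).
  rewrite E in Hx, Hy.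
  assert (Hx' : fst z = B i j k z * fst (psi i) + B j k i z * fst (psi j) + 0 * fst (psi j)) by lra.
  assert (Hy' : snd z = B i j k z * snd (psi i) + B j k i z * snd (psi j) + 0 * snd (psi j)) by lra.
  assert (Hm' := area_nz _ _ _ (Fc _ _ _ Hm)). assert (Hm'' := area_nz _ _ _ (Fc _ _ _ (Fc _ _ _ Hm))).
  assert (Hm0 := area_nz _ _ _ Hm).
  repeat split.
  - rewrite (bc_affine _ _ _ Hm0 _ _ 0 _ _ _ z Hs0 Hx' Hy').
    rewrite bc_self, bc_other1 by auto. ring.
  - rewrite (bc_affine _ _ _ Hm' _ _ 0 _ _ _ z Hs0 Hx' Hy').
    rewrite bc_self, bc_other2 by auto. ring.
  - rewrite (bc_affine _ _ _ Hm'' _ _ 0 _ _ _ z Hs0 Hx' Hy').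
    rewrite bc_other1, bc_other2 by auto. ring.
Qed.

Lemma opposite_sides i j k m : F i j k -> F i j m -> k <> m -> area i j k * area i j m < 0.
Proof.
  intros Hk Hm Hne. apply Rnot_le_lt. intros Hle.
  assert (N1 := area_nz _ _ _ Hk). assert (N2 := area_nz _ _ _ Hm).
  assert (Nm := area_nz _ _ _ (Fc _ _ _ (Fc _ _ _ Hm))).
  assert (Nm' := area_nz _ _ _ (Fc _ _ _ Hm)).
  assert (Hq : 0 < area i j k / area i j m).
  { replace (area i j k / area i j m) with (area i j k * area i j m / (area i j m) ^ 2) by (field; auto).
    apply Rdiv_lt_0_compat; [|apply pow2_gt_0; auto].
    destruct Hle as [H|H]; auto. exfalso. symmetry in H. apply Rmult_integral in H. tauto. }
  assert (Emk : B m i j (psi k) = area i j k / area i j m).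
  { unfold bc. f_equal; [rewrite <- (crs_cyc (psi k)); auto|rewrite <- (crs_cyc (psi m)); auto]. }
  (* [a] bounds the coordinates of [psi k] in the triangle [ijm]; the weight [s] of [k], with
     [s * (1 + a) = 1/4], is so small that the coordinates at [i] and [j] stay nonnegative there. *)
  set (a := Rabs (B i j m (psi k)) + Rabs (B j m i (psi k))).
  assert (Ha : 0 <= a) by (unfold a; pose proof (Rabs_pos (B i j m (psi k)));
    pose proof (Rabs_pos (B j m i (psi k))); lra).
  set (s := / (4 * (1 + a))).
  assert (Hs : 0 < s) by (apply Rinv_0_lt_compat; lra).
  assert (Hsa : s * (1 + a) = / 4) by (unfold s; field; lra).
  set (z := pt3 (psi i) (psi j) (psi k) ((1 - s) / 2) ((1 - s) / 2) s).
  destruct (bc_pt3 (psi i) (psi j) (psi k) ((1 - s) / 2) ((1 - s) / 2) s N1 ltac:(lra)) as (E1 & E2 & E3).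
  fold z in E1, E2, E3.
  assert (s <= / 4) by nra.
  assert (F1 : B m i j z = s * B m i j (psi k)).
  { rewrite (bc_affine _ _ _ Nm ((1 - s) / 2) ((1 - s) / 2) s (psi i) (psi j) (psi k)) by (auto; lra).
    rewrite bc_other1, bc_other2 by auto. ring. }
  assert (F2 : B i j m z = (1 - s) / 2 + s * B i j m (psi k)).
  { rewrite (bc_affine _ _ _ N2 ((1 - s) / 2) ((1 - s) / 2) s (psi i) (psi j) (psi k)) by (auto; lra).
    rewrite bc_self, bc_other1 by auto. ring. }
  assert (F3 : B j m i z = (1 - s) / 2 + s * B j m i (psi k)).
  { rewrite (bc_affine _ _ _ Nm' ((1 - s) / 2) ((1 - s) / 2) s (psi i) (psi j) (psi k)) by (auto; lra).
    rewrite bc_self, bc_other2 by auto. ring. }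
  assert (A1 : - a <= B i j m (psi k)).
  { unfold a. pose proof (Rle_abs (- B i j m (psi k))). rewrite Rabs_Ropp in H0.
    pose proof (Rabs_pos (B j m i (psi k))). lra. }
  assert (A2 : - a <= B j m i (psi k)).
  { unfold a. pose proof (Rle_abs (- B j m i (psi k))). rewrite Rabs_Ropp in H0.
    pose proof (Rabs_pos (B i j m (psi k))). lra. }
  destruct (te_meet _ _ _ _ G k i j i j m z) as [E|[E|E]].
  - now apply Fc, Fc.
  - auto.
  - apply inT_cyc, inT_cyc. unfold inT. rewrite E1, E2, E3. lra.
  - unfold inT. rewrite F1, F2, F3, Emk. repeat split; nra.
  - rewrite E3. auto.
  - destruct (F_neq F HS _ _ _ Hk) as (? & ? & ?). auto.
  - destruct (F_neq F HS _ _ _ Hk) as (? & ? & ?). auto.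
  - auto.
Qed.

Lemma other_side i j k m z : F i j k -> F i j m -> k <> m -> B k i j z < 0 -> 0 < B m i j z.
Proof.
  intros Hk Hm Hne Hz. pose proof (opposite_sides i j k m Hk Hm Hne) as Ho.
  assert (N1 := area_nz _ _ _ Hk). assert (N2 := area_nz _ _ _ Hm).
  unfold bc in *. rewrite <- (crs_cyc (psi k)) in Hz. rewrite <- (crs_cyc (psi m)).
  set (c := crs z (psi i) (psi j)) in *.
  replace (c / area i j m) with (c / area i j k * (area i j k * area i j m) / (area i j m) ^ 2)
    by (field; auto).
  apply Rdiv_lt_0_compat; [nra | apply pow2_gt_0; auto].
Qed.

Definition nbr_pairs (s : list V) i : list (V * V) :=
  filter (fun jk => if excluded_middle_informative (F i (fst jk) (snd jk)) then true else false)
    (list_prod s s).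

Lemma in_nbr_pairs s i j k : (forall j k, F i j k -> In j s) ->
  In (j, k) (nbr_pairs s i) <-> F i j k.
Proof.
  intros Hs. unfold nbr_pairs. rewrite filter_In, in_prod_iff. simpl.
  destruct (excluded_middle_informative (F i j k)) as [H|H]; split; try tauto.
  - intros _. repeat split; [apply (Hs j k); auto | apply (Hs k j); auto].
  - intros [_ H']. discriminate.
Qed.

(** Turn a ray around [i], starting on an edge and ending in the direction of [z]. Let [c] be the
    last angle lying in some sector. Inside a sector the ray can be turned further, and on a side
    the second face at that edge takes over, so [c] cannot precede the direction of [z]. *)
Lemma sector_cover i z : exists j k, F i j k /\ 0 <= B j k i z /\ 0 <= B k i j z.
Proof.
  pose proof HS as (_ & _ & Hv & _ & Hfin & _).
  destruct (Hv i) as (j0 & k0 & H0). destruct (Hfin i) as [s Hs].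
  assert (N0 := area_nz _ _ _ H0).
  assert (N0' := area_nz _ _ _ (Fc _ _ _ H0)). assert (N0'' := area_nz _ _ _ (Fc _ _ _ (Fc _ _ _ H0))).
  destruct (classic (z = psi i)) as [->|Hz].
  { exists j0, k0. rewrite bc_other1, bc_other2 by auto. split; auto. lra. }
  set (P := nbr_pairs s i).
  assert (HP : forall j k, In (j, k) P <-> F i j k) by (intros; now apply in_nbr_pairs).
  apply NNPP. intros Hno.
  pose proof (dst_pos z (psi i) Hz) as Hr. set (r := dst z (psi i)) in *.
  set (g := fun t => (fst (psi i) + r * cos t, snd (psi i) + r * sin t)).
  assert (Hg : cpath g) by apply cpath_circle.
  set (h := fun (jk : V * V) (t : R) =>
    Rmin (B (fst jk) (snd jk) i (g t)) (B (snd jk) i (fst jk) (g t))).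
  assert (Hh : forall jk, continuity (h jk))
    by (intros jk; apply continuity_Rmin; now apply continuity_bc).
  set (M := fun t => lmax P (fun jk => h jk t)).
  assert (HMc : continuity M) by (apply continuity_lmax; auto).
  assert (HM : forall t, 0 <= M t <-> exists j k, F i j k /\ 0 <= B j k i (g t) /\ 0 <= B k i j (g t)).
  { intros t. unfold M. rewrite lmax_nonneg. split.
    - intros [[j k] [H1 H2]]. exists j, k. apply HP in H1. unfold h in H2; simpl in H2.
      split; auto. revert H2. unfold Rmin. destruct (Rle_dec _ _); lra.
    - intros (j & k & H1 & H2 & H3). exists (j, k). split; [now apply HP|].
      unfold h; simpl. now apply Rmin_glb. }
  destruct (polar (psi i) z Hz) as (tz & Htz & Ez). fold r in Ez.
  assert (Hlen := te_pos _ _ _ _ G _ _ _ H0). rewrite dst_sym in Hlen.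
  assert (Hj0 : psi j0 <> psi i) by (intros E; rewrite E, dst_refl in Hlen; lra).
  destruct (polar (psi i) (psi j0) Hj0) as (t0 & Ht0 & E0).
  assert (HM0 : 0 <= M t0).
  { apply HM. exists j0, k0. split; auto.
    set (c := r / len j0 i).
    assert (Hc : 0 < c) by (apply Rdiv_lt_0_compat; auto).
    assert (Hx : fst (g t0) = (1 - c) * fst (psi i) + c * fst (psi j0) + 0 * fst (psi i)).
    { rewrite E0 at 1. unfold g, c. simpl. field. lra. }
    assert (Hy : snd (g t0) = (1 - c) * snd (psi i) + c * snd (psi j0) + 0 * snd (psi i)).
    { rewrite E0 at 1. unfold g, c. simpl. field. lra. }
    rewrite (bc_affine _ _ _ N0' (1 - c) c 0 _ _ _ _ ltac:(lra) Hx Hy).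
    rewrite (bc_affine _ _ _ N0'' (1 - c) c 0 _ _ _ _ ltac:(lra) Hx Hy).
    rewrite bc_self, !bc_other2, bc_other1 by auto. lra. }
  (* A full turn is added so that the end of the interval lies to the right of the starting
     angle. *)
  assert (HMz : M (tz + 2 * PI) < 0).
  { apply Rnot_le_lt. intros H. apply HM in H. apply Hno.
    replace (g (tz + 2 * PI)) with z in H; auto.
    rewrite Ez. unfold g. rewrite cos_plus, sin_plus, cos_2PI, sin_2PI. f_equal; ring. }
  destruct (last_nonneg M t0 (tz + 2 * PI) HMc) as (c & Hc & Hc0 & Hc1); auto; [lra|].
  apply HM in Hc0.
  (* A sector whose side [ik] is the only one the ray may touch: the turn continues in [ijk] or
     across [ij]. The other cases are this one with [j] and [k] exchanged, or put the ray at the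
     centre. *)
  assert (Hmain : forall j k, F i j k -> 0 < B j k i (g c) -> 0 <= B k i j (g c) -> False).
  { intros j k Hf Hj Hk.
    assert (exists m, F i j m /\ m <> k) as (m & Hm & Hmk).
    { destruct (te_second _ _ _ _ G i j k Hf) as (m & ? & ?). eauto. }
    assert (Hj' : exists d, 0 < d /\ forall x, Rabs (x - c) < d -> 0 < B j k i (g x))
      by (apply (continuity_pos_nbhd (fun x => B j k i (g x))); auto; now apply continuity_bc).
    destruct Hj' as (d1 & Hd1 & Hd1').
    assert (Hd2 : exists d, 0 < d /\ forall x, Rabs (x - c) < d -> 0 <= B k i j (g x)
       \/ 0 < B j m i (g x)).
    { destruct Hk as [Hk|Hk].
      - destruct (continuity_pos_nbhd (fun x => B k i j (g x)) c) as (d & Hd & Hd'); auto;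
          [now apply continuity_bc|]. exists d. split; auto. intros x Hx. left. left. auto.
      - destruct (line_bary i j k m (g c) Hf Hm (eq_sym Hk)) as (_ & E & _).
        destruct (continuity_pos_nbhd (fun x => B j m i (g x)) c) as (d & Hd & Hd');
          [now apply continuity_bc | rewrite E; auto |].
        exists d. split; auto. }
    destruct Hd2 as (d2 & Hd2 & Hd2').
    set (x := Rmin (tz + 2 * PI) (c + Rmin d1 d2 / 2)).
    assert (Hx : c < x <= tz + 2 * PI /\ x - c < d1 /\ x - c < d2).
    { unfold x, Rmin. repeat destruct (Rle_dec _ _); lra. }
    assert (Hxa : Rabs (x - c) < d1 /\ Rabs (x - c) < d2).
    { rewrite Rabs_pos_eq; lra. }
    specialize (Hc1 x ltac:(lra)). apply Rlt_not_le in Hc1. apply Hc1. apply HM.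
    specialize (Hd1' x ltac:(tauto)).
    destruct (Rle_lt_dec 0 (B k i j (g x))) as [Hk'|Hk'].
    - exists j, k. repeat split; auto. lra.
    - exists j, m. destruct (Hd2' x ltac:(tauto)) as [H|H]; [lra|].
      repeat split; auto; [lra|]. left. apply (other_side i j k m); auto. }
  destruct Hc0 as (j & k & Hf & Hj & Hk).
  destruct Hj as [Hj|Hj]; [now apply (Hmain j k)|].
  destruct Hk as [Hk|Hk].
  - apply (Hmain k j); auto; rewrite bc_swap; auto. rewrite <- Hj. lra.
  - assert (Nf := area_nz _ _ _ Hf).
    assert (E : B i j k (g c) = 1) by (pose proof (bc_sum _ _ _ Nf (g c)); lra).
    pose proof (bc_fst _ _ _ Nf (g c)) as Hx. pose proof (bc_snd _ _ _ Nf (g c)) as Hy.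
    rewrite E, <- Hj, <- Hk in Hx, Hy. unfold g in Hx, Hy. simpl in Hx, Hy.
    assert (Hcc : cos c = 0) by nra. assert (Hss : sin c = 0) by nra.
    pose proof (sin2_cos2 c) as H. rewrite Hcc, Hss in H. unfold Rsqr in H. lra.
Qed.

(** Take the sector at [i] that contains [psi p]. Either [p] is in the triangle, hence is [j] or
    [k], or it lies beyond the side [jk]; then the coordinate at [i] drops from 1 to below 0 between
    [i] and [p], which costs distance. *)
Lemma vertex_separation_some i p : p <> i -> exists j k, F i j k /\ kappa ^ 2 * len i j <= len i p.
Proof.
  intros Hp. destruct (sector_cover i (psi p)) as (j & k & Hf & Hj & Hk).
  exists j, k. split; auto.
  pose proof (te_kappa _ _ _ _ G) as K0. pose proof (kappa_le1 _ _ _ Hf) as K1.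
  pose proof (te_pos _ _ _ _ G _ _ _ Hf) as L1.
  pose proof (len_ratio _ _ _ Hf) as L2.
  destruct (Rle_lt_dec 0 (B i j k (psi p))) as [Hi|Hi].
  - destruct (vertex_in_face p i j k Hf) as [E|[E|E]]; [now repeat split| | |].
    + contradiction.
    + subst. assert (kappa ^ 2 <= 1) by nra. nra.
    + subst. assert (kappa ^ 2 <= kappa) by nra. nra.
  - pose proof (bary_lip2 i j k (psi i) (psi p) Hf) as H.
    rewrite bc_self in H by now apply area_nz.
    assert (1 <= Rabs (1 - B i j k (psi p))) by (rewrite Rabs_pos_eq; lra).
    assert (0 < kappa ^ 2 * len i j) by (apply Rmult_lt_0_compat; auto; apply pow_lt; auto). nra.
Qed.

End Star.

Lemma sin_interval (x a : R) : 0 <= x < 2 * PI -> 0 < a < PI -> 0 <= sin x -> 0 <= sin (a - x) -> x <= a.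
Proof.
  intros Hx Ha H1 H2. pose proof PI_RGT_0.
  apply Rnot_lt_le. intros Hlt.
  destruct (Rle_lt_dec x PI) as [H3|H3].
  - assert (0 < sin (x - a)) by (apply sin_gt_0; lra).
    replace (a - x) with (- (x - a)) in H2 by ring. rewrite sin_neg in H2. lra.
  - assert (sin x < 0) by (apply sin_lt_0; lra). lra.
Qed.

Definition dotp (p q r : C) : R :=
  (fst q - fst p) * (fst r - fst p) + (snd q - snd p) * (snd r - snd p).

Lemma angle_cos_sin {V : Type} (psi : V -> C) (i j k : V) :
  0 < dst (psi i) (psi j) -> 0 < dst (psi i) (psi k) -> crs (psi i) (psi j) (psi k) <> 0 ->
  let th := angle (fun a b => dst (psi a) (psi b)) i j k in
  cos th = dotp (psi i) (psi j) (psi k) / (dst (psi i) (psi j) * dst (psi i) (psi k)) /\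
  sin th = Rabs (crs (psi i) (psi j) (psi k)) / (dst (psi i) (psi j) * dst (psi i) (psi k)) /\
  0 < th < PI.
Proof.
  intros Hj Hk Hne th. unfold th, angle.
  pose proof (dst_sqr (psi i) (psi j)) as E1. pose proof (dst_sqr (psi i) (psi k)) as E2.
  pose proof (dst_sqr (psi j) (psi k)) as E3.
  set (a := dst (psi i) (psi j)) in *. set (b := dst (psi i) (psi k)) in *.
  set (c := dst (psi j) (psi k)) in *.
  set (D := dotp (psi i) (psi j) (psi k)). set (X := crs (psi i) (psi j) (psi k)) in *.
  assert (Eq : (a ^ 2 + b ^ 2 - c ^ 2) / (2 * a * b) = D / (a * b)).
  { assert (E : a ^ 2 + b ^ 2 - c ^ 2 = 2 * D) by (rewrite E1, E2, E3; unfold D, dotp; ring).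
    rewrite E. field. lra. }
  assert (HL : D ^ 2 + X ^ 2 = (a * b) ^ 2).
  { replace ((a * b) ^ 2) with (a ^ 2 * b ^ 2) by ring. rewrite E1, E2. unfold D, X, dotp, crs. ring. }
  rewrite Eq. set (q := D / (a * b)).
  assert (Hab : 0 < a * b) by nra.
  assert (HX : 0 < X ^ 2) by (apply pow2_gt_0; auto).
  assert (Hq1 : 1 - q ^ 2 = (X / (a * b)) ^ 2).
  { unfold q. replace (1 - (D / (a * b)) ^ 2) with (((a * b) ^ 2 - D ^ 2) / (a * b) ^ 2) by (field; lra).
    replace ((a * b) ^ 2 - D ^ 2) with (X ^ 2) by lra. field. lra. }
  assert (Hxp : 0 < (X / (a * b)) ^ 2).
  { apply pow2_gt_0. unfold Rdiv. apply Rmult_integral_contrapositive_currified; auto.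
    apply Rinv_neq_0_compat. lra. }
  assert (Hq2 : -1 < q < 1) by (split; nra).
  split; [apply cos_acos; lra|]. split.
  - rewrite sin_acos by lra. replace (1 - Rsqr q) with (Rsqr (X / (a * b))) by (unfold Rsqr; lra).
    rewrite sqrt_Rsqr_abs. unfold Rdiv. rewrite Rabs_mult, Rabs_inv, (Rabs_pos_eq (a * b)) by lra. reflexivity.
  - now apply acos_bound_lt.
Qed.

(** * The angle sum at a vertex *)

Section VertexAngles.
Context {V : Type} (F : V -> V -> V -> Prop) (psi : V -> C) (kappa eps : R).
Hypothesis G : fat_triangulation F psi kappa eps.
Implicit Types (i j k m n p q : V).

Notation B i j k z := (bc (psi i) (psi j) (psi k) z).
Notation T i j k z := (inT (psi i) (psi j) (psi k) z).
Notation len i j := (dst (psi i) (psi j)).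
Notation area i j k := (crs (psi i) (psi j) (psi k)).
Notation ang i j k := (angle (fun a b => dst (psi a) (psi b)) i j k).

Let HS := te_surf _ _ _ _ G.
Let Fc i j k : F i j k -> F j k i := F_cyc F HS i j k.
Let Fs i j k : F i j k -> F j i k := F_swap12 F HS i j k.
Let Fr i j k : F i j k -> F i k j := F_swap23 F HS i j k.
Let Nz i j k : F i j k -> area i j k <> 0 := area_nz F psi kappa eps G i j k.
Let Lp i j k : F i j k -> 0 < len i j := te_pos _ _ _ _ G i j k.

Lemma ang_swap i j k : ang i k j = ang i j k.
Proof.
  unfold angle. f_equal. rewrite (dst_sym (psi k) (psi j)). f_equal; ring.
Qed.

Lemma second_direction i j k t : F i j k -> 0 < area i j k ->
  psi j = (fst (psi i) + len j i * cos t, snd (psi i) + len j i * sin t) ->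
  psi k = (fst (psi i) + len k i * cos (t + ang i j k), snd (psi i) + len k i * sin (t + ang i j k)).
Proof.
  intros Hf Ha Ej. assert (Hj := Lp _ _ _ Hf). assert (Hk := Lp _ _ _ (Fr _ _ _ Hf)).
  destruct (angle_cos_sin psi i j k Hj Hk (Nz _ _ _ Hf)) as (Ec & Es & _).
  rewrite cos_plus, sin_plus, Ec, Es. rewrite Rabs_pos_eq by lra.
  rewrite (dst_sym (psi k)). rewrite (dst_sym (psi j)) in Ej.
  assert (E1 : fst (psi j) = fst (psi i) + len i j * cos t) by now rewrite Ej at 1.
  assert (E2 : snd (psi j) = snd (psi i) + len i j * sin t) by now rewrite Ej at 1.
  unfold dotp, crs. rewrite E1, E2.
  rewrite (surjective_pairing (psi k)) at 1.
  pose proof (sin2_cos2 t) as H1. unfold Rsqr in H1.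
  set (L := len i j) in *. set (M := len i k) in *.
  set (c := cos t) in *. set (s := sin t) in *.
  f_equal.
  - replace (M * _) with ((fst (psi k) - fst (psi i)) * (s * s + c * c)) by (field; lra).
    rewrite H1. ring.
  - replace (M * _) with ((snd (psi k) - snd (psi i)) * (s * s + c * c)) by (field; lra).
    rewrite H1. ring.
Qed.

Lemma sector_coords i j k t th : F i j k -> 0 < area i j k ->
  psi j = (fst (psi i) + len j i * cos t, snd (psi i) + len j i * sin t) ->
  let z := (fst (psi i) + cos th, snd (psi i) + sin th) in
  B j k i z = len k i * sin (t + ang i j k - th) / area i j k /\
  B k i j z = len j i * sin (th - t) / area i j k.
Proof.
  intros Hf Ha Ej z. pose proof (second_direction i j k t Hf Ha Ej) as Ek.
  assert (E1 : fst (psi j) = fst (psi i) + len j i * cos t) by now rewrite Ej at 1.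
  assert (E2 : snd (psi j) = snd (psi i) + len j i * sin t) by now rewrite Ej at 1.
  assert (E3 : fst (psi k) = fst (psi i) + len k i * cos (t + ang i j k)) by now rewrite Ek at 1.
  assert (E4 : snd (psi k) = snd (psi i) + len k i * sin (t + ang i j k)) by now rewrite Ek at 1.
  unfold bc. rewrite (crs_cyc (psi i) (psi j) (psi k)), <- (crs_cyc (psi k) (psi i) (psi j)).
  rewrite !sin_minus.
  split; f_equal; unfold crs at 1, z; simpl; rewrite ?E1, ?E2, ?E3, ?E4; ring.
Qed.

(** The positively oriented representative of each triangle at [i], so that its sector is the arc
    running counterclockwise from [j] to [k]. *)
Definition pos_pairs (s : list V) i : list (V * V) :=
  filter (fun jk => if excluded_middle_informative (F i (fst jk) (snd jk) /\ 0 < area i (fst jk) (snd jk))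
                    then true else false) (list_prod s s).

Lemma in_pos_pairs s i j k : (forall j k, F i j k -> In j s) ->
  In (j, k) (pos_pairs s i) <-> F i j k /\ 0 < area i j k.
Proof.
  intros Hs. unfold pos_pairs. rewrite filter_In, in_prod_iff. simpl.
  destruct (excluded_middle_informative _) as [H|H]; split; try tauto.
  - intros _. repeat split; [apply (Hs j k) | apply (Hs k j); apply Fr]; tauto.
  - intros [_ H']. discriminate.
Qed.

(** Shrink [v] towards [i] until it lies in both triangles. Then [j] and [k] are vertices of the
    second triangle, and the orientation excludes the exchanged order. *)
Lemma sectors_disjoint i j k j' k' v : F i j k -> F i j' k' ->
  0 < area i j k -> 0 < area i j' k' ->
  0 < B j k i v -> 0 < B k i j v -> 0 < B j' k' i v -> 0 < B k' i j' v -> j = j' /\ k = k'.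
Proof.
  intros Hf Hf' Ha Ha' H1 H2 H3 H4.
  set (s := / (1 + B j k i v + B k i j v + B j' k' i v + B k' i j' v)).
  assert (Hs : 0 < s) by (apply Rinv_0_lt_compat; lra).
  assert (Es : s * (1 + B j k i v + B k i j v + B j' k' i v + B k' i j' v) = 1) by (unfold s; field; lra).
  set (z := ((1 - s) * fst (psi i) + s * fst v, (1 - s) * snd (psi i) + s * snd v) : C).
  assert (HT : forall j k, F i j k -> B j k i z = s * B j k i v /\ B k i j z = s * B k i j v
     /\ B i j k z = 1 - s * B j k i v - s * B k i j v).
  { intros a b Hab. assert (N := Nz _ _ _ Hab). assert (N1 := Nz _ _ _ (Fc _ _ _ Hab)).
    assert (N2 := Nz _ _ _ (Fc _ _ _ (Fc _ _ _ Hab))).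
    assert (E1 : B a b i z = s * B a b i v).
    { rewrite (bc_affine _ _ _ N1 (1 - s) s 0 (psi i) v v z) by (try (simpl; ring)).
      rewrite bc_other2 by auto. ring. }
    assert (E2 : B b i a z = s * B b i a v).
    { rewrite (bc_affine _ _ _ N2 (1 - s) s 0 (psi i) v v z) by (try (simpl; ring)).
      rewrite bc_other1 by auto. ring. }
    repeat split; auto. pose proof (bc_sum _ _ _ N z). lra. }
  destruct (HT j k Hf) as (A1 & A2 & A3). destruct (HT j' k' Hf') as (A4 & A5 & A6).
  assert (T1 : T i j k z) by (unfold inT; rewrite A1, A2, A3; repeat split; nra).
  assert (T2 : T i j' k' z) by (unfold inT; rewrite A4, A5, A6; repeat split; nra).
  destruct (F_neq F HS _ _ _ Hf) as (N1 & N2 & N3).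
  assert (Hj : j = i \/ j = j' \/ j = k').
  { apply (te_meet _ _ _ _ G j k i i j' k' z); auto; [now apply inT_cyc|]. rewrite A1. nra. }
  assert (Hk : k = i \/ k = j' \/ k = k').
  { apply (te_meet _ _ _ _ G k i j i j' k' z); auto; [now apply inT_cyc, inT_cyc|]. rewrite A2. nra. }
  destruct Hj as [-> |[-> | ->]], Hk as [-> |[-> | ->]]; try tauto.
  exfalso. rewrite crs_swap in Ha'. lra.
Qed.

(** The sectors cut arcs out of the circle [[0, 2 PI]]. Disjointness bounds the total length of the
    arcs by [2 PI], and [sector_cover] gives the opposite bound. *)
Lemma angle_sum_pos s i : NoDup s -> (forall j k, F i j k -> In j s) ->
  lsum (pos_pairs s i) (fun jk => ang i (fst jk) (snd jk)) = 2 * PI.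
Proof.
  intros Hnd Hs. pose proof PI_RGT_0 as Hpi.
  assert (Hal : forall j, exists t, psi j <> psi i -> 0 <= t < 2 * PI /\
     psi j = (fst (psi i) + len j i * cos t, snd (psi i) + len j i * sin t)).
  { intros j. destruct (classic (psi j = psi i)) as [E|E].
    - exists 0. tauto.
    - destruct (polar _ _ E) as (t & H1 & H2). exists t. auto. }
  set (al := fun j => proj1_sig (constructive_indefinite_description _ (Hal j))).
  assert (Hal' : forall j k, F i j k -> 0 <= al j < 2 * PI /\
     psi j = (fst (psi i) + len j i * cos (al j), snd (psi i) + len j i * sin (al j))).
  { intros j k Hf. unfold al. destruct (constructive_indefinite_description _ (Hal j)) as [t Ht]. simpl.
    apply Ht. intros E. apply Lp in Hf. rewrite E, dst_refl in Hf. lra. }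
  set (P := pos_pairs s i).
  assert (HP : forall j k, In (j, k) P <-> F i j k /\ 0 < area i j k) by (intros; now apply in_pos_pairs).
  (* An arc may pass the angle [2 PI]. The boolean selects the piece up to [2 PI] or the remainder
     that starts again at 0, which may have length 0. *)
  set (L := list_prod P (true :: false :: nil)).
  set (an := fun jk : V * V => ang i (fst jk) (snd jk)).
  set (lo := fun x : (V * V) * bool => if snd x then al (fst (fst x)) else 0).
  set (hi := fun x : (V * V) * bool => if snd x then Rmin (al (fst (fst x)) + an (fst x)) (2 * PI)
     else Rmax 0 (al (fst (fst x)) + an (fst x) - 2 * PI)).
  assert (Han : forall j k, F i j k -> 0 < ang i j k < PI).
  { intros j k Hf.
    exact (proj2 (proj2 (angle_cos_sin psi i j k (Lp _ _ _ Hf) (Lp _ _ _ (Fr _ _ _ Hf)) (Nz _ _ _ Hf)))). }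
  assert (Hsum : lsum L (fun x => hi x - lo x) = lsum P an).
  { unfold L. rewrite lsum_list_prod. apply lsum_ext. intros [j k] Hjk. apply HP in Hjk.
    destruct (Hal' j k ltac:(tauto)) as [? _]. destruct (Han j k ltac:(tauto)).
    unfold lsum, hi, lo, an in *; simpl in *. unfold Rmin, Rmax. repeat destruct (Rle_dec _ _); lra. }
  assert (HL : forall x, In x L -> F i (fst (fst x)) (snd (fst x)) /\ 0 < area i (fst (fst x)) (snd (fst x))).
  { intros [[j k] b] Hx. unfold L in Hx. apply in_prod_iff in Hx. now apply HP. }
  assert (Hlh : forall x, In x L -> 0 <= lo x <= hi x /\ hi x <= 2 * PI).
  { intros [[j k] b] Hx. destruct (HL _ Hx) as [Hf _]. simpl in Hf.
    destruct (Hal' j k Hf) as [? _]. destruct (Han j k Hf).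
    unfold hi, lo, an; simpl. destruct b; unfold Rmin, Rmax; destruct (Rle_dec _ _); lra. }
  assert (NL : NoDup L).
  { unfold L, P, pos_pairs. apply NoDup_list_prod; [apply NoDup_filter, NoDup_list_prod; auto|].
    constructor; [simpl; intuition discriminate|]. constructor; [simpl; tauto|constructor]. }
  fold an. rewrite <- Hsum. apply Rle_antisym.
  - apply Rle_trans with (1 * (2 * PI - 0)); [|lra].
    rewrite (lsum_ext L _ (fun x => 1 * (hi x - lo x))) by (intros; ring).
    apply (weighted_intervals_high L lo hi (fun _ => 1) 0 (2 * PI) 1); [lra|exact Hlh|].
    intros th Hth.
    rewrite (lsum_ext L _ (fun x => ind (lo x < th < hi x))) by (intros; ring).
    apply lsum_ind_unique; auto.
    set (z := (fst (psi i) + cos th, snd (psi i) + sin th) : C).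
    assert (Hin : forall x, In x L -> lo x < th < hi x ->
      0 < B (fst (fst x)) (snd (fst x)) i z /\ 0 < B (snd (fst x)) i (fst (fst x)) z /\
      (snd x = true <-> al (fst (fst x)) < th)).
    { intros [[j k] b] Hx Hlt. destruct (HL _ Hx) as [Hf Ha]. simpl in Hf, Ha. simpl fst; simpl snd.
      destruct (Hal' j k Hf) as [Hb Ej]. pose proof (Han j k Hf) as Hang.
      destruct (sector_coords i j k (al j) th Hf Ha Ej) as [C1 C2]. fold z in C1, C2.
      assert (Lj := Lp _ _ _ Hf). assert (Lk := Lp _ _ _ (Fr _ _ _ Hf)).
      rewrite (dst_sym (psi j)) in C2. rewrite (dst_sym (psi k)) in C1.
      rewrite C1, C2. unfold lo, hi, an in Hlt; simpl in Hlt. destruct b.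
      - assert (th < al j + ang i j k) by (revert Hlt; unfold Rmin; destruct (Rle_dec _ _); lra).
        assert (0 < sin (al j + ang i j k - th)) by (apply sin_gt_0; lra).
        assert (0 < sin (th - al j)) by (apply sin_gt_0; lra).
        repeat split; try (apply Rdiv_lt_0_compat; auto; nra). intros; lra.
      - assert (th < al j + ang i j k - 2 * PI) by (revert Hlt; unfold Rmax; destruct (Rle_dec _ _); lra).
        assert (0 < sin (al j + ang i j k - th)).
        { replace (al j + ang i j k - th) with ((al j + ang i j k - 2 * PI - th) + 2 * PI) by ring.
          rewrite sin_plus, cos_2PI, sin_2PI. rewrite Rmult_1_r, Rmult_0_r, Rplus_0_r. apply sin_gt_0; lra. }
        assert (0 < sin (th - al j)).
        { replace (th - al j) with ((th + 2 * PI - al j) - 2 * PI) by ring.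
          rewrite sin_minus, cos_2PI, sin_2PI. rewrite Rmult_1_r, Rmult_0_r, Rminus_0_r. apply sin_gt_0; lra. }
        repeat split; try (apply Rdiv_lt_0_compat; auto; nra); intros; try lra; discriminate. }
    intros x y Hx Hy Hlx Hly.
    destruct (Hin x Hx Hlx) as (X1 & X2 & X3). destruct (Hin y Hy Hly) as (Y1 & Y2 & Y3).
    destruct (HL x Hx) as [Hfx Hax]. destruct (HL y Hy) as [Hfy Hay].
    destruct x as [[j k] b], y as [[j' k'] b']; simpl in *.
    destruct (sectors_disjoint i j k j' k' z) as [E1 E2]; auto. subst.
    f_equal. destruct b, b'; auto; exfalso.
    + assert (false = true) by (apply Y3, X3; auto). discriminate.
    + assert (false = true) by (apply X3, Y3; auto). discriminate.
  - replace (2 * PI) with (2 * PI - 0) by ring.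
    apply interval_cover_length; [lra|intros; now apply Hlh|].
    intros th Hth.
    set (z := (fst (psi i) + cos th, snd (psi i) + sin th) : C).
    assert (exists j k, F i j k /\ 0 < area i j k /\ 0 <= B j k i z /\ 0 <= B k i j z) as (j & k & Hf & Ha & Hj & Hk).
    { destruct (sector_cover F psi kappa eps G i z) as (j & k & Hf & Hj & Hk).
      destruct (Rlt_dec 0 (area i j k)) as [Ha|Ha]; [exists j, k; auto|].
      exists k, j. assert (N := Nz _ _ _ Hf). repeat split; auto.
      - rewrite crs_swap. assert (area i j k < 0); [|lra]. destruct (Rtotal_order (area i j k) 0) as [?|[?|?]]; tauto.
      - now rewrite bc_swap.
      - now rewrite bc_swap. }
    destruct (Hal' j k Hf) as [Hb Ej]. pose proof (Han j k Hf) as Hang.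
    destruct (sector_coords i j k (al j) th Hf Ha Ej) as [C1 C2]. fold z in C1, C2.
    assert (Lj := Lp _ _ _ Hf). assert (Lk := Lp _ _ _ (Fr _ _ _ Hf)).
    rewrite (dst_sym (psi j)) in C2. rewrite (dst_sym (psi k)) in C1.
    assert (Hpull : forall l x, 0 < l -> 0 <= l * x / area i j k -> 0 <= x).
    { intros l x Hl Hx. apply Rnot_lt_le. intros Hneg.
      assert (l * x / area i j k < 0); [|lra].
      apply Ropp_lt_cancel. rewrite Ropp_0.
      replace (- (l * x / area i j k)) with (l * (- x) / area i j k) by (field; lra).
      apply Rdiv_lt_0_compat; nra. }
    rewrite C1 in Hj. rewrite C2 in Hk. apply Hpull in Hj; auto. apply Hpull in Hk; auto.
    assert (Hin : forall b, In ((j, k), b) L).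
    { intros b. unfold L. apply in_prod_iff. split; [now apply HP|]. destruct b; simpl; auto. }
    destruct (Rle_lt_dec (al j) th) as [Hc|Hc].
    + exists ((j, k), true). split; auto. unfold lo, hi, an; simpl.
      assert (th - al j <= ang i j k).
      { apply sin_interval; auto; [lra|]. now replace (ang i j k - (th - al j)) with (al j + ang i j k - th) by ring. }
      unfold Rmin. destruct (Rle_dec _ _); lra.
    + exists ((j, k), false). split; auto. unfold lo, hi, an; simpl.
      assert (th - al j + 2 * PI <= ang i j k).
      { apply sin_interval; auto; [lra| |].
        - rewrite sin_plus, cos_2PI, sin_2PI. lra.
        - replace (ang i j k - (th - al j + 2 * PI)) with ((al j + ang i j k - th) - 2 * PI) by ring.
          rewrite sin_minus, cos_2PI, sin_2PI. lra. }
      unfold Rmax. destruct (Rle_dec _ _); lra.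
Qed.

(** Ordered pairs count every triangle at [i] twice, whence [4 * PI]. *)
Lemma angle_sum s i : NoDup s -> (forall j k, F i j k -> In j s) ->
  lsum s (fun j => lsum s (fun k => ind (F i j k) * ang i j k)) = 4 * PI.
Proof.
  intros Hnd Hs. pose proof (angle_sum_pos s i Hnd Hs) as H. unfold pos_pairs in H.
  rewrite lsum_filter, lsum_list_prod in H. simpl in H.
  set (f := fun j k => (if if excluded_middle_informative (F i j k /\ 0 < area i j k) then true else false
     then 1 else 0) * ang i j k) in *.
  assert (E : lsum s (fun j => lsum s (fun k => ind (F i j k) * ang i j k)) =
    lsum s (fun j => lsum s (fun k => f j k)) + lsum s (fun j => lsum s (fun k => f k j))).
  { rewrite <- lsum_plus. apply lsum_ext. intros j _. rewrite <- lsum_plus. apply lsum_ext. intros k _.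
    unfold f. rewrite (ang_swap i k j).
    assert (Hsym : F i k j <-> F i j k) by (split; apply Fr).
    assert (Ear : area i k j = - area i j k) by apply crs_swap.
    destruct (classic (F i j k)) as [Hf|Hf].
    - rewrite (ind_true _ Hf).
      assert (N := Nz _ _ _ Hf).
      destruct (excluded_middle_informative (F i j k /\ 0 < area i j k)) as [H1|H1];
      destruct (excluded_middle_informative (F i k j /\ 0 < area i k j)) as [H2|H2]; try lra; exfalso.
      assert (~ 0 < area i j k) by tauto. assert (~ 0 < area i k j) by tauto.
      apply N. lra.
    - rewrite (ind_false _ Hf).
      destruct (excluded_middle_informative (F i j k /\ 0 < area i j k)) as [H1|H1]; [tauto|].
      destruct (excluded_middle_informative (F i k j /\ 0 < area i k j)) as [H2|H2]; [tauto|]. lra. }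
  rewrite E. rewrite (lsum_swap s s (fun j k => f k j)).
  change (lsum s (fun x => lsum s (fun y => f x y)) = 2 * PI) in H. lra.
Qed.

End VertexAngles.

Definition eqdecV {V : Type} (x y : V) : {x = y} + {x <> y} := excluded_middle_informative (x = y).

(** * Separation of vertices and faces *)

Section Separation.
Context {V : Type} (F : V -> V -> V -> Prop) (psi : V -> C) (kappa eps : R).
Hypothesis G : fat_triangulation F psi kappa eps.
Implicit Types (i j k m n p q : V).

Notation B i j k z := (bc (psi i) (psi j) (psi k) z).
Notation T i j k z := (inT (psi i) (psi j) (psi k) z).
Notation len i j := (dst (psi i) (psi j)).
Notation area i j k := (crs (psi i) (psi j) (psi k)).
Notation ang i j k := (angle (fun a b => dst (psi a) (psi b)) i j k).

Let HS := te_surf _ _ _ _ G.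
Let Fc i j k : F i j k -> F j k i := F_cyc F HS i j k.
Let Fs i j k : F i j k -> F j i k := F_swap12 F HS i j k.
Let Fr i j k : F i j k -> F i k j := F_swap23 F HS i j k.
Let Nz i j k : F i j k -> area i j k <> 0 := area_nz F psi kappa eps G i j k.
Let Lp i j k : F i j k -> 0 < len i j := te_pos _ _ _ _ G i j k.
Let K0 : 0 < kappa := te_kappa _ _ _ _ G.

Lemma star_list i : exists s, NoDup s /\ forall j k, F i j k -> In j s.
Proof.
  pose proof HS as (_ & _ & _ & _ & Hfin & _). destruct (Hfin i) as [s Hs].
  exists (nodup eqdecV s). split; [apply NoDup_nodup|]. intros j k H. apply nodup_In. eauto.
Qed.

(** There are at most [4 PI / eps] ordered pairs of consecutive neighbours, and between such
    neighbours the logarithm of the edge length changes by at most [ln (/ kappa)]. *)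
Definition star_const : R := exp (4 * PI / eps * ln (/ kappa)).

(** The link of [i] is connected, so the intervals between the logarithmic lengths of consecutive
    neighbours cover everything between the values at [m] and [j]. *)
Lemma star_comparable i j k m n : F i j k -> F i m n -> len i j <= star_const * len i m.
Proof.
  intros Hj Hm. destruct (star_list i) as [s [Hnd Hs]].
  set (P := nbr_pairs F s i).
  assert (HP : forall j k, In (j, k) P <-> F i j k) by (intros; now apply (in_nbr_pairs F psi kappa eps G)).
  assert (K1 : kappa <= 1) by (eapply kappa_le1; eauto).
  assert (Hlk : 0 <= ln (/ kappa)).
  { rewrite <- ln_1. apply ln_le; [lra|]. rewrite <- Rinv_1. apply Rinv_le_contravar; lra. }
  pose proof (te_eps _ _ _ _ G) as He.
  set (h := fun v => ln (len i v)).
  assert (Hstep : forall a b, F i a b -> Rabs (h a - h b) <= ln (/ kappa)).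
  { assert (Hone : forall a b, F i a b -> h a - h b <= ln (/ kappa)).
    { intros a b Hab. unfold h.
      assert (La := Lp _ _ _ Hab). assert (Lb := Lp _ _ _ (Fr _ _ _ Hab)).
      assert (len i a <= / kappa * len i b).
      { pose proof (len_ratio F psi kappa eps G i a b Hab). apply Rmult_le_reg_l with kappa; auto.
        rewrite <- Rmult_assoc, Rinv_r, Rmult_1_l by lra. auto. }
      apply ln_le in H; auto. rewrite ln_mult in H; auto; [lra|]. now apply Rinv_0_lt_compat. }
    intros a b Hab. pose proof (Hone a b Hab). pose proof (Hone b a (Fr _ _ _ Hab)).
    apply Rabs_le. lra. }
  (* Every corner at [i] has angle at least [eps] and the angles sum to [4 PI] over ordered
     pairs. *)
  assert (Hcount : lsum P (fun _ => 1) <= 4 * PI / eps).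
  { apply Rmult_le_reg_r with eps; auto. unfold Rdiv. rewrite Rmult_assoc, Rinv_l, Rmult_1_r by lra.
    rewrite <- (angle_sum F psi kappa eps G s i Hnd Hs), Rmult_comm, <- lsum_scal.
    unfold P, nbr_pairs. rewrite lsum_filter, lsum_list_prod.
    apply lsum_le. intros a _. apply lsum_le. intros b _. simpl. unfold ind.
    destruct (excluded_middle_informative (F i a b)) as [Hab|]; [|lra].
    pose proof (te_angle _ _ _ _ G i a b Hab). lra. }
  assert (Hmain : h j - h m <= 4 * PI / eps * ln (/ kappa)).
  { destruct (Rle_lt_dec (h j) (h m)) as [Hle|Hlt].
    { assert (0 <= 4 * PI / eps * ln (/ kappa)); [|lra]. apply Rmult_le_pos; auto.
      pose proof PI_RGT_0. apply Rmult_le_pos; [lra|]. left. now apply Rinv_0_lt_compat. }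
    apply Rle_trans with (lsum P (fun ab => Rmax (h (fst ab)) (h (snd ab)) - Rmin (h (fst ab)) (h (snd ab)))).
    - apply interval_cover_length; [lra| |].
      + intros ab _. eapply Rle_trans; [apply Rmin_l|apply Rmax_l].
      + intros c Hc. apply NNPP. intros Hno.
        assert (Hpres : forall a b, link_path F i a b -> h a < c -> h b < c).
        { intros a b Hl. induction Hl as [a|a b d Hab Hl IH]; auto. intros Ha. apply IH.
          apply Rnot_le_lt. intros Hb. apply Hno. exists (a, b). split; [now apply HP|]. simpl.
          unfold Rmin, Rmax. destruct (Rle_dec _ _); lra. }
        assert (h j < c); [|lra]. apply (Hpres m j); [|lra].
        pose proof HS as (_ & _ & _ & _ & _ & Hl & _). apply Hl; eexists; eauto.
    - apply Rle_trans with (lsum P (fun _ => ln (/ kappa) * 1)).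
      + apply lsum_le. intros [a b] Hab. apply HP in Hab. specialize (Hstep a b Hab). simpl.
        revert Hstep. unfold Rmin, Rmax, Rabs. destruct (Rle_dec _ _), (Rcase_abs _); lra.
      + rewrite lsum_scal, Rmult_comm. apply Rmult_le_compat_r; auto. }
  assert (La := Lp _ _ _ Hj). assert (Lb := Lp _ _ _ Hm).
  unfold h in Hmain. unfold star_const.
  assert (Hmain' : ln (len i j) <= 4 * PI / eps * ln (/ kappa) + ln (len i m)) by lra.
  rewrite <- (exp_ln (len i j)), <- (exp_ln (len i m)) at 1 by auto. rewrite <- exp_plus.
  destruct Hmain' as [H|H]; [left; now apply exp_increasing | rewrite H; lra].
Qed.

Lemma star_const_pos : 0 < star_const.
Proof. apply exp_pos. Qed.

Definition sep_const : R := kappa ^ 2 / star_const.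

Lemma sep_const_pos : 0 < sep_const.
Proof. apply Rdiv_lt_0_compat; [now apply pow_lt|apply star_const_pos]. Qed.

Lemma vertex_separation i j k p : F i j k -> p <> i -> sep_const * len i j <= len i p.
Proof.
  intros Hf Hp.
  destruct (vertex_separation_some F psi kappa eps G i p Hp) as (a & b & Hab & Hl).
  pose proof (star_comparable i j k a b Hf Hab). pose proof star_const_pos.
  apply Rle_trans with (2 := Hl). unfold sep_const.
  apply Rmult_le_reg_l with star_const; auto.
  replace (star_const * (kappa ^ 2 / star_const * len i j)) with (kappa ^ 2 * len i j) by (field; lra).
  assert (0 < kappa ^ 2) by now apply pow_lt. nra.
Qed.

Lemma face_len_le i j k : F i j k -> kappa * len i j <= len i k /\ kappa * len i j <= len j k.
Proof.
  intros H. split; [now apply (len_ratio F psi kappa eps G)|].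
  rewrite (dst_sym (psi i)). apply (len_ratio F psi kappa eps G). now apply Fs.
Qed.

Lemma bary_lip3 i j k z z' : F i j k ->
  kappa ^ 3 * len i j * Rabs (B i j k z - B i j k z') <= dst z z' /\
  kappa ^ 3 * len i j * Rabs (B j k i z - B j k i z') <= dst z z' /\
  kappa ^ 3 * len i j * Rabs (B k i j z - B k i j z') <= dst z z'.
Proof.
  intros H. assert (K1 : kappa <= 1) by (eapply kappa_le1; eauto).
  destruct (face_len_le i j k H) as [L1 L2].
  pose proof (bary_lip2 F psi kappa eps G i j k z z' H) as H1.
  pose proof (bary_lip2 F psi kappa eps G j k i z z' (Fc _ _ _ H)) as H2.
  pose proof (bary_lip2 F psi kappa eps G k i j z z' (Fc _ _ _ (Fc _ _ _ H))) as H3.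
  rewrite (dst_sym (psi k)) in H3.
  assert (P2 : 0 < kappa ^ 2) by now apply pow_lt.
  assert (Hx : forall l D, 0 <= D -> kappa * len i j <= l -> kappa ^ 2 * l * D <= dst z z' ->
     kappa ^ 3 * len i j * D <= dst z z').
  { intros l D HD Hl Hd. apply Rle_trans with (2 := Hd). apply Rmult_le_compat_r; auto.
    replace (kappa ^ 3 * len i j) with (kappa ^ 2 * (kappa * len i j)) by ring.
    apply Rmult_le_compat_l; lra. }
  assert (Lij := Lp _ _ _ H).
  repeat split; [apply (Hx (len i j))|apply (Hx (len j k))|apply (Hx (len i k))]; auto; try apply Rabs_pos.
  nra.
Qed.

(* The vertex [p] lies beyond the edge [ij] of [f], and beyond the edge [jm] of the triangle across it:
   if it is close to [f] it must be close to [psi j]. *)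
Lemma face_separation_corner i j k m p x : F i j k -> F i j m -> T i j k x ->
  p <> j -> B k i j (psi p) < 0 -> B i j m (psi p) < 0 ->
  sep_const * kappa ^ 6 / 2 * len i j <= dst x (psi p).
Proof.
  intros Hf Hm (X1 & X2 & X3) Hp Hk Hi.
  destruct (bary_lip3 i j k x (psi p) Hf) as (L1 & L2 & L3).
  set (d := len i j) in *. assert (Hd : 0 < d) by apply (Lp _ _ _ Hf).
  assert (K1 : kappa <= 1) by (eapply kappa_le1; eauto).
  set (t := dst x (psi p) / (kappa ^ 3 * d)).
  assert (P3 : 0 < kappa ^ 3) by now apply pow_lt.
  assert (Pd : 0 < kappa ^ 3 * d) by nra.
  assert (Et : dst x (psi p) = t * (kappa ^ 3 * d)) by (unfold t; field; lra).
  assert (Hdiv : forall D, kappa ^ 3 * d * D <= dst x (psi p) -> D <= t).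
  { intros D HD. apply Rmult_le_reg_r with (kappa ^ 3 * d); auto. lra. }
  apply Hdiv in L1. apply Hdiv in L3.
  assert (Ht : 0 <= t) by (pose proof (Rabs_pos (B i j k x - B i j k (psi p))); lra).
  assert (Bk : - t <= B k i j (psi p)) by (apply Rabs_le_between in L3; lra).
  assert (Bi : - t <= B i j k (psi p)) by (apply Rabs_le_between in L1; lra).
  set (mu := B i j m (psi k)).
  assert (Hmu : Rabs mu <= / kappa ^ 3).
  { pose proof (bary_lip2 F psi kappa eps G i j m (psi k) (psi j) Hm) as H.
    rewrite bc_other1 in H by now apply Nz. rewrite Rminus_0_r in H. fold mu d in H.
    assert (Hkj : kappa * dst (psi k) (psi j) <= d).
    { rewrite (dst_sym (psi k)). unfold d. rewrite (dst_sym (psi i)).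
      apply (len_ratio F psi kappa eps G). auto. }
    apply Rmult_le_reg_l with (kappa ^ 3 * d); auto.
    replace (kappa ^ 3 * d * / kappa ^ 3) with d by (field; lra).
    replace (kappa ^ 3 * d * Rabs mu) with (kappa * (kappa ^ 2 * d * Rabs mu)) by ring. nra. }
  assert (Eaff : B i j m (psi p) = B i j k (psi p) + mu * B k i j (psi p)).
  { rewrite (bc_affine _ _ _ (Nz _ _ _ Hm) _ _ _ (psi i) (psi j) (psi k) (psi p)
      (bc_sum _ _ _ (Nz _ _ _ Hf) (psi p)) (bc_fst _ _ _ (Nz _ _ _ Hf) (psi p))
      (bc_snd _ _ _ (Nz _ _ _ Hf) (psi p))).
    rewrite bc_self, bc_other1 by now apply Nz. fold mu. ring. }
  assert (Hinv : 1 <= / kappa ^ 3).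
  { rewrite <- Rinv_1. apply Rinv_le_contravar; auto. simpl. nra. }
  assert (Hmub : mu * - B k i j (psi p) <= / kappa ^ 3 * t).
  { apply Rle_trans with (Rabs mu * - B k i j (psi p)).
    - apply Rmult_le_compat_r; [lra|apply Rle_abs].
    - apply Rmult_le_compat; try lra. apply Rabs_pos. }
  assert (Bi' : Rabs (B i j k (psi p)) <= / kappa ^ 3 * t) by (apply Rabs_le; nra).
  assert (Bk' : Rabs (B k i j (psi p)) <= t) by (apply Rabs_le; lra).
  assert (Hjp : dst (psi j) (psi p) <= Rabs (B i j k (psi p)) * d + Rabs (B k i j (psi p)) * len j k).
  { assert (E : (psi j - psi p)%C = (RtoC (B i j k (psi p)) * (psi j - psi i) + RtoC (B k i j (psi p)) * (psi j - psi k))%C).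
    { pose proof (bc_sum _ _ _ (Nz _ _ _ Hf) (psi p)) as S1.
      rewrite (pt3_bc (psi i) (psi j) (psi k) (psi p) (Nz _ _ _ Hf)) at 1.
      replace (B j k i (psi p)) with (1 - B i j k (psi p) - B k i j (psi p)) by lra.
      unfold pt3, RtoC, Cminus, Cplus, Copp, Cmult. destruct (psi i), (psi j), (psi k). simpl. f_equal; ring. }
    unfold dst at 1. rewrite E. eapply Rle_trans; [apply Cmod_triangle|].
    rewrite !Cmod_mult, !Cmod_R. unfold d. rewrite (dst_sym (psi i) (psi j)). unfold dst. lra. }
  assert (Hjk : len j k <= / kappa ^ 3 * d).
  { assert (kappa * len j k <= d).
    { unfold d. rewrite (dst_sym (psi i)). apply (len_ratio F psi kappa eps G). now apply Fc. }
    assert (0 < len j k) by apply (Lp _ _ _ (Fc _ _ _ Hf)).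
    apply Rmult_le_reg_l with (kappa ^ 3); auto. rewrite <- Rmult_assoc, Rinv_r, Rmult_1_l by lra.
    assert (kappa ^ 3 <= kappa) by (simpl; nra). nra. }
  pose proof (vertex_separation j i k p (Fs _ _ _ Hf) Hp) as Hsep.
  rewrite (dst_sym (psi j) (psi i)) in Hsep. fold d in Hsep.
  assert (Hfin : sep_const * d <= 2 * (/ kappa ^ 3 * t * d)).
  { apply Rle_trans with (1 := Hsep). apply Rle_trans with (1 := Hjp).
    assert (Rabs (B i j k (psi p)) * d <= / kappa ^ 3 * t * d) by (apply Rmult_le_compat_r; lra).
    assert (Rabs (B k i j (psi p)) * len j k <= t * (/ kappa ^ 3 * d)).
    { apply Rmult_le_compat; auto; [apply Rabs_pos|apply dst_nonneg]. }
    lra. }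
  rewrite Et.
  replace (sep_const * kappa ^ 6 / 2 * d) with (kappa ^ 6 / 2 * (sep_const * d)) by (field; lra).
  apply Rle_trans with (kappa ^ 6 / 2 * (2 * (/ kappa ^ 3 * t * d))).
  - apply Rmult_le_compat_l; auto. assert (0 < kappa ^ 6) by now apply pow_lt. lra.
  - right. field. lra.
Qed.

(** The minimum covers the two cases of [face_separation_side]; the factor [kappa] passes from the
    separating side to [ij]. *)
Definition face_const : R := kappa * Rmin (kappa ^ 5) (sep_const * kappa ^ 6 / 2).

Lemma face_const_pos : 0 < face_const.
Proof.
  unfold face_const. apply Rmult_lt_0_compat; auto. apply Rmin_glb_lt; [now apply pow_lt|].
  pose proof sep_const_pos. assert (0 < kappa ^ 6) by now apply pow_lt. nra.
Qed.

(** Let [ijm] be the second face at [ij]. If [p = m], its coordinate at [k] is at most [- kappa^2]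
    by comparison of areas. Otherwise [p] is not in [ijm], so it lies beyond one of the other two
    sides, and [face_separation_corner] applies at [j] or at [i]. *)
Lemma face_separation_side i j k p x : F i j k -> T i j k x -> p <> i -> p <> j -> p <> k ->
  B k i j (psi p) < 0 -> Rmin (kappa ^ 5) (sep_const * kappa ^ 6 / 2) * len i j <= dst x (psi p).
Proof.
  intros Hf HT Hi Hj Hk Hb. assert (Hd := Lp _ _ _ Hf).
  assert (K1 : kappa <= 1) by (eapply kappa_le1; eauto).
  destruct (te_second _ _ _ _ G i j k Hf) as (m & Hmk & Hm).
  pose proof (other_side F psi kappa eps G i j k m (psi p) Hf Hm (not_eq_sym Hmk) Hb) as Hpm.
  assert (Hcorner : sep_const * kappa ^ 6 / 2 * len i j <= dst x (psi p) ->
    Rmin (kappa ^ 5) (sep_const * kappa ^ 6 / 2) * len i j <= dst x (psi p)).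
  { intros H. eapply Rle_trans; [|apply H]. apply Rmult_le_compat_r; [lra|apply Rmin_r]. }
  destruct (classic (p = m)) as [->|Hpm'].
  - apply Rle_trans with (kappa ^ 5 * len i j).
    { apply Rmult_le_compat_r; [lra|apply Rmin_l]. }
    destruct (bary_lip3 i j k x (psi m) Hf) as (_ & _ & L3).
    destruct HT as (_ & _ & X3).
    assert (Hbm : kappa ^ 2 <= Rabs (B k i j (psi m))).
    { unfold bc. unfold Rdiv. rewrite Rabs_mult, Rabs_inv.
      pose proof (te_fat _ _ _ _ G i j m Hm) as H1. rewrite (crs_cyc (psi m)) in H1.
      pose proof (crs_abs_le (psi i) (psi j) (psi k)) as H2. rewrite (crs_cyc (psi k)) in H2.
      pose proof (len_ratio F psi kappa eps G i k j (Fr _ _ _ Hf)) as H3.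
      set (a := Rabs (crs (psi m) (psi i) (psi j))) in *.
      set (b := Rabs (crs (psi k) (psi i) (psi j))) in *.
      assert (Hb0 : 0 < b) by (apply Rabs_pos_lt, Nz, Fc, Fc, Hf).
      apply Rmult_le_reg_r with b; auto. rewrite Rmult_assoc, Rinv_l, Rmult_1_r by lra.
      apply Rle_trans with (2 := H1).
      apply Rle_trans with (kappa ^ 2 * (len i j * len i k)).
      - apply Rmult_le_compat_l; auto. left. now apply pow_lt.
      - replace (kappa ^ 2 * (len i j * len i k)) with (kappa * len i j * (kappa * len i k)) by ring.
        replace (kappa * len i j ^ 2) with (kappa * len i j * len i j) by ring.
        apply Rmult_le_compat_l; auto. nra. }
    rewrite Rabs_left in Hbm by auto.
    assert (kappa ^ 2 <= Rabs (B k i j x - B k i j (psi m))) by (rewrite Rabs_pos_eq; lra).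
    apply Rle_trans with (2 := L3).
    replace (kappa ^ 5 * len i j) with (kappa ^ 3 * len i j * kappa ^ 2) by ring.
    apply Rmult_le_compat_l; auto. left. apply Rmult_lt_0_compat; auto. now apply pow_lt.
  - apply Hcorner.
    destruct (Rle_lt_dec 0 (B i j m (psi p))) as [H1|H1].
    + destruct (Rle_lt_dec 0 (B j m i (psi p))) as [H2|H2].
      * exfalso. destruct (vertex_in_face F psi kappa eps G p i j m Hm) as [E|[E|E]]; auto.
        repeat split; auto. lra.
      * rewrite (dst_sym (psi i)).
        apply (face_separation_corner j i k m p x); auto.
        -- now apply inT_swap, inT_cyc.
        -- now rewrite bc_swap.
        -- now rewrite bc_swap.
    + apply (face_separation_corner i j k m p x); auto.
Qed.

Lemma face_separation i j k p x : F i j k -> T i j k x -> p <> i -> p <> j -> p <> k ->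
  face_const * len i j <= dst x (psi p).
Proof.
  intros Hf HT Hi Hj Hk. assert (K1 : kappa <= 1) by (eapply kappa_le1; eauto).
  destruct (face_len_le i j k Hf) as [L1 L2]. assert (Lij := Lp _ _ _ Hf).
  set (c := Rmin (kappa ^ 5) (sep_const * kappa ^ 6 / 2)).
  assert (Hc : 0 < c) by (pose proof face_const_pos; unfold face_const in *; fold c in H; nra).
  unfold face_const. fold c.
  destruct (Rlt_dec (B k i j (psi p)) 0) as [H1|H1].
  { apply Rle_trans with (c * len i j); [|now apply (face_separation_side i j k)].
    apply Rmult_le_compat_r; nra. }
  destruct (Rlt_dec (B i j k (psi p)) 0) as [H2|H2].
  { apply Rle_trans with (c * len j k).
    - replace (kappa * c * len i j) with (c * (kappa * len i j)) by ring. apply Rmult_le_compat_l; lra.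
    - apply (face_separation_side j k i); auto; now apply inT_cyc. }
  destruct (Rlt_dec (B j k i (psi p)) 0) as [H3|H3].
  { apply Rle_trans with (c * len k i).
    - rewrite (dst_sym (psi k)). replace (kappa * c * len i j) with (c * (kappa * len i j)) by ring.
      apply Rmult_le_compat_l; lra.
    - apply (face_separation_side k i j); auto; now apply inT_cyc, inT_cyc. }
  exfalso. destruct (vertex_in_face F psi kappa eps G p i j k Hf) as [E|[E|E]]; auto.
  repeat split; lra.
Qed.

End Separation.

(** * Neighbourhoods of faces, packing, and oscillation along paths *)

Section Cover.
Context {V : Type} (F : V -> V -> V -> Prop) (psi : V -> C) (kappa eps : R).
Hypothesis G : fat_triangulation F psi kappa eps.
Implicit Types (i j k m n p q : V).

Notation B i j k z := (bc (psi i) (psi j) (psi k) z).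
Notation T i j k z := (inT (psi i) (psi j) (psi k) z).
Notation len i j := (dst (psi i) (psi j)).
Notation area i j k := (crs (psi i) (psi j) (psi k)).

Let HS := te_surf _ _ _ _ G.
Let Fc i j k : F i j k -> F j k i := F_cyc F HS i j k.
Let Fs i j k : F i j k -> F j i k := F_swap12 F HS i j k.
Let Fr i j k : F i j k -> F i k j := F_swap23 F HS i j k.
Let Nz i j k : F i j k -> area i j k <> 0 := area_nz F psi kappa eps G i j k.
Let Lp i j k : F i j k -> 0 < len i j := te_pos _ _ _ _ G i j k.
Let K0 : 0 < kappa := te_kappa _ _ _ _ G.

Lemma bary_pos_nbhd i j k x : F i j k -> 0 < B i j k x ->
  exists d, 0 < d /\ forall y, dst x y < d -> 0 < B i j k y.
Proof.
  intros Hf Hx. assert (Lij := Lp _ _ _ Hf).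
  assert (P2 : 0 < kappa ^ 2) by now apply pow_lt.
  exists (kappa ^ 2 * len i j * B i j k x). split; [apply Rmult_lt_0_compat; nra|].
  intros y Hy. pose proof (bary_lip2 F psi kappa eps G i j k x y Hf) as H.
  assert (HD : Rabs (B i j k x - B i j k y) < B i j k x).
  { apply Rmult_lt_reg_l with (kappa ^ 2 * len i j); [nra|]. lra. }
  apply Rabs_def2 in HD. lra.
Qed.

Lemma vertex_nbhd i j k : F i j k -> exists d, 0 < d /\
  forall y, dst (psi i) y < d -> exists a b, F i a b /\ T i a b y.
Proof.
  intros Hf. assert (Lij := Lp _ _ _ Hf).
  pose proof (star_const_pos kappa eps) as Hsc.
  assert (P2 : 0 < kappa ^ 2) by now apply pow_lt.
  exists (kappa ^ 2 * (len i j / star_const kappa eps)).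
  split; [apply Rmult_lt_0_compat; auto; now apply Rdiv_lt_0_compat|].
  intros y Hy. destruct (sector_cover F psi kappa eps G i y) as (a & b & Hab & Ha & Hb).
  exists a, b. split; auto. repeat split; auto.
  pose proof (star_comparable F psi kappa eps G i j k a b Hf Hab) as Hsl.
  pose proof (bary_lip2 F psi kappa eps G i a b (psi i) y Hab) as H.
  rewrite bc_self in H by auto.
  assert (HD : Rabs (1 - B i a b y) < 1).
  { assert (Lia := Lp _ _ _ Hab).
    apply Rmult_lt_reg_l with (kappa ^ 2 * len i a); [nra|].
    apply Rle_lt_trans with (1 := H). apply Rlt_le_trans with (1 := Hy).
    rewrite Rmult_1_r. apply Rmult_le_compat_l; [lra|].
    apply Rmult_le_reg_l with (star_const kappa eps); auto.
    replace (star_const kappa eps * (len i j / star_const kappa eps)) with (len i j) by (field; lra). auto. }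
  apply Rabs_def2 in HD. lra.
Qed.

Lemma edge_nbhd i j k x : F i j k -> B k i j x = 0 -> 0 < B i j k x -> 0 < B j k i x ->
  exists d, 0 < d /\ forall y, dst x y < d -> exists m, F i j m /\ T i j m y.
Proof.
  intros Hf Hk Hi Hj. destruct (te_second _ _ _ _ G i j k Hf) as (m & Hmk & Hm).
  destruct (line_bary F psi kappa eps G i j k m x Hf Hm Hk) as (E1 & E2 & _).
  destruct (bary_pos_nbhd i j k x Hf Hi) as (d1 & D1 & D1').
  destruct (bary_pos_nbhd j k i x (Fc _ _ _ Hf) Hj) as (d2 & D2 & D2').
  destruct (bary_pos_nbhd i j m x Hm ltac:(lra)) as (d3 & D3 & D3').
  destruct (bary_pos_nbhd j m i x (Fc _ _ _ Hm) ltac:(lra)) as (d4 & D4 & D4').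
  exists (Rmin (Rmin d1 d2) (Rmin d3 d4)). split; [repeat apply Rmin_glb_lt; auto|].
  intros y Hy.
  assert (Hy' : dst x y < d1 /\ dst x y < d2 /\ dst x y < d3 /\ dst x y < d4).
  { revert Hy. unfold Rmin. repeat destruct (Rle_dec _ _); lra. }
  destruct Hy' as (Y1 & Y2 & Y3 & Y4).
  specialize (D1' y Y1). specialize (D2' y Y2). specialize (D3' y Y3). specialize (D4' y Y4).
  destruct (Rle_lt_dec 0 (B k i j y)) as [H|H].
  - exists k. split; auto. repeat split; lra.
  - exists m. split; auto.
    pose proof (other_side F psi kappa eps G i j k m y Hf Hm (not_eq_sym Hmk) H).
    repeat split; lra.
Qed.

(** Inside the face one triangle suffices, on an edge the second face is added, and at a vertex the
    whole star. This openness replaces surjectivity for the second embedding. *)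
Lemma face_nbhd i j k x : F i j k -> T i j k x -> exists d, 0 < d /\
  forall y, dst x y < d -> exists a b c, F a b c /\ T a b c y /\ (a = i \/ a = j \/ a = k).
Proof.
  intros Hf (Hi & Hj & Hk).
  assert (Hvert : forall i j k, F i j k -> B j k i x = 0 -> B k i j x = 0 -> exists d, 0 < d /\
    forall y, dst x y < d -> exists a b c, F a b c /\ T a b c y /\ a = i).
  { intros i' j' k' Hf' E1 E2.
    assert (Ex : x = psi i').
    { rewrite (pt3_bc _ _ _ x (Nz _ _ _ Hf')). rewrite E1, E2.
      pose proof (bc_sum _ _ _ (Nz _ _ _ Hf') x).
      replace (B i' j' k' x) with 1 by lra. unfold pt3.
      transitivity (fst (psi i'), snd (psi i')); [f_equal; ring | symmetry; apply surjective_pairing]. }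
    rewrite Ex. destruct (vertex_nbhd i' j' k' Hf') as (d & Hd & Hd').
    exists d. split; auto. intros y Hy. destruct (Hd' y Hy) as (a & b & H1 & H2).
    exists i', a, b. auto. }
  assert (Hedge : forall i j k, F i j k -> B k i j x = 0 -> 0 < B i j k x -> 0 < B j k i x -> exists d, 0 < d /\
    forall y, dst x y < d -> exists a b c, F a b c /\ T a b c y /\ a = i).
  { intros i' j' k' Hf' E1 E2 E3. destruct (edge_nbhd i' j' k' x Hf' E1 E2 E3) as (d & Hd & Hd').
    exists d. split; auto. intros y Hy. destruct (Hd' y Hy) as (m & H1 & H2). exists i', j', m. auto. }
  assert (Hwk : forall v, v = i \/ v = j \/ v = k ->
    (exists d, 0 < d /\ forall y, dst x y < d -> exists a b c, F a b c /\ T a b c y /\ a = v) ->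
    exists d, 0 < d /\ forall y, dst x y < d -> exists a b c, F a b c /\ T a b c y /\ (a = i \/ a = j \/ a = k)).
  { intros v Hv (d & Hd & Hd'). exists d. split; auto. intros y Hy.
    destruct (Hd' y Hy) as (a & b & c & H1 & H2 & ->). exists v, b, c. auto. }
  assert (F1 := Fc _ _ _ Hf). assert (F2 := Fc _ _ _ F1).
  destruct (Req_dec (B i j k x) 0) as [Zi|Zi], (Req_dec (B j k i x) 0) as [Zj|Zj],
    (Req_dec (B k i j x) 0) as [Zk|Zk].
  - pose proof (bc_sum _ _ _ (Nz _ _ _ Hf) x). lra.
  - apply (Hwk k); auto. apply (Hvert k i j); auto.
  - apply (Hwk j); auto. apply (Hvert j k i); auto.
  - apply (Hwk j); auto. apply (Hedge j k i); auto; lra.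
  - apply (Hwk i); auto. apply (Hvert i j k); auto.
  - apply (Hwk k); auto. apply (Hedge k i j); auto; lra.
  - apply (Hwk i); auto. apply (Hedge i j k); auto; lra.
  - destruct (bary_pos_nbhd i j k x Hf ltac:(lra)) as (d1 & D1 & D1').
    destruct (bary_pos_nbhd j k i x F1 ltac:(lra)) as (d2 & D2 & D2').
    destruct (bary_pos_nbhd k i j x F2 ltac:(lra)) as (d3 & D3 & D3').
    exists (Rmin d1 (Rmin d2 d3)). split; [repeat apply Rmin_glb_lt; auto|].
    intros y Hy.
    assert (Hy' : dst x y < d1 /\ dst x y < d2 /\ dst x y < d3)
      by (revert Hy; unfold Rmin; repeat destruct (Rle_dec _ _); lra).
    exists i, j, k. split; auto. split; auto.
    repeat split; left; [apply D1'|apply D2'|apply D3']; tauto.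
Qed.

Lemma triangle_point_dst i j k x : F i j k -> T i j k x -> dst (psi i) x <= len i j / kappa.
Proof.
  intros Hf HT. assert (K1 : kappa <= 1) by (eapply kappa_le1; eauto). assert (Lij := Lp _ _ _ Hf).
  apply (inT_dst_le (psi i) (psi j) (psi k)); auto.
  - rewrite dst_refl. left. now apply Rdiv_lt_0_compat.
  - apply Rmult_le_reg_l with kappa; auto. replace (kappa * (len i j / kappa)) with (len i j) by (field; lra). nra.
  - apply Rmult_le_reg_l with kappa; auto. replace (kappa * (len i j / kappa)) with (len i j) by (field; lra).
    apply (len_ratio F psi kappa eps G). now apply Fr.
Qed.

(** The two summands are the two cases of [faces_reach]. *)
Definition reach_const : R := 1 + (/ face_const kappa eps + star_const kappa eps / kappa) / kappa.

Lemma reach_const_ge1 : 1 <= reach_const.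
Proof.
  unfold reach_const. pose proof (face_const_pos F psi kappa eps G). pose proof (star_const_pos kappa eps).
  assert (0 < / face_const kappa eps) by now apply Rinv_0_lt_compat.
  assert (0 < star_const kappa eps / kappa) by now apply Rdiv_lt_0_compat.
  assert (0 < (/ face_const kappa eps + star_const kappa eps / kappa) / kappa) by (apply Rdiv_lt_0_compat; lra).
  lra.
Qed.

(** If [q] is a vertex of the triangle, its sides are comparable with [len q a]. Otherwise the
    triangle stays away from [q] by a multiple of its size, which is therefore at most a multiple of
    [r]. *)
Lemma faces_reach q a b r i j k x : F q a b -> len q a <= r -> F i j k -> T i j k x ->
  dst (psi q) x <= r -> dst (psi q) (psi i) <= reach_const * r /\ len i j <= reach_const * r.
Proof.
  intros Hq Hqa Hf HT Hx.
  assert (K1 : kappa <= 1) by (eapply kappa_le1; eauto).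
  pose proof (face_const_pos F psi kappa eps G) as Hfc. pose proof (star_const_pos kappa eps) as Hsc.
  assert (Lij := Lp _ _ _ Hf). assert (Lqa := Lp _ _ _ Hq).
  pose proof (triangle_point_dst i j k x Hf HT) as Hix.
  assert (Hlen : len i j <= r / face_const kappa eps \/ len i j <= star_const kappa eps * r / kappa).
  {    destruct (classic (q = i)) as [->|N1].
    { right. pose proof (star_comparable F psi kappa eps G i j k a b Hf Hq).
      apply Rmult_le_reg_r with kappa; auto.
      replace (star_const kappa eps * r / kappa * kappa) with (star_const kappa eps * r) by (field; lra). nra. }
    destruct (classic (q = j)) as [->|N2].
    { right. pose proof (star_comparable F psi kappa eps G j i k a b (Fs _ _ _ Hf) Hq) as H.
      rewrite (dst_sym (psi j) (psi i)) in H.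
      apply Rmult_le_reg_r with kappa; auto.
      replace (star_const kappa eps * r / kappa * kappa) with (star_const kappa eps * r) by (field; lra). nra. }
    destruct (classic (q = k)) as [->|N3].
    { right. pose proof (star_comparable F psi kappa eps G k i j a b (Fc _ _ _ (Fc _ _ _ Hf)) Hq) as H.
      pose proof (len_ratio F psi kappa eps G i j k Hf) as H1. rewrite (dst_sym (psi i) (psi k)) in H1.
      apply Rmult_le_reg_r with kappa; auto.
      replace (star_const kappa eps * r / kappa * kappa) with (star_const kappa eps * r) by (field; lra). nra. }
    left. pose proof (face_separation F psi kappa eps G i j k q x Hf HT N1 N2 N3) as H.
    rewrite (dst_sym x) in H.
    apply Rmult_le_reg_l with (face_const kappa eps); auto.
    replace (face_const kappa eps * (r / face_const kappa eps)) with r by (field; lra). lra. }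
  set (lam := / face_const kappa eps + star_const kappa eps / kappa).
  assert (Hlam : len i j <= lam * r).
  { unfold lam. rewrite Rmult_plus_distr_r.
    assert (0 < / face_const kappa eps * r) by (apply Rmult_lt_0_compat; [now apply Rinv_0_lt_compat|lra]).
    assert (0 < star_const kappa eps / kappa * r) by (apply Rmult_lt_0_compat; [now apply Rdiv_lt_0_compat|lra]).
    unfold Rdiv in *. destruct Hlen; lra. }
  assert (Hl1 : len i j / kappa <= lam / kappa * r).
  { unfold Rdiv. replace (lam * / kappa * r) with (lam * r * / kappa) by ring.
    apply Rmult_le_compat_r; [left; now apply Rinv_0_lt_compat|auto]. }
  assert (Hl2 : len i j <= len i j / kappa).
  { apply Rmult_le_reg_l with kappa; auto. replace (kappa * (len i j / kappa)) with (len i j) by (field; lra). nra. }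
  unfold reach_const. fold lam. rewrite Rmult_plus_distr_r. split; [|lra].
  pose proof (dst_tri (psi q) x (psi i)) as H. rewrite (dst_sym x) in H. lra.
Qed.

(* The half-scale square around the point with coordinates [(1/2, 1/3, 1/6)] stays inside the chamber
   [b_i > b_j > b_k > 0]; distinct ordered triples have disjoint chambers. *)
Lemma packing (L : list (V * V * V)) (x0 : C) (r : R) : NoDup L -> 0 < r ->
  (forall i j k, In (i, j, k) L -> F i j k /\ dst x0 (psi i) <= r /\ dst x0 (psi j) <= r /\ dst x0 (psi k) <= r) ->
  lsum L (fun f => len (fst (fst f)) (snd (fst f)) ^ 2) <= 6400 / kappa ^ 6 * r ^ 2.
Proof.
  intros HN Hr HL.
  assert (P3 : 0 < kappa ^ 3) by now apply pow_lt.
  (* Moving by at most [sd] changes a coordinate by at most [1/20], while the values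
     [1/2 > 1/3 > 1/6 > 0] have gaps [1/6]. *)
  set (sd := fun f : V * V * V => kappa ^ 3 * len (fst (fst f)) (snd (fst f)) / 20).
  set (ct := fun f : V * V * V => pt3 (psi (fst (fst f))) (psi (snd (fst f))) (psi (snd f)) (1/2) (1/3) (1/6)).
  assert (Hct : forall f, In f L -> dst x0 (ct f) <= r /\ 0 < sd f <= r / 2).
  { intros [[i j] k] Hf. destruct (HL _ _ _ Hf) as (Hf' & D1 & D2 & D3).
    assert (K1 : kappa <= 1) by (eapply kappa_le1; eauto). assert (Lij := Lp _ _ _ Hf').
    split; [apply dst_pt3_le; simpl; auto; lra|]. unfold sd; simpl fst; simpl snd. split.
    - apply Rdiv_lt_0_compat; nra.
    - pose proof (dst_tri (psi i) x0 (psi j)) as H. rewrite (dst_sym (psi i) x0) in H.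
      assert (kappa ^ 3 <= 1) by (rewrite <- (pow1 3); apply pow_incr; lra).
      assert (kappa ^ 3 * len i j <= 1 * len i j) by (apply Rmult_le_compat_r; lra). lra. }
  set (xl := fun f => fst (ct f) - sd f / 2). set (xh := fun f => fst (ct f) + sd f / 2).
  set (yl := fun f => snd (ct f) - sd f / 2). set (yh := fun f => snd (ct f) + sd f / 2).
  assert (Hbx : forall f, In f L -> fst x0 - 2 * r <= xl f <= xh f /\ xh f <= fst x0 + 2 * r).
  { intros f Hf. destruct (Hct f Hf) as [D Hs]. pose proof (dst_fst x0 (ct f)) as H.
    apply Rabs_le_between in H. unfold xl, xh. lra. }
  assert (Hby : forall f, In f L -> snd x0 - 2 * r <= yl f <= yh f /\ yh f <= snd x0 + 2 * r).
  { intros f Hf. destruct (Hct f Hf) as [D Hs]. pose proof (dst_snd x0 (ct f)) as H.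
    apply Rabs_le_between in H. unfold yl, yh. lra. }
  assert (Hchamber : forall i j k z, In (i, j, k) L ->
    xl (i, j, k) < fst z < xh (i, j, k) -> yl (i, j, k) < snd z < yh (i, j, k) ->
    B k i j z < B j k i z < B i j k z /\ 0 < B k i j z).
  { intros i j k z Hf Hx Hy. destruct (HL _ _ _ Hf) as (Hf' & _). destruct (Hct _ Hf) as [_ Hs].
    destruct (bc_pt3 (psi i) (psi j) (psi k) (1/2) (1/3) (1/6) (Nz _ _ _ Hf') ltac:(lra)) as (E1 & E2 & E3).
    assert (Hd : dst z (ct (i, j, k)) <= sd (i, j, k)).
    { eapply Rle_trans; [apply dst_le_sum|]. unfold xl, xh, yl, yh in *.
      assert (Rabs (fst z - fst (ct (i, j, k))) <= sd (i, j, k) / 2) by (apply Rabs_le; lra).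
      assert (Rabs (snd z - snd (ct (i, j, k))) <= sd (i, j, k) / 2) by (apply Rabs_le; lra). lra. }
    destruct (bary_lip3 F psi kappa eps G i j k z (ct (i, j, k)) Hf') as (A1 & A2 & A3).
    assert (Lij := Lp _ _ _ Hf').
    assert (Hsm : forall D, kappa ^ 3 * len i j * D <= dst z (ct (i, j, k)) -> D <= / 20).
    { intros D HD. apply Rmult_le_reg_l with (kappa ^ 3 * len i j); [nra|].
      unfold sd in Hd; simpl fst in Hd; simpl snd in Hd. lra. }
    apply Hsm in A1. apply Hsm in A2. apply Hsm in A3.
    unfold ct in A1, A2, A3; simpl fst in A1, A2, A3; simpl snd in A1, A2, A3.
    rewrite E1 in A1. rewrite E2 in A2. rewrite E3 in A3.
    apply Rabs_le_between in A1, A2, A3. lra. }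
  (* A common point forces equal vertex sets; the order of its coordinates then forces equal
     triples. *)
  assert (Huniq : forall z f g, In f L -> In g L ->
    xl f < fst z < xh f -> yl f < snd z < yh f -> xl g < fst z < xh g -> yl g < snd z < yh g -> f = g).
  { intros z [[i j] k] [[i' j'] k'] Hf Hg X1 Y1 X2 Y2.
    destruct (Hchamber i j k z Hf X1 Y1) as [O1 O2]. destruct (Hchamber i' j' k' z Hg X2 Y2) as [O3 O4].
    destruct (HL _ _ _ Hf) as (Ff & _). destruct (HL _ _ _ Hg) as (Fg & _).
    assert (T1 : T i j k z) by (repeat split; lra). assert (T2 : T i' j' k' z) by (repeat split; lra).
    assert (I1 : i = i' \/ i = j' \/ i = k') by (apply (te_meet _ _ _ _ G i j k i' j' k' z); auto; lra).
    assert (I2 : j = i' \/ j = j' \/ j = k').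
    { apply (te_meet _ _ _ _ G j k i i' j' k' z); auto; [now apply inT_cyc|lra]. }
    assert (I3 : k = i' \/ k = j' \/ k = k').
    { apply (te_meet _ _ _ _ G k i j i' j' k' z); auto; now apply inT_cyc, inT_cyc. }
    destruct (F_neq F HS _ _ _ Ff) as (N1 & N2 & N3).
    destruct I1 as [-> |[-> | ->]], I2 as [-> |[-> | ->]], I3 as [-> |[-> | ->]]; try tauto; exfalso;
      rewrite ?(bc_swap (psi i') (psi j') (psi k')), ?(bc_swap (psi j') (psi k') (psi i')),
        ?(bc_swap (psi k') (psi i') (psi j')) in *; lra. }
  (* Area by slices: at fixed abscissa the vertical sides of the squares are disjoint; the next step
     integrates over the abscissa. *)
  assert (Hslice : forall c, lsum L (fun f => ind (xl f < c < xh f) * sd f) <= 4 * r).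
  { intros c.
    rewrite (lsum_ext L _ (fun f => ind (xl f < c < xh f) * (yh f - yl f)))
      by (intros f _; unfold yh, yl; field).
    replace (4 * r) with (1 * ((snd x0 + 2 * r) - (snd x0 - 2 * r))) by ring.
    apply weighted_intervals_high; [lra|auto|].
    intros c' _.
    rewrite (lsum_ext L _ (fun f => ind ((xl f < c < xh f) /\ (yl f < c' < yh f)))).
    - apply lsum_ind_unique; auto. intros f g Hf Hg [X1 Y1] [X2 Y2]. now apply (Huniq (c, c')).
    - intros f _. unfold ind. repeat destruct (excluded_middle_informative _); try lra; exfalso; tauto. }
  assert (Hall : lsum L (fun f => sd f * sd f) <= 4 * r * (4 * r)).
  { rewrite (lsum_ext L _ (fun f => sd f * (xh f - xl f))) by (intros f _; unfold xh, xl; field).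
    replace (4 * r * (4 * r)) with (4 * r * ((fst x0 + 2 * r) - (fst x0 - 2 * r))) by ring.
    apply weighted_intervals_high; [lra|auto|auto]. }
  rewrite (lsum_ext L _ (fun f => 400 / kappa ^ 6 * (sd f * sd f))).
  - rewrite lsum_scal. replace (6400 / kappa ^ 6 * r ^ 2) with (400 / kappa ^ 6 * (4 * r * (4 * r))) by (field; lra).
    apply Rmult_le_compat_l; auto. left. apply Rdiv_lt_0_compat; [lra|now apply pow_lt].
  - intros f _. unfold sd. field. lra.
Qed.

(** Dominates the difference of any two values of [h] on the face. *)
Definition ftri (h : V -> R) (f : V * V * V) : R :=
  Rabs (h (fst (fst f)) - h (snd (fst f))) + Rabs (h (fst (fst f)) - h (snd f)).

Definition inF (f : V * V * V) (z : C) : Prop := T (fst (fst f)) (snd (fst f)) (snd f) z.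

Definition vtx (v : V) (f : V * V * V) : Prop := v = fst (fst f) \/ v = snd (fst f) \/ v = snd f.

Lemma faces_share_vertex f g z : F (fst (fst f)) (snd (fst f)) (snd f) -> F (fst (fst g)) (snd (fst g)) (snd g) ->
  inF f z -> inF g z -> exists v, vtx v f /\ vtx v g.
Proof.
  destruct f as [[i j] k], g as [[i' j'] k']. unfold inF, vtx; simpl. intros Hf Hg Tf Tg.
  pose proof (bc_sum _ _ _ (Nz _ _ _ Hf) z) as Hs. pose proof Tf as (T1 & T2 & T3).
  destruct (Rlt_dec 0 (B i j k z)) as [P|P].
  { exists i. split; auto. apply (te_meet _ _ _ _ G i j k i' j' k' z); auto. }
  destruct (Rlt_dec 0 (B j k i z)) as [P'|P'].
  { exists j. split; auto. apply (te_meet _ _ _ _ G j k i i' j' k' z); auto. now apply inT_cyc. }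
  exists k. split; auto. apply (te_meet _ _ _ _ G k i j i' j' k' z); auto; [now apply inT_cyc, inT_cyc|lra].
Qed.

(* A path cannot pass from triangles with all values below [c] to triangles with all values above [c]
   without meeting a triangle that straddles [c]. *)
Lemma path_oscillation (L : list (V * V * V)) (g : R -> C) (a b : R) (h : V -> R) :
  cpath g -> (forall f, In f L -> F (fst (fst f)) (snd (fst f)) (snd f)) ->
  (forall t, a <= t <= b -> exists f, In f L /\ inF f (g t)) ->
  forall f1 f2 t1 t2 p q, In f1 L -> In f2 L -> a <= t1 <= b -> a <= t2 <= b ->
  inF f1 (g t1) -> inF f2 (g t2) -> vtx p f1 -> vtx q f2 ->
  h q - h p <= lsum L (fun f => ind (exists t, a <= t <= b /\ inF f (g t)) * ftri h f).
Proof.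
  intros Hg HL Hcov f1 f2 t1 t2 p q L1 L2 B1 B2 I1 I2 V1 V2.
  destruct (Rle_lt_dec (h q) (h p)) as [Hle|Hlt].
  { apply Rle_trans with 0; [lra|]. apply lsum_nonneg. intros f _.
    apply Rmult_le_pos; [apply ind_bounds|]. unfold ftri.
    pose proof (Rabs_pos (h (fst (fst f)) - h (snd (fst f)))). pose proof (Rabs_pos (h (fst (fst f)) - h (snd f))). lra. }
  set (lo := fun f : V * V * V => Rmin (h (fst (fst f))) (Rmin (h (snd (fst f))) (h (snd f)))).
  set (hi := fun f : V * V * V => Rmax (h (fst (fst f))) (Rmax (h (snd (fst f))) (h (snd f)))).
  assert (Hlo : forall f v, vtx v f -> lo f <= h v <= hi f).
  { intros f v Hv. unfold lo, hi, Rmin, Rmax. destruct Hv as [-> |[-> | ->]]; repeat destruct (Rle_dec _ _); lra. }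
  assert (Hhl : forall f, 0 <= hi f - lo f <= ftri h f).
  { intros f. unfold lo, hi, ftri, Rmin, Rmax, Rabs. repeat destruct (Rle_dec _ _); repeat destruct (Rcase_abs _); lra. }
  set (mt := fun f => exists t, a <= t <= b /\ inF f (g t)).
  set (L' := filter (fun f => if excluded_middle_informative (mt f) then true else false) L).
  apply Rle_trans with (lsum L' (fun f => hi f - lo f)).
  - apply interval_cover_length; [lra| |].
    { intros f _. specialize (Hhl f). lra. }
    intros c Hc. apply NNPP. intros Hno.
    assert (Hns : forall f, In f L -> mt f -> hi f < c \/ c < lo f).
    { intros f Hf Hm. destruct (Rlt_dec (hi f) c); auto. destruct (Rlt_dec c (lo f)); auto.
      exfalso. apply Hno. exists f. split; [|lra]. unfold L'. apply filter_In. split; auto.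
      destruct (excluded_middle_informative (mt f)); tauto. }
    set (U1 := filter (fun f => if Rlt_dec (hi f) c then true else false) L).
    set (U2 := filter (fun f => if Rlt_dec c (lo f) then true else false) L).
    assert (HU1 : forall f, In f U1 <-> In f L /\ hi f < c).
    { intros f. unfold U1. rewrite filter_In. destruct (Rlt_dec (hi f) c); intuition discriminate. }
    assert (HU2 : forall f, In f U2 <-> In f L /\ c < lo f).
    { intros f. unfold U2. rewrite filter_In. destruct (Rlt_dec c (lo f)); intuition discriminate. }
    assert (Hf1 : In f1 U1).
    { apply HU1. split; auto. destruct (Hns f1 L1) as [|H]; auto; [exists t1; auto|].
      specialize (Hlo f1 p V1). lra. }
    assert (Hf2 : In f2 U2).
    { apply HU2. split; auto. destruct (Hns f2 L2) as [H|]; auto; [exists t2; auto|].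
      specialize (Hlo f2 q V2). lra. }
    set (gg := fun (f : V * V * V) t => mb (psi (fst (fst f))) (psi (snd (fst f))) (psi (snd f)) (g t)).
    assert (Hgg : forall f t, 0 <= gg f t <-> inF f (g t)) by (intros; apply mb_nonneg).
    assert (Hgc : forall f, continuity (gg f)) by (intros f; now apply continuity_mb).
    assert (Hcv : forall t, a <= t <= b -> exists f, (In f U1 \/ In f U2) /\ 0 <= gg f t).
    { intros t Ht. destruct (Hcov t Ht) as (f & Hf & If). exists f. split; [|now apply Hgg].
      destruct (Hns f Hf) as [H|H]; [exists t; auto|left; apply HU1; auto|right; apply HU2; auto]. }
    assert (Hmeet : exists t x y, In x U1 /\ In y U2 /\ 0 <= gg x t /\ 0 <= gg y t).
    { destruct (Rle_lt_dec t1 t2) as [Ht|Ht].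
      - destruct (closed_cover_meet U1 U2 gg t1 t2 Ht Hgc) as (t & x & y & _ & H1 & H2 & H3 & H4).
        + intros t Ht'. apply Hcv. lra.
        + exists f1. split; auto. now apply Hgg.
        + exists f2. split; auto. now apply Hgg.
        + exists t, x, y. auto.
      - destruct (closed_cover_meet U2 U1 gg t2 t1 ltac:(lra) Hgc) as (t & x & y & _ & H1 & H2 & H3 & H4).
        + intros t Ht'. destruct (Hcv t ltac:(lra)) as (f & Hf & Hf'). exists f. split; auto. tauto.
        + exists f2. split; auto. now apply Hgg.
        + exists f1. split; auto. now apply Hgg.
        + exists t, y, x. auto. }
    destruct Hmeet as (t & x & y & X1 & Y1 & X2 & Y2). apply HU1 in X1. apply HU2 in Y1.
    apply Hgg in X2. apply Hgg in Y2.
    destruct (faces_share_vertex x y (g t)) as (v & Vx & Vy); auto; try (apply HL; tauto).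
    pose proof (Hlo x v Vx). pose proof (Hlo y v Vy). lra.
  - unfold L'. rewrite lsum_filter. apply lsum_le. intros f Hf. unfold ind. fold (mt f).
    destruct (excluded_middle_informative (mt f)); [specialize (Hhl f)|]; lra.
Qed.

End Cover.

(** * Angles along the path [e^{-u(t)} = 1 - t + t e^{-u}] *)

(* Squared edge lengths of a triangle are, up to a common factor, [X a], [Y b], [Z c] with
   [X, Y, Z] linear in [t]: in these coordinates nondegeneracy is a round cone and the Delaunay
   condition is linear, so both persist along the path. *)
Definition xt (s t : R) : R := 1 - t + t * s.

(** Heron's formula: sixteen times the squared area of the triangle with squared sides [X a], [Y b],
    [Z c]. *)
Definition hq (a b c si sj sk t : R) : R :=
  4 * (xt si t * a) * (xt sj t * b) - (xt si t * a + xt sj t * b - xt sk t * c) ^ 2.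

(** The cotangent of the angle opposite the side [c], divided by the two scale factors. This
    division is what the variation of [u] produces. *)
Definition cotw (a b c si sj sk t : R) : R :=
  (xt si t * a + xt sj t * b - xt sk t * c) / sqrt (hq a b c si sj sk t) / (xt si t * xt sj t).

(** The cosine of the same angle. *)
Definition qcos (a b c si sj sk t : R) : R :=
  (xt si t * a + xt sj t * b - xt sk t * c) / (2 * sqrt ((xt si t * a) * (xt sj t * b))).

Lemma xt_pos s t : 0 < s -> 0 <= t <= 1 -> 0 < xt s t.
Proof.
  intros Hs Ht. unfold xt. destruct (Req_dec t 1) as [->|H]; [lra|]. assert (0 <= t * s) by nra. lra.
Qed.

Lemma hq_perm1 a b c si sj sk t : hq c a b sk si sj t = hq a b c si sj sk t.
Proof. unfold hq. ring. Qed.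

Lemma hq_perm2 a b c si sj sk t : hq b a c sj si sk t = hq a b c si sj sk t.
Proof. unfold hq. ring. Qed.

(** A round cone is convex; the mixed term is bounded by the Cauchy-Schwarz inequality. *)
Lemma cone_convex (rho d0 e0 g0 d1 e1 g1 al be : R) : 0 <= rho -> 0 <= al -> 0 <= be -> 0 <= g0 -> 0 <= g1 ->
  d0 ^ 2 + e0 ^ 2 <= rho * g0 ^ 2 -> d1 ^ 2 + e1 ^ 2 <= rho * g1 ^ 2 ->
  (al * d0 + be * d1) ^ 2 + (al * e0 + be * e1) ^ 2 <= rho * (al * g0 + be * g1) ^ 2.
Proof.
  intros Hr Ha Hb Hg0 Hg1 H0 H1.
  assert (Hx : d0 * d1 + e0 * e1 <= rho * g0 * g1).
  { assert (Hsq : (d0 * d1 + e0 * e1) ^ 2 <= (rho * g0 * g1) ^ 2).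
    { apply Rle_trans with ((d0 ^ 2 + e0 ^ 2) * (d1 ^ 2 + e1 ^ 2)).
      - assert (0 <= (d0 * e1 - e0 * d1) ^ 2) by apply pow2_ge_0. nra.
      - replace ((rho * g0 * g1) ^ 2) with ((rho * g0 ^ 2) * (rho * g1 ^ 2)) by ring.
        apply Rmult_le_compat; auto; apply Rplus_le_le_0_compat; apply pow2_ge_0. }
    apply Rabs_le_of_sqr in Hsq; [|apply Rmult_le_pos; auto; now apply Rmult_le_pos].
    eapply Rle_trans; [apply Rle_abs|exact Hsq]. }
  assert (A0 : al ^ 2 * (d0 ^ 2 + e0 ^ 2) <= al ^ 2 * (rho * g0 ^ 2)) by (apply Rmult_le_compat_l; [apply pow2_ge_0|auto]).
  assert (A1 : be ^ 2 * (d1 ^ 2 + e1 ^ 2) <= be ^ 2 * (rho * g1 ^ 2)) by (apply Rmult_le_compat_l; [apply pow2_ge_0|auto]).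
  assert (A2 : 2 * (al * be) * (d0 * d1 + e0 * e1) <= 2 * (al * be) * (rho * g0 * g1))
    by (apply Rmult_le_compat_l; [nra|auto]).
  nra.
Qed.

(** With [A], [B], [C] the scaled squared sides, [hq = (A + B)^2 - (A - B)^2 - (A + B - C)^2], so
    the bound says that a vector depending linearly on [t] lies in the cone with
    [rho = 1 - kap^2]. *)
Lemma hq_lower (kap a b c si sj sk t : R) : 0 <= kap <= 1 -> 0 < a -> 0 < b -> 0 < si -> 0 < sj -> 0 <= t <= 1 ->
  kap ^ 2 * (a + b) ^ 2 <= hq a b c si sj sk 0 ->
  kap ^ 2 * (si * a + sj * b) ^ 2 <= hq a b c si sj sk 1 ->
  kap ^ 2 * (xt si t * a + xt sj t * b) ^ 2 <= hq a b c si sj sk t.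
Proof.
  intros Hk Ha Hb Hi Hj Ht H0 H1. unfold hq, xt in *.
  assert (H := cone_convex (1 - kap ^ 2) (a - b) (a + b - c) (a + b)
    (si * a - sj * b) (si * a + sj * b - sk * c) (si * a + sj * b) (1 - t) t).
  assert (0 <= 1 - kap ^ 2) by nra.
  assert (0 < si * a) by nra. assert (0 < sj * b) by nra.
  assert (Hc := H ltac:(lra) ltac:(lra) ltac:(lra) ltac:(lra) ltac:(lra) ltac:(nra) ltac:(nra)).
  nra.
Qed.

Section AngleFlow.
Context (a b c si sj sk : R).
Hypothesis Ha : 0 < a.
Hypothesis Hb : 0 < b.
Hypothesis Hc : 0 < c.
Hypothesis Hi : 0 < si.
Hypothesis Hj : 0 < sj.
Hypothesis Hk : 0 < sk.
Hypothesis Hq : forall t, 0 <= t <= 1 -> 0 < hq a b c si sj sk t.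

Lemma cotw_continuous a' b' c' si' sj' sk' t : 0 < xt si' t -> 0 < xt sj' t -> 0 < hq a' b' c' si' sj' sk' t ->
  continuous (cotw a' b' c' si' sj' sk') t.
Proof.
  intros H1 H2 H3. apply (ex_derive_continuous (cotw a' b' c' si' sj' sk')).
  unfold cotw. unfold hq, xt in *. auto_derive.
  repeat split; try nra; auto.
  - apply Rgt_not_eq. apply sqrt_lt_R0. revert H3. simpl. intros H3.
    eapply Rlt_le_trans; [exact H3|]. right. ring.
Qed.

Lemma qcos_derive t : 0 <= t <= 1 ->
  is_derive (qcos a b c si sj sk) t
   ((((si - 1) * a + (sj - 1) * b - (sk - 1) * c) -
     (xt si t * a + xt sj t * b - xt sk t * c) * ((si - 1) * a * (xt sj t * b) + xt si t * a * ((sj - 1) * b))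
       / (2 * ((xt si t * a) * (xt sj t * b)))) / (2 * sqrt ((xt si t * a) * (xt sj t * b)))).
Proof.
  intros Ht. pose proof (xt_pos si t Hi Ht) as X1. pose proof (xt_pos sj t Hj Ht) as X2.
  assert (HP : 0 < (xt si t * a) * (xt sj t * b)) by (apply Rmult_lt_0_compat; nra).
  pose proof (sqrt_lt_R0 _ HP) as HY. pose proof (sqrt_sqrt _ (Rlt_le _ _ HP)) as EY.
  unfold qcos, xt in *. auto_derive.
  - repeat split; auto.
    change (2 * sqrt ((1 - t + t * si) * a * ((1 - t + t * sj) * b)) <> 0). lra.
  - set (Y := sqrt ((1 - t + t * si) * a * ((1 - t + t * sj) * b))) in *.
    replace (1 + - t + t * si) with (1 - t + t * si) by ring.
    replace (1 + - t + t * sj) with (1 - t + t * sj) by ring.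
    replace (1 + - t + t * sk) with (1 - t + t * sk) by ring.
    fold Y. rewrite <- EY. field. lra.
Qed.

Lemma qcos_bounds t : 0 <= t <= 1 -> -1 < qcos a b c si sj sk t < 1 /\
  sqrt (1 - Rsqr (qcos a b c si sj sk t)) =
    sqrt (hq a b c si sj sk t) / (2 * sqrt ((xt si t * a) * (xt sj t * b))).
Proof.
  intros Ht. pose proof (xt_pos si t Hi Ht) as X1. pose proof (xt_pos sj t Hj Ht) as X2.
  assert (HP : 0 < (xt si t * a) * (xt sj t * b)) by (apply Rmult_lt_0_compat; nra).
  pose proof (sqrt_lt_R0 _ HP) as HY. pose proof (sqrt_sqrt _ (Rlt_le _ _ HP)) as EY.
  specialize (Hq t Ht). unfold qcos.
  set (Y := sqrt _) in *. set (D := xt si t * a + xt sj t * b - xt sk t * c) in *.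
  assert (Eh : hq a b c si sj sk t = 4 * (Y * Y) - D ^ 2) by (rewrite EY; unfold hq, D; ring).
  assert (E : 1 - Rsqr (D / (2 * Y)) = hq a b c si sj sk t / (2 * Y) ^ 2).
  { rewrite Eh. unfold Rsqr. field. lra. }
  assert (Hp : 0 < hq a b c si sj sk t / (2 * Y) ^ 2) by (apply Rdiv_lt_0_compat; auto; apply pow_lt; lra).
  split; [unfold Rsqr in E; split; nra|].
  rewrite E, sqrt_div_alt by (apply pow_lt; lra). rewrite sqrt_pow2 by lra. reflexivity.
Qed.

(** The classical variation of an angle under vertex scaling: a change of [u_i - u_k] moves the
    angle at [k] by half the cotangent of the angle at [j]. Along this path [u_i' - u_k'] is
    [sk - si] divided by the two scale factors, so the constant numerator leaves the integral. *)
Lemma angle_flow :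
  acos (qcos a b c si sj sk 1) - acos (qcos a b c si sj sk 0) =
  / 2 * (sk - si) * RInt (cotw c a b sk si sj) 0 1 + / 2 * (sk - sj) * RInt (cotw c b a sk sj si) 0 1.
Proof.
  set (df := fun t => / 2 * (sk - si) * cotw c a b sk si sj t + / 2 * (sk - sj) * cotw c b a sk sj si t).
  assert (Hd : forall t, 0 <= t <= 1 -> is_derive (fun t => acos (qcos a b c si sj sk t)) t (df t)).
  { intros t Ht. pose proof (xt_pos si t Hi Ht) as X1. pose proof (xt_pos sj t Hj Ht) as X2.
    pose proof (xt_pos sk t Hk Ht) as X3.
    destruct (qcos_bounds t Ht) as [Q1 Q2].
    pose proof (derive_pt_eq_1 _ _ _ _ (derive_pt_acos _ Q1)) as Hac. apply is_derive_Reals in Hac.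
    pose proof (is_derive_comp _ _ t _ _ Hac (qcos_derive t Ht)) as H.
    replace (df t) with (scal
      ((((si - 1) * a + (sj - 1) * b - (sk - 1) * c) -
     (xt si t * a + xt sj t * b - xt sk t * c) * ((si - 1) * a * (xt sj t * b) + xt si t * a * ((sj - 1) * b))
       / (2 * ((xt si t * a) * (xt sj t * b)))) / (2 * sqrt ((xt si t * a) * (xt sj t * b))))
      (-1 / sqrt (1 - Rsqr (qcos a b c si sj sk t)))); [exact H|].
    rewrite Q2. unfold scal; simpl; unfold mult; simpl. unfold df, cotw.
    rewrite (hq_perm1 a b c), (hq_perm1 b a c), (hq_perm2 a b c).
    specialize (Hq t Ht). pose proof (sqrt_lt_R0 _ Hq) as HZ. set (Z := sqrt (hq a b c si sj sk t)) in *.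
    assert (HP : 0 < (xt si t * a) * (xt sj t * b)) by (apply Rmult_lt_0_compat; nra).
    pose proof (sqrt_lt_R0 _ HP) as HY. set (Y := sqrt (xt si t * a * (xt sj t * b))) in *.
    clearbody Y Z. unfold xt in *. field. repeat split; lra. }
  assert (Hx : forall s t, 0 < s -> Rmin 0 1 <= t <= Rmax 0 1 -> 0 < xt s t).
  { intros s t Hs Ht. rewrite Rmin_left, Rmax_right in Ht by lra. now apply xt_pos. }
  assert (Hq' : forall t, Rmin 0 1 <= t <= Rmax 0 1 -> 0 < hq a b c si sj sk t).
  { intros t Ht. rewrite Rmin_left, Rmax_right in Ht by lra. auto. }
  assert (C1 : forall t, Rmin 0 1 <= t <= Rmax 0 1 -> continuous (cotw c a b sk si sj) t).
  { intros t Ht. apply cotw_continuous; auto. rewrite hq_perm1. auto. }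
  assert (C2 : forall t, Rmin 0 1 <= t <= Rmax 0 1 -> continuous (cotw c b a sk sj si) t).
  { intros t Ht. apply cotw_continuous; auto. rewrite hq_perm1, hq_perm2. auto. }
  assert (HI : is_RInt df 0 1 (acos (qcos a b c si sj sk 1) - acos (qcos a b c si sj sk 0))).
  { apply (is_RInt_derive (fun t => acos (qcos a b c si sj sk t)) df 0 1).
    - intros t Ht. rewrite Rmin_left, Rmax_right in Ht by lra. auto.
    - intros t Ht. unfold df. apply (continuous_plus (fun t => / 2 * (sk - si) * cotw c a b sk si sj t)).
      + apply (continuous_mult (fun _ => / 2 * (sk - si)) (cotw c a b sk si sj)); auto. apply continuous_const.
      + apply (continuous_mult (fun _ => / 2 * (sk - sj)) (cotw c b a sk sj si)); auto. apply continuous_const. }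
  rewrite <- (is_RInt_unique (V := R_CompleteNormedModule) _ _ _ _ HI).
  assert (I1 := RInt_correct (V := R_CompleteNormedModule) _ _ _ (ex_RInt_continuous _ _ _ C1)).
  assert (I2 := RInt_correct (V := R_CompleteNormedModule) _ _ _ (ex_RInt_continuous _ _ _ C2)).
  apply (is_RInt_unique (V := R_CompleteNormedModule)). unfold df.
  apply (is_RInt_plus (V := R_NormedModule)); apply (is_RInt_scal (V := R_NormedModule)); auto.
Qed.

End AngleFlow.

(** The factor [1 / sin] is at least 1. If one cosine is negative, the other is at least as large in
    absolute value and so carries the larger factor. *)
Lemma cot_sum_ge q1 q2 : -1 < q1 < 1 -> -1 < q2 < 1 -> 0 <= q1 + q2 ->
  q1 + q2 <= q1 / sqrt (1 - Rsqr q1) + q2 / sqrt (1 - Rsqr q2).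
Proof.
  assert (Hr : forall q, -1 < q < 1 -> 1 <= / sqrt (1 - Rsqr q)).
  { intros q Hq. assert (0 < 1 - Rsqr q) by (unfold Rsqr; nra).
    apply Rle_trans with (/ 1); [lra|]. apply Rinv_le_contravar; [now apply sqrt_lt_R0|].
    apply Rle_trans with (sqrt 1); [apply sqrt_le_1_alt; unfold Rsqr; nra | rewrite sqrt_1; lra]. }
  assert (Hm : forall p q, -1 < p < 1 -> -1 < q < 1 -> q < 0 -> 0 <= p + q -> 
     / sqrt (1 - Rsqr q) <= / sqrt (1 - Rsqr p)).
  { intros p q Hp Hq Hneg Hs. assert (0 < 1 - Rsqr p) by (unfold Rsqr; nra).
    apply Rinv_le_contravar; [now apply sqrt_lt_R0|]. apply sqrt_le_1_alt. unfold Rsqr. nra. }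
  intros H1 H2 Hs. unfold Rdiv. pose proof (Hr q1 H1). pose proof (Hr q2 H2).
  destruct (Rlt_dec q1 0) as [N1|N1]; [|destruct (Rlt_dec q2 0) as [N2|N2]].
  - pose proof (Hm q2 q1 H2 H1 N1 ltac:(lra)). nra.
  - pose proof (Hm q1 q2 H1 H2 N2 ltac:(lra)). nra.
  - nra.
Qed.

(** An antiderivative is [t / xt s t], because [xt s t - t * (s - 1) = 1]. *)
Lemma is_RInt_inv_sqr s : 0 < s -> is_RInt (fun t => / (xt s t) ^ 2) 0 1 (/ s).
Proof.
  intros Hs.
  assert (Hx : forall t, Rmin 0 1 <= t <= Rmax 0 1 -> 0 < xt s t).
  { intros t Ht. rewrite Rmin_left, Rmax_right in Ht by lra. now apply xt_pos. }
  replace (/ s) with (minus (1 / xt s 1) (0 / xt s 0))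
    by (unfold minus, plus, opp, xt; simpl; field; lra).
  apply (is_RInt_derive (fun t => t / xt s t)).
  - intros t Ht. specialize (Hx t Ht). unfold xt in *. auto_derive; [lra|]. field. lra.
  - intros t Ht. specialize (Hx t Ht). apply (ex_derive_continuous (fun t => / (xt s t) ^ 2)).
    unfold xt in *. auto_derive. replace (1 + - t + t * s) with (1 - t + t * s) by ring.
    apply Rgt_not_eq. nra.
Qed.

(** An antiderivative is minus [(1 - t)^2] over [2 * s * xt s t ^ 2], because
    [xt s t + (1 - t) * (s - 1) = s]. *)
Lemma is_RInt_ratio_cube s : 0 < s -> is_RInt (fun t => (1 - t) / (xt s t) ^ 3) 0 1 (/ (2 * s)).
Proof.
  intros Hs.
  assert (Hx : forall t, Rmin 0 1 <= t <= Rmax 0 1 -> 0 < xt s t).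
  { intros t Ht. rewrite Rmin_left, Rmax_right in Ht by lra. now apply xt_pos. }
  replace (/ (2 * s)) with (minus (- (1 - 1) ^ 2 / (2 * s * xt s 1 ^ 2)) (- (1 - 0) ^ 2 / (2 * s * xt s 0 ^ 2)))
    by (unfold minus, plus, opp, xt; simpl; field; lra).
  apply (is_RInt_derive (fun t => - (1 - t) ^ 2 / (2 * s * xt s t ^ 2))).
  - intros t Ht. specialize (Hx t Ht). unfold xt in *. auto_derive.
    + replace (1 + - t + t * s) with (1 - t + t * s) by ring.
      apply Rmult_integral_contrapositive_currified; [lra|]. nra.
    + field. lra.
  - intros t Ht. specialize (Hx t Ht). apply (ex_derive_continuous (fun t => (1 - t) / (xt s t) ^ 3)).
    unfold xt in *. auto_derive. replace (1 + - t + t * s) with (1 - t + t * s) by ring.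
    apply Rgt_not_eq. set (y := 1 - t + t * s) in *.
    assert (0 < y * (y * y)) by (repeat apply Rmult_lt_0_compat; auto). lra.
Qed.

(** * Two-sided bounds for the integrated edge weights *)

Section EdgeWeight.
Context (kap E c0 a1 b1 a2 b2 c si sj s1 s2 : R).
Hypothesis Hkap : 0 < kap <= 1.
Hypothesis HE : 1 <= E.
Hypothesis Hc0 : 0 <= c0.
Hypothesis Ha1 : 0 < a1.
Hypothesis Hb1 : 0 < b1.
Hypothesis Ha2 : 0 < a2.
Hypothesis Hb2 : 0 < b2.
Hypothesis Hc : 0 < c.
Hypothesis Hi : 0 < si.
Hypothesis Hj : 0 < sj.
Hypothesis HEi : si <= E * sj.
Hypothesis HEj : sj <= E * si.
Hypothesis N10 : kap ^ 2 * (a1 + b1) ^ 2 <= hq a1 b1 c si sj s1 0.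
Hypothesis N11 : kap ^ 2 * (si * a1 + sj * b1) ^ 2 <= hq a1 b1 c si sj s1 1.
Hypothesis N20 : kap ^ 2 * (a2 + b2) ^ 2 <= hq a2 b2 c si sj s2 0.
Hypothesis N21 : kap ^ 2 * (si * a2 + sj * b2) ^ 2 <= hq a2 b2 c si sj s2 1.
Hypothesis D0 : c0 <= qcos a1 b1 c si sj s1 0 + qcos a2 b2 c si sj s2 0.
Hypothesis D1 : 0 <= qcos a1 b1 c si sj s1 1 + qcos a2 b2 c si sj s2 1.

(** The factor that makes the cosine linear in [t] depends on the edge only, not on the triangle.
    Hence the sum of the two cosines opposite an edge, the Delaunay quantity, is linear after the
    same scaling. *)
Lemma qcos_linear a b s t : 0 < a -> 0 < b -> 0 <= t <= 1 ->
  sqrt (xt si t * xt sj t) * qcos a b c si sj s t =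
  (1 - t) * qcos a b c si sj s 0 + t * (sqrt (si * sj) * qcos a b c si sj s 1).
Proof.
  intros Ha Hb Ht. pose proof (xt_pos si t Hi Ht) as X1. pose proof (xt_pos sj t Hj Ht) as X2.
  assert (Hxx : 0 < xt si t * xt sj t) by nra. assert (Hss : 0 < si * sj) by nra.
  assert (Hab : 0 < a * b) by nra.
  assert (Es : forall x y, 0 < x -> 0 < y -> sqrt ((x * a) * (y * b)) = sqrt (x * y) * sqrt (a * b)).
  { intros x y Hx Hy. rewrite <- sqrt_mult_alt by nra. f_equal. ring. }
  unfold qcos. rewrite !Es by (auto; unfold xt; lra).
  replace (xt si 0 * xt sj 0) with 1 by (unfold xt; ring).
  replace (xt si 1 * xt sj 1) with (si * sj) by (unfold xt; ring).
  rewrite sqrt_1.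
  pose proof (sqrt_lt_R0 _ Hxx). pose proof (sqrt_lt_R0 _ Hss). pose proof (sqrt_lt_R0 _ Hab).
  set (N := sqrt (xt si t * xt sj t)) in *. set (S := sqrt (si * sj)) in *. set (Y := sqrt (a * b)) in *.
  unfold xt. field. lra.
Qed.

Lemma cotw_bounds a b s t : 0 < a -> 0 < b -> 0 <= t <= 1 ->
  kap ^ 2 * (a + b) ^ 2 <= hq a b c si sj s 0 ->
  kap ^ 2 * (si * a + sj * b) ^ 2 <= hq a b c si sj s 1 ->
  0 < hq a b c si sj s t /\ -1 < qcos a b c si sj s t < 1 /\
  cotw a b c si sj s t = qcos a b c si sj s t / sqrt (1 - Rsqr (qcos a b c si sj s t)) / (xt si t * xt sj t) /\
  cotw a b c si sj s t <= / kap / (xt si t * xt sj t).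
Proof.
  intros Ha Hb Ht N0 N1.
  pose proof (xt_pos si t Hi Ht) as X1. pose proof (xt_pos sj t Hj Ht) as X2.
  assert (Hlow : forall t, 0 <= t <= 1 -> kap ^ 2 * (xt si t * a + xt sj t * b) ^ 2 <= hq a b c si sj s t)
    by (intros t' Ht'; apply hq_lower; auto; lra).
  assert (Hpos : forall t, 0 <= t <= 1 -> 0 < hq a b c si sj s t).
  { intros t' Ht'. eapply Rlt_le_trans; [|apply Hlow; auto].
    pose proof (xt_pos si t' Hi Ht'). pose proof (xt_pos sj t' Hj Ht').
    apply Rmult_lt_0_compat; apply pow_lt; nra. }
  destruct (qcos_bounds a b c si sj s Ha Hb Hi Hj Hpos t Ht) as [Q1 Q2].
  specialize (Hlow t Ht). specialize (Hpos t Ht).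
  pose proof (sqrt_lt_R0 _ Hpos) as HZ.
  split; auto. split; auto.
  assert (HP : 0 < (xt si t * a) * (xt sj t * b)) by (apply Rmult_lt_0_compat; nra).
  pose proof (sqrt_lt_R0 _ HP) as HY.
  split.
  - rewrite Q2. unfold cotw, qcos. field. repeat split; nra.
  - unfold cotw. unfold Rdiv. apply Rmult_le_compat_r.
    { left. apply Rinv_0_lt_compat. nra. }
    set (D := xt si t * a + xt sj t * b - xt s t * c). set (S := xt si t * a + xt sj t * b) in *.
    assert (HS : 0 < S) by (unfold S; nra).
    assert (HD : Rabs D <= S).
    { apply Rabs_le_of_sqr; [lra|]. unfold hq in Hpos. fold S D in Hpos.
      assert (0 <= (xt si t * a - xt sj t * b) ^ 2) by apply pow2_ge_0. unfold S. nra. }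
    assert (HZ2 : kap * S <= sqrt (hq a b c si sj s t)).
    { rewrite <- (sqrt_pow2 (kap * S)) by nra. apply sqrt_le_1_alt. rewrite Rpow_mult_distr. auto. }
    apply Rmult_le_reg_r with (sqrt (hq a b c si sj s t)); auto.
    rewrite Rmult_assoc, Rinv_l, Rmult_1_r by lra.
    apply Rle_trans with S; [eapply Rle_trans; [apply Rle_abs|auto]|].
    apply Rmult_le_reg_l with kap; [lra|]. rewrite <- Rmult_assoc, Rinv_r, Rmult_1_l by lra. auto.
Qed.

(** The Delaunay gap [c0] is available only at [t = 0], so the pointwise lower bound decays like
    [1 - t]; its integral is still positive. The comparison functions, multiples of [(1 - t) / xt^3]
    and of [1 / xt^2], have the explicit integrals computed above. *)
Lemma edge_weight_bounds :
  c0 / (2 * E ^ 2 * si) <= RInt (cotw a1 b1 c si sj s1) 0 1 + RInt (cotw a2 b2 c si sj s2) 0 1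
   <= 2 * E / (kap * si).
Proof.
  assert (Hx : forall t, 0 <= t <= 1 -> 0 < xt si t /\ 0 < xt sj t /\ xt si t <= E * xt sj t /\ xt sj t <= E * xt si t).
  { intros t Ht. repeat split; try (now apply xt_pos); unfold xt; nra. }
  assert (C1 : ex_RInt (cotw a1 b1 c si sj s1) 0 1).
  { apply (ex_RInt_continuous (V := R_CompleteNormedModule)). intros t Ht.
    rewrite Rmin_left, Rmax_right in Ht by lra. destruct (Hx t Ht) as (? & ? & _).
    apply cotw_continuous; auto. now apply cotw_bounds. }
  assert (C2 : ex_RInt (cotw a2 b2 c si sj s2) 0 1).
  { apply (ex_RInt_continuous (V := R_CompleteNormedModule)). intros t Ht.
    rewrite Rmin_left, Rmax_right in Ht by lra. destruct (Hx t Ht) as (? & ? & _).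
    apply cotw_continuous; auto. now apply cotw_bounds. }
  assert (I1 := RInt_correct (V := R_CompleteNormedModule) _ _ _ C1).
  assert (I2 := RInt_correct (V := R_CompleteNormedModule) _ _ _ C2).
  assert (I := is_RInt_plus (V := R_NormedModule) _ _ _ _ _ _ I1 I2).
  split.
  - assert (L := is_RInt_scal (V := R_NormedModule) _ 0 1 (c0 / E ^ 2) _ (is_RInt_ratio_cube si Hi)).
    replace (c0 / (2 * E ^ 2 * si)) with (scal (c0 / E ^ 2) (/ (2 * si)))
      by (unfold scal; simpl; unfold mult; simpl; field; lra).
    apply (is_RInt_le _ _ _ _ _ _ Rle_0_1 L I).
    intros t Ht. assert (Ht' : 0 <= t <= 1) by lra. destruct (Hx t Ht') as (X1 & X2 & X3 & X4).
    destruct (cotw_bounds a1 b1 s1 t Ha1 Hb1 Ht' N10 N11) as (_ & Q1 & W1 & _).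
    destruct (cotw_bounds a2 b2 s2 t Ha2 Hb2 Ht' N20 N21) as (_ & Q2 & W2 & _).
    change (c0 / E ^ 2 * ((1 - t) / xt si t ^ 3) <= cotw a1 b1 c si sj s1 t + cotw a2 b2 c si sj s2 t).
    rewrite W1, W2.
    pose proof (qcos_linear a1 b1 s1 t Ha1 Hb1 Ht') as L1.
    pose proof (qcos_linear a2 b2 s2 t Ha2 Hb2 Ht') as L2.
    set (q1 := qcos a1 b1 c si sj s1 t) in *. set (q2 := qcos a2 b2 c si sj s2 t) in *.
    assert (Hxx : 0 < xt si t * xt sj t) by nra.
    pose proof (sqrt_lt_R0 _ Hxx) as HN. set (N := sqrt (xt si t * xt sj t)) in *.
    assert (HNE : N <= E * xt si t).
    { unfold N. rewrite <- (sqrt_pow2 (E * xt si t)) by nra. apply sqrt_le_1_alt. nra. }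
    assert (Hsum : (1 - t) * c0 <= N * (q1 + q2)).
    { rewrite Rmult_plus_distr_l, L1, L2.
      assert (0 <= t * (sqrt (si * sj) * (qcos a1 b1 c si sj s1 1 + qcos a2 b2 c si sj s2 1))).
      { apply Rmult_le_pos; [lra|]. apply Rmult_le_pos; [apply sqrt_pos|auto]. }
      assert ((1 - t) * c0 <= (1 - t) * (qcos a1 b1 c si sj s1 0 + qcos a2 b2 c si sj s2 0))
        by (apply Rmult_le_compat_l; lra). lra. }
    assert (Hq0 : 0 <= q1 + q2).
    { apply Rmult_le_reg_l with N; auto. rewrite Rmult_0_r. eapply Rle_trans; [|apply Hsum].
      apply Rmult_le_pos; lra. }
    pose proof (cot_sum_ge q1 q2 Q1 Q2 Hq0) as Hcs.
    apply Rle_trans with ((q1 + q2) / (xt si t * xt sj t)).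
    + apply Rmult_le_reg_r with (xt si t * xt sj t); auto.
      unfold Rdiv. rewrite (Rmult_assoc (q1 + q2)), Rinv_l, Rmult_1_r by lra.
      apply Rmult_le_reg_l with N; auto. eapply Rle_trans; [|apply Hsum].
      set (x := xt si t) in *. set (y := xt sj t) in *.
      assert (Hp : 0 <= (1 - t) * c0) by (apply Rmult_le_pos; lra).
      replace (N * (c0 * / E ^ 2 * ((1 - t) * / x ^ 3) * (x * y)))
        with ((1 - t) * c0 * ((N * y) * / (E ^ 2 * x ^ 2))) by (field; lra).
      rewrite <- (Rmult_1_r ((1 - t) * c0)) at 2. apply Rmult_le_compat_l; auto.
      assert (0 < E ^ 2 * x ^ 2) by (apply Rmult_lt_0_compat; apply pow_lt; lra).
      apply Rmult_le_reg_r with (E ^ 2 * x ^ 2); auto.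
      rewrite Rmult_assoc, Rinv_l, Rmult_1_r, Rmult_1_l by lra.
      replace (E ^ 2 * x ^ 2) with ((E * x) * (E * x)) by ring.
      apply Rmult_le_compat; lra.
    + unfold Rdiv. rewrite <- Rmult_plus_distr_r. apply Rmult_le_compat_r; auto.
      left. now apply Rinv_0_lt_compat.
  - assert (L := is_RInt_scal (V := R_NormedModule) _ 0 1 (2 * E / kap) _ (is_RInt_inv_sqr si Hi)).
    replace (2 * E / (kap * si)) with (scal (2 * E / kap) (/ si))
      by (unfold scal; simpl; unfold mult; simpl; field; lra).
    apply (is_RInt_le _ _ _ _ _ _ Rle_0_1 I L).
    intros t Ht. assert (Ht' : 0 <= t <= 1) by lra. destruct (Hx t Ht') as (X1 & X2 & X3 & X4).
    destruct (cotw_bounds a1 b1 s1 t Ha1 Hb1 Ht' N10 N11) as (_ & _ & _ & W1).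
    destruct (cotw_bounds a2 b2 s2 t Ha2 Hb2 Ht' N20 N21) as (_ & _ & _ & W2).
    change (cotw a1 b1 c si sj s1 t + cotw a2 b2 c si sj s2 t <= 2 * E / kap * / xt si t ^ 2).
    assert (Hz : / kap / (xt si t * xt sj t) <= E / kap * / xt si t ^ 2).
    { set (x := xt si t) in *. set (y := xt sj t) in *.
      apply Rmult_le_reg_r with (kap * (x * y)); [apply Rmult_lt_0_compat; nra|].
      replace (/ kap / (x * y) * (kap * (x * y))) with 1 by (field; lra).
      replace (E / kap * / x ^ 2 * (kap * (x * y))) with (E * y * / x) by (field; lra).
      apply Rmult_le_reg_r with x; auto. rewrite Rmult_assoc, Rinv_l, Rmult_1_r by lra. lra. }
    unfold Rdiv in *. lra.
Qed.

End EdgeWeight.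

Lemma exp_diff_bounds (d M : R) : Rabs d <= M ->
  exp (- M) * d ^ 2 <= (exp d - 1) * d /\ Rabs (exp d - 1) <= exp M * Rabs d.
Proof.
  intros Hd. apply Rabs_le_between in Hd as Hd'.
  assert (Hm : forall x y, x <= y -> exp x <= exp y).
  { intros x y [H|H]; [left; now apply exp_increasing | rewrite H; lra]. }
  assert (HM0 : exp (- M) <= 1) by (rewrite <- exp_0; apply Hm; lra).
  assert (HM1 : 1 <= exp M) by (rewrite <- exp_0; apply Hm; lra).
  pose proof (exp_pos (- M)). pose proof (exp_pos d).
  pose proof (exp_ineq1_le d) as E1. pose proof (exp_ineq1_le (- d)) as E2.
  assert (Ei : exp d * exp (- d) = 1) by (rewrite <- exp_plus, Rplus_opp_r; apply exp_0).
  assert (Hb : exp (- M) <= exp d <= exp M) by (split; apply Hm; lra).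
  destruct (Rle_lt_dec 0 d) as [H1|H1].
  - assert (exp d - 1 <= d * exp d) by nra.
    split; [nra|]. rewrite !Rabs_pos_eq by lra. nra.
  - assert (1 - exp d >= exp d * - d) by nra.
    split; [nra|]. rewrite !Rabs_left1 by nra. nra.
Qed.

(** The sum of cosines is twice the product of the cosines of half the sum and half the difference;
    both half-angles are at most [(PI - e) / 2] in absolute value. *)
Lemma acos_decr_sum (t1 t2 e : R) : 0 <= t1 <= PI -> 0 <= t2 <= PI -> 0 < e -> t1 + t2 <= PI - e ->
  2 * sin (e / 2) ^ 2 <= cos t1 + cos t2.
Proof.
  intros H1 H2 He H. pose proof PI_RGT_0.
  rewrite form1.
  assert (Hs : 0 < sin (e / 2)) by (apply sin_gt_0; lra).
  assert (Hc : forall x, Rabs x <= (PI - e) / 2 -> sin (e / 2) <= cos x).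
  { intros x Hx. replace (sin (e / 2)) with (cos ((PI - e) / 2)).
    - rewrite <- (Rabs_pos_eq ((PI - e) / 2)) by lra.
      assert (Ec : cos x = cos (Rabs x)) by (unfold Rabs; destruct (Rcase_abs x); [now rewrite cos_neg|auto]).
      rewrite Ec, Rabs_pos_eq by lra. pose proof (Rabs_pos x). apply cos_decr_1; lra.
    - replace ((PI - e) / 2) with (PI / 2 - e / 2) by field. now rewrite cos_shift. }
  assert (C1 : sin (e / 2) <= cos ((t1 - t2) / 2)) by (apply Hc, Rabs_le; lra).
  assert (C2 : sin (e / 2) <= cos ((t1 + t2) / 2)) by (apply Hc, Rabs_le; lra).
  assert (sin (e / 2) * sin (e / 2) <= cos ((t1 - t2) / 2) * cos ((t1 + t2) / 2))
    by (apply Rmult_le_compat; lra). nra.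
Qed.

Lemma cos_sum_nonneg (t1 t2 : R) : 0 <= t1 <= PI -> 0 <= t2 <= PI -> t1 + t2 <= PI -> 0 <= cos t1 + cos t2.
Proof.
  intros H1 H2 H. assert (cos (PI - t2) <= cos t1).
  { apply cos_decr_1; lra. }
  rewrite cos_minus, cos_PI, sin_PI in H0. lra.
Qed.

(** * From angle variations to edge fluxes *)

Section Flux.
Context {V : Type} (F : V -> V -> V -> Prop) (psi psi' : V -> C) (kappa eps eps0 : R) (u : V -> R).
Hypothesis G : fat_triangulation F psi kappa eps.
Hypothesis G' : fat_triangulation F psi' kappa eps.
Hypothesis Hu : forall i j, is_edge F i j ->
  dst (psi' i) (psi' j) = exp ((u i + u j) / 2) * dst (psi i) (psi j).
Hypothesis He0 : 0 < eps0.
Hypothesis HUD : forall i j k1 k2, F i j k1 -> F i j k2 -> k1 <> k2 ->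
  angle (fun a b => dst (psi a) (psi b)) k1 i j + angle (fun a b => dst (psi a) (psi b)) k2 i j <= PI - eps0.
Hypothesis HD : forall i j k1 k2, F i j k1 -> F i j k2 -> k1 <> k2 ->
  angle (fun a b => dst (psi' a) (psi' b)) k1 i j + angle (fun a b => dst (psi' a) (psi' b)) k2 i j <= PI.
Implicit Types (i j k m n p q : V).

Notation len i j := (dst (psi i) (psi j)).
Notation len' i j := (dst (psi' i) (psi' j)).
Notation ang i j k := (angle (fun a b => dst (psi a) (psi b)) i j k).
Notation ang' i j k := (angle (fun a b => dst (psi' a) (psi' b)) i j k).

Let HS := te_surf _ _ _ _ G.
Let Fc i j k : F i j k -> F j k i := F_cyc F HS i j k.
Let Fs i j k : F i j k -> F j i k := F_swap12 F HS i j k.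
Let Fr i j k : F i j k -> F i k j := F_swap23 F HS i j k.
Let Lp i j k : F i j k -> 0 < len i j := te_pos _ _ _ _ G i j k.
Let Lp' i j k : F i j k -> 0 < len' i j := te_pos _ _ _ _ G' i j k.
Let K0 : 0 < kappa := te_kappa _ _ _ _ G.

Definition ubound : R := -4 * ln kappa.

(** In a triangle with third vertex [c], the ratio of the sides at [c] is multiplied by
    [exp ((u a - u b) / 2)]. Both ratios are controlled by [kappa], so this factor is at most
    [kappa^-2]. *)
Lemma u_diff_bound i j k : F i j k -> Rabs (u i - u j) <= ubound.
Proof.
  assert (Hone : forall i j k, F i j k -> u i - u j <= ubound).
  { intros a b c H. unfold ubound.
    assert (L1 := Lp _ _ _ (Fr _ _ _ H)). assert (L2 := Lp _ _ _ (Fc _ _ _ H)).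
    pose proof (len_ratio F psi' kappa eps G' c a b (Fc _ _ _ (Fc _ _ _ H))) as R1.
    pose proof (len_ratio F psi kappa eps G c b a (Fr _ _ _ (Fc _ _ _ (Fc _ _ _ H)))) as R2.
    rewrite (Hu c a) in R1 by (exists b; auto). rewrite (Hu c b) in R1 by (exists a; auto).
    rewrite (dst_sym (psi c) (psi a)) in *. rewrite (dst_sym (psi c) (psi b)) in *.
    set (x := len a c) in *. set (y := len b c) in *.
    assert (Hx : kappa ^ 2 * exp ((u a - u b) / 2) * x <= 1 * x).
    { replace ((u c + u a) / 2) with ((u a - u b) / 2 + (u c + u b) / 2) in R1 by field.
      rewrite exp_plus in R1. pose proof (exp_pos ((u c + u b) / 2)) as P1.
      pose proof (exp_pos ((u a - u b) / 2)) as P2.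
      set (e1 := exp ((u c + u b) / 2)) in *. set (e2 := exp ((u a - u b) / 2)) in *.
      assert (R3 : kappa * e2 * x <= y) by (apply Rmult_le_reg_l with e1; auto; lra).
      assert (kappa * (kappa * e2 * x) <= kappa * y) by (apply Rmult_le_compat_l; lra). lra. }
    apply Rmult_le_reg_r in Hx; auto.
    assert (Hl : ln (kappa ^ 2 * exp ((u a - u b) / 2)) <= ln 1).
    { apply ln_le; auto. apply Rmult_lt_0_compat; [now apply pow_lt|apply exp_pos]. }
    rewrite ln_1, ln_mult, ln_exp in Hl; [|now apply pow_lt|apply exp_pos].
    replace (kappa ^ 2) with (kappa * kappa) in Hl by ring. rewrite ln_mult in Hl by auto. lra. }
  intros H. pose proof (Hone i j k H). pose proof (Hone j i k (Fs _ _ _ H)). apply Rabs_le. lra.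
Qed.

Let s i : R := exp (- u i).
Let Hs i : 0 < s i := exp_pos (- u i).

Lemma sqrt_prod_sqr x y : 0 <= x -> 0 <= y -> sqrt (x ^ 2 * y ^ 2) = x * y.
Proof. intros Hx Hy. replace (x ^ 2 * y ^ 2) with ((x * y) ^ 2) by ring. apply sqrt_pow2. nra. Qed.

Lemma qcos_start i j k : F i j k ->
  acos (qcos (len j k ^ 2) (len i k ^ 2) (len i j ^ 2) (s i) (s j) (s k) 0) = ang k i j.
Proof.
  intros H. assert (L1 := Lp _ _ _ (Fr _ _ _ H)). assert (L2 := Lp _ _ _ (Fc _ _ _ H)).
  unfold angle, qcos, xt. f_equal.
  replace ((1 - 0 + 0 * s i) * len j k ^ 2 * ((1 - 0 + 0 * s j) * len i k ^ 2)) with (len j k ^ 2 * len i k ^ 2) by ring.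
  rewrite sqrt_prod_sqr by lra. rewrite (dst_sym (psi k) (psi i)), (dst_sym (psi k) (psi j)).
  field. lra.
Qed.

(** The factor on the right is symmetric in the three vertices, so the squared lengths at [t = 1]
    are those of a triangle similar to the image triangle, with the same angles. *)
Lemma scaled_len i j k : F i j k -> s i * len j k ^ 2 = exp (- (u i + u j + u k)) * len' j k ^ 2.
Proof.
  intros H. rewrite (Hu j k) by (exists i; auto). unfold s.
  rewrite Rpow_mult_distr, <- Rmult_assoc. f_equal.
  simpl. rewrite Rmult_1_r, <- !exp_plus. f_equal. field.
Qed.

Lemma qcos_end i j k : F i j k ->
  acos (qcos (len j k ^ 2) (len i k ^ 2) (len i j ^ 2) (s i) (s j) (s k) 1) = ang' k i j.
Proof.
  intros H. assert (L1 := Lp' _ _ _ (Fr _ _ _ H)). assert (L2 := Lp' _ _ _ (Fc _ _ _ H)).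
  unfold angle, qcos, xt. f_equal.
  replace (1 - 1 + 1 * s i) with (s i) by ring. replace (1 - 1 + 1 * s j) with (s j) by ring.
  replace (1 - 1 + 1 * s k) with (s k) by ring.
  rewrite (scaled_len i j k H), (scaled_len j i k (Fs _ _ _ H)), (scaled_len k i j (Fc _ _ _ (Fc _ _ _ H))).
  replace (u j + u i + u k) with (u i + u j + u k) by ring.
  replace (u k + u i + u j) with (u i + u j + u k) by ring.
  pose proof (exp_pos (- (u i + u j + u k))) as P. set (sg := exp (- (u i + u j + u k))) in *.
  replace (sg * len' j k ^ 2 * (sg * len' i k ^ 2)) with ((sg * len' j k) ^ 2 * len' i k ^ 2) by ring.
  rewrite sqrt_prod_sqr by nra. rewrite (dst_sym (psi' k) (psi' i)), (dst_sym (psi' k) (psi' j)).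
  field. repeat split; lra.
Qed.

Lemma heron_area (p q r : C) :
  4 * dst q r ^ 2 * dst p r ^ 2 - (dst q r ^ 2 + dst p r ^ 2 - dst p q ^ 2) ^ 2 = (2 * crs p q r) ^ 2.
Proof. rewrite !dst_sqr. unfold crs. ring. Qed.

(** Add the fatness inequalities for the two sides at [k]. *)
Lemma area_fat (ps : V -> C) : fat_triangulation F ps kappa eps -> forall i j k, F i j k ->
  kappa ^ 2 * (dst (ps j) (ps k) ^ 2 + dst (ps i) (ps k) ^ 2) ^ 2 <= (2 * crs (ps i) (ps j) (ps k)) ^ 2.
Proof.
  intros Gp i j k H.
  pose proof (te_fat _ _ _ _ Gp j k i (Fc _ _ _ H)) as H1.
  pose proof (te_fat _ _ _ _ Gp i k j (Fr _ _ _ H)) as H2.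
  rewrite crs_cyc in H1. rewrite crs_swap, Rabs_Ropp in H2.
  rewrite <- (pow2_abs (2 * _)), Rabs_mult, (Rabs_pos_eq 2) by lra.
  rewrite <- Rpow_mult_distr. apply pow_incr. split; [|lra].
  apply Rmult_le_pos; [lra|]. pose proof (pow2_ge_0 (dst (ps j) (ps k))). pose proof (pow2_ge_0 (dst (ps i) (ps k))). lra.
Qed.

Lemma hq_start i j k : F i j k ->
  kappa ^ 2 * (len j k ^ 2 + len i k ^ 2) ^ 2 <= hq (len j k ^ 2) (len i k ^ 2) (len i j ^ 2) (s i) (s j) (s k) 0.
Proof.
  intros H. eapply Rle_trans; [apply (area_fat psi G i j k H)|]. rewrite <- heron_area.
  unfold hq, xt. right. ring.
Qed.

Lemma hq_end i j k : F i j k ->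
  kappa ^ 2 * (s i * len j k ^ 2 + s j * len i k ^ 2) ^ 2 <=
    hq (len j k ^ 2) (len i k ^ 2) (len i j ^ 2) (s i) (s j) (s k) 1.
Proof.
  intros H. unfold hq, xt.
  replace (1 - 1 + 1 * s i) with (s i) by ring. replace (1 - 1 + 1 * s j) with (s j) by ring.
  replace (1 - 1 + 1 * s k) with (s k) by ring.
  rewrite (scaled_len i j k H), (scaled_len j i k (Fs _ _ _ H)), (scaled_len k i j (Fc _ _ _ (Fc _ _ _ H))).
  replace (u j + u i + u k) with (u i + u j + u k) by ring.
  replace (u k + u i + u j) with (u i + u j + u k) by ring.
  pose proof (exp_pos (- (u i + u j + u k))) as P. set (sg := exp (- (u i + u j + u k))) in *.
  pose proof (area_fat psi' G' i j k H) as Ha. rewrite <- heron_area in Ha.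
  apply Rmult_le_compat_l with (r := sg ^ 2) in Ha; [|apply pow2_ge_0]. lra.
Qed.

(** The contribution of the face [ijk] to the weight of the edge [ij]: the cotangent weight at [k],
    integrated along the path. *)
Let W i j k : R := RInt (cotw (len j k ^ 2) (len i k ^ 2) (len i j ^ 2) (s i) (s j) (s k)) 0 1.

Lemma W_sym i j k : W j i k = W i j k.
Proof.
  unfold W. rewrite (dst_sym (psi j) (psi i)). apply RInt_ext. intros t _. unfold cotw.
  rewrite hq_perm2. f_equal; [f_equal; ring | ring].
Qed.

Lemma hq_path_pos i j k t : F i j k -> 0 <= t <= 1 ->
  0 < hq (len j k ^ 2) (len i k ^ 2) (len i j ^ 2) (s i) (s j) (s k) t.
Proof.
  intros H Ht. assert (L1 := Lp _ _ _ (Fr _ _ _ H)). assert (L2 := Lp _ _ _ (Fc _ _ _ H)).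
  assert (P1 : 0 < len j k ^ 2) by now apply pow_lt. assert (P2 : 0 < len i k ^ 2) by now apply pow_lt.
  eapply Rlt_le_trans; [|apply (hq_lower kappa); auto using hq_start, hq_end].
  - pose proof (xt_pos (s i) t (Hs i) Ht). pose proof (xt_pos (s j) t (Hs j) Ht).
    apply Rmult_lt_0_compat; apply pow_lt; nra.
  - split; [lra|]. eapply kappa_le1; eauto.
Qed.

Lemma angle_change i j k : F i j k ->
  ang' i j k - ang i j k = / 2 * (s i - s j) * W i j k + / 2 * (s i - s k) * W i k j.
Proof.
  intros H. assert (H' : F j k i) by auto.
  rewrite <- (qcos_start j k i H'), <- (qcos_end j k i H').
  assert (L1 := Lp _ _ _ H). assert (L2 := Lp _ _ _ H'). assert (L3 := Lp _ _ _ (Fr _ _ _ H)).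
  rewrite angle_flow.
  - unfold W. rewrite (dst_sym (psi k) (psi i)), (dst_sym (psi j) (psi i)), (dst_sym (psi k) (psi j)). reflexivity.
  - rewrite (dst_sym (psi k)). now apply pow_lt.
  - rewrite (dst_sym (psi j)). now apply pow_lt.
  - apply Hs.
  - apply Hs.
  - apply Hs.
  - intros t Ht. now apply hq_path_pos.
Qed.

Let E := exp ubound.

Lemma s_ratio i j k : F i j k -> s i <= E * s j.
Proof.
  intros H. pose proof (u_diff_bound i j k H) as Hd. apply Rabs_le_between in Hd.
  unfold s, E. rewrite <- exp_plus.
  destruct (Rle_lt_or_eq_dec (- u i) (ubound + - u j)) as [H1|H1]; [lra|left; now apply exp_increasing|rewrite H1; lra].
Qed.

Lemma E_ge1 i j k : F i j k -> 1 <= E.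
Proof.
  intros H. pose proof (s_ratio i j k H). pose proof (s_ratio j i k (Fs _ _ _ H)).
  pose proof (Hs i). pose proof (Hs j). apply Rnot_lt_le. intros Hlt.
  assert (E * s i < s i) by nra. assert (E * s j < s j) by nra. lra.
Qed.

Lemma W_pair_bounds i j k1 k2 : F i j k1 -> F i j k2 -> k1 <> k2 ->
  2 * sin (eps0 / 2) ^ 2 / (2 * E ^ 2 * s i) <= W i j k1 + W i j k2 <= 2 * E / (kappa * s i).
Proof.
  intros H1 H2 Hne.
  assert (K1 : kappa <= 1) by (eapply kappa_le1; eauto).
  assert (A1 := Lp _ _ _ (Fc _ _ _ H1)). assert (A2 := Lp _ _ _ (Fr _ _ _ H1)).
  assert (A3 := Lp _ _ _ (Fc _ _ _ H2)). assert (A4 := Lp _ _ _ (Fr _ _ _ H2)). assert (A5 := Lp _ _ _ H1).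
  assert (Hcos : forall k t, F i j k -> (t = 0 \/ t = 1) ->
    qcos (len j k ^ 2) (len i k ^ 2) (len i j ^ 2) (s i) (s j) (s k) t =
    cos (acos (qcos (len j k ^ 2) (len i k ^ 2) (len i j ^ 2) (s i) (s j) (s k) t))).
  { intros k t Hk Ht. assert (0 <= t <= 1) by (destruct Ht; lra).
    assert (L1 := Lp _ _ _ (Fr _ _ _ Hk)). assert (L2 := Lp _ _ _ (Fc _ _ _ Hk)).
    rewrite cos_acos; auto.
    destruct (qcos_bounds (len j k ^ 2) (len i k ^ 2) (len i j ^ 2) (s i) (s j) (s k)) with (t := t) as [Q _]; auto;
      try (now apply pow_lt); [intros; now apply hq_path_pos|lra]. }
  apply edge_weight_bounds; auto using hq_start, hq_end; try (now apply pow_lt).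
  - eapply E_ge1; eauto.
  - pose proof (pow2_ge_0 (sin (eps0 / 2))). lra.
  - eapply s_ratio; eauto.
  - eapply s_ratio; eauto.
  - rewrite (Hcos k1 0), (Hcos k2 0) by auto. rewrite !qcos_start by auto.
    apply acos_decr_sum; auto; apply acos_bound.
  - rewrite (Hcos k1 1), (Hcos k2 1) by auto. rewrite !qcos_end by auto.
    apply cos_sum_nonneg; auto; apply acos_bound.
Qed.

(** The two apexes at an edge are not given by functions, so the weight is obtained by description;
    [wsum_eq] shows that the choice does not matter. Off the edges the value is 0. *)
Let wsum_spec i j (w : R) : Prop :=
  exists k1 k2, k1 <> k2 /\ F i j k1 /\ F i j k2 /\ w = W i j k1 + W i j k2.

Let wsum i j : R :=
  match excluded_middle_informative (exists w, wsum_spec i j w) with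
  | left H => proj1_sig (constructive_indefinite_description _ H)
  | right _ => 0
  end.

Lemma edge_two_faces i j k1 k2 k : F i j k1 -> F i j k2 -> k1 <> k2 -> F i j k -> k = k1 \/ k = k2.
Proof.
  intros H1 H2 Hne H. pose proof HS as (_ & _ & _ & H3 & _).
  destruct (H3 i j k1 k2 k H1 H2 H) as [E1|[E1|E1]]; auto. contradiction.
Qed.

Lemma wsum_eq i j k1 k2 : F i j k1 -> F i j k2 -> k1 <> k2 -> wsum i j = W i j k1 + W i j k2.
Proof.
  intros H1 H2 Hne. unfold wsum. destruct (excluded_middle_informative _) as [H|H].
  - destruct (constructive_indefinite_description _ H) as (w & k3 & k4 & N & H3 & H4 & ->). simpl.
    destruct (edge_two_faces i j k1 k2 k3 H1 H2 Hne H3) as [-> | ->];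
    destruct (edge_two_faces i j k1 k2 k4 H1 H2 Hne H4) as [-> | ->]; try tauto; ring.
  - exfalso. apply H. exists (W i j k1 + W i j k2), k1, k2. auto.
Qed.

Lemma wsum_nonedge i j : ~ is_edge F i j -> wsum i j = 0.
Proof.
  intros H. unfold wsum. destruct (excluded_middle_informative _) as [H1|H1]; auto.
  exfalso. destruct H1 as (w & k1 & k2 & _ & H2 & _). apply H. now exists k1.
Qed.

Lemma lsum_two (L : list V) (P : V -> Prop) (f : V -> R) (k1 k2 : V) : NoDup L -> k1 <> k2 ->
  In k1 L -> In k2 L -> P k1 -> P k2 -> (forall k, P k -> k = k1 \/ k = k2) ->
  lsum L (fun k => ind (P k) * f k) = f k1 + f k2.
Proof.
  intros HN Hne I1 I2 P1 P2 HP.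
  destruct (in_split _ _ I1) as (l1 & l2 & ->).
  assert (HN' := NoDup_remove_2 _ _ _ HN). assert (HN1 := NoDup_remove_1 _ _ _ HN).
  assert (I2' : In k2 (l1 ++ l2)).
  { apply in_app_iff in I2. apply in_app_iff. destruct I2 as [|[|]]; auto. contradiction. }
  rewrite lsum_app, lsum_cons, ind_true by auto.
  enough (lsum (l1 ++ l2) (fun k => ind (P k) * f k) = f k2) by (rewrite lsum_app in H; lra).
  destruct (in_split _ _ I2') as (m1 & m2 & Em). rewrite Em in *.
  assert (HN2 := NoDup_remove_2 _ _ _ HN1).
  rewrite lsum_app, lsum_cons, ind_true by auto.
  enough (lsum (m1 ++ m2) (fun k => ind (P k) * f k) = 0) by (rewrite lsum_app in H; lra).
  apply lsum_zero. intros k Hk. rewrite ind_false; [ring|]. intros Pk.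
  destruct (HP k Pk) as [-> | ->]; [|contradiction].
  apply HN'. apply in_app_iff in Hk. apply in_app_iff. simpl. tauto.
Qed.

(** The flux is half the difference of [s = e^{-u}] across the edge times the integrated weight. It
    is antisymmetric because the weight is symmetric, and its sum at a vertex vanishes because the
    angle sum is the same in both metrics. *)
Lemma flux_exists : exists (A : V -> V -> R) (c1 C1 : R), 0 < c1 /\ 0 < C1 /\
  (forall i j, A j i = - A i j) /\
  (forall i j, ~ is_edge F i j -> A i j = 0) /\
  (forall i j, is_edge F i j -> c1 * (u i - u j) ^ 2 <= A i j * (u i - u j) /\ Rabs (A i j) <= C1 * Rabs (u i - u j)) /\
  (forall i L, NoDup L -> (forall j k, F i j k -> In j L) -> lsum L (fun j => A i j) = 0).
Proof.
  destruct (classic (exists v : V, True)) as [[v0 _]|Hv0].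
  2:{ exists (fun _ _ => 0), 1, 1.
      repeat split; try lra; intros; exfalso;
        match goal with v : V |- _ => apply Hv0; now exists v end. }
  pose proof (exp_pos ubound) as HE. fold E in HE.
  (* Since [s j - s i = s i * (exp (u i - u j) - 1)], the weight enters as [s i * wsum i j], between
     [sin^2 / E^2] and [2 E / kappa]. The exponential costs one more factor [E]. *)
  exists (fun i j => / 2 * (s j - s i) * wsum i j), (sin (eps0 / 2) ^ 2 / (2 * E ^ 3)), (E ^ 2 / kappa).
  assert (Hedge : forall i j, is_edge F i j -> exists k1 k2, F i j k1 /\ F i j k2 /\ k1 <> k2).
  { intros i j [k H]. destruct (te_second _ _ _ _ G i j k H) as (m & N & Hm). exists k, m. auto. }
  (* The two angles opposite an edge are positive, so the Delaunay gap [eps0] is less than [PI]. *)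
  assert (Hsin : 0 < sin (eps0 / 2)).
  { pose proof HS as (_ & _ & Hv & _). destruct (Hv v0) as (j & k & H).
    destruct (Hedge v0 j (ex_intro _ k H)) as (k1 & k2 & H1 & H2 & N).
    pose proof (HUD v0 j k1 k2 H1 H2 N). pose proof (te_angle _ _ _ _ G _ _ _ (Fc _ _ _ (Fc _ _ _ H1))).
    pose proof (te_angle _ _ _ _ G _ _ _ (Fc _ _ _ (Fc _ _ _ H2))). pose proof (te_eps _ _ _ _ G).
    apply sin_gt_0; lra. }
  assert (Hsym : forall i j, wsum j i = wsum i j).
  { intros i j. destruct (classic (is_edge F i j)) as [H|H].
    - destruct (Hedge i j H) as (k1 & k2 & H1 & H2 & N).
      rewrite (wsum_eq i j k1 k2), (wsum_eq j i k1 k2) by auto. now rewrite (W_sym i j k1), (W_sym i j k2).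
    - rewrite !wsum_nonedge; auto. intros [k Hk]. apply H. exists k. auto. }
  assert (P3 : 0 < E ^ 3) by now apply pow_lt.
  repeat split.
  - apply Rdiv_lt_0_compat; [now apply pow_lt|lra].
  - apply Rdiv_lt_0_compat; [now apply pow_lt|auto].
  - intros i j. rewrite Hsym. ring.
  - intros i j H. rewrite wsum_nonedge by auto. ring.
  - destruct (Hedge i j H) as (k1 & k2 & H1 & H2 & N). rewrite (wsum_eq i j k1 k2) by auto.
    destruct (W_pair_bounds i j k1 k2 H1 H2 N) as [WL _]. set (w := W i j k1 + W i j k2) in *.
    destruct (exp_diff_bounds (u i - u j) ubound (u_diff_bound i j k1 H1)) as [X1 _].
    assert (Es : s j - s i = s i * (exp (u i - u j) - 1)).
    { unfold s. rewrite Rmult_minus_distr_l, <- exp_plus. rewrite Rmult_1_r. f_equal. f_equal. ring. }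
    rewrite Es. pose proof (Hs i) as Si. pose proof (Hs j) as Sj.
    assert (Hw : sin (eps0 / 2) ^ 2 / E ^ 2 <= s i * w).
    { apply Rmult_le_compat_l with (r := s i) in WL; [|lra].
      eapply Rle_trans; [|exact WL]. right. field. lra. }
    assert (X0 : 0 <= (exp (u i - u j) - 1) * (u i - u j)).
    { eapply Rle_trans; [|exact X1]. apply Rmult_le_pos; [left; apply exp_pos|apply pow2_ge_0]. }
    replace (/ 2 * (s i * (exp (u i - u j) - 1)) * w * (u i - u j))
      with (/ 2 * ((s i * w) * ((exp (u i - u j) - 1) * (u i - u j)))) by ring.
    apply Rle_trans with (/ 2 * (sin (eps0 / 2) ^ 2 / E ^ 2 * (exp (- ubound) * (u i - u j) ^ 2))).
    + rewrite exp_Ropp. fold E. right. field. lra.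
    + apply Rmult_le_compat_l; [lra|]. apply Rmult_le_compat; auto.
      * left. apply Rdiv_lt_0_compat; now apply pow_lt.
      * apply Rmult_le_pos; [left; apply exp_pos|apply pow2_ge_0].
  - destruct (Hedge i j H) as (k1 & k2 & H1 & H2 & N). rewrite (wsum_eq i j k1 k2) by auto.
    destruct (W_pair_bounds i j k1 k2 H1 H2 N) as [WL WU]. set (w := W i j k1 + W i j k2) in *.
    destruct (exp_diff_bounds (u i - u j) ubound (u_diff_bound i j k1 H1)) as [_ X1].
    assert (Es : s j - s i = s i * (exp (u i - u j) - 1)).
    { unfold s. rewrite Rmult_minus_distr_l, <- exp_plus. rewrite Rmult_1_r. f_equal. f_equal. ring. }
    rewrite Es. pose proof (Hs i) as Si.
    assert (Hw0 : 0 <= s i * w).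
    { apply Rmult_le_pos; [lra|]. eapply Rle_trans; [|exact WL].
      assert (0 < E ^ 2) by now apply pow_lt.
      left. apply Rdiv_lt_0_compat; [|nra]. assert (0 < sin (eps0 / 2) ^ 2) by now apply pow_lt. lra. }
    assert (Hw : s i * w <= 2 * E / kappa).
    { apply Rmult_le_compat_l with (r := s i) in WU; [|lra].
      eapply Rle_trans; [exact WU|]. right. field. lra. }
    replace (/ 2 * (s i * (exp (u i - u j) - 1)) * w)
      with (/ 2 * ((s i * w) * (exp (u i - u j) - 1))) by ring.
    rewrite Rabs_mult, (Rabs_pos_eq (/ 2)), Rabs_mult, (Rabs_pos_eq (s i * w)) by (auto; lra).
    apply Rle_trans with (/ 2 * ((2 * E / kappa) * (exp ubound * Rabs (u i - u j)))).
    + apply Rmult_le_compat_l; [lra|]. apply Rmult_le_compat; auto. apply Rabs_pos.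
    + fold E. right. field. lra.
  - intros i L HN HL.
    assert (Hsum : lsum L (fun j => lsum L (fun k => ind (F i j k) * (ang' i j k - ang i j k))) = 0).
    { pose proof (angle_sum F psi kappa eps G L i HN HL) as S1.
      pose proof (angle_sum F psi' kappa eps G' L i HN HL) as S2.
      rewrite (lsum_ext L _ (fun j => lsum L (fun k => ind (F i j k) * ang' i j k) -
         lsum L (fun k => ind (F i j k) * ang i j k))).
      - rewrite lsum_minus. lra.
      - intros j _. rewrite <- lsum_minus. apply lsum_ext. intros k _. ring. }
    assert (Hrow : forall j, In j L -> lsum L (fun k => ind (F i j k) * (/ 2 * (s i - s j) * W i j k)) =
       - (/ 2 * (s j - s i) * wsum i j)).
    { intros j _. destruct (classic (is_edge F i j)) as [He|He].
      - destruct (Hedge i j He) as (k1 & k2 & H1 & H2 & N).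
        rewrite (lsum_two L (F i j) _ k1 k2); auto.
        + rewrite (wsum_eq i j k1 k2) by auto. ring.
        + apply (HL k1 j). auto.
        + apply (HL k2 j). auto.
        + intros k. now apply edge_two_faces.
      - rewrite wsum_nonedge by auto. rewrite lsum_zero; [ring|]. intros k _.
        rewrite ind_false; [ring|]. intros Hk. apply He. now exists k. }
    (* Each angle change splits into one term for each of its two sides; regrouped by sides, both
       halves equal minus the total flux at [i]. *)
    assert (Hsplit : lsum L (fun j => lsum L (fun k => ind (F i j k) * (ang' i j k - ang i j k))) =
      lsum L (fun j => lsum L (fun k => ind (F i j k) * (/ 2 * (s i - s j) * W i j k))) +
      lsum L (fun j => lsum L (fun k => ind (F i k j) * (/ 2 * (s i - s k) * W i k j)))).
    { rewrite <- lsum_plus. apply lsum_ext. intros j _. rewrite <- lsum_plus. apply lsum_ext. intros k _.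
      rewrite (ind_iff (F i k j) (F i j k)) by (split; apply Fr).
      destruct (classic (F i j k)) as [Hf|Hf].
      - rewrite (angle_change i j k Hf). ring.
      - rewrite (ind_false _ Hf). ring. }
    rewrite Hsplit in Hsum.
    rewrite (lsum_swap L L (fun j k => ind (F i k j) * (/ 2 * (s i - s k) * W i k j))) in Hsum.
    rewrite (lsum_ext L _ _ Hrow) in Hsum.
    rewrite (lsum_ext L _ (fun j => -1 * (/ 2 * (s j - s i) * wsum i j))) in Hsum by (intros; ring).
    rewrite lsum_scal in Hsum. lra.
Qed.

End Flux.

(** * Energy estimates *)

Section Sums.
Context {V : Type} (F : V -> V -> V -> Prop).
Hypothesis HS : surface_triangulation F.
Implicit Types (i j k m n p q : V) (Z : list V).

(** Ordered triples: every face with vertices in [Z] occurs six times. Likewise [esum] counts every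
    edge twice. *)
Definition Tri Z : list (V * V * V) :=
  filter (fun f => if excluded_middle_informative (F (fst (fst f)) (snd (fst f)) (snd f)) then true else false)
    (list_prod (list_prod Z Z) Z).

Definition esum Z (g : V -> V -> R) : R :=
  lsum Z (fun i => lsum Z (fun j => ind (is_edge F i j) * g i j)).

Lemma in_Tri Z i j k : In (i, j, k) (Tri Z) <-> F i j k /\ In i Z /\ In j Z /\ In k Z.
Proof.
  unfold Tri. rewrite filter_In, !in_prod_iff. simpl.
  destruct (excluded_middle_informative (F i j k)); intuition discriminate.
Qed.

Lemma NoDup_Tri Z : NoDup Z -> NoDup (Tri Z).
Proof. intros H. unfold Tri. apply NoDup_filter. repeat apply NoDup_list_prod; auto. Qed.

Lemma lsum_Tri Z (g : V * V * V -> R) :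
  lsum (Tri Z) g = lsum Z (fun i => lsum Z (fun j => lsum Z (fun k => ind (F i j k) * g (i, j, k)))).
Proof.
  unfold Tri. rewrite lsum_filter, !lsum_list_prod.
  apply lsum_ext. intros i _. apply lsum_ext. intros j _. apply lsum_ext. intros k _. simpl. unfold ind.
  destruct (excluded_middle_informative (F i j k)); reflexivity.
Qed.

Lemma lsum_Tri_swap Z (g : V * V * V -> R) :
  lsum (Tri Z) g = lsum (Tri Z) (fun f => g (fst (fst f), snd f, snd (fst f))).
Proof.
  rewrite !lsum_Tri. apply lsum_ext. intros i _. simpl.
  rewrite (lsum_swap Z Z (fun j k => ind (F i j k) * g (i, k, j))).
  apply lsum_ext. intros j _. apply lsum_ext. intros k _.
  rewrite (ind_iff (F i j k) (F i k j)); [reflexivity|]. split; apply (F_swap23 F HS).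
Qed.

Lemma edge_faces_le2 Z i j : NoDup Z -> lsum Z (fun k => ind (F i j k)) <= 2 * ind (is_edge F i j).
Proof.
  intros HN. destruct (classic (is_edge F i j)) as [[k0 Hk0]|H].
  - rewrite (ind_true (is_edge F i j)) by (exists k0; auto).
    destruct (classic (exists m, m <> k0 /\ F i j m)) as [(m & Nm & Hm)|Hno].
    + apply Rle_trans with (lsum Z (fun k => ind (k = k0) + ind (k = m))).
      * apply lsum_le. intros k _. pose proof (ind_bounds (k = k0)). pose proof (ind_bounds (k = m)).
        destruct (classic (F i j k)) as [Hf|Hf]; [|rewrite (ind_false _ Hf); lra].
        pose proof HS as (_ & _ & _ & H3 & _).
        destruct (H3 i j k0 m k Hk0 Hm Hf) as [E|[E|E]]; [congruence| |]; subst.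
        -- rewrite (ind_true (k = k)) by auto. pose proof (ind_bounds (F i j k)). lra.
        -- rewrite (ind_true (k = k)) by auto. pose proof (ind_bounds (F i j k)). lra.
      * rewrite lsum_plus.
        assert (lsum Z (fun k => ind (k = k0)) <= 1) by (apply lsum_ind_unique; auto; congruence).
        assert (lsum Z (fun k => ind (k = m)) <= 1) by (apply lsum_ind_unique; auto; congruence). lra.
    + assert (lsum Z (fun k => ind (F i j k)) <= 1); [|lra].
      apply lsum_ind_unique; auto. intros x y _ _ Hx Hy.
      assert (x = k0) by (apply NNPP; intros N; apply Hno; eauto).
      assert (y = k0) by (apply NNPP; intros N; apply Hno; eauto). congruence.
  - rewrite (ind_false (is_edge F i j)) by auto. rewrite lsum_zero; [lra|].
    intros k _. apply ind_false. intros Hf. apply H. exists k. auto.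
Qed.

Lemma Tri_le_esum Z (g : V -> V -> R) : NoDup Z -> (forall i j, 0 <= g i j) ->
  lsum (Tri Z) (fun f => g (fst (fst f)) (snd (fst f))) <= 2 * esum Z g.
Proof.
  intros HN Hg. rewrite lsum_Tri. simpl. unfold esum. rewrite <- lsum_scal. apply lsum_le. intros i _.
  rewrite <- lsum_scal. apply lsum_le. intros j _.
  rewrite (lsum_ext Z _ (fun k => g i j * ind (F i j k))) by (intros; ring).
  rewrite lsum_scal. pose proof (edge_faces_le2 Z i j HN). specialize (Hg i j). nra.
Qed.

(** Each edge with a positive term is charged to a face inside [Z] that has it as its first two
    vertices. *)
Lemma esum_le_Tri Z (g h : V -> V -> R) : (forall i j, 0 <= h i j) ->
  (forall i j, In i Z -> In j Z -> is_edge F i j ->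
     g i j <= 0 \/ (exists k, In k Z /\ F i j k) /\ g i j <= h i j) ->
  esum Z g <= lsum (Tri Z) (fun f => h (fst (fst f)) (snd (fst f))).
Proof.
  intros Hh H. rewrite lsum_Tri. simpl. apply lsum_le. intros i Hi. apply lsum_le. intros j Hj.
  rewrite (lsum_ext Z _ (fun k => h i j * ind (F i j k))) by (intros; ring). rewrite lsum_scal.
  assert (Hs : 0 <= lsum Z (fun k => ind (F i j k))) by (apply lsum_nonneg; intros; apply ind_bounds).
  specialize (Hh i j).
  destruct (classic (is_edge F i j)) as [He|He].
  - rewrite (ind_true _ He). destruct (H i j Hi Hj He) as [H1|[(k & Hk & Hf) H1]]; [nra|].
    assert (ind (F i j k) <= lsum Z (fun k => ind (F i j k)))
      by (apply (lsum_In_le Z (fun k => ind (F i j k))); auto; intros; apply ind_bounds).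
    rewrite ind_true in H0 by auto. nra.
  - rewrite (ind_false _ He). nra.
Qed.

Lemma esum_le Z (g h : V -> V -> R) :
  (forall i j, In i Z -> In j Z -> is_edge F i j -> g i j <= h i j) -> esum Z g <= esum Z h.
Proof.
  intros H. apply lsum_le. intros i Hi. apply lsum_le. intros j Hj.
  destruct (classic (is_edge F i j)) as [He|He]; [rewrite (ind_true _ He); specialize (H i j Hi Hj He)
    | rewrite (ind_false _ He)]; lra.
Qed.

Lemma esum_plus Z (g h : V -> V -> R) : esum Z (fun i j => g i j + h i j) = esum Z g + esum Z h.
Proof.
  unfold esum. rewrite <- lsum_plus. apply lsum_ext. intros i _. rewrite <- lsum_plus.
  apply lsum_ext. intros j _. ring.
Qed.

Lemma esum_scal Z c (g : V -> V -> R) : esum Z (fun i j => c * g i j) = c * esum Z g.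
Proof.
  unfold esum. rewrite <- lsum_scal. apply lsum_ext. intros i _. rewrite <- lsum_scal.
  apply lsum_ext. intros j _. ring.
Qed.

Lemma esum_list Z (g : V -> V -> R) :
  esum Z g = lsum (list_prod Z Z) (fun ij => ind (is_edge F (fst ij) (snd ij)) * g (fst ij) (snd ij)).
Proof. unfold esum. now rewrite lsum_list_prod. Qed.

Lemma esum_CS Z (g h : V -> V -> R) :
  (esum Z (fun i j => g i j * h i j)) ^ 2 <= esum Z (fun i j => g i j ^ 2) * esum Z (fun i j => h i j ^ 2).
Proof.
  rewrite !esum_list.
  set (e := fun ij : V * V => ind (is_edge F (fst ij) (snd ij))).
  assert (He : forall ij, e ij * e ij = e ij) by (intros ij; unfold e, ind; destruct (excluded_middle_informative _); ring).
  pose proof (lsum_CS (list_prod Z Z) (fun ij => e ij * g (fst ij) (snd ij)) (fun ij => e ij * h (fst ij) (snd ij))) as H.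
  rewrite (lsum_ext _ (fun x => e x * g (fst x) (snd x) * (e x * h (fst x) (snd x)))
    (fun ij => e ij * (g (fst ij) (snd ij) * h (fst ij) (snd ij)))) in H
    by (intros ij _; transitivity ((e ij * e ij) * (g (fst ij) (snd ij) * h (fst ij) (snd ij))); [ring | now rewrite He]).
  rewrite (lsum_ext _ (fun x => (e x * g (fst x) (snd x)) ^ 2) (fun ij => e ij * g (fst ij) (snd ij) ^ 2)) in H
    by (intros ij _; transitivity ((e ij * e ij) * g (fst ij) (snd ij) ^ 2); [ring | now rewrite He]).
  rewrite (lsum_ext _ (fun x => (e x * h (fst x) (snd x)) ^ 2) (fun ij => e ij * h (fst ij) (snd ij) ^ 2)) in H
    by (intros ij _; transitivity ((e ij * e ij) * h (fst ij) (snd ij) ^ 2); [ring | now rewrite He]).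
  exact H.
Qed.

End Sums.

(* The conformal factor [v] solves a uniformly elliptic divergence-form equation: [A i j] is the
   flux through the edge [ij], comparable to [v i - v j]. *)
Record elliptic {V : Type} (F : V -> V -> V -> Prop) (v : V -> R) (A : V -> V -> R) (c1 C1 M : R) : Prop := {
  el_c : 0 < c1;
  el_C : 0 < C1;
  el_anti : forall i j, A j i = - A i j;
  el_none : forall i j, ~ is_edge F i j -> A i j = 0;
  el_lo : forall i j, is_edge F i j -> c1 * (v i - v j) ^ 2 <= A i j * (v i - v j);
  el_hi : forall i j, is_edge F i j -> Rabs (A i j) <= C1 * Rabs (v i - v j);
  el_sum : forall i L, NoDup L -> (forall j k, F i j k -> In j L) -> lsum L (fun j => A i j) = 0;
  el_M : forall i j, is_edge F i j -> Rabs (v i - v j) <= M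
}.

(** The ellipticity bounds are even in the differences, so the estimates for [exp v] apply to
    [exp (- v)] as well. *)
Lemma elliptic_opp {V : Type} (F : V -> V -> V -> Prop) v A c1 C1 M :
  elliptic F v A c1 C1 M -> elliptic F (fun i => - v i) (fun i j => - A i j) c1 C1 M.
Proof.
  intros [H1 H2 H3 H4 H5 H6 H7 H8].
  assert (E : forall i j, - v i - - v j = - (v i - v j)) by (intros; ring).
  constructor; auto; intros; rewrite ?E.
  - rewrite H3. ring.
  - rewrite H4 by auto. ring.
  - specialize (H5 i j H). nra.
  - rewrite !Rabs_Ropp. auto.
  - rewrite (lsum_ext L _ (fun j => -1 * A i j)) by (intros; ring). rewrite lsum_scal, H7 by auto. ring.
  - rewrite Rabs_Ropp. auto.
Qed.

(** * Caccioppoli inequalities and the maximum principle *)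

Section Caccioppoli.
Context {V : Type} (F : V -> V -> V -> Prop) (v : V -> R) (A : V -> V -> R) (c1 C1 M : R).
Hypothesis HS : surface_triangulation F.
Hypothesis HL : elliptic F v A c1 C1 M.
Implicit Types (i j k m n p q : V) (Z : list V).

Definition cacc0 : R := C1 * (1 + exp (2 * M)) / 2 / (c1 * exp (- (2 * M))).

(** Write [y = exp v] and split [eta_i^2 y_i^2 - eta_j^2 y_j^2] into half of
    [(eta_i^2 + eta_j^2) (y_i^2 - y_j^2)], which yields energy by ellipticity, and half of
    [(eta_i^2 - eta_j^2) (y_i^2 + y_j^2)], the error term. *)
Lemma flux_pointwise i j (eta : V -> R) : is_edge F i j -> (forall i, 0 <= eta i) ->
  c1 * exp (- (2 * M)) * ((v i - v j) ^ 2 * (eta i ^ 2 + eta j ^ 2) * exp (v i) ^ 2)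
  - C1 * (1 + exp (2 * M)) / 2 * (Rabs (v i - v j) * Rabs (eta i ^ 2 - eta j ^ 2) * exp (v i) ^ 2)
  <= A i j * (eta i ^ 2 * exp (v i) ^ 2 - eta j ^ 2 * exp (v j) ^ 2).
Proof.
  intros He Heta. pose proof (el_lo _ _ _ _ _ _ HL i j He) as H1. pose proof (el_hi _ _ _ _ _ _ HL i j He) as H2.
  pose proof (el_M _ _ _ _ _ _ HL i j He) as H3.
  pose proof (el_c _ _ _ _ _ _ HL) as Hc1. pose proof (el_C _ _ _ _ _ _ HL) as HC1.
  set (D := v i - v j) in *. set (a := A i j) in *.
  set (Y := exp (v i) ^ 2). assert (HY : 0 < Y) by (apply pow_lt, exp_pos).
  assert (EYj : exp (v j) ^ 2 = Y * exp (-2 * D)).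
  { unfold Y. replace (-2 * D) with (- D + - D) by ring. rewrite exp_plus.
    replace (exp (v i) ^ 2 * (exp (- D) * exp (- D))) with ((exp (v i) * exp (- D)) ^ 2) by ring.
    rewrite <- exp_plus. f_equal. f_equal. unfold D. ring. }
  rewrite EYj. set (Ej := exp (-2 * D)).
  assert (HD2 : Rabs (-2 * D) <= 2 * M).
  { rewrite Rabs_mult. replace (Rabs (-2)) with 2 by (rewrite Rabs_left; lra). lra. }
  destruct (exp_diff_bounds (-2 * D) (2 * M) HD2) as [X1 _]. fold Ej in X1.
  assert (HEj : 0 < Ej <= exp (2 * M)).
  { split; [apply exp_pos|]. unfold Ej. apply Rabs_le_between in HD2.
    destruct (Rle_lt_or_eq_dec (-2 * D) (2 * M)) as [H|H]; [lra|left; now apply exp_increasing|rewrite H; lra]. }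
  set (em := exp (- (2 * M))) in *. assert (Hem : 0 < em) by apply exp_pos.
  assert (Hmain : 2 * c1 * em * D ^ 2 <= a * (1 - Ej)).
  { destruct (Req_dec D 0) as [E0|E0].
    - rewrite E0 in *. rewrite Rabs_R0, Rmult_0_r in H2.
      assert (a = 0) by (apply Rabs_le_between in H2; lra). rewrite H. lra.
    - assert (HDp : 0 < D ^ 2) by now apply pow2_gt_0.
      apply Rmult_le_reg_r with (D ^ 2); auto.
      replace (a * (1 - Ej) * D ^ 2) with ((a * D) * ((1 - Ej) * D)) by ring.
      apply Rle_trans with ((c1 * D ^ 2) * (2 * em * D ^ 2)); [right; ring|].
      apply Rmult_le_compat; auto; [nra| |lra]. apply Rmult_le_pos; nra. }
  set (e1 := eta i ^ 2). set (e2 := eta j ^ 2).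
  assert (P1 : 0 <= e1) by apply pow2_ge_0. assert (P2 : 0 <= e2) by apply pow2_ge_0.
  assert (T1 : c1 * em * (D ^ 2 * (e1 + e2) * Y) <= / 2 * (e1 + e2) * Y * (a * (1 - Ej))).
  { apply Rle_trans with (/ 2 * (e1 + e2) * Y * (2 * c1 * em * D ^ 2)); [right; field|].
    apply Rmult_le_compat_l; auto. apply Rmult_le_pos; [|lra]. apply Rmult_le_pos; lra. }
  assert (T2 : - (C1 * (1 + exp (2 * M)) / 2 * (Rabs D * Rabs (e1 - e2) * Y)) <= / 2 * (e1 - e2) * Y * (a * (1 + Ej))).
  { assert (HA : Rabs (/ 2 * (e1 - e2) * Y * (a * (1 + Ej))) <= C1 * (1 + exp (2 * M)) / 2 * (Rabs D * Rabs (e1 - e2) * Y)).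
    { rewrite !Rabs_mult. rewrite (Rabs_pos_eq (/ 2)), (Rabs_pos_eq Y), (Rabs_pos_eq (1 + Ej)) by lra.
      apply Rle_trans with (/ 2 * Rabs (e1 - e2) * Y * ((C1 * Rabs D) * (1 + exp (2 * M)))); [|right; field].
      apply Rmult_le_compat_l.
      - apply Rmult_le_pos; [|lra]. apply Rmult_le_pos; [lra|apply Rabs_pos].
      - apply Rmult_le_compat; try lra. apply Rabs_pos. }
    apply Rabs_le_between in HA. lra. }
  replace (a * (e1 * Y - e2 * (Y * Ej))) with
    (/ 2 * (e1 + e2) * Y * (a * (1 - Ej)) + / 2 * (e1 - e2) * Y * (a * (1 + Ej))) by field.
  lra.
Qed.

(** Test the equation with [eta^2 e^{2v}]. Summation by parts gives zero: [A] is antisymmetric and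
    its row sums vanish where [eta] does not. The right side is kept linear in [|v i - v j|]: it
    lives only where [eta] varies, which the Liouville argument exploits. *)
Lemma caccioppoli0 Z (eta : V -> R) : NoDup Z -> (forall i, 0 <= eta i) ->
  (forall i, eta i <> 0 -> forall j k, F i j k -> In j Z) ->
  esum F Z (fun i j => (v i - v j) ^ 2 * (eta i ^ 2 + eta j ^ 2) * exp (v i) ^ 2) <=
  cacc0 * esum F Z (fun i j => Rabs (v i - v j) * Rabs (eta i ^ 2 - eta j ^ 2) * exp (v i) ^ 2).
Proof.
  intros HN Heta Hsup.
  pose proof (el_c _ _ _ _ _ _ HL) as Hc1.
  assert (Hem : 0 < c1 * exp (- (2 * M))) by (apply Rmult_lt_0_compat; auto; apply exp_pos).
  assert (Hrow : forall i, lsum Z (fun j => A i j * (eta i ^ 2 * exp (v i) ^ 2)) = 0).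
  { intros i. rewrite (lsum_ext Z _ (fun j => (eta i ^ 2 * exp (v i) ^ 2) * A i j)) by (intros; ring).
    rewrite lsum_scal. destruct (Req_dec (eta i) 0) as [E|E]; [rewrite E; ring|].
    apply Rmult_eq_0_compat_l. exact (el_sum _ _ _ _ _ _ HL i Z HN (Hsup i E)). }
  assert (H0 : esum F Z (fun i j => A i j * (eta i ^ 2 * exp (v i) ^ 2 - eta j ^ 2 * exp (v j) ^ 2)) = 0).
  { unfold esum.
    rewrite (lsum_ext Z _ (fun i => lsum Z (fun j => A i j * (eta i ^ 2 * exp (v i) ^ 2))
      - lsum Z (fun j => A i j * (eta j ^ 2 * exp (v j) ^ 2)))).
    - rewrite lsum_minus. rewrite (lsum_zero Z (fun i => lsum Z (fun j => A i j * (eta i ^ 2 * exp (v i) ^ 2)))) by auto.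
      rewrite (lsum_swap Z Z (fun i j => A i j * (eta j ^ 2 * exp (v j) ^ 2))).
      rewrite lsum_zero; [ring|]. intros j _.
      rewrite (lsum_ext Z _ (fun i => -1 * (A j i * (eta j ^ 2 * exp (v j) ^ 2)))).
      + rewrite lsum_scal, Hrow. ring.
      + intros i _. rewrite (el_anti _ _ _ _ _ _ HL j i). ring.
    - intros i _. rewrite <- lsum_minus. apply lsum_ext. intros j _.
      destruct (classic (is_edge F i j)) as [He|He]; [rewrite (ind_true _ He); ring|].
      rewrite (el_none _ _ _ _ _ _ HL i j He). ring. }
  assert (H1 : esum F Z (fun i j => c1 * exp (- (2 * M)) * ((v i - v j) ^ 2 * (eta i ^ 2 + eta j ^ 2) * exp (v i) ^ 2)
     + - (C1 * (1 + exp (2 * M)) / 2) * (Rabs (v i - v j) * Rabs (eta i ^ 2 - eta j ^ 2) * exp (v i) ^ 2)) <= 0).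
  { rewrite <- H0. apply esum_le. intros i j _ _ He. pose proof (flux_pointwise i j eta He Heta). lra. }
  rewrite esum_plus, !esum_scal in H1.
  apply Rmult_le_reg_l with (c1 * exp (- (2 * M))); auto. unfold cacc0.
  set (X := esum F Z (fun i j => Rabs (v i - v j) * Rabs (eta i ^ 2 - eta j ^ 2) * exp (v i) ^ 2)) in *.
  replace (c1 * exp (- (2 * M)) * (C1 * (1 + exp (2 * M)) / 2 / (c1 * exp (- (2 * M))) * X))
    with (C1 * (1 + exp (2 * M)) / 2 * X) by (field; pose proof (exp_pos (- (2 * M))); lra).
  lra.
Qed.

(** Young's inequality absorbs half of the energy into the left side. *)
Lemma caccioppoli Z (eta : V -> R) : NoDup Z -> (forall i, 0 <= eta i) ->
  (forall i, eta i <> 0 -> forall j k, F i j k -> In j Z) ->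
  esum F Z (fun i j => (v i - v j) ^ 2 * (eta i ^ 2 + eta j ^ 2) * exp (v i) ^ 2) <=
  2 * cacc0 ^ 2 * esum F Z (fun i j => (eta i - eta j) ^ 2 * exp (v i) ^ 2).
Proof.
  intros HN Heta Hsup. pose proof (caccioppoli0 Z eta HN Heta Hsup) as H.
  set (X := esum F Z (fun i j => (v i - v j) ^ 2 * (eta i ^ 2 + eta j ^ 2) * exp (v i) ^ 2)) in *.
  set (K := cacc0) in *.
  assert (HK : K * esum F Z (fun i j => Rabs (v i - v j) * Rabs (eta i ^ 2 - eta j ^ 2) * exp (v i) ^ 2)
     <= / 2 * X + K ^ 2 * esum F Z (fun i j => (eta i - eta j) ^ 2 * exp (v i) ^ 2)).
  { unfold X. rewrite <- !esum_scal, <- esum_plus. apply esum_le. intros i j _ _ _.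
    set (Y := exp (v i) ^ 2). assert (HY : 0 < Y) by (apply pow_lt, exp_pos).
    replace (eta i ^ 2 - eta j ^ 2) with ((eta i - eta j) * (eta i + eta j)) by ring.
    rewrite Rabs_mult, (Rabs_pos_eq (eta i + eta j)) by (pose proof (Heta i); pose proof (Heta j); lra).
    rewrite <- (pow2_abs (v i - v j)), <- (pow2_abs (eta i - eta j)).
    set (d := Rabs (v i - v j)). set (w := Rabs (eta i - eta j)). set (a := eta i). set (b := eta j).
    replace (K * (d * (w * (a + b)) * Y)) with ((K * w * (d * (a + b))) * Y) by ring.
    replace (/ 2 * (d ^ 2 * (a ^ 2 + b ^ 2) * Y) + K ^ 2 * (w ^ 2 * Y)) with
      ((/ 2 * d ^ 2 * (a ^ 2 + b ^ 2) + K ^ 2 * w ^ 2) * Y) by ring.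
    apply Rmult_le_compat_r; [lra|].
    assert (0 <= (K * w - / 2 * (d * (a + b))) ^ 2) by apply pow2_ge_0.
    assert (0 <= (d * (a - b)) ^ 2) by apply pow2_ge_0. nra. }
  lra.
Qed.

(** At a maximum over [P] whose neighbours all lie in [P], the fluxes are nonnegative with sum zero,
    so all neighbours share the value. Follow an edge path to [o]: the maximal value persists until
    a vertex with a neighbour outside [P] is reached. *)
Lemma maximum_principle Z (P : V -> Prop) q o : (forall i, P i <-> In i Z) -> P q -> ~ P o ->
  exists i j, P i /\ ~ P j /\ is_edge F i j /\ v q <= v i.
Proof.
  intros HP Hq Ho.
  assert (Hmax : exists m, P m /\ v q <= v m /\ forall i, P i -> v i <= v m).
  { assert (Hex : forall L, (forall i, In i L -> P i) -> exists m, P m /\ v q <= v m /\ forall i, In i L -> v i <= v m).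
    { induction L as [|x L IH]; intros HLP.
      - exists q. repeat split; auto; [lra|]. intros i [].
      - destruct IH as (m & Pm & Hqm & Hm); [intros; apply HLP; now right|].
        destruct (Rle_lt_dec (v x) (v m)).
        + exists m. repeat split; auto. intros i [->|Hi]; auto.
        + exists x. repeat split; [apply HLP; now left|lra|]. intros i [->|Hi]; [lra|]. specialize (Hm i Hi). lra. }
    destruct (Hex Z) as (m & Pm & Hqm & Hm); [intros i Hi; now apply HP|].
    exists m. repeat split; auto. intros i Hi. apply Hm. now apply HP. }
  destruct Hmax as (m & Pm & Hqm & Hm).
  assert (Hpath : forall a b, edge_path F a b -> P a -> v a = v m -> ~ P b ->
    exists i j, P i /\ ~ P j /\ is_edge F i j /\ v q <= v i).
  { intros a b Hab. induction Hab as [a|a b c Hab Hbc IH]; intros Pa Ea Nc; [contradiction|].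
    destruct (classic (exists j, is_edge F a j /\ ~ P j)) as [(j & Hj & Nj)|Hin].
    { exists a, j. repeat split; auto. lra. }
    assert (Hall : forall j, is_edge F a j -> P j) by (intros j Hj; apply NNPP; intros N; apply Hin; eauto).
    apply IH; auto.
    assert (Hnn : forall j, is_edge F a j -> 0 <= A a j).
    { intros j Hj. pose proof (el_lo _ _ _ _ _ _ HL a j Hj) as H1. pose proof (el_hi _ _ _ _ _ _ HL a j Hj) as H2.
      pose proof (Hm j (Hall j Hj)) as H3. pose proof (el_c _ _ _ _ _ _ HL) as H4.
      destruct (Req_dec (v a) (v j)) as [E|E].
      - rewrite E, Rminus_diag, Rabs_R0, Rmult_0_r in H2. apply Rabs_le_between in H2. lra.
      - assert (0 < v a - v j) by lra. assert (0 <= c1 * (v a - v j) ^ 2) by (apply Rmult_le_pos; [lra|apply pow2_ge_0]). nra. }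
    pose proof HS as (_ & _ & _ & _ & Hfin & _). destruct (Hfin a) as [s Hs].
    set (s' := nodup (@eqdecV V) (b :: s)).
    assert (Hsum := el_sum _ _ _ _ _ _ HL a s' (NoDup_nodup _ _)).
    assert (Hs' : forall j k, F a j k -> In j s') by (intros j k Hf; apply nodup_In; right; eauto).
    specialize (Hsum Hs').
    assert (Hle : A a b <= lsum s' (fun j => A a j)).
    { apply (lsum_In_le s' (fun j => A a j)); [|apply nodup_In; now left].
      intros j _. destruct (classic (is_edge F a j)) as [Hj|Hj]; auto.
      rewrite (el_none _ _ _ _ _ _ HL a j Hj). lra. }
    pose proof (el_lo _ _ _ _ _ _ HL a b Hab) as H1. pose proof (Hnn b Hab).
    pose proof (Hm b (Hall b Hab)). pose proof (el_c _ _ _ _ _ _ HL).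
    assert (HA0 : A a b = 0) by lra. rewrite HA0 in H1.
    assert (0 <= (v a - v b) ^ 2) by apply pow2_ge_0.
    assert ((v a - v b) ^ 2 = 0) by nra. nra. }
  pose proof HS as (_ & _ & _ & _ & _ & _ & Hconn).
  exact (Hpath m o (Hconn m o) Pm eq_refl Ho).
Qed.

End Caccioppoli.

Definition circ (c : C) (t : R) : R -> C := fun th => (fst c + t * cos th, snd c + t * sin th).

Lemma dst_circ c t th : 0 <= t -> dst c (circ c t th) = t.
Proof.
  intros Ht. pose proof (dst_nonneg c (circ c t th)). pose proof (dst_sqr c (circ c t th)) as H1.
  pose proof (sin2_cos2 th) as H2. unfold Rsqr in H2. unfold circ in H1 at 2 3; simpl in H1.
  assert (dst c (circ c t th) * dst c (circ c t th) = t * t) by nra. nra.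
Qed.

Lemma on_circ c z t : 0 < t -> dst c z = t -> exists th, 0 <= th <= 2 * PI /\ z = circ c t th.
Proof.
  intros Ht Hd. destruct (polar c z) as (th & H1 & H2).
  - intros ->. rewrite dst_refl in Hd. lra.
  - exists th. split; [lra|]. rewrite dst_sym in H2. rewrite Hd in H2. exact H2.
Qed.

Lemma segment_crosses_circle (c p q : C) t : dst c p <= t -> t < dst c q ->
  exists s, 0 <= s <= 1 /\ dst c ((1 - s) * fst p + s * fst q, (1 - s) * snd p + s * snd q) = t.
Proof.
  intros Hp Hq. pose proof (dst_nonneg c p) as Hp0.
  set (g := fun s => ((1 - s) * fst p + s * fst q, (1 - s) * snd p + s * snd q) : C).
  set (f := fun s => t ^ 2 - ((fst c - fst (g s)) ^ 2 + (snd c - snd (g s)) ^ 2)).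
  assert (Ef : forall s, f s = t ^ 2 - dst c (g s) ^ 2) by (intros s; unfold f; now rewrite dst_sqr).
  assert (Hf : continuity f).
  { intros s. apply derivable_continuous_pt. unfold f, g; simpl. reg. }
  assert (G0 : g 0 = p) by (unfold g; rewrite (surjective_pairing p); simpl; f_equal; ring).
  assert (G1 : g 1 = q) by (unfold g; rewrite (surjective_pairing q); simpl; f_equal; ring).
  destruct (last_nonneg f 0 1 Hf Rlt_0_1) as (s & Hs & Hs0 & Hs1).
  - rewrite Ef, G0. nra.
  - rewrite Ef, G1. nra.
  - exists s. split; [lra|]. fold (g s). pose proof (dst_nonneg c (g s)).
    destruct (Rle_lt_dec (f s) 0) as [H0|H0].
    + rewrite Ef in *. assert (dst c (g s) ^ 2 = t ^ 2) by lra. nra.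
    + exfalso. destruct (continuity_pos_nbhd f s Hf H0) as (d & Hd & Hd').
      set (x := Rmin 1 (s + d / 2)).
      assert (Hx : s < x <= 1 /\ x - s < d) by (unfold x, Rmin; destruct (Rle_dec _ _); lra).
      specialize (Hs1 x ltac:(lra)). specialize (Hd' x). rewrite Rabs_pos_eq in Hd' by lra.
      specialize (Hd' ltac:(lra)). lra.
Qed.

(** * Triangles meeting a disc or a circle *)

Section Near.
Context {V : Type} (F : V -> V -> V -> Prop) (psi : V -> C) (kappa eps : R).
Hypothesis G : fat_triangulation F psi kappa eps.
Implicit Types (i j k m n p q : V) (Z : list V).

Notation B i j k z := (bc (psi i) (psi j) (psi k) z).
Notation T i j k z := (inT (psi i) (psi j) (psi k) z).
Notation len i j := (dst (psi i) (psi j)).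
Notation Cr := (reach_const kappa eps).

Let HS := te_surf _ _ _ _ G.
Let Fc i j k : F i j k -> F j k i := F_cyc F HS i j k.
Let Fs i j k : F i j k -> F j i k := F_swap12 F HS i j k.
Let Fr i j k : F i j k -> F i k j := F_swap23 F HS i j k.
Let Nz i j k : F i j k -> crs (psi i) (psi j) (psi k) <> 0 := area_nz F psi kappa eps G i j k.
Let Lp i j k : F i j k -> 0 < len i j := te_pos _ _ _ _ G i j k.
Let K0 : 0 < kappa := te_kappa _ _ _ _ G.

Lemma faces_reach3 q a b r i j k x : F q a b -> len q a <= r -> F i j k -> T i j k x ->
  dst (psi q) x <= r ->
  dst (psi q) (psi i) <= Cr * r /\ dst (psi q) (psi j) <= Cr * r /\ dst (psi q) (psi k) <= Cr * r.
Proof.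
  intros Hq Hl Hf HT Hx. repeat split.
  - exact (proj1 (faces_reach F psi kappa eps G q a b r i j k x Hq Hl Hf HT Hx)).
  - exact (proj1 (faces_reach F psi kappa eps G q a b r j k i x Hq Hl (Fc _ _ _ Hf) (inT_cyc _ _ _ _ HT) Hx)).
  - exact (proj1 (faces_reach F psi kappa eps G q a b r k i j x Hq Hl (Fc _ _ _ (Fc _ _ _ Hf))
      (inT_cyc _ _ _ _ (inT_cyc _ _ _ _ HT)) Hx)).
Qed.

Lemma star_reach3 q a b r i j k : F q a b -> len q a <= r -> F i j k -> dst (psi q) (psi i) <= r ->
  dst (psi q) (psi i) <= Cr * r /\ dst (psi q) (psi j) <= Cr * r /\ dst (psi q) (psi k) <= Cr * r.
Proof.
  intros Hq Hl Hf Hi. apply (faces_reach3 q a b r i j k (psi i)); auto. apply inT_vertex. auto.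
Qed.

Lemma inT_edge_point i j k s : F i j k -> 0 <= s <= 1 ->
  T i j k ((1 - s) * fst (psi i) + s * fst (psi j), (1 - s) * snd (psi i) + s * snd (psi j)).
Proof.
  intros Hf Hs.
  replace ((1 - s) * fst (psi i) + s * fst (psi j), (1 - s) * snd (psi i) + s * snd (psi j))
    with (pt3 (psi i) (psi j) (psi k) (1 - s) s 0) by (unfold pt3; f_equal; ring).
  destruct (bc_pt3 (psi i) (psi j) (psi k) (1 - s) s 0 (Nz _ _ _ Hf) ltac:(ring)) as (E1 & E2 & E3).
  unfold inT. rewrite E1, E2, E3. lra.
Qed.

Lemma vertex_fst_le i j k z : F i j k -> T i j k z ->
  (exists p, vtx p (i, j, k) /\ fst (psi p) <= fst z) /\ (exists p, vtx p (i, j, k) /\ fst z <= fst (psi p)).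
Proof.
  intros Hf (H1 & H2 & H3). pose proof (bc_fst _ _ _ (Nz _ _ _ Hf) z) as E.
  pose proof (bc_sum _ _ _ (Nz _ _ _ Hf) z) as S. unfold vtx; simpl.
  split; apply NNPP; intros Hno.
  - assert (A1 : fst z < fst (psi i)) by (apply Rnot_le_lt; intros H; apply Hno; eauto).
    assert (A2 : fst z < fst (psi j)) by (apply Rnot_le_lt; intros H; apply Hno; eauto).
    assert (A3 : fst z < fst (psi k)) by (apply Rnot_le_lt; intros H; apply Hno; eauto).
    assert (0 < B i j k z * (fst (psi i) - fst z) + B j k i z * (fst (psi j) - fst z) + B k i j z * (fst (psi k) - fst z));
      [|nra].
    destruct (Rlt_dec 0 (B i j k z)); [|destruct (Rlt_dec 0 (B j k i z))]; nra.
  - assert (A1 : fst z > fst (psi i)) by (apply Rnot_le_gt; intros H; apply Hno; eauto).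
    assert (A2 : fst z > fst (psi j)) by (apply Rnot_le_gt; intros H; apply Hno; eauto).
    assert (A3 : fst z > fst (psi k)) by (apply Rnot_le_gt; intros H; apply Hno; eauto).
    assert (0 < B i j k z * (fst z - fst (psi i)) + B j k i z * (fst z - fst (psi j)) + B k i j z * (fst z - fst (psi k)));
      [|nra].
    destruct (Rlt_dec 0 (B i j k z)); [|destruct (Rlt_dec 0 (B j k i z))]; nra.
Qed.

Lemma vertex_outside q i j k z t : F i j k -> T i j k z -> t < dst (psi q) z ->
  exists p, vtx p (i, j, k) /\ t < dst (psi q) (psi p).
Proof.
  intros Hf HT Hz. apply NNPP. intros Hno.
  assert (H : forall p, vtx p (i, j, k) -> dst (psi q) (psi p) <= t)
    by (intros p Hp; apply Rnot_lt_le; intros H; apply Hno; eauto).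
  assert (dst (psi q) z <= t); [|lra].
  apply (inT_dst_le (psi i) (psi j) (psi k)); auto; apply H; unfold vtx; simpl; auto.
Qed.

End Near.

Definition cutoff (c : C) (r : R) (z : C) : R := Rmax 0 (Rmin 1 (2 - dst c z / r)).

Lemma cutoff_facts c r : 0 < r ->
  (forall z, 0 <= cutoff c r z) /\ (forall z, dst c z <= r -> cutoff c r z = 1) /\
  (forall z, cutoff c r z <> 0 -> dst c z <= 2 * r) /\
  (forall z w, (cutoff c r z - cutoff c r w) ^ 2 <= dst z w ^ 2 / r ^ 2).
Proof.
  intros Hr.
  assert (Hdiv : forall x, x / r <= 1 <-> x <= r).
  { intros x. split; intros H.
    - apply Rmult_le_reg_r with (/ r); [now apply Rinv_0_lt_compat|]. rewrite Rinv_r by lra. exact H.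
    - apply Rmult_le_reg_r with r; auto. unfold Rdiv. rewrite Rmult_assoc, Rinv_l by lra. lra. }
  repeat split.
  - intros z. apply Rmax_l.
  - intros z Hz. apply Hdiv in Hz. unfold cutoff. rewrite Rmin_left by lra. apply Rmax_right. lra.
  - intros z Hz. apply Rnot_lt_le. intros H. apply Hz. unfold cutoff. apply Rmax_left.
    eapply Rle_trans; [apply Rmin_r|].
    assert (2 < dst c z / r); [|lra].
    apply Rmult_lt_reg_r with r; auto. unfold Rdiv. rewrite Rmult_assoc, Rinv_l by lra. lra.
  - intros z w. replace (dst z w ^ 2 / r ^ 2) with ((dst z w / r) ^ 2) by (field; lra).
    rewrite <- (pow2_abs (cutoff c r z - cutoff c r w)). apply pow_incr. split; [apply Rabs_pos|].
    assert (Hd : Rabs (dst c z / r - dst c w / r) <= dst z w / r).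
    { unfold Rdiv. rewrite <- Rmult_minus_distr_r, Rabs_mult, (Rabs_pos_eq (/ r)) by (left; now apply Rinv_0_lt_compat).
      apply Rmult_le_compat_r; [left; now apply Rinv_0_lt_compat|]. apply Rabs_le.
      pose proof (dst_tri c w z). pose proof (dst_tri c z w).
      rewrite (dst_sym w z) in *. lra. }
    eapply Rle_trans; [|exact Hd]. unfold cutoff.
    generalize (dst c z / r), (dst c w / r). intros s t.
    unfold Rmax, Rmin, Rabs. repeat destruct (Rle_dec _ _); repeat destruct (Rcase_abs _); lra.
Qed.

(** * The sup estimate by length-area on circles *)

Section SupEstimate.
Context {V : Type} (F : V -> V -> V -> Prop) (psi : V -> C) (kappa eps : R).
Context (v : V -> R) (A : V -> V -> R) (c1 C1 M : R).
Hypothesis G : fat_triangulation F psi kappa eps.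
Hypothesis HL : elliptic F v A c1 C1 M.
Implicit Types (i j k m n p : V).

Notation B i j k z := (bc (psi i) (psi j) (psi k) z).
Notation T i j k z := (inT (psi i) (psi j) (psi k) z).
Notation len i j := (dst (psi i) (psi j)).
Notation Cr := (reach_const kappa eps).
Notation y i := (exp (v i)).

Let HS := te_surf _ _ _ _ G.
Let Fc i j k : F i j k -> F j k i := F_cyc F HS i j k.
Let Fs i j k : F i j k -> F j i k := F_swap12 F HS i j k.
Let Fr i j k : F i j k -> F i k j := F_swap23 F HS i j k.
Let Lp i j k : F i j k -> 0 < len i j := te_pos _ _ _ _ G i j k.
Let K0 : 0 < kappa := te_kappa _ _ _ _ G.
Let Cr1 : 1 <= Cr := reach_const_ge1 F psi kappa eps G.

Context (q a b : V) (rho : R) (Z : list V).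
Hypothesis Hq : F q a b.
Hypothesis Hqa : len q a <= rho.
Hypothesis HN : NoDup Z.
Hypothesis HZ : forall i, In i Z <-> dst (psi q) (psi i) <= 4 * Cr ^ 2 * rho.
Hypothesis Hcov : forall z, dst (psi q) z <= 3 * rho -> exists i j k, F i j k /\ T i j k z.

Let Hrho : 0 < rho.
Proof. pose proof (Lp _ _ _ Hq). lra. Qed.

(** Triangles meeting the circles of radius at most [2 * rho] have their vertices within [R1]. The
    cutoff is 1 there and vanishes beyond [2 * R1], and the stars of its support stay within
    [Cr * (2 * R1)], the radius in [HZ]. *)
Let R1 := 2 * Cr * rho.

Let R1_ge : 2 * rho <= R1.
Proof. unfold R1. nra. Qed.

Let R2_ge : R1 <= 4 * Cr ^ 2 * rho.
Proof.
  unfold R1. apply Rmult_le_compat_r; [lra|]. nra.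
Qed.

Definition se_near (f : V * V * V) : Prop :=
  dst (psi q) (psi (fst (fst f))) <= R1 /\ dst (psi q) (psi (snd (fst f))) <= R1 /\ dst (psi q) (psi (snd f)) <= R1.

Lemma near_in_Tri i j k : F i j k -> se_near (i, j, k) -> In (i, j, k) (Tri F Z).
Proof. intros Hf (H1 & H2 & H3). simpl in *. apply in_Tri. repeat split; auto; apply HZ; lra. Qed.

Lemma meet_near i j k x : F i j k -> T i j k x -> dst (psi q) x <= 2 * rho -> se_near (i, j, k).
Proof.
  intros Hf HT Hx. unfold se_near; simpl. unfold R1.
  replace (2 * Cr * rho) with (Cr * (2 * rho)) by ring.
  apply (faces_reach3 F psi kappa eps G q a b (2 * rho) i j k x); auto. lra.
Qed.

(** The second term is a length weighted by [y]; it takes over on circles where [y] varies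
    little. *)
Definition se_weight (f : V * V * V) : R :=
  ftri (fun i => y i) f + len (fst (fst f)) (snd (fst f)) * y (fst (fst f)) / (kappa * rho).

(** By the maximum principle some edge crossing the circle has an end with [y] at least [y q]. If a
    triangle on the circle has a vertex with [y] below [y q / 2], the oscillation of [y] along the
    circle is at least [y q / 2]. Otherwise [y] is at least [y q / 2] on all these triangles, and
    their lengths add up to a fixed multiple of the diameter. *)
Lemma circle_estimate t : rho <= t <= 2 * rho ->
  y q / 2 <= lsum (Tri F Z) (fun f => ind (exists th, 0 <= th <= 2 * PI /\ inF psi f (circ (psi q) t th)) * se_weight f).
Proof.
  intros Ht. pose proof PI_RGT_0 as Hpi.
  set (Lt := Tri F Z).
  assert (HLt : forall f, In f Lt -> F (fst (fst f)) (snd (fst f)) (snd f)).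
  { intros [[i j] k] Hf. apply in_Tri in Hf. tauto. }
  assert (Hg : cpath (circ (psi q) t)) by apply cpath_circle.
  assert (Hcv : forall th, 0 <= th <= 2 * PI -> exists f, In f Lt /\ inF psi f (circ (psi q) t th)).
  { intros th _. assert (Hd := dst_circ (psi q) t th ltac:(lra)).
    destruct (Hcov (circ (psi q) t th)) as (i & j & k & Hf & HT); [lra|].
    exists (i, j, k). split; auto. apply near_in_Tri; auto. apply (meet_near i j k (circ (psi q) t th)); auto. lra. }
  assert (Hmeet : forall i j k x, F i j k -> T i j k x -> dst (psi q) x = t ->
     In (i, j, k) Lt /\ exists th, 0 <= th <= 2 * PI /\ inF psi (i, j, k) (circ (psi q) t th)).
  { intros i j k x Hf HT Hx. split.
    - apply near_in_Tri; auto. apply (meet_near i j k x); auto. lra.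
    - destruct (on_circ (psi q) x t ltac:(lra) Hx) as (th & H1 & ->). exists th. auto. }
  set (Zt := filter (fun i => if Rle_dec (dst (psi q) (psi i)) t then true else false) Z).
  assert (HZt : forall i, dst (psi q) (psi i) <= t <-> In i Zt).
  { intros i. unfold Zt. rewrite filter_In. destruct (Rle_dec (dst (psi q) (psi i)) t) as [H|H].
    - split; auto. intros _. split; auto. apply HZ. lra.
    - split; [tauto|]. intros [_ H']. discriminate. }
  assert (exists o, t < dst (psi q) (psi o)) as [o Ho].
  { assert (Hd := dst_circ (psi q) (3 * rho) 0 ltac:(lra)).
    destruct (Hcov (circ (psi q) (3 * rho) 0)) as (i & j & k & Hf & HT); [lra|].
    destruct (vertex_outside F psi kappa eps G q i j k (circ (psi q) (3 * rho) 0) t Hf HT) as (p & _ & Hp); [lra|eauto]. }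
  destruct (maximum_principle F v A c1 C1 M HS HL Zt (fun i => dst (psi q) (psi i) <= t) q o HZt) as (i0 & j0 & Hi0 & Hj0 & [k0 Hf0] & Hv0).
  { rewrite dst_refl. lra. }
  { lra. }
  assert (Hy0 : y q <= y i0).
  { destruct Hv0 as [H|H]; [left; now apply exp_increasing|rewrite H; lra]. }
  destruct (segment_crosses_circle (psi q) (psi i0) (psi j0) t Hi0 ltac:(lra)) as (s & Hs & Es).
  destruct (Hmeet i0 j0 k0 _ Hf0 (inT_edge_point F psi kappa eps G i0 j0 k0 s Hf0 Hs) Es) as [Hin0 (th0 & Hth0 & HT0)].
  pose proof (exp_pos (v q)) as Hyq.
  set (mt := fun f => exists th, 0 <= th <= 2 * PI /\ inF psi f (circ (psi q) t th)).
  assert (Hft : forall (h : V -> R) f, 0 <= ftri h f).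
  { intros h f. unfold ftri. pose proof (Rabs_pos (h (fst (fst f)) - h (snd (fst f)))).
    pose proof (Rabs_pos (h (fst (fst f)) - h (snd f))). lra. }
  assert (Hl2 : forall f : V * V * V, 0 <= len (fst (fst f)) (snd (fst f)) * y (fst (fst f)) / (kappa * rho)).
  { intros f. apply Rmult_le_pos; [apply Rmult_le_pos; [apply dst_nonneg|left; apply exp_pos]|].
    left. apply Rinv_0_lt_compat. nra. }
  destruct (classic (exists f p, In f Lt /\ mt f /\ vtx p f /\ y p < y q / 2)) as [(f & p & Hf & (th & Hth & HT) & Hp & Hlow)|Hno].
  - pose proof (path_oscillation F psi kappa eps G Lt (circ (psi q) t) 0 (2 * PI) (fun i => y i) Hg HLt Hcv
      f (i0, j0, k0) th th0 p i0 Hf Hin0 Hth Hth0 HT HT0 Hp) as H.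
    specialize (H ltac:(unfold vtx; simpl; auto)).
    change (y i0 - y p <= lsum Lt (fun f => ind (mt f) * ftri (fun i => y i) f)) in H.
    apply Rle_trans with (lsum Lt (fun f => ind (mt f) * ftri (fun i => y i) f)); [lra|].
    apply lsum_le. intros g _. fold (mt g). unfold se_weight. specialize (Hl2 g).
    apply Rmult_le_compat_l; [apply ind_bounds|lra].
  - assert (Hge : forall f p, In f Lt -> mt f -> vtx p f -> y q / 2 <= y p).
    { intros f p Hf Hm Hp. apply Rnot_lt_le. intros H. apply Hno. exists f, p. auto. }
    (* The diameter is measured by the first coordinate, between the leftmost and rightmost points
       of the circle. *)
    destruct (Hcv PI) as (f1 & Hf1 & HT1); [lra|]. destruct (Hcv 0) as (f2 & Hf2 & HT2); [lra|].
    assert (Hw1 : exists p, vtx p f1 /\ fst (psi p) <= fst (psi q) - t).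
    { destruct f1 as [[i j] k]. destruct (vertex_fst_le F psi kappa eps G i j k _ (HLt _ Hf1) HT1) as [(p & Hp & Hp') _].
      exists p. split; auto. unfold circ in Hp'; simpl in Hp'. rewrite cos_PI in Hp'. lra. }
    assert (Hw2 : exists p, vtx p f2 /\ fst (psi q) + t <= fst (psi p)).
    { destruct f2 as [[i j] k]. destruct (vertex_fst_le F psi kappa eps G i j k _ (HLt _ Hf2) HT2) as [_ (p & Hp & Hp')].
      exists p. split; auto. unfold circ in Hp'; simpl in Hp'. rewrite cos_0 in Hp'. lra. }
    destruct Hw1 as (p1 & Hp1 & Hx1). destruct Hw2 as (p2 & Hp2 & Hx2).
    pose proof (path_oscillation F psi kappa eps G Lt (circ (psi q) t) 0 (2 * PI) (fun i => fst (psi i)) Hg HLt Hcv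
      f1 f2 PI 0 p1 p2 Hf1 Hf2 ltac:(lra) ltac:(lra) HT1 HT2 Hp1 Hp2) as H.
    change (fst (psi p2) - fst (psi p1) <= lsum Lt (fun f => ind (mt f) * ftri (fun i => fst (psi i)) f)) in H.
    assert (H' : y q / 2 * (2 * t) <= y q / 2 * lsum Lt (fun f => ind (mt f) * ftri (fun i => fst (psi i)) f)).
    { apply Rmult_le_compat_l; lra. }
    rewrite <- lsum_scal in H'.
    apply Rmult_le_reg_l with (2 * rho); [lra|].
    apply Rle_trans with (y q / 2 * (2 * t)); [nra|]. apply Rle_trans with (1 := H').
    rewrite <- lsum_scal. apply lsum_le. intros f Hf.
    fold (mt f). destruct (classic (mt f)) as [Hm|Hm]; [|rewrite (ind_false _ Hm); lra].
    rewrite (ind_true _ Hm). rewrite !Rmult_1_l. unfold se_weight.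
    specialize (HLt f Hf). specialize (Hge f (fst (fst f)) Hf Hm ltac:(unfold vtx; auto)).
    destruct f as [[i j] k]; simpl in *. specialize (Hft (fun i => y i) (i, j, k)).
    assert (K1 : kappa <= 1) by (eapply kappa_le1; eauto).
    assert (Hfl : kappa * ftri (fun i => fst (psi i)) (i, j, k) <= 2 * len i j).
    { unfold ftri; simpl. pose proof (dst_fst (psi i) (psi j)). pose proof (dst_fst (psi i) (psi k)).
      pose proof (len_ratio F psi kappa eps G i k j (Fr _ _ _ HLt)).
      pose proof (dst_nonneg (psi i) (psi j)).
      assert (kappa * Rabs (fst (psi i) - fst (psi j)) <= 1 * len i j).
      { apply Rmult_le_compat; try lra. apply Rabs_pos. }
      assert (kappa * Rabs (fst (psi i) - fst (psi k)) <= kappa * len i k) by (apply Rmult_le_compat_l; lra). lra. }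
    assert (Hl : ftri (fun i => fst (psi i)) (i, j, k) <= 2 * len i j / kappa).
    { apply Rmult_le_reg_l with kappa; auto. replace (kappa * (2 * len i j / kappa)) with (2 * len i j) by (field; lra). auto. }
    assert (E : 2 * rho * (len i j * y i / (kappa * rho)) = 2 * len i j / kappa * y i) by (field; lra).
    rewrite Rmult_plus_distr_l, E.
    assert (0 <= 2 * rho * ftri (fun i => y i) (i, j, k)) by (apply Rmult_le_pos; lra).
    assert (y q / 2 * ftri (fun i => fst (psi i)) (i, j, k) <= y i * (2 * len i j / kappa)); [|lra].
    apply Rmult_le_compat; auto; [lra|]. apply Rplus_le_le_0_compat; apply Rabs_pos.
Qed.

Definition se_sum : R := lsum (Tri F Z) (fun f => len (fst (fst f)) (snd (fst f)) ^ 2 * y (fst (fst f)) ^ 2).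

Let se_eta i : R := cutoff (psi q) R1 (psi i).

(** On an edge the oscillation of [exp v] is at most [exp M * |v i - v j|] times the value at one
    end, so the Caccioppoli inequality with a cutoff equal to 1 within [R1] applies. *)
Lemma near_energy :
  lsum (Tri F Z) (fun f => ind (se_near f) * ftri (fun i => y i) f ^ 2) <=
  8 * exp M ^ 2 * (cacc0 c1 C1 M) ^ 2 / R1 ^ 2 * se_sum.
Proof.
  destruct (cutoff_facts (psi q) R1 ltac:(lra)) as (E0' & E1' & E2' & E3').
  assert (E0 : forall i, 0 <= se_eta i) by (intros; apply E0').
  assert (E1 : forall i, dst (psi q) (psi i) <= R1 -> se_eta i = 1) by (intros; now apply E1').
  assert (E2 : forall i, se_eta i <> 0 -> dst (psi q) (psi i) <= 2 * R1) by (intros; now apply E2').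
  assert (E3 : forall i j, (se_eta i - se_eta j) ^ 2 <= len i j ^ 2 / R1 ^ 2) by (intros; apply E3').
  assert (HR1 : 0 < R1) by lra. assert (HR1' : 0 < / R1 ^ 2) by (apply Rinv_0_lt_compat, pow_lt; auto).
  assert (Hsup : forall i, se_eta i <> 0 -> forall j k, F i j k -> In j Z).
  { intros i Hi j k Hf. apply HZ. apply E2 in Hi.
    replace (4 * Cr ^ 2 * rho) with (Cr * (2 * R1)) by (unfold R1; ring).
    apply (star_reach3 F psi kappa eps G q a b (2 * R1) i j k); auto. lra. }
  pose proof (caccioppoli F v A c1 C1 M HL Z se_eta HN E0 Hsup) as Hc.
  set (K := cacc0 c1 C1 M) in *.
  assert (Hrhs : esum F Z (fun i j => (se_eta i - se_eta j) ^ 2 * y i ^ 2) <= / R1 ^ 2 * se_sum).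
  { unfold se_sum. rewrite <- lsum_scal.
    apply (esum_le_Tri F Z _ (fun i j => / R1 ^ 2 * (len i j ^ 2 * y i ^ 2))).
    - intros i j. apply Rmult_le_pos; [lra|]. apply Rmult_le_pos; apply pow2_ge_0.
    - intros i j Hi Hj [k Hk]. destruct (Req_dec (se_eta i - se_eta j) 0) as [E|E].
      + left. rewrite E. lra.
      + right. split.
        * exists k. split; auto. destruct (Req_dec (se_eta i) 0) as [Ei|Ei].
          -- apply (Hsup j) with (k := i); [intros Ej; apply E; lra|auto].
          -- apply (Hsup i) with (k := j); auto.
        * specialize (E3 i j). replace (/ R1 ^ 2 * (len i j ^ 2 * y i ^ 2)) with (len i j ^ 2 / R1 ^ 2 * y i ^ 2) by (unfold Rdiv; ring).
          apply Rmult_le_compat_r; auto. apply pow2_ge_0. }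
  set (N1 := fun i => dst (psi q) (psi i) <= R1).
  set (g := fun i j => ind (N1 i) * ind (N1 j) * ((v i - v j) ^ 2 * y i ^ 2)).
  assert (Hg0 : forall i j, 0 <= g i j).
  { intros i j. unfold g. pose proof (ind_bounds (N1 i)). pose proof (ind_bounds (N1 j)).
    apply Rmult_le_pos; [nra|]. apply Rmult_le_pos; apply pow2_ge_0. }
  assert (Hlhs : 2 * esum F Z g <= esum F Z (fun i j => (v i - v j) ^ 2 * (se_eta i ^ 2 + se_eta j ^ 2) * y i ^ 2)).
  { rewrite <- esum_scal. apply esum_le. intros i j _ _ _. unfold g.
    assert (P : 0 <= (v i - v j) ^ 2 * y i ^ 2) by (apply Rmult_le_pos; apply pow2_ge_0).
    assert (P2 : 0 <= se_eta i ^ 2 + se_eta j ^ 2) by (apply Rplus_le_le_0_compat; apply pow2_ge_0).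
    replace ((v i - v j) ^ 2 * (se_eta i ^ 2 + se_eta j ^ 2) * y i ^ 2)
      with ((se_eta i ^ 2 + se_eta j ^ 2) * ((v i - v j) ^ 2 * y i ^ 2)) by ring.
    rewrite <- Rmult_assoc. apply Rmult_le_compat_r; auto.
    destruct (classic (N1 i)) as [Hi|Hi]; [|rewrite (ind_false _ Hi); lra].
    destruct (classic (N1 j)) as [Hj|Hj]; [|rewrite (ind_false _ Hj); lra].
    rewrite (E1 i Hi), (E1 j Hj), !ind_true by auto. lra. }
  pose proof (Tri_le_esum F HS Z g HN Hg0) as T1.
  assert (T2 : lsum (Tri F Z) (fun f => g (fst (fst f)) (snd f)) <= 2 * esum F Z g).
  { eapply Rle_trans; [|exact T1]. right.
    rewrite (lsum_Tri_swap F HS Z (fun f => g (fst (fst f)) (snd f))). reflexivity. }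
  pose proof (exp_pos M) as HM.
  apply Rle_trans with (2 * exp M ^ 2 * (lsum (Tri F Z) (fun f => g (fst (fst f)) (snd (fst f))) +
     lsum (Tri F Z) (fun f => g (fst (fst f)) (snd f)))).
  - rewrite <- lsum_plus, <- lsum_scal. apply lsum_le. intros [[i j] k] Hf. simpl.
    apply in_Tri in Hf. destruct Hf as [Hf _].
    assert (Hosc : forall j, is_edge F i j -> Rabs (y i - y j) <= exp M * Rabs (v i - v j) * y i).
    { intros j' Hj'. pose proof (el_M _ _ _ _ _ _ HL i j' Hj') as Hd.
      rewrite Rabs_minus_sym in Hd. destruct (exp_diff_bounds (v j' - v i) M Hd) as [_ Hx].
      replace (y i - y j') with (- ((exp (v j' - v i) - 1) * y i)).
      - rewrite Rabs_Ropp, Rabs_mult, (Rabs_pos_eq (y i)) by (left; apply exp_pos).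
        apply Rmult_le_compat_r; [left; apply exp_pos|]. rewrite (Rabs_minus_sym (v i)). auto.
      - rewrite Rmult_minus_distr_r, <- exp_plus. replace (v j' - v i + v i) with (v j') by ring. ring. }
    destruct (classic (se_near (i, j, k))) as [Hn|Hn].
    + rewrite (ind_true _ Hn), Rmult_1_l. destruct Hn as (n1 & n2 & n3). simpl in n1, n2, n3.
      unfold g. rewrite !ind_true by auto. unfold ftri; simpl fst; simpl snd.
      pose proof (Hosc j (ex_intro _ k Hf)) as O1. pose proof (Hosc k (ex_intro _ j (Fr _ _ _ Hf))) as O2.
      pose proof (Rabs_pos (y i - y j)) as O3. pose proof (Rabs_pos (y i - y k)) as O4.
      rewrite <- (pow2_abs (v i - v j)), <- (pow2_abs (v i - v k)).
      set (s1 := Rabs (y i - y j)) in *. set (s2 := Rabs (y i - y k)) in *.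
      set (d1 := Rabs (v i - v j)) in *. set (d2 := Rabs (v i - v k)) in *.
      assert (Q1 : s1 ^ 2 <= (exp M * d1 * y i) ^ 2) by (apply pow_incr; lra).
      assert (Q2 : s2 ^ 2 <= (exp M * d2 * y i) ^ 2) by (apply pow_incr; lra).
      assert (0 <= (s1 - s2) ^ 2) by apply pow2_ge_0. nra.
    + rewrite (ind_false _ Hn), Rmult_0_l. apply Rmult_le_pos.
      * apply Rmult_le_pos; [lra|apply pow2_ge_0].
      * pose proof (Hg0 i j). pose proof (Hg0 i k). lra.
  - assert (0 < exp M ^ 2) by now apply pow_lt.
    assert (HX : lsum (Tri F Z) (fun f => g (fst (fst f)) (snd (fst f))) +
      lsum (Tri F Z) (fun f => g (fst (fst f)) (snd f)) <= 4 * (K ^ 2 * (/ R1 ^ 2 * se_sum))).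
    { assert (0 <= K ^ 2) by apply pow2_ge_0.
      assert (K ^ 2 * esum F Z (fun i j => (se_eta i - se_eta j) ^ 2 * y i ^ 2) <= K ^ 2 * (/ R1 ^ 2 * se_sum))
        by (apply Rmult_le_compat_l; auto). lra. }
    apply Rle_trans with (2 * exp M ^ 2 * (4 * (K ^ 2 * (/ R1 ^ 2 * se_sum)))).
    + apply Rmult_le_compat_l; lra.
    + right. field. lra.
Qed.

Definition sup_const : R :=
  16 * (6400 / kappa ^ 6 * 4 * Cr ^ 2) * (4 * exp M ^ 2 * (cacc0 c1 C1 M) ^ 2 / Cr ^ 2 + 2 / kappa ^ 2) / kappa ^ 2.

(** Integrate [circle_estimate] over [rho < t < 2 * rho]. A triangle meets only circles whose radius
    differs from the distance to its first vertex by at most its length over [kappa]. The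
    Cauchy-Schwarz inequality then separates the energy of [y] from the area of the disc, which
    [packing] bounds. *)
Lemma sup_estimate : y q ^ 2 <= sup_const / rho ^ 2 * se_sum.
Proof.
  set (o := fun f => ind (se_near f) * se_weight f).
  set (n := fun f => ind (se_near f) * len (fst (fst f)) (snd (fst f))).
  assert (Hlen0 : forall f : V * V * V, 0 <= len (fst (fst f)) (snd (fst f))) by (intros; apply dst_nonneg).
  assert (Hw0 : forall f, 0 <= se_weight f).
  { intros f. unfold se_weight, ftri. specialize (Hlen0 f).
    assert (0 <= len (fst (fst f)) (snd (fst f)) * y (fst (fst f)) / (kappa * rho)).
    { apply Rmult_le_pos; [apply Rmult_le_pos; auto; left; apply exp_pos|]. left. apply Rinv_0_lt_compat. nra. }
    pose proof (Rabs_pos (y (fst (fst f)) - y (snd (fst f)))). pose proof (Rabs_pos (y (fst (fst f)) - y (snd f))). lra. }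
  assert (Hint : y q / 2 * (2 * rho - rho) <=
    lsum (Tri F Z) (fun f => o f * ((dst (psi q) (psi (fst (fst f))) + len (fst (fst f)) (snd (fst f)) / kappa)
       - (dst (psi q) (psi (fst (fst f))) - len (fst (fst f)) (snd (fst f)) / kappa)))).
  { apply weighted_intervals_low; [lra| | |].
    - intros f _. unfold o. apply Rmult_le_pos; auto. apply ind_bounds.
    - intros f _. specialize (Hlen0 f).
      assert (0 <= len (fst (fst f)) (snd (fst f)) / kappa) by (apply Rmult_le_pos; auto; left; now apply Rinv_0_lt_compat). lra.
    - intros t Ht. eapply Rle_trans; [apply (circle_estimate t); lra|].
      apply lsum_le. intros [[i j] k] Hf. apply in_Tri in Hf. destruct Hf as [Hf _].
      destruct (classic (exists th, 0 <= th <= 2 * PI /\ inF psi (i, j, k) (circ (psi q) t th))) as [Hm|Hm].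
      + rewrite (ind_true _ Hm). destruct Hm as (th & Hth & HT). unfold inF in HT; simpl in HT.
        assert (Hd := dst_circ (psi q) t th ltac:(lra)). set (x := circ (psi q) t th) in *.
        pose proof (triangle_point_dst F psi kappa eps G i j k x Hf HT) as Hx.
        assert (Hn : se_near (i, j, k)) by (apply (meet_near i j k x); auto; lra).
        unfold o. rewrite (ind_true _ Hn). simpl fst; simpl snd.
        rewrite ind_true; [lra|].
        pose proof (dst_tri (psi q) (psi i) x). pose proof (dst_tri (psi q) x (psi i)).
        rewrite (dst_sym x) in *. lra.
      + rewrite (ind_false _ Hm). rewrite Rmult_0_l. apply Rmult_le_pos; [apply ind_bounds|].
        unfold o. apply Rmult_le_pos; auto. apply ind_bounds. }
  assert (Hint' : y q * rho * kappa / 4 <= lsum (Tri F Z) (fun f => o f * n f)).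
  { apply Rmult_le_reg_l with (2 / kappa); [apply Rdiv_lt_0_compat; lra|].
    apply Rle_trans with (y q / 2 * (2 * rho - rho)); [right; field; lra|].
    apply Rle_trans with (1 := Hint). rewrite <- lsum_scal. right. apply lsum_ext. intros f _.
    unfold o, n. unfold ind. destruct (excluded_middle_informative (se_near f)); field; lra. }
  pose proof (lsum_CS (Tri F Z) o n) as HCS.
  set (L1 := filter (fun f => if excluded_middle_informative (se_near f) then true else false) (Tri F Z)).
  assert (Hn2 : lsum (Tri F Z) (fun f => n f ^ 2) <= 6400 / kappa ^ 6 * R1 ^ 2).
  { apply Rle_trans with (lsum L1 (fun f => len (fst (fst f)) (snd (fst f)) ^ 2)).
    - unfold L1. rewrite lsum_filter. apply lsum_le. intros f _. unfold n, ind.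
      destruct (excluded_middle_informative (se_near f)); right; ring.
    - apply (packing F psi kappa eps G L1 (psi q) R1); [apply NoDup_filter, NoDup_Tri; auto|lra|].
      intros i j k Hf. unfold L1 in Hf. apply filter_In in Hf. destruct Hf as [Hf Hn].
      apply in_Tri in Hf. destruct (excluded_middle_informative (se_near (i, j, k))) as [(N1 & N2 & N3)|]; [|discriminate].
      repeat split; auto. tauto. }
  assert (HS0 : 0 <= se_sum).
  { apply lsum_nonneg. intros. apply Rmult_le_pos; apply pow2_ge_0. }
  assert (Ho2 : lsum (Tri F Z) (fun f => o f ^ 2) <=
     2 * (8 * exp M ^ 2 * (cacc0 c1 C1 M) ^ 2 / R1 ^ 2 * se_sum) + 2 / (kappa * rho) ^ 2 * se_sum).
  { eapply Rle_trans; [|apply Rplus_le_compat_r, Rmult_le_compat_l, near_energy; lra].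
    unfold se_sum. rewrite <- !lsum_scal, <- lsum_plus. apply lsum_le. intros f _.
    unfold o. assert (Hii : ind (se_near f) ^ 2 = ind (se_near f)) by (unfold ind; destruct (excluded_middle_informative _); ring).
    rewrite Rpow_mult_distr, Hii. unfold se_weight.
    set (x := ftri (fun i => y i) f). set (l := len (fst (fst f)) (snd (fst f))). set (yy := y (fst (fst f))).
    replace (2 / (kappa * rho) ^ 2 * (l ^ 2 * yy ^ 2)) with (2 * (l * yy / (kappa * rho)) ^ 2) by (field; lra).
    set (w := l * yy / (kappa * rho)).
    pose proof (ind_bounds (se_near f)). set (e := ind (se_near f)) in *.
    assert (0 <= (x - w) ^ 2) by apply pow2_ge_0. assert (0 <= w ^ 2) by apply pow2_ge_0.
    assert (e * (x + w) ^ 2 <= e * (2 * x ^ 2 + 2 * w ^ 2)) by (apply Rmult_le_compat_l; nra).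
    assert (e * (2 * w ^ 2) <= 1 * (2 * w ^ 2)) by (apply Rmult_le_compat_r; nra). lra. }
  assert (Hsq : (y q * rho * kappa / 4) ^ 2 <= lsum (Tri F Z) (fun f => o f * n f) ^ 2).
  { apply pow_incr. split; auto. pose proof (exp_pos (v q)). assert (0 < y q * rho * kappa) by (apply Rmult_lt_0_compat; nra). lra. }
  assert (HR1 : 0 < R1) by lra.
  assert (P6 : 0 < 6400 / kappa ^ 6) by (apply Rdiv_lt_0_compat; [lra|now apply pow_lt]).
  set (Bo := 2 * (8 * exp M ^ 2 * (cacc0 c1 C1 M) ^ 2 / R1 ^ 2 * se_sum) + 2 / (kappa * rho) ^ 2 * se_sum) in *.
  assert (Hall : (y q * rho * kappa / 4) ^ 2 <= Bo * (6400 / kappa ^ 6 * R1 ^ 2)).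
  { eapply Rle_trans; [exact Hsq|]. eapply Rle_trans; [exact HCS|].
    apply Rmult_le_compat; auto; apply lsum_nonneg; intros; apply pow2_ge_0. }
  apply Rmult_le_reg_l with ((rho * kappa / 4) ^ 2); [apply pow_lt; nra|].
  replace ((rho * kappa / 4) ^ 2 * y q ^ 2) with ((y q * rho * kappa / 4) ^ 2) by field.
  eapply Rle_trans; [exact Hall|]. right. unfold Bo, sup_const, R1. field.
  repeat split; lra.
Qed.

End SupEstimate.

(** * Distortion of discs *)

Inductive conn {V : Type} (F : V -> V -> V -> Prop) (P : V -> Prop) (o : V) : V -> Prop :=
| conn_refl : P o -> conn F P o o
| conn_step : forall i j, conn F P o i -> is_edge F i j -> P j -> conn F P o j.

Lemma conn_holds {V : Type} (F : V -> V -> V -> Prop) P o i : conn F P o i -> P i.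
Proof. now destruct 1. Qed.

Lemma list_argmax {A : Type} (f : A -> R) (L : list A) : L <> nil ->
  exists x, In x L /\ forall y, In y L -> f y <= f x.
Proof.
  induction L as [|a L IH]; intros H; [contradiction|].
  destruct L as [|b L].
  - exists a. split; [now left|]. intros y [->|[]]. lra.
  - destruct IH as (x & Hx & Hm); [discriminate|]. destruct (Rle_lt_dec (f a) (f x)).
    + exists x. split; [now right|]. intros y [->|Hy]; auto.
    + exists a. split; [now left|]. intros y [->|Hy]; [lra|]. specialize (Hm y Hy). lra.
Qed.

Section Outward.
Context {V : Type} (F : V -> V -> V -> Prop) (psi : V -> C) (kappa eps : R).
Hypothesis G : fat_triangulation F psi kappa eps.

(** Reflect [psi o] in [psi i] and take the sector at [i] that contains the reflected point. One of
    its two sides makes an acute angle with the outward direction, so its end is farther from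
    [psi o]. *)
Lemma outward_neighbor (o i : V) : exists j, is_edge F i j /\ dst (psi o) (psi i) < dst (psi o) (psi j).
Proof.
  pose proof (te_surf _ _ _ _ G) as HS.
  destruct (classic (psi i = psi o)) as [E|E].
  - pose proof HS as (_ & _ & Hv & _). destruct (Hv i) as (j & k & Hf). exists j. split; [now exists k|].
    rewrite E, dst_refl. rewrite <- E. now apply (te_pos _ _ _ _ G i j k).
  - set (z := (2 * fst (psi i) - fst (psi o), 2 * snd (psi i) - snd (psi o)) : C).
    destruct (sector_cover F psi kappa eps G i z) as (j & k & Hf & Hj & Hk).
    assert (N := area_nz F psi kappa eps G i j k Hf).
    pose proof (bc_fst _ _ _ N z) as Ex. pose proof (bc_snd _ _ _ N z) as Ey.
    pose proof (bc_sum _ _ _ N z) as Es.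
    set (b1 := bc (psi j) (psi k) (psi i) z) in *. set (b2 := bc (psi k) (psi i) (psi j) z) in *.
    set (b0 := bc (psi i) (psi j) (psi k) z) in *. unfold z in Ex, Ey; simpl in Ex, Ey.
    set (dx := fst (psi i) - fst (psi o)). set (dy := snd (psi i) - snd (psi o)).
    assert (Hd : 0 < dx ^ 2 + dy ^ 2).
    { pose proof (dst_pos _ _ E) as H. pose proof (dst_sqr (psi i) (psi o)) as H1. fold dx dy in H1.
      rewrite <- H1. now apply pow_lt. }
    set (d1 := (fst (psi j) - fst (psi i)) * dx + (snd (psi j) - snd (psi i)) * dy).
    set (d2 := (fst (psi k) - fst (psi i)) * dx + (snd (psi k) - snd (psi i)) * dy).
    assert (Hsum : dx ^ 2 + dy ^ 2 = b1 * d1 + b2 * d2).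
    { unfold d1, d2.
      replace (b1 * _ + b2 * _) with
       ((b1 * fst (psi j) + b2 * fst (psi k) - (b1 + b2) * fst (psi i)) * dx +
        (b1 * snd (psi j) + b2 * snd (psi k) - (b1 + b2) * snd (psi i)) * dy) by ring.
      replace (b1 * fst (psi j) + b2 * fst (psi k) - (b1 + b2) * fst (psi i)) with dx
        by (unfold dx; replace (b1 + b2) with (1 - b0) by lra; lra).
      replace (b1 * snd (psi j) + b2 * snd (psi k) - (b1 + b2) * snd (psi i)) with dy
        by (unfold dy; replace (b1 + b2) with (1 - b0) by lra; lra).
      ring. }
    assert (Hgo : forall m, 0 < (fst (psi m) - fst (psi i)) * dx + (snd (psi m) - snd (psi i)) * dy ->
       dst (psi o) (psi i) < dst (psi o) (psi m)).
    { intros m Hm. pose proof (dst_nonneg (psi o) (psi i)). pose proof (dst_nonneg (psi o) (psi m)).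
      pose proof (dst_sqr (psi o) (psi i)) as H1. pose proof (dst_sqr (psi o) (psi m)) as H2.
      assert (dst (psi o) (psi i) ^ 2 < dst (psi o) (psi m) ^ 2); [|nra].
      rewrite H1, H2. unfold dx, dy in Hm.
      pose proof (pow2_ge_0 (fst (psi m) - fst (psi i))). pose proof (pow2_ge_0 (snd (psi m) - snd (psi i))). nra. }
    destruct (Rlt_dec 0 d1) as [H1|H1]; [exists j; split; [now exists k|now apply Hgo]|].
    destruct (Rlt_dec 0 d2) as [H2|H2].
    + exists k. split; [exists j; now apply (F_swap23 F HS)|now apply Hgo].
    + exfalso. nra.
Qed.

End Outward.

(** * Length-area estimate for shells of the image *)

Section Modulus.
Context {V : Type} (F : V -> V -> V -> Prop) (psi psi' : V -> C) (kappa eps : R).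
Hypothesis G : fat_triangulation F psi kappa eps.
Hypothesis G' : fat_triangulation F psi' kappa eps.
Hypothesis Hcov : forall z, exists i j k, F i j k /\ inT (psi i) (psi j) (psi k) z.
Implicit Types (i j k p : V).

Notation T i j k z := (inT (psi i) (psi j) (psi k) z).
Notation len i j := (dst (psi i) (psi j)).
Notation len' i j := (dst (psi' i) (psi' j)).
Notation Cr := (reach_const kappa eps).

Let HS := te_surf _ _ _ _ G.
Let Fc i j k : F i j k -> F j k i := F_cyc F HS i j k.
Let Fs i j k : F i j k -> F j i k := F_swap12 F HS i j k.
Let Fr i j k : F i j k -> F i k j := F_swap23 F HS i j k.
Let K0 : 0 < kappa := te_kappa _ _ _ _ G.
Let Cr1 : 1 <= Cr := reach_const_ge1 F psi kappa eps G.

(** Bounds, by [shell_step], the growth over one face of the image distance to [o]. *)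
Definition shell_ratio : R := 2 + star_const kappa eps + / sep_const kappa eps.

Context (o oa ob q2 : V) (r a0 : R) (N : nat) (Z : list V).
Hypothesis Ho : F o oa ob.
Hypothesis Hr : len o oa <= r.
Hypothesis Ha0 : len' o oa <= a0.
Hypothesis HN : NoDup Z.
Hypothesis HZ : forall i, In i Z <-> len o i <= Cr * (3 * r).
Hypothesis Hconn : exists i, conn F (fun i => len' o i <= a0) o i /\ r < len o i.
Hypothesis Hq2 : len o q2 <= r.
Hypothesis Hw2 : shell_ratio ^ (2 * N) * a0 <= len' o q2.

Notation Q := shell_ratio.
Notation w i := (len' o i).

Let Lt := Tri F Z.

Let Hr0 : 0 < r.
Proof. pose proof (te_pos _ _ _ _ G _ _ _ Ho). lra. Qed.

Let Ha00 : 0 < a0.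
Proof. pose proof (te_pos _ _ _ _ G' _ _ _ Ho). lra. Qed.

Let Q2 : 2 <= Q.
Proof.
  unfold shell_ratio. pose proof (star_const_pos kappa eps).
  assert (0 < / sep_const kappa eps) by (apply Rinv_0_lt_compat, (sep_const_pos F psi kappa eps G)). lra.
Qed.

(** At [p = o] the edges of the star are comparable with [len' o oa]. Elsewhere [o] is separated
    from [p] by a multiple of every edge at [p]. *)
Lemma shell_step p p' k : F p p' k -> w p' <= Q * Rmax (w p) a0.
Proof.
  intros Hf. pose proof (star_const_pos kappa eps) as S1.
  pose proof (sep_const_pos F psi kappa eps G) as S2.
  assert (S3 : 0 < / sep_const kappa eps) by now apply Rinv_0_lt_compat.
  pose proof (dst_nonneg (psi' o) (psi' p)) as W0.
  pose proof (Rmax_l (w p) a0). pose proof (Rmax_r (w p) a0).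
  set (mx := Rmax (w p) a0) in *.
  destruct (classic (p = o)) as [->|Hne].
  - pose proof (star_comparable F psi' kappa eps G' o p' k oa ob Hf Ho) as H1.
    apply Rle_trans with (star_const kappa eps * mx).
    + apply Rle_trans with (1 := H1). apply Rmult_le_compat_l; lra.
    + apply Rmult_le_compat_r; [lra|]. unfold shell_ratio. lra.
  - pose proof (vertex_separation F psi' kappa eps G' p p' k o Hf (not_eq_sym Hne)) as H1.
    rewrite (dst_sym (psi' p) (psi' o)) in H1.
    assert (H2 : len' p p' <= / sep_const kappa eps * w p).
    { apply Rmult_le_reg_l with (sep_const kappa eps); auto. rewrite <- Rmult_assoc, Rinv_r, Rmult_1_l by lra. auto. }
    pose proof (dst_tri (psi' o) (psi' p) (psi' p')).
    assert (/ sep_const kappa eps * w p <= / sep_const kappa eps * mx) by (apply Rmult_le_compat_l; lra).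
    apply Rle_trans with ((1 + / sep_const kappa eps) * mx); [lra|].
    apply Rmult_le_compat_r; [lra|]. unfold shell_ratio. lra.
Qed.

(** Shell [n] is the image annulus between the radii [sa n] and [sb n]. The truncated distance
    [sh n] varies only across this shell. *)
Let sa (n : nat) : R := Q ^ (2 * n) * a0.
Let sb (n : nat) : R := Q * sa n.
Let sh (n : nat) (i : V) : R := Rmin (sb n) (Rmax (sa n) (w i)).

Lemma shell_facts n : a0 <= sa n /\ 2 * sa n <= sb n.
Proof.
  assert (1 <= Q ^ (2 * n)) by (apply pow_R1_Rle; lra).
  assert (Ha : a0 <= Q ^ (2 * n) * a0) by nra.
  unfold sb, sa. split; [auto|]. apply Rmult_le_compat_r; lra.
Qed.

Lemma shell_next n n' : (n < n')%nat -> Q * sb n <= sa n'.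
Proof.
  intros H. unfold sb, sa.
  replace (Q * (Q * (Q ^ (2 * n) * a0))) with (Q ^ (2 * S n) * a0).
  - apply Rmult_le_compat_r; [lra|]. apply Rle_pow; [lra|lia].
  - replace (2 * S n)%nat with (S (S (2 * n))) by lia. simpl. ring.
Qed.

(* The shells are separated by more than the variation of [w] over a face, so that a face is active for
   at most one [n]. *)
Definition active (n : nat) (f : V * V * V) : Prop :=
  (exists p, vtx p f /\ w p < sb n) /\ (exists p, vtx p f /\ sa n < w p).

Lemma active_unique n n' f : F (fst (fst f)) (snd (fst f)) (snd f) -> active n f -> active n' f -> n = n'.
Proof.
  intros Hf. assert (Hstep : forall p p', vtx p f -> vtx p' f -> w p' <= Q * Rmax (w p) a0).
  { assert (Hsame : forall p, w p <= Q * Rmax (w p) a0).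
    { intros p. pose proof (Rmax_l (w p) a0). pose proof (Rmax_r (w p) a0). nra. }
    intros p p' [-> |[-> | ->]] [-> |[-> | ->]]; auto; eapply shell_step; eauto. }
  assert (Hlt : forall m m', (m < m')%nat -> active m f -> active m' f -> False).
  { intros m m' Hm [(p & Vp & Hp) _] [_ (p' & Vp' & Hp')].
    pose proof (Hstep p p' Vp Vp') as H1. pose proof (shell_next m m' Hm) as H2.
    destruct (shell_facts m) as [F1 F2].
    assert (Rmax (w p) a0 <= sb m) by (apply Rmax_lub; lra).
    assert (Q * Rmax (w p) a0 <= Q * sb m) by (apply Rmult_le_compat_l; lra). lra. }
  intros H1 H2. destruct (Nat.lt_trichotomy n n') as [H|[H|H]]; auto; exfalso; eauto.
Qed.

Lemma inactive_osc n f : ~ active n f -> ftri (sh n) f = 0.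
Proof.
  intros H. destruct (shell_facts n) as [F1 F2].
  assert (Hc : (forall p, vtx p f -> sb n <= w p) \/ (forall p, vtx p f -> w p <= sa n)).
  { destruct (classic (exists p, vtx p f /\ w p < sb n)) as [H1|H1].
    - right. intros p Hp. apply Rnot_lt_le. intros Hlt. apply H. split; eauto.
    - left. intros p Hp. apply Rnot_lt_le. intros Hlt. apply H1. eauto. }
  assert (V1 : vtx (fst (fst f)) f) by (unfold vtx; auto).
  assert (V2 : vtx (snd (fst f)) f) by (unfold vtx; auto).
  assert (V3 : vtx (snd f) f) by (unfold vtx; auto).
  unfold ftri, sh. destruct Hc as [Hc|Hc].
  - pose proof (Hc _ V1). pose proof (Hc _ V2). pose proof (Hc _ V3).
    rewrite !Rmax_right by lra. rewrite !Rmin_left by lra. rewrite !Rminus_diag, Rabs_R0. ring.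
  - pose proof (Hc _ V1). pose proof (Hc _ V2). pose proof (Hc _ V3).
    rewrite !Rmax_left by lra. rewrite !Rminus_diag, Rabs_R0. ring.
Qed.

Lemma osc_le_len' n i j k : F i j k -> ftri (sh n) (i, j, k) <= 2 / kappa * len' i j.
Proof.
  intros Hf. assert (K1 : kappa <= 1) by (eapply kappa_le1; eauto).
  assert (Hlip : forall p p', Rabs (sh n p - sh n p') <= len' p p').
  { intros p p'. assert (Hd : Rabs (w p - w p') <= len' p p').
    { apply Rabs_le. pose proof (dst_tri (psi' o) (psi' p) (psi' p')). pose proof (dst_tri (psi' o) (psi' p') (psi' p)).
      rewrite (dst_sym (psi' p') (psi' p)) in *. lra. }
    eapply Rle_trans; [|exact Hd]. unfold sh. generalize (w p), (w p'), (sa n), (sb n). intros x y c d.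
    unfold Rmin, Rmax, Rabs. repeat destruct (Rle_dec _ _); repeat destruct (Rcase_abs _); lra. }
  unfold ftri; simpl. pose proof (Hlip i j). pose proof (Hlip i k).
  pose proof (len_ratio F psi' kappa eps G' i k j (Fr _ _ _ Hf)).
  pose proof (dst_nonneg (psi' i) (psi' j)). 
  apply Rmult_le_reg_l with kappa; auto.
  replace (kappa * (2 / kappa * len' i j)) with (2 * len' i j) by (field; lra). nra.
Qed.

Lemma meet_in_Tri i j k x : F i j k -> T i j k x -> dst (psi o) x <= 3 * r -> In (i, j, k) Lt.
Proof.
  intros Hf HT Hx. apply in_Tri.
  destruct (faces_reach3 F psi kappa eps G o oa ob (3 * r) i j k x Ho ltac:(lra) Hf HT Hx) as (A1 & A2 & A3).
  repeat split; auto; now apply HZ.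
Qed.

Lemma Lt_face f : In f Lt -> F (fst (fst f)) (snd (fst f)) (snd f).
Proof. destruct f as [[i j] k]. intros H. apply in_Tri in H. simpl. tauto. Qed.

Let mcirc (t : R) (f : V * V * V) : Prop := exists th, 0 <= th <= 2 * PI /\ inF psi f (circ (psi o) t th).

Let hline (c : R) (s : R) : C := (fst (psi o) + s, snd (psi o) + c).

Let mline (c : R) (f : V * V * V) : Prop := exists s, 0 <= s <= 2 * r /\ inF psi f (hline c s).

(** The connected set in [Hconn] leads from [o] beyond radius [r], so one of its edges crosses every
    smaller circle; its inner end has image within [a0]. *)
Lemma inner_value t n : r / 2 <= t <= r -> exists f p, In f Lt /\ mcirc t f /\ vtx p f /\ sh n p = sa n.
Proof.
  intros Ht. destruct Hconn as (e & He & Hre).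
  assert (Hex : forall i, conn F (fun i => w i <= a0) o i -> t < len o i ->
    exists i j, w i <= a0 /\ len o i <= t /\ t < len o j /\ is_edge F i j).
  { intros i Hi. induction Hi as [Hp|i j Hi IH Hij Hj]; intros Hlt.
    - rewrite dst_refl in Hlt. lra.
    - destruct (Rle_lt_dec (len o i) t) as [H|H]; [|auto].
      exists i, j. repeat split; auto. exact (conn_holds F _ o i Hi). }
  destruct (Hex e He ltac:(lra)) as (i & j & Hwi & Hi & Hj & [k Hf]).
  destruct (segment_crosses_circle (psi o) (psi i) (psi j) t Hi Hj) as (s & Hs & Es).
  pose proof (inT_edge_point F psi kappa eps G i j k s Hf Hs) as HT.
  exists (i, j, k), i. repeat split.
  - eapply meet_in_Tri; eauto. lra.
  - destruct (on_circ (psi o) _ t ltac:(lra) Es) as (th & H1 & H2). exists th. split; auto.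
    unfold inF; simpl. rewrite <- H2. exact HT.
  - unfold vtx; simpl; auto.
  - unfold sh. destruct (shell_facts n). rewrite Rmax_left by lra. apply Rmin_right. lra.
Qed.

(** Take the vertex of the disc of radius [t] with the farthest image. Its outward neighbour has to
    leave the disc, so their edge crosses the circle, and its image distance is at least that of
    [q2]. *)
Lemma outer_value t n : (n < N)%nat -> r <= t <= 2 * r -> exists f p, In f Lt /\ mcirc t f /\ vtx p f /\ sh n p = sb n.
Proof.
  intros Hn Ht.
  set (Zt := filter (fun i => if Rle_dec (len o i) t then true else false) Z).
  assert (HZt : forall i, len o i <= t <-> In i Zt).
  { intros i. unfold Zt. rewrite filter_In. destruct (Rle_dec (len o i) t) as [H|H].
    - split; auto. intros _. split; auto. apply HZ. nra.
    - split; [tauto|]. intros [_ H']. discriminate. }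
  destruct (list_argmax (fun i => w i) Zt) as (i & Hi & Hm).
  { intros E. assert (H : In q2 Zt) by (apply HZt; lra). rewrite E in H. destruct H. }
  assert (Hwi : w q2 <= w i) by (apply Hm, HZt; lra).
  destruct (outward_neighbor F psi' kappa eps G' o i) as (j & [k Hf] & Hwj).
  apply HZt in Hi.
  assert (Hj : t < len o j).
  { apply Rnot_le_lt. intros Hj. apply HZt in Hj. specialize (Hm j Hj). lra. }
  destruct (segment_crosses_circle (psi o) (psi i) (psi j) t Hi Hj) as (s & Hs & Es).
  pose proof (inT_edge_point F psi kappa eps G i j k s Hf Hs) as HT.
  exists (i, j, k), i. repeat split.
  - eapply meet_in_Tri; eauto. lra.
  - destruct (on_circ (psi o) _ t ltac:(lra) Es) as (th & H1 & H2). exists th. split; auto.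
    unfold inF; simpl. rewrite <- H2. exact HT.
  - unfold vtx; simpl; auto.
  - destruct (shell_facts n) as [F1 F2]. pose proof (shell_next n N Hn) as F3.
    fold (sa N) in Hw2. assert (sb n <= w i) by nra.
    unfold sh. rewrite Rmax_right by lra. apply Rmin_left. lra.
Qed.

Let lsc (n : nat) (P : V * V * V -> Prop) : R := lsum Lt (fun f => ind (P f) * ftri (sh n) f).

(** The circle of radius [t1], a horizontal line and the circle of radius [t2] together form a
    connected set on which [sh n] takes both extreme values. *)
Lemma shell_crossing n t1 t2 c : (n < N)%nat -> r / 2 <= t1 <= r -> r <= t2 <= 2 * r -> 0 <= c <= r / 4 ->
  sb n - sa n <= lsc n (mcirc t1) + lsc n (mcirc t2) + lsc n (mline c).
Proof.
  intros Hn H1 H2 Hc. pose proof PI_RGT_0 as Hpi.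
  assert (Hcovc : forall t, 0 <= t <= 2 * r -> forall th, 0 <= th <= 2 * PI -> exists f, In f Lt /\ inF psi f (circ (psi o) t th)).
  { intros t Ht th _. assert (Hd := dst_circ (psi o) t th ltac:(lra)).
    destruct (Hcov (circ (psi o) t th)) as (i & j & k & Hf & HT).
    exists (i, j, k). split; auto. eapply meet_in_Tri; eauto. lra. }
  assert (Hcovl : forall s, 0 <= s <= 2 * r -> exists f, In f Lt /\ inF psi f (hline c s)).
  { intros s Hs. destruct (Hcov (hline c s)) as (i & j & k & Hf & HT).
    exists (i, j, k). split; auto. eapply meet_in_Tri; eauto.
    apply dst_le_iff; [lra|]. unfold hline; simpl. nra. }
  assert (Hl : cpath (hline c)) by (split; unfold hline; simpl; intros s; apply derivable_continuous_pt; reg).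
  (* As [c <= r / 4 < t], the line meets the circle at abscissa [sqrt (t^2 - c^2)]. *)
  assert (Hpt : forall t, r / 2 <= t <= 2 * r -> exists s th, 0 <= s <= 2 * r /\ 0 <= th <= 2 * PI /\ hline c s = circ (psi o) t th).
  { intros t Ht. assert (H0 : 0 <= t ^ 2 - c ^ 2) by nra.
    set (s := sqrt (t ^ 2 - c ^ 2)). pose proof (sqrt_pos (t ^ 2 - c ^ 2)) as S1. fold s in S1.
    assert (S2 : s * s = t ^ 2 - c ^ 2) by now apply sqrt_sqrt.
    assert (Hd : dst (psi o) (hline c s) = t).
    { pose proof (dst_nonneg (psi o) (hline c s)). pose proof (dst_sqr (psi o) (hline c s)) as E.
      unfold hline in E at 2 3; simpl in E. assert (dst (psi o) (hline c s) * dst (psi o) (hline c s) = t * t) by nra. nra. }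
    destruct (on_circ (psi o) (hline c s) t ltac:(lra) Hd) as (th & T1 & T2).
    exists s, th. repeat split; auto; try lra. nra. }
  destruct (Hpt t1 ltac:(lra)) as (s1 & th1 & S1 & T1 & E1).
  destruct (Hpt t2 ltac:(lra)) as (s2 & th2 & S2 & T2 & E2).
  destruct (Hcovl s1 S1) as (f1 & F1 & I1). destruct (Hcovl s2 S2) as (f2 & F2 & I2).
  destruct (inner_value t1 n H1) as (g1 & p1 & G1 & (u1 & U1 & J1) & V1 & W1).
  destruct (outer_value t2 n Hn H2) as (g2 & p2 & G2 & (u2 & U2 & J2) & V2 & W2).
  set (x1 := fst (fst f1)). set (x2 := fst (fst f2)).
  assert (X1 : vtx x1 f1) by (unfold vtx; auto). assert (X2 : vtx x2 f2) by (unfold vtx; auto).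
  assert (I1' := I1). rewrite E1 in I1'. assert (I2' := I2). rewrite E2 in I2'.
  pose proof (path_oscillation F psi kappa eps G Lt (circ (psi o) t1) 0 (2 * PI) (sh n) (cpath_circle _ _) Lt_face
    (Hcovc t1 ltac:(lra)) g1 f1 u1 th1 p1 x1 G1 F1 U1 T1 J1 I1' V1 X1) as P1.
  pose proof (path_oscillation F psi kappa eps G Lt (circ (psi o) t2) 0 (2 * PI) (sh n) (cpath_circle _ _) Lt_face
    (Hcovc t2 ltac:(lra)) f2 g2 th2 u2 x2 p2 F2 G2 T2 U2 I2' J2 X2 V2) as P2.
  pose proof (path_oscillation F psi kappa eps G Lt (hline c) 0 (2 * r) (sh n) Hl Lt_face
    Hcovl f1 f2 s1 s2 x1 x2 F1 F2 S1 S2 I1 I2 X1 X2) as P3.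
  fold (mcirc t1) in P1. unfold lsc, mcirc, mline. rewrite W1 in P1. rewrite W2 in P2. lra.
Qed.

(** In one of three families, inner circles, outer circles or horizontal lines, every member carries
    a third of the oscillation: otherwise three bad members would contradict [shell_crossing].
    Integrate over that family, whose parameter interval has length at least [r / 4]. *)
Lemma shell_area n : (n < N)%nat ->
  (sb n - sa n) * r * kappa / 24 <= lsum Lt (fun f => ftri (sh n) f * len (fst (fst f)) (snd (fst f))).
Proof.
  intros Hn. destruct (shell_facts n) as [F1 F2]. set (dl := (sb n - sa n) / 3).
  assert (Hft : forall f, 0 <= ftri (sh n) f) by (intros f; unfold ftri; apply Rplus_le_le_0_compat; apply Rabs_pos).
  assert (Hgen : forall (Nrm : C -> R) (m : R -> V * V * V -> Prop) (x y : R), r / 4 <= y - x ->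
    (forall z z', Rabs (Nrm z - Nrm z') <= dst z z') ->
    (forall t f, m t f -> exists z, inF psi f z /\ Nrm z = t) ->
    (forall t, x <= t <= y -> dl <= lsc n (m t)) ->
    (sb n - sa n) * r * kappa / 24 <= lsum Lt (fun f => ftri (sh n) f * len (fst (fst f)) (snd (fst f)))).
  { intros Nrm m x y Hxy Hlip Hm Hall.
    assert (HW : dl * (y - x) <= lsum Lt (fun f => ftri (sh n) f *
       ((Nrm (psi (fst (fst f))) + len (fst (fst f)) (snd (fst f)) / kappa)
       - (Nrm (psi (fst (fst f))) - len (fst (fst f)) (snd (fst f)) / kappa)))).
    { apply weighted_intervals_low; [lra|auto| |].
      - intros f _. pose proof (dst_nonneg (psi (fst (fst f))) (psi (snd (fst f)))).
        assert (0 <= len (fst (fst f)) (snd (fst f)) / kappa) by (apply Rmult_le_pos; auto; left; now apply Rinv_0_lt_compat). lra.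
      - intros t Ht. eapply Rle_trans; [apply (Hall t); lra|]. unfold lsc. apply lsum_le. intros f Hf.
        apply Rmult_le_compat_r; auto. apply ind_impl. intros Hmt.
        destruct (Hm t f Hmt) as (z & HTz & Ez). apply Lt_face in Hf. destruct f as [[i j] k]; simpl in *.
        pose proof (triangle_point_dst F psi kappa eps G i j k z Hf HTz) as Hd.
        pose proof (Hlip (psi i) z) as Hl. rewrite Ez in Hl. apply Rabs_le_between in Hl. lra. }
    assert (Hdl : dl * (r / 4) <= dl * (y - x)) by (apply Rmult_le_compat_l; unfold dl; lra).
    apply Rmult_le_reg_l with (2 / kappa); [apply Rdiv_lt_0_compat; lra|].
    apply Rle_trans with (dl * (r / 4)); [right; unfold dl; field; lra|].
    apply Rle_trans with (1 := Hdl). apply Rle_trans with (1 := HW).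
    rewrite <- lsum_scal. right. apply lsum_ext. intros f _. field. lra. }
  assert (Hlc : forall z z', Rabs (dst (psi o) z - dst (psi o) z') <= dst z z').
  { intros z z'. apply Rabs_le. pose proof (dst_tri (psi o) z z'). pose proof (dst_tri (psi o) z' z).
    rewrite (dst_sym z' z) in *. lra. }
  assert (Hmc : forall x y, 0 <= x -> (forall t, x <= t <= y -> dl <= lsc n (mcirc t)) ->
     forall t, x <= t <= y -> dl <= lsc n (fun f => x <= t /\ mcirc t f)).
  { intros x y Hx H t Ht. eapply Rle_trans; [apply (H t Ht)|]. unfold lsc. apply lsum_le. intros f _.
    apply Rmult_le_compat_r; auto. apply ind_impl. intros; split; auto; lra. }
  destruct (classic (forall t, r / 2 <= t <= r -> dl <= lsc n (mcirc t))) as [C1|C1].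
  { apply (Hgen (fun z => dst (psi o) z) (fun t f => r / 2 <= t /\ mcirc t f) (r / 2) r); auto; [lra| |].
    - intros t f [Ht (th & Hth & HT)]. exists (circ (psi o) t th). split; auto. apply dst_circ. lra.
    - apply Hmc; auto. lra. }
  destruct (classic (forall t, r <= t <= 2 * r -> dl <= lsc n (mcirc t))) as [C2|C2].
  { apply (Hgen (fun z => dst (psi o) z) (fun t f => r <= t /\ mcirc t f) r (2 * r)); auto; [lra| |].
    - intros t f [Ht (th & Hth & HT)]. exists (circ (psi o) t th). split; auto. apply dst_circ. lra.
    - apply Hmc; auto. lra. }
  assert (C3 : forall c, 0 <= c <= r / 4 -> dl <= lsc n (mline c)).
  { intros c Hc. apply Rnot_lt_le. intros H3.
    apply not_all_ex_not in C1. destruct C1 as [t1 C1]. apply imply_to_and in C1. destruct C1 as [R1 C1].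
    apply not_all_ex_not in C2. destruct C2 as [t2 C2]. apply imply_to_and in C2. destruct C2 as [R2 C2].
    pose proof (shell_crossing n t1 t2 c Hn R1 R2 Hc). unfold dl in *. lra. }
  apply (Hgen (fun z => snd z - snd (psi o)) mline 0 (r / 4)); auto; [lra| |].
  - intros z z'. replace (snd z - snd (psi o) - (snd z' - snd (psi o))) with (snd z - snd z') by ring. apply dst_snd.
  - intros t f (s & Hs & HT). exists (hline t s). split; auto. unfold hline; simpl. ring.
Qed.

Let SA (n : nat) : R := lsum Lt (fun f => ind (active n f) * len (fst (fst f)) (snd (fst f)) ^ 2).

Definition shell_const : R := (48 / kappa) ^ 2 * ((2 / kappa) ^ 2 * (6400 / kappa ^ 6 * Cr ^ 2)).

(** Cauchy-Schwarz on [shell_area]. The squared oscillations are bounded by the image area near the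
    shell, a multiple of [sb n ^ 2]; since [sb n - sa n] is at least half of [sb n], this factor
    cancels and an area proportional to [r^2] is left for the active faces. *)
Lemma shell_area_lower n : (n < N)%nat -> r ^ 2 <= shell_const * SA n.
Proof.
  intros Hn. destruct (shell_facts n) as [F1 F2]. pose proof (shell_area n Hn) as H.
  set (e := fun f => ind (active n f)).
  assert (He : forall f, e f * e f = e f) by (intros f; unfold e, ind; destruct (excluded_middle_informative _); ring).
  rewrite (lsum_ext Lt _ (fun f => ftri (sh n) f * (e f * len (fst (fst f)) (snd (fst f))))) in H.
  2:{ intros f _. unfold e. destruct (classic (active n f)) as [Ha|Ha].
      - rewrite (ind_true _ Ha). ring.
      - rewrite (inactive_osc n f Ha). ring. }
  pose proof (lsum_CS Lt (ftri (sh n)) (fun f => e f * len (fst (fst f)) (snd (fst f)))) as HCS.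
  assert (ESA : lsum Lt (fun f => (e f * len (fst (fst f)) (snd (fst f))) ^ 2) = SA n).
  { apply lsum_ext. intros f _. fold (e f).
    transitivity ((e f * e f) * len (fst (fst f)) (snd (fst f)) ^ 2); [ring|now rewrite He]. }
  cbv beta in HCS. rewrite ESA in HCS.
  set (Lac := filter (fun f => if excluded_middle_informative (active n f) then true else false) Lt).
  assert (Hosc : lsum Lt (fun f => ftri (sh n) f ^ 2) <= (2 / kappa) ^ 2 * (6400 / kappa ^ 6 * (Cr * sb n) ^ 2)).
  { apply Rle_trans with ((2 / kappa) ^ 2 * lsum Lac (fun f => len' (fst (fst f)) (snd (fst f)) ^ 2)).
    - unfold Lac. rewrite lsum_filter, <- lsum_scal. apply lsum_le. intros f Hf.
      destruct (excluded_middle_informative (active n f)) as [Ha|Ha].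
      + apply Lt_face in Hf. destruct f as [[i j] k]; cbn [fst snd] in *. pose proof (osc_le_len' n i j k Hf).
        rewrite Rmult_1_l, <- Rpow_mult_distr. apply pow_incr. split; auto.
        unfold ftri. apply Rplus_le_le_0_compat; apply Rabs_pos.
      + rewrite (inactive_osc n f Ha). lra.
    - apply Rmult_le_compat_l; [apply pow2_ge_0|].
      apply (packing F psi' kappa eps G' Lac (psi' o) (Cr * sb n)).
      + apply NoDup_filter, NoDup_Tri; auto.
      + nra.
      + intros i j k Hf. unfold Lac in Hf. apply filter_In in Hf. destruct Hf as [Hf Ha].
        apply Lt_face in Hf. simpl in Hf.
        destruct (excluded_middle_informative (active n (i, j, k))) as [[(p & Vp & Hp) _]|]; [|discriminate].
        split; auto. unfold vtx in Vp; simpl in Vp.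
        assert (Hoa : len' o oa <= sb n) by lra.
        destruct Vp as [-> |[-> | ->]].
        * apply (star_reach3 F psi' kappa eps G' o oa ob (sb n) i j k); auto. lra.
        * destruct (star_reach3 F psi' kappa eps G' o oa ob (sb n) j k i) as (A1 & A2 & A3); auto. lra.
        * destruct (star_reach3 F psi' kappa eps G' o oa ob (sb n) k i j) as (A1 & A2 & A3); auto. lra. }
  assert (HSA : 0 <= SA n).
  { apply lsum_nonneg. intros f _. apply Rmult_le_pos; [apply ind_bounds|apply pow2_ge_0]. }
  set (X := (sb n - sa n) * r * kappa / 24) in *.
  assert (HX0 : sb n * r * kappa / 48 <= X).
  { unfold X. assert (0 < r * kappa) by nra.
    assert (sb n / 2 * (r * kappa) <= (sb n - sa n) * (r * kappa)) by (apply Rmult_le_compat_r; lra). lra. }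
  assert (Hsb : 0 < sb n) by lra.
  assert (Hpp : 0 < sb n * r * kappa).
  { apply Rmult_lt_0_compat; [apply Rmult_lt_0_compat; [exact Hsb|exact Hr0]|exact K0]. }
  assert (HX1 : (sb n * r * kappa / 48) ^ 2 <= (2 / kappa) ^ 2 * (6400 / kappa ^ 6 * (Cr * sb n) ^ 2) * SA n).
  { apply Rle_trans with (X ^ 2).
    - apply pow_incr. split; auto. lra.
    - eapply Rle_trans; [|apply Rmult_le_compat_r; [exact HSA|exact Hosc]].
      eapply Rle_trans; [|exact HCS]. apply pow_incr. split; auto.
      apply Rle_trans with (2 := HX0). lra. }
  apply Rmult_le_reg_l with ((sb n * kappa / 48) ^ 2); [apply pow_lt; nra|].
  replace ((sb n * kappa / 48) ^ 2 * r ^ 2) with ((sb n * r * kappa / 48) ^ 2) by field.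
  apply Rle_trans with (1 := HX1). right. unfold shell_const. field. lra.
Qed.

(** No face is active for two shells, so the areas of the shells add up within one disc of radius
    comparable to [r]. *)
Lemma shell_count : INR N <= shell_const * (6400 / kappa ^ 6 * (3 * Cr) ^ 2).
Proof.
  assert (P6 : 0 < kappa ^ 6) by now apply pow_lt.
  assert (Hc : 0 <= shell_const).
  { unfold shell_const. apply Rmult_le_pos; [apply pow2_ge_0|]. apply Rmult_le_pos; [apply pow2_ge_0|].
    apply Rmult_le_pos; [|apply pow2_ge_0]. left. apply Rdiv_lt_0_compat; lra. }
  assert (Hsum : lsum (seq 0 N) SA <= 6400 / kappa ^ 6 * (Cr * (3 * r)) ^ 2).
  { unfold SA. rewrite lsum_swap.
    apply Rle_trans with (lsum Lt (fun f => len (fst (fst f)) (snd (fst f)) ^ 2)).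
    - apply lsum_le. intros f Hf. apply Lt_face in Hf.
      rewrite (lsum_ext _ _ (fun n => len (fst (fst f)) (snd (fst f)) ^ 2 * ind (active n f))) by (intros; ring).
      rewrite lsum_scal.
      assert (lsum (seq 0 N) (fun n => ind (active n f)) <= 1).
      { apply lsum_ind_unique; [apply seq_NoDup|]. intros x y _ _ Hx Hy. eapply active_unique; eauto. }
      pose proof (pow2_ge_0 (len (fst (fst f)) (snd (fst f)))). nra.
    - apply (packing F psi kappa eps G Lt (psi o) (Cr * (3 * r))); [apply NoDup_Tri; auto|nra|].
      intros i j k Hf. apply in_Tri in Hf. destruct Hf as (Hf & A1 & A2 & A3).
      repeat split; auto; now apply HZ. }
  assert (Hlow : r ^ 2 * INR N <= shell_const * lsum (seq 0 N) SA).
  { rewrite <- lsum_scal. apply Rle_trans with (lsum (seq 0 N) (fun _ => r ^ 2)).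
    - generalize (r ^ 2). intros x. clear. generalize 0%nat. induction N as [|m IH]; intros s; [simpl; lra|].
      change (seq s (S m)) with (s :: seq (S s) m). rewrite lsum_cons, S_INR. specialize (IH (S s)).
      cbv beta. lra.
    - apply lsum_le. intros n Hn. apply in_seq in Hn. apply shell_area_lower. lia. }
  assert (Hr2 : 0 < r ^ 2) by now apply pow_lt.
  apply Rmult_le_reg_l with (r ^ 2); auto. apply Rle_trans with (1 := Hlow).
  apply Rle_trans with (shell_const * (6400 / kappa ^ 6 * (Cr * (3 * r)) ^ 2)).
  - apply Rmult_le_compat_l; auto.
  - right. field. lra.
Qed.

End Modulus.

(** * Two-sided bounds for the conformal factor *)

Section Rigidity.
Context {V : Type} (F : V -> V -> V -> Prop) (psi psi' : V -> C) (kappa eps : R).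
Context (u : V -> R) (A : V -> V -> R) (c1 C1 M : R).
Hypothesis G : fat_triangulation F psi kappa eps.
Hypothesis G' : fat_triangulation F psi' kappa eps.
Hypothesis Hcov : forall z, exists i j k, F i j k /\ inT (psi i) (psi j) (psi k) z.
Hypothesis Hfin : forall r, exists L : list V, forall i, dst 0 (psi i) <= r -> In i L.
Hypothesis HL : elliptic F u A c1 C1 M.
Hypothesis Hu : forall i j, is_edge F i j ->
  dst (psi' i) (psi' j) = exp ((u i + u j) / 2) * dst (psi i) (psi j).
Implicit Types (i j k p q : V).

Notation T' i j k z := (inT (psi' i) (psi' j) (psi' k) z).
Notation len i j := (dst (psi i) (psi j)).
Notation len' i j := (dst (psi' i) (psi' j)).
Notation Cr := (reach_const kappa eps).

Let HS := te_surf _ _ _ _ G.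
Let Fc i j k : F i j k -> F j k i := F_cyc F HS i j k.
Let Fs i j k : F i j k -> F j i k := F_swap12 F HS i j k.
Let Fr i j k : F i j k -> F i k j := F_swap23 F HS i j k.
Let K0 : 0 < kappa := te_kappa _ _ _ _ G.
Let Cr1 : 1 <= Cr := reach_const_ge1 F psi kappa eps G.

Lemma ball_list (c : C) (r : R) : exists Z, NoDup Z /\ forall i, In i Z <-> dst c (psi i) <= r.
Proof.
  destruct (Hfin (dst 0 c + r)) as [L HL0].
  exists (nodup (@eqdecV V) (filter (fun i => if Rle_dec (dst c (psi i)) r then true else false) L)).
  split; [apply NoDup_nodup|]. intros i. rewrite nodup_In, filter_In.
  destruct (Rle_dec (dst c (psi i)) r) as [H|H].
  - split; auto. intros _. split; auto. apply HL0. pose proof (dst_tri 0 c (psi i)). lra.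
  - split; [intros [_ H']; discriminate | tauto].
Qed.

(** Consider the vertices joined to [o] through vertices of image distance at most [Cr * rho]. If
    they all stay within [r], finitely many triangles have such a vertex first, and their union is
    closed. By [face_nbhd] a segment of the image disc starting at [psi' o] cannot leave this union,
    since a triangle meeting the disc has all its vertices within [Cr * rho]. *)
Lemma dichotomy o oa ob r rho : F o oa ob -> len o oa <= r -> len' o oa <= rho ->
  (exists i, conn F (fun i => len' o i <= Cr * rho) o i /\ r < len o i) \/
  (forall z, dst (psi' o) z <= rho -> exists i j k, F i j k /\ T' i j k z /\ len o i <= r).
Proof.
  intros Ho Hr Hrho.
  set (P := fun i => len' o i <= Cr * rho).
  assert (Hrho0 : 0 < rho) by (pose proof (te_pos _ _ _ _ G' _ _ _ Ho); lra).
  destruct (classic (exists i, conn F P o i /\ r < len o i)) as [H|Hno]; [left; auto|right].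
  assert (Hin : forall i, conn F P o i -> len o i <= r).
  { intros i Hi. apply Rnot_lt_le. intros H. apply Hno. eauto. }
  assert (Po : conn F P o o) by (apply conn_refl; unfold P; rewrite dst_refl; nra).
  destruct (ball_list (psi o) (Cr * r)) as (Z & HN & HZ).
  set (U := filter (fun f => if excluded_middle_informative (conn F P o (fst (fst f))) then true else false) (Tri F Z)).
  assert (HU : forall i j k, In (i, j, k) U <-> F i j k /\ conn F P o i).
  { intros i j k. unfold U. rewrite filter_In, in_Tri. simpl.
    destruct (excluded_middle_informative (conn F P o i)) as [Hc|Hc]; split; try tauto.
    - intros [Hf _]. destruct (star_reach3 F psi kappa eps G o oa ob r i j k Ho Hr Hf (Hin i Hc)) as (X1 & X2 & X3).
      repeat split; auto; now apply HZ.
    - intros [_ H']. discriminate. }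
  intros z Hz.
  set (g := fun s => ((1 - s) * fst (psi' o) + s * fst z, (1 - s) * snd (psi' o) + s * snd z) : C).
  assert (Hg : cpath g) by apply cpath_line.
  set (m := fun (f : V * V * V) s => mb (psi' (fst (fst f))) (psi' (snd (fst f))) (psi' (snd f)) (g s)).
  set (mm := fun s => lmax U (fun f => m f s)).
  assert (Hmm : continuity mm) by (apply continuity_lmax; intros f _; now apply continuity_mb).
  assert (Hmm0 : forall s, 0 <= mm s <-> exists i j k, F i j k /\ conn F P o i /\ T' i j k (g s)).
  { intros s. unfold mm. rewrite lmax_nonneg. split.
    - intros [[[i j] k] [H1 H2]]. apply HU in H1. apply mb_nonneg in H2. exists i, j, k. tauto.
    - intros (i & j & k & H1 & H2 & H3). exists (i, j, k). split; [now apply HU|now apply mb_nonneg]. }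
  assert (Hgd : forall s, 0 <= s <= 1 -> dst (psi' o) (g s) <= rho).
  { intros s Hs. replace (g s) with (pt3 (psi' o) z z (1 - s) s 0) by (unfold g, pt3; f_equal; ring).
    apply dst_pt3_le; auto; try lra. rewrite dst_refl. lra. }
  assert (G0 : g 0 = psi' o) by (unfold g; rewrite (surjective_pairing (psi' o)); simpl; f_equal; ring).
  assert (G1 : g 1 = z) by (unfold g; rewrite (surjective_pairing z); simpl; f_equal; ring).
  destruct (Rle_lt_dec 0 (mm 1)) as [H1|H1].
  { apply Hmm0 in H1. rewrite G1 in H1. destruct H1 as (i & j & k & X1 & X2 & X3). exists i, j, k. auto. }
  exfalso.
  destruct (last_nonneg mm 0 1 Hmm Rlt_0_1) as (c & Hc & Hc0 & Hc1); auto.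
  { apply Hmm0. exists o, oa, ob. rewrite G0. repeat split; auto; apply inT_vertex; eapply area_nz; eauto. }
  apply Hmm0 in Hc0. destruct Hc0 as (i & j & k & Hf & Hci & HT).
  destruct (faces_reach3 F psi' kappa eps G' o oa ob rho i j k (g c) Ho Hrho Hf HT (Hgd c ltac:(lra))) as (X1 & X2 & X3).
  assert (Hcj : conn F P o j) by (apply (conn_step F P o i j); auto; exists k; auto).
  assert (Hck : conn F P o k) by (apply (conn_step F P o i k); auto; exists j; auto).
  destruct (face_nbhd F psi' kappa eps G' i j k (g c) Hf HT) as (d & Hd & Hd').
  set (D := dst (psi' o) z + 1). assert (HD : 0 < D) by (pose proof (dst_nonneg (psi' o) z); unfold D; lra).
  set (s := Rmin 1 (c + d / D / 2)).
  assert (HdD : 0 < d / D) by now apply Rdiv_lt_0_compat.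
  assert (Hs : c < s <= 1 /\ s - c < d / D) by (unfold s, Rmin; destruct (Rle_dec _ _); lra).
  assert (Hdist : dst (g c) (g s) < d).
  { assert (E : (g c - g s)%C = (RtoC (s - c) * (psi' o - z))%C).
    { unfold g, RtoC, Cminus, Cplus, Copp, Cmult. destruct (psi' o), z. simpl. f_equal; ring. }
    unfold dst. rewrite E, Cmod_mult, Cmod_R, Rabs_pos_eq by lra. fold (dst (psi' o) z).
    apply Rle_lt_trans with ((s - c) * D).
    - apply Rmult_le_compat_l; unfold D; lra.
    - apply Rmult_lt_reg_r with (/ D); [now apply Rinv_0_lt_compat|].
      rewrite Rmult_assoc, Rinv_r, Rmult_1_r by lra. apply Hs. }
  destruct (Hd' (g s) Hdist) as (a & b & e & Hf2 & HT2 & Ha).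
  specialize (Hc1 s ltac:(lra)). apply Rlt_not_le in Hc1. apply Hc1. apply Hmm0.
  exists a, b, e. repeat split; auto; try apply HT2. destruct Ha as [-> |[-> | ->]]; auto.
Qed.

Definition low_const : R := sup_const kappa eps c1 C1 M * (exp M * (6400 / kappa ^ 6 * Cr ^ 2)).

Lemma sup_const_nonneg : 0 <= sup_const kappa eps c1 C1 M.
Proof.
  unfold sup_const.
  assert (P6 : 0 < 6400 / kappa ^ 6) by (apply Rdiv_lt_0_compat; [lra|now apply pow_lt]).
  assert (P2 : 0 < kappa ^ 2) by now apply pow_lt. assert (PC : 0 < Cr ^ 2) by (apply pow_lt; lra).
  assert (0 <= 4 * exp M ^ 2 * cacc0 c1 C1 M ^ 2 / Cr ^ 2).
  { apply Rmult_le_pos; [|left; now apply Rinv_0_lt_compat].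
    apply Rmult_le_pos; [|apply pow2_ge_0]. apply Rmult_le_pos; [lra|apply pow2_ge_0]. }
  assert (0 < 2 / kappa ^ 2) by (apply Rdiv_lt_0_compat; lra).
  apply Rmult_le_pos; [|left; now apply Rinv_0_lt_compat].
  apply Rmult_le_pos; [|lra]. apply Rmult_le_pos; [lra|]. apply Rmult_le_pos; lra.
Qed.

Lemma low_const_nonneg : 0 <= low_const.
Proof.
  unfold low_const. apply Rmult_le_pos; [apply sup_const_nonneg|].
  apply Rmult_le_pos; [left; apply exp_pos|]. apply Rmult_le_pos; [|apply pow2_ge_0].
  left. apply Rdiv_lt_0_compat; [lra|now apply pow_lt].
Qed.

Lemma exp_edge i j : is_edge F i j -> exp (u j - u i) <= exp M.
Proof.
  intros H. pose proof (el_M _ _ _ _ _ _ HL i j H) as Hd. apply Rabs_le_between in Hd.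
  destruct (Rle_lt_or_eq_dec (u j - u i) M) as [X|X]; [lra|left; now apply exp_increasing|rewrite X; lra].
Qed.

(** Conformality turns the weighted sums in [sup_estimate] into areas in the other plane. *)
Lemma weighted_len i j : is_edge F i j ->
  len' i j ^ 2 * exp (- u i) ^ 2 <= exp M * len i j ^ 2 /\ len i j ^ 2 * exp (u i) ^ 2 <= exp M * len' i j ^ 2.
Proof.
  intros H. assert (H' : is_edge F j i) by (destruct H as [k Hk]; exists k; auto).
  pose proof (exp_edge i j H) as E1. pose proof (exp_edge j i H') as E2.
  rewrite (Hu i j H).
  assert (Q1 : (exp ((u i + u j) / 2) * len i j) ^ 2 * exp (- u i) ^ 2 = exp (u j - u i) * len i j ^ 2).
  { replace ((exp ((u i + u j) / 2) * len i j) ^ 2 * exp (- u i) ^ 2) with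
      ((exp ((u i + u j) / 2) * exp ((u i + u j) / 2) * (exp (- u i) * exp (- u i))) * len i j ^ 2) by ring.
    rewrite <- !exp_plus. f_equal. f_equal. field. }
  assert (Q2 : exp (u i) ^ 2 * len i j ^ 2 = exp (u i - u j) * (exp ((u i + u j) / 2) * len i j) ^ 2).
  { replace (exp (u i - u j) * (exp ((u i + u j) / 2) * len i j) ^ 2) with
      ((exp (u i - u j) * (exp ((u i + u j) / 2) * exp ((u i + u j) / 2))) * len i j ^ 2) by ring.
    rewrite <- !exp_plus. simpl. rewrite Rmult_1_r, <- exp_plus. f_equal. f_equal. field. }
  split.
  - rewrite Q1. apply Rmult_le_compat_r; auto. apply pow2_ge_0.
  - rewrite Rmult_comm, Q2. apply Rmult_le_compat_r; auto. apply pow2_ge_0.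
Qed.

(** The sup estimate for [- u] in the second plane, around [psi' q]. The covering hypothesis
    confines the triangles involved to a disc of radius [Cr * r] in the first plane, where [packing]
    bounds the sum. *)
Lemma lower_bound o oa ob r rho q qa qb rho' : F o oa ob -> len o oa <= r ->
  (forall z, dst (psi' o) z <= rho -> exists i j k, F i j k /\ T' i j k z /\ len o i <= r) ->
  F q qa qb -> len' q qa <= rho' -> len' o q + 4 * Cr ^ 2 * rho' <= rho ->
  exp (- u q) ^ 2 <= low_const * r ^ 2 / rho' ^ 2.
Proof.
  intros Ho Hr Hc Hq Hqa Hin.
  assert (Hrho' : 0 < rho') by (pose proof (te_pos _ _ _ _ G' _ _ _ Hq); lra).
  assert (Hr0 : 0 < r) by (pose proof (te_pos _ _ _ _ G _ _ _ Ho); lra).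
  assert (HC : 1 <= Cr ^ 2) by (apply pow_R1_Rle; auto).
  destruct (ball_list (psi o) (Cr * r)) as (Z0 & HN0 & HZ0).
  set (Z := filter (fun i => if Rle_dec (len' q i) (4 * Cr ^ 2 * rho') then true else false) Z0).
  assert (Hsub : forall i, len' q i <= 4 * Cr ^ 2 * rho' -> In i Z0).
  { intros p Hp. apply HZ0.
    destruct (Hc (psi' p)) as (i & j & k & Hf & HT & Hi).
    { pose proof (dst_tri (psi' o) (psi' q) (psi' p)). lra. }
    destruct (star_reach3 F psi kappa eps G o oa ob r i j k Ho Hr Hf Hi) as (X1 & X2 & X3).
    destruct (vertex_in_face F psi' kappa eps G' p i j k Hf HT) as [-> |[-> | ->]]; auto. }
  assert (HZ : forall i, In i Z <-> len' q i <= 4 * Cr ^ 2 * rho').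
  { intros i. unfold Z. rewrite filter_In. destruct (Rle_dec (len' q i) (4 * Cr ^ 2 * rho')) as [H|H].
    - split; auto.
    - split; [intros [_ X]; discriminate|tauto]. }
  assert (HN : NoDup Z) by now apply NoDup_filter.
  pose proof (sup_estimate F psi' kappa eps (fun i => - u i) _ c1 C1 M G' (elliptic_opp F u A c1 C1 M HL)
    q qa qb rho' Z Hq Hqa HN HZ) as H.
  assert (H' : exp (- u q) ^ 2 <= sup_const kappa eps c1 C1 M / rho' ^ 2 *
    lsum (Tri F Z) (fun f => len' (fst (fst f)) (snd (fst f)) ^ 2 * exp (- u (fst (fst f))) ^ 2)).
  { apply H. intros z Hz. destruct (Hc z) as (i & j & k & Hf & HT & _); eauto.
    pose proof (dst_tri (psi' o) (psi' q) z). nra. }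
  assert (Hs : lsum (Tri F Z) (fun f => len' (fst (fst f)) (snd (fst f)) ^ 2 * exp (- u (fst (fst f))) ^ 2) <=
     exp M * (6400 / kappa ^ 6 * (Cr * r) ^ 2)).
  { apply Rle_trans with (exp M * lsum (Tri F Z) (fun f => len (fst (fst f)) (snd (fst f)) ^ 2)).
    - rewrite <- lsum_scal. apply lsum_le. intros [[i j] k] Hf. apply in_Tri in Hf.
      apply weighted_len. exists k. tauto.
    - apply Rmult_le_compat_l; [left; apply exp_pos|].
      apply (packing F psi kappa eps G (Tri F Z) (psi o) (Cr * r)); [now apply NoDup_Tri|nra|].
      intros i j k Hf. apply in_Tri in Hf. destruct Hf as (Hf & X1 & X2 & X3).
      apply HZ, Hsub, HZ0 in X1. apply HZ, Hsub, HZ0 in X2. apply HZ, Hsub, HZ0 in X3. auto. }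
  apply Rle_trans with (1 := H').
  apply Rle_trans with (sup_const kappa eps c1 C1 M / rho' ^ 2 * (exp M * (6400 / kappa ^ 6 * (Cr * r) ^ 2))).
  - apply Rmult_le_compat_l; auto. apply Rmult_le_pos; [apply sup_const_nonneg|].
    left. apply Rinv_0_lt_compat, pow_lt; auto.
  - right. unfold low_const. field. lra.
Qed.

Lemma upper_bound o q qa qb r m : F q qa qb -> len q qa <= r -> 0 < m ->
  (forall i, len q i <= 4 * Cr ^ 2 * r -> len' o i <= m) ->
  exp (u q) ^ 2 <= low_const * m ^ 2 / r ^ 2.
Proof.
  intros Hq Hqa Hm Hin.
  assert (Hr0 : 0 < r) by (pose proof (te_pos _ _ _ _ G _ _ _ Hq); lra).
  destruct (ball_list (psi q) (4 * Cr ^ 2 * r)) as (Z & HN & HZ).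
  pose proof (sup_estimate F psi kappa eps u A c1 C1 M G HL q qa qb r Z Hq Hqa HN HZ (fun z _ => Hcov z)) as H.
  assert (Hs : se_sum F psi u Z <= exp M * (6400 / kappa ^ 6 * m ^ 2)).
  { unfold se_sum. apply Rle_trans with (exp M * lsum (Tri F Z) (fun f => len' (fst (fst f)) (snd (fst f)) ^ 2)).
    - rewrite <- lsum_scal. apply lsum_le. intros [[i j] k] Hf. apply in_Tri in Hf.
      apply weighted_len. exists k. tauto.
    - apply Rmult_le_compat_l; [left; apply exp_pos|].
      apply (packing F psi' kappa eps G' (Tri F Z) (psi' o) m); [now apply NoDup_Tri|auto|].
      intros i j k Hf. apply in_Tri in Hf. destruct Hf as (Hf & X1 & X2 & X3).
      repeat split; auto; apply Hin; now apply HZ. }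
  apply Rle_trans with (1 := H).
  assert (HP : 0 < 6400 / kappa ^ 6) by (apply Rdiv_lt_0_compat; [lra|now apply pow_lt]).
  assert (HC : 1 <= Cr ^ 2) by (apply pow_R1_Rle; auto).
  apply Rle_trans with (sup_const kappa eps c1 C1 M / r ^ 2 * (exp M * (6400 / kappa ^ 6 * (Cr ^ 2 * m ^ 2)))).
  - apply Rmult_le_compat_l.
    + apply Rmult_le_pos; [apply sup_const_nonneg|]. left. apply Rinv_0_lt_compat, pow_lt; auto.
    + apply Rle_trans with (1 := Hs). apply Rmult_le_compat_l; [left; apply exp_pos|].
      apply Rmult_le_compat_l; [lra|]. pose proof (pow2_ge_0 m). nra.
  - right. unfold low_const. field. lra.
Qed.

(** With more shells than [shell_count] permits, the image distance of [q] cannot reach the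
    outermost one. *)
Lemma modulus_bound : exists Lam, 1 <= Lam /\ forall o oa ob r a0 q, F o oa ob -> len o oa <= r -> len' o oa <= a0 ->
  (exists i, conn F (fun i => len' o i <= a0) o i /\ r < len o i) -> len o q <= r -> len' o q <= Lam * a0.
Proof.
  set (K := shell_const kappa eps * (6400 / kappa ^ 6 * (3 * Cr) ^ 2)).
  destruct (nfloor_ex (Rabs K + 1)) as [N HN0]; [pose proof (Rabs_pos K); lra|].
  assert (HNK : K < INR N) by (pose proof (Rle_abs K); lra).
  exists (shell_ratio kappa eps ^ (2 * N)). split.
  { apply pow_R1_Rle. unfold shell_ratio. pose proof (star_const_pos kappa eps).
    assert (0 < / sep_const kappa eps) by (apply Rinv_0_lt_compat, (sep_const_pos F psi kappa eps G)). lra. }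
  intros o oa ob r a0 q Ho Hr Ha Hc Hq. apply Rnot_lt_le. intros Hlt.
  destruct (ball_list (psi o) (Cr * (3 * r))) as (Z & HN & HZ).
  pose proof (shell_count F psi psi' kappa eps G G' Hcov o oa ob q r a0 N Z Ho Hr Ha HN HZ Hc Hq (Rlt_le _ _ Hlt)) as H.
  fold K in H. lra.
Qed.

(** At large scale around a fixed [o], the image of a disc of radius [r] is at most of size [Cb * r]
    and its triangles fill an image disc of size [ep * r]. The failure of either would, through
    [dichotomy] and the pointwise bounds, contradict the value of [u o]. The two inclusions, applied
    at scales large enough to contain an arbitrary [q], bound [u q] from both sides. *)
Lemma factor_bounded : exists Bd, forall q, - Bd <= u q <= Bd.
Proof.
  destruct (classic (exists v : V, True)) as [[o _]|Hv0].
  2:{ exists 0. intros q. exfalso. apply Hv0. now exists q. }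
  pose proof HS as (_ & _ & Hv & _). destruct (Hv o) as (oa & ob & Ho).
  destruct modulus_bound as (Lam & HLam & Hmod).
  pose proof low_const_nonneg as HK. set (K := low_const) in *.
  assert (HC : 1 <= Cr ^ 2) by (apply pow_R1_Rle; auto).
  set (c4 := 4 * Cr ^ 2) in *. assert (Hc4 : 4 <= c4) by (unfold c4; lra).
  assert (Hl0 := te_pos _ _ _ _ G _ _ _ Ho). assert (Hl0' := te_pos _ _ _ _ G' _ _ _ Ho).
  assert (HKK : forall e, 0 < e -> K * e ^ 2 / (K + 1) ^ 2 < e ^ 2).
  { intros e He. assert (He2 : 0 < e ^ 2) by now apply pow_lt.
    assert (HK1 : 0 < (K + 1) ^ 2) by (apply pow_lt; lra).
    apply Rmult_lt_reg_r with ((K + 1) ^ 2); auto. unfold Rdiv. rewrite Rmult_assoc, Rinv_l by lra. nra. }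
  set (e := exp (- u o)). assert (He : 0 < e) by apply exp_pos.
  (* Chosen so that filling the image disc of radius [D * r] would make the lower estimate at [o]
     read [e^2 <= K e^2 / (K + 1)^2]. *)
  set (D := c4 * (K + 1) / e). assert (HD : 0 < D) by (apply Rdiv_lt_0_compat; nra).
  set (r0 := Rmax (len o oa) (len' o oa * c4 / D)).
  assert (Hr0 : len o oa <= r0 /\ len' o oa * c4 / D <= r0) by (split; [apply Rmax_l|apply Rmax_r]).
  set (Cb := Lam * (Cr * D)). assert (HCb : 0 < Cb) by (unfold Cb; apply Rmult_lt_0_compat; nra).
  (* Filling being impossible, [dichotomy] yields the connected set needed by the length-area
     bound. *)
  assert (Hgrow : forall r q, r0 <= r -> len o q <= r -> len' o q <= Cb * r).
  { intros r q Hr Hq. set (rho := D * r). assert (Hrp : 0 < r) by lra.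
    assert (Hoa : len' o oa <= rho / c4).
    { apply Rmult_le_reg_r with (c4 / D); [apply Rdiv_lt_0_compat; lra|].
      replace (rho / c4 * (c4 / D)) with r by (unfold rho; field; lra). unfold Rdiv in *. lra. }
    assert (Hoa2 : rho / c4 <= rho).
    { apply Rmult_le_reg_r with c4; [lra|]. replace (rho / c4 * c4) with rho by (field; lra).
      assert (0 < rho) by (unfold rho; nra). nra. }
    destruct (dichotomy o oa ob r rho Ho ltac:(lra) ltac:(lra)) as [Hc|Hc].
    - pose proof (Hmod o oa ob r (Cr * rho) q Ho ltac:(lra)) as Hm.
      assert (len' o oa <= Cr * rho) by nra. specialize (Hm ltac:(auto) Hc Hq).
      unfold Cb. unfold rho in Hm. lra.
    - exfalso. pose proof (lower_bound o oa ob r rho o oa ob (rho / c4) Ho ltac:(lra) Hc Ho Hoa) as Hlb.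
      assert (Hin : len' o o + 4 * Cr ^ 2 * (rho / c4) <= rho).
      { rewrite dst_refl. fold c4. right. field. lra. }
      specialize (Hlb Hin). fold e in Hlb. fold K in Hlb.
      replace (K * r ^ 2 / (rho / c4) ^ 2) with (K * e ^ 2 / (K + 1) ^ 2) in Hlb
        by (unfold rho, D; field; repeat split; lra).
      pose proof (HKK e He). lra. }
  set (U := K * (Cb * (1 + c4)) ^ 2).
  assert (Hup : forall q, exp (u q) ^ 2 <= U).
  { intros q. destruct (Hv q) as (qa & qb & Hq). assert (Hlq := te_pos _ _ _ _ G _ _ _ Hq).
    set (r := Rmax r0 (Rmax (len o q) (len q qa))).
    assert (R1 : r0 <= r) by apply Rmax_l.
    assert (R2 : len o q <= r) by (eapply Rle_trans; [apply Rmax_l|apply Rmax_r]).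
    assert (R3 : len q qa <= r) by (eapply Rle_trans; [apply Rmax_r|apply Rmax_r]).
    assert (Hrp : 0 < r) by lra.
    pose proof (upper_bound o q qa qb r (Cb * ((1 + c4) * r)) Hq R3) as Hub.
    assert (Hpos : 0 < Cb * ((1 + c4) * r)) by (apply Rmult_lt_0_compat; nra).
    specialize (Hub Hpos). fold K in Hub.
    replace (K * (Cb * ((1 + c4) * r)) ^ 2 / r ^ 2) with U in Hub by (unfold U; field; lra).
    apply Hub. intros i Hi. fold c4 in Hi. apply Hgrow; [nra|].
    pose proof (dst_tri (psi o) (psi q) (psi i)). lra. }
  set (f := exp (u o)). assert (Hf : 0 < f) by apply exp_pos.
  (* The dual choice: if the image of the disc had size [Lam * Cr * ep * s], the upper estimate at
     [o] would read [f^2 <= K f^2 / (K + 1)^2]. *)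
  set (ep := f / (Lam * Cr * c4 * (K + 1))).
  assert (Hden : 0 < Lam * Cr * c4 * (K + 1)).
  { apply Rmult_lt_0_compat; [|lra]. apply Rmult_lt_0_compat; [|lra]. nra. }
  assert (Hep : 0 < ep) by now apply Rdiv_lt_0_compat.
  assert (Hfill : forall s, len o oa * c4 <= s -> len' o oa / ep <= s ->
    forall z, dst (psi' o) z <= ep * s -> exists i j k, F i j k /\ T' i j k z /\ len o i <= s).
  { intros s Hs1 Hs2. assert (Hs0 : 0 < s) by nra.
    assert (Hoa : len' o oa <= ep * s).
    { apply Rmult_le_reg_r with (/ ep); [now apply Rinv_0_lt_compat|].
      replace (ep * s * / ep) with s by (field; lra). exact Hs2. }
    destruct (dichotomy o oa ob s (ep * s) Ho ltac:(nra) Hoa) as [Hc|Hc]; auto.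
    exfalso.
    assert (Hm : forall i, len o i <= s -> len' o i <= Lam * (Cr * (ep * s))).
    { intros i Hi. apply (Hmod o oa ob s (Cr * (ep * s)) i Ho); auto; nra. }
    assert (Hs4 : len o oa <= s / c4).
    { apply Rmult_le_reg_r with c4; [lra|]. replace (s / c4 * c4) with s by (field; lra). auto. }
    pose proof (upper_bound o o oa ob (s / c4) (Lam * (Cr * (ep * s))) Ho Hs4) as Hub.
    assert (Hpos : 0 < Lam * (Cr * (ep * s))).
    { apply Rmult_lt_0_compat; [lra|]. apply Rmult_lt_0_compat; [lra|]. now apply Rmult_lt_0_compat. }
    specialize (Hub Hpos). fold K f in Hub.
    replace (K * (Lam * (Cr * (ep * s))) ^ 2 / (s / c4) ^ 2) with (K * f ^ 2 / (K + 1) ^ 2) in Hub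
      by (unfold ep; field; repeat split; lra).
    pose proof (HKK f Hf).
    assert (f ^ 2 <= K * f ^ 2 / (K + 1) ^ 2); [|lra].
    apply Hub. intros i Hi. fold c4 in Hi. apply Hm.
    replace (c4 * (s / c4)) with s in Hi by (field; lra). auto. }
  set (Lw := K * (2 * c4 / ep) ^ 2).
  assert (Hdn : forall q, exp (- u q) ^ 2 <= Lw).
  { intros q. destruct (Hv q) as (qa & qb & Hq). assert (Hlq := te_pos _ _ _ _ G' _ _ _ Hq).
    set (s := Rmax (Rmax (len o oa * c4) (len' o oa / ep)) (Rmax (2 * len' o q / ep) (2 * c4 * len' q qa / ep))).
    assert (S1 : len o oa * c4 <= s) by (eapply Rle_trans; [apply Rmax_l|apply Rmax_l]).
    assert (S2 : len' o oa / ep <= s) by (eapply Rle_trans; [apply Rmax_r|apply Rmax_l]).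
    assert (S3 : 2 * len' o q / ep <= s) by (eapply Rle_trans; [apply Rmax_l|apply Rmax_r]).
    assert (S4 : 2 * c4 * len' q qa / ep <= s) by (eapply Rle_trans; [apply Rmax_r|apply Rmax_r]).
    assert (Hs0 : 0 < s) by nra.
    assert (Hx : forall x, x / ep <= s -> x <= ep * s).
    { intros x H. apply Rmult_le_compat_l with (r := ep) in H; [|lra].
      replace (ep * (x / ep)) with x in H by (field; lra). auto. }
    apply Hx in S3. apply Hx in S4.
    assert (Hqa : len' q qa <= ep * s / (2 * c4)).
    { apply Rmult_le_reg_l with (2 * c4); [lra|]. replace (2 * c4 * (ep * s / (2 * c4))) with (ep * s) by (field; lra). auto. }
    pose proof (lower_bound o oa ob s (ep * s) q qa qb (ep * s / (2 * c4)) Ho ltac:(nra) (Hfill s S1 S2) Hq Hqa) as Hlb.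
    fold c4 K in Hlb.
    replace (c4 * (ep * s / (2 * c4))) with (ep * s / 2) in Hlb by (field; lra).
    specialize (Hlb ltac:(lra)).
    replace (K * s ^ 2 / (ep * s / (2 * c4)) ^ 2) with Lw in Hlb by (unfold Lw; field; repeat split; lra).
    exact Hlb. }
  assert (Hln : forall x Y, exp x ^ 2 <= Y -> x <= ln (Y + 1)).
  { intros x Y H. pose proof (exp_pos x) as Hx. 
    destruct (Rle_lt_dec x 0) as [H0|H0].
    - apply Rle_trans with 0; auto. rewrite <- ln_1. apply ln_le; [lra|]. pose proof (pow2_ge_0 (exp x)). lra.
    - rewrite <- (ln_exp x). apply ln_le; auto. pose proof (exp_ineq1_le x). nra. }
  exists (Rmax (ln (U + 1)) (ln (Lw + 1))). intros q.
  pose proof (Hln (u q) U (Hup q)). pose proof (Hln (- u q) Lw (Hdn q)).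
  pose proof (Rmax_l (ln (U + 1)) (ln (Lw + 1))). pose proof (Rmax_r (ln (U + 1)) (ln (Lw + 1))). lra.
Qed.

End Rigidity.

(** * A Liouville theorem *)

Lemma esum_sub {V : Type} (F : V -> V -> V -> Prop) Z Z' (P : V -> Prop) (g : V -> V -> R) :
  NoDup Z' -> incl Z' Z -> (forall i, In i Z' -> P i) -> (forall i j, 0 <= g i j) ->
  esum F Z' g <= esum F Z (fun i j => ind (P i) * ind (P j) * g i j).
Proof.
  intros HN HI HP Hg. rewrite !esum_list.
  rewrite (lsum_ext (list_prod Z' Z') _
    (fun ij => ind (is_edge F (fst ij) (snd ij)) * (ind (P (fst ij)) * ind (P (snd ij)) * g (fst ij) (snd ij)))).
  - apply lsum_incl_le.
    + now apply NoDup_list_prod.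
    + intros [i j] H. apply in_prod_iff in H. apply in_prod_iff. split; apply HI; tauto.
    + intros [i j] _. simpl. pose proof (ind_bounds (is_edge F i j)). pose proof (ind_bounds (P i)).
      pose proof (ind_bounds (P j)). repeat apply Rmult_le_pos; auto; lra.
  - intros [i j] H. apply in_prod_iff in H. simpl. rewrite !(ind_true (P _)) by (apply HP; tauto). ring.
Qed.

(* Otherwise [S] would grow at least linearly, by [S 0 ^ 2 / K] at each step. *)
Lemma bounded_growth (S : nat -> R) (K B : R) : 0 < K -> (forall n, 0 <= S n <= B) ->
  (forall n, S n ^ 2 <= K * (S (n + 1)%nat - S n)) -> S 0%nat = 0.
Proof.
  intros HK HB HS.
  destruct (Req_dec (S 0%nat) 0) as [E|E]; auto. exfalso.
  assert (H0 : 0 < S 0%nat) by (specialize (HB 0%nat); lra).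
  set (s := S 0%nat) in *.
  assert (Hs : 0 < s ^ 2 / K) by (apply Rdiv_lt_0_compat; auto; now apply pow_lt).
  assert (Hn : forall n, s + INR n * (s ^ 2 / K) <= S n).
  { induction n as [|n IH].
    - simpl INR. unfold s. lra.
    - rewrite S_INR. replace (Datatypes.S n) with (n + 1)%nat by lia.
      pose proof (pos_INR n) as Hp. specialize (HS n).
      assert (s <= S n) by nra.
      assert (Hq : s ^ 2 <= S n ^ 2) by (apply pow_incr; lra).
      assert (s ^ 2 / K <= S (n + 1)%nat - S n); [|lra].
      apply Rmult_le_reg_l with K; auto. replace (K * (s ^ 2 / K)) with (s ^ 2) by (field; lra). lra. }
  destruct (INR_unbounded (B / (s ^ 2 / K))) as [n Hb].
  specialize (Hn n). pose proof (proj2 (HB n)).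
  apply Rmult_lt_compat_r with (r := s ^ 2 / K) in Hb; auto.
  replace (B / (s ^ 2 / K) * (s ^ 2 / K)) with B in Hb by (field; split; lra). lra.
Qed.

Section Liouville.
Context {V : Type} (F : V -> V -> V -> Prop) (psi : V -> C) (kappa eps : R).
Context (v : V -> R) (A : V -> V -> R) (c1 C1 M Bd : R).
Hypothesis G : fat_triangulation F psi kappa eps.
Hypothesis Hfin : forall r, exists L : list V, forall i, dst 0 (psi i) <= r -> In i L.
Hypothesis HL : elliptic F v A c1 C1 M.
Hypothesis HB : forall q, - Bd <= v q <= Bd.
Implicit Types (i j k p q : V).

Notation len i j := (dst (psi i) (psi j)).
Notation Cr := (reach_const kappa eps).
Notation energy Z := (esum F Z (fun i j => (v i - v j) ^ 2)).

Let HS := te_surf _ _ _ _ G.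
Let Fs i j k : F i j k -> F j i k := F_swap12 F HS i j k.
Let K0 : 0 < kappa := te_kappa _ _ _ _ G.
Let Cr1 : 1 <= Cr := reach_const_ge1 F psi kappa eps G.
Let K := cacc0 c1 C1 M.
Let area := 6400 / kappa ^ 6 * (2 * Cr) ^ 2.
Let lo := exp (- Bd) ^ 2.
Let hi := exp Bd ^ 2.

Lemma cacc0_pos : 0 < cacc0 c1 C1 M.
Proof.
  unfold cacc0. pose proof (el_c _ _ _ _ _ _ HL). pose proof (el_C _ _ _ _ _ _ HL).
  pose proof (exp_pos (2 * M)). pose proof (exp_pos (- (2 * M))).
  apply Rdiv_lt_0_compat; [|now apply Rmult_lt_0_compat].
  apply Rdiv_lt_0_compat; [|lra]. apply Rmult_lt_0_compat; lra.
Qed.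

Let Kp : 0 < K := cacc0_pos.

(** With a cutoff between [r] and [2 * r], the energy of the cutoff is bounded independently of [r].
    Caccioppoli's inequality then bounds the energy in the disc. For the second estimate the error
    term of [caccioppoli0] vanishes on edges inside the disc, where the cutoff is 1, so
    Cauchy-Schwarz bounds it by the energy of the remaining edges of [Z']. *)
Lemma energy_estimates o a b r Z Z' : F o a b -> len o a <= r ->
  NoDup Z -> (forall i, In i Z <-> len o i <= r) ->
  NoDup Z' -> (forall i, In i Z' <-> len o i <= 2 * Cr * r) ->
  energy Z <= K ^ 2 * hi * area / lo /\
  energy Z ^ 2 <= K ^ 2 * hi ^ 2 * area / lo ^ 2 * (energy Z' - energy Z).
Proof.
  intros Ho Hr HN HZ HN' HZ'.
  assert (Hr0 : 0 < r) by (pose proof (te_pos _ _ _ _ G _ _ _ Ho); lra).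
  assert (Hlo : 0 < lo) by (apply pow_lt, exp_pos).
  assert (Hhi : 0 < hi) by (apply pow_lt, exp_pos).
  pose proof Kp as HK.
  assert (Hmono : forall s t, s <= t -> exp s ^ 2 <= exp t ^ 2).
  { intros s t Hst. apply pow_incr. split; [left; apply exp_pos|].
    destruct Hst as [Hst| ->]; [left; now apply exp_increasing|lra]. }
  assert (Hexp : forall i, lo <= exp (v i) ^ 2 <= hi)
    by (intros i; specialize (HB i); split; apply Hmono; lra).
  set (eta := fun i => cutoff (psi o) r (psi i)).
  destruct (cutoff_facts (psi o) r Hr0) as (E0 & E1 & E2 & E3).
  assert (Hsup : forall i, eta i <> 0 -> forall j k, F i j k -> In j Z').
  { intros i Hi j k Hf. apply HZ'. apply E2 in Hi.
    replace (2 * Cr * r) with (Cr * (2 * r)) by ring.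
    apply (star_reach3 F psi kappa eps G o a b (2 * r) i j k); auto. lra. }
  assert (Heta1 : forall i, eta i <= 1).
  { intros i. unfold eta, cutoff. apply Rmax_lub; [lra|apply Rmin_l]. }
  assert (Heta0 : forall i, 0 <= eta i) by (intros i; apply E0).
  set (W := esum F Z' (fun i j => (eta i - eta j) ^ 2)).
  assert (HW : W <= area).
  { apply Rle_trans with (lsum (Tri F Z') (fun f => / r ^ 2 * len (fst (fst f)) (snd (fst f)) ^ 2)).
    - apply (esum_le_Tri F Z' _ (fun i j => / r ^ 2 * len i j ^ 2)).
      + intros i j. apply Rmult_le_pos; [left; apply Rinv_0_lt_compat, pow_lt; auto|apply pow2_ge_0].
      + intros i j Hi Hj [k Hk]. destruct (Req_dec (eta i - eta j) 0) as [E|E].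
        * left. rewrite E. lra.
        * right. split.
          -- exists k. split; auto. destruct (Req_dec (eta i) 0) as [Ei|Ei].
             ++ apply (Hsup j) with (k := i); [intros Ej; apply E; lra|].
                apply (F_swap23 F HS). auto.
             ++ apply (Hsup i) with (k := j); auto. apply (F_swap23 F HS). auto.
          -- specialize (E3 (psi i) (psi j)). unfold eta. lra.
    - rewrite lsum_scal.
      apply Rle_trans with (/ r ^ 2 * (6400 / kappa ^ 6 * (2 * Cr * r) ^ 2)).
      + apply Rmult_le_compat_l; [left; apply Rinv_0_lt_compat, pow_lt; auto|].
        apply (packing F psi kappa eps G (Tri F Z') (psi o) (2 * Cr * r)); [now apply NoDup_Tri|nra|].
        intros i j k Hf. apply in_Tri in Hf. destruct Hf as (Hf & X1 & X2 & X3).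
        repeat split; auto; now apply HZ'.
      + right. unfold area. field. split; lra. }
  set (N := fun i => len o i <= r).
  assert (Hsub : energy Z <= esum F Z' (fun i j => ind (N i) * ind (N j) * (v i - v j) ^ 2)).
  { apply esum_sub; auto.
    - intros i Hi. apply HZ', Rle_trans with r; [now apply HZ|nra].
    - intros i Hi. now apply HZ.
    - intros. apply pow2_ge_0. }
  set (I := esum F Z' (fun i j => ind (N i) * ind (N j) * (v i - v j) ^ 2)) in *.
  set (X := esum F Z' (fun i j => (v i - v j) ^ 2 * (eta i ^ 2 + eta j ^ 2) * exp (v i) ^ 2)).
  assert (HX : 2 * lo * I <= X).
  { unfold I, X. rewrite <- esum_scal. apply esum_le. intros i j _ _ _.
    pose proof (pow2_ge_0 (v i - v j)) as P1. pose proof (proj1 (Hexp i)) as P2.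
    assert (P3 : 2 * (ind (N i) * ind (N j)) <= eta i ^ 2 + eta j ^ 2).
    { destruct (classic (N i)) as [Hi|Hi], (classic (N j)) as [Hj|Hj];
        rewrite ?(ind_true (N i)), ?(ind_true (N j)), ?(ind_false (N i)), ?(ind_false (N j)) by auto;
        try (pose proof (pow2_ge_0 (eta i)); pose proof (pow2_ge_0 (eta j)); lra).
      unfold eta. rewrite !E1 by auto. lra. }
    assert (P4 : 0 <= ind (N i) * ind (N j))
      by (apply Rmult_le_pos; apply ind_bounds).
    replace (2 * lo * (ind (N i) * ind (N j) * (v i - v j) ^ 2))
      with ((v i - v j) ^ 2 * (2 * (ind (N i) * ind (N j))) * lo) by ring.
    apply Rmult_le_compat; try lra.
    - apply Rmult_le_pos; lra.
    - apply Rmult_le_compat_l; lra. }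
  assert (Hen : 0 <= energy Z).
  { rewrite esum_list. apply lsum_nonneg. intros ij _. apply Rmult_le_pos; [apply ind_bounds|apply pow2_ge_0]. }
  split.
  - pose proof (caccioppoli F v A c1 C1 M HL Z' eta HN' Heta0 Hsup) as Hc. fold X K in Hc.
    assert (HY : esum F Z' (fun i j => (eta i - eta j) ^ 2 * exp (v i) ^ 2) <= hi * W).
    { unfold W. rewrite <- esum_scal. apply esum_le. intros i j _ _ _.
      pose proof (pow2_ge_0 (eta i - eta j)). pose proof (Hexp i). nra. }
    assert (HY2 : K ^ 2 * esum F Z' (fun i j => (eta i - eta j) ^ 2 * exp (v i) ^ 2) <= K ^ 2 * (hi * area)).
    { apply Rmult_le_compat_l; [apply pow2_ge_0|]. nra. }
    apply Rmult_le_reg_l with lo; auto. replace (lo * (K ^ 2 * hi * area / lo)) with (K ^ 2 * (hi * area)) by (field; lra).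
    nra.
  - pose proof (caccioppoli0 F v A c1 C1 M HL Z' eta HN' Heta0 Hsup) as Hc. fold X K in Hc.
    (* The factor [1 - ind (N i) * ind (N j)] restricts to edges that are not inside the smaller
       disc. *)
    set (g := fun i j => (1 - ind (N i) * ind (N j)) * Rabs (v i - v j)).
    set (h := fun i j => 2 * Rabs (eta i - eta j)).
    set (Q := esum F Z' (fun i j => g i j * h i j)).
    assert (HQ : esum F Z' (fun i j => Rabs (v i - v j) * Rabs (eta i ^ 2 - eta j ^ 2) * exp (v i) ^ 2) <= hi * Q).
    { unfold Q. rewrite <- esum_scal. apply esum_le. intros i j _ _ _.
      pose proof (Rabs_pos (v i - v j)) as P1.
      assert (P2 : Rabs (v i - v j) * Rabs (eta i ^ 2 - eta j ^ 2) <= g i j * h i j).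
      { unfold g, h.
        assert (P3 : Rabs (eta i ^ 2 - eta j ^ 2) <= 2 * Rabs (eta i - eta j)).
        { replace (eta i ^ 2 - eta j ^ 2) with ((eta i + eta j) * (eta i - eta j)) by ring.
          rewrite Rabs_mult. apply Rmult_le_compat_r; [apply Rabs_pos|].
          rewrite Rabs_pos_eq; [pose proof (Heta1 i); pose proof (Heta1 j)|pose proof (Heta0 i); pose proof (Heta0 j)]; lra. }
        assert (P4 : Rabs (v i - v j) * Rabs (eta i ^ 2 - eta j ^ 2) <= Rabs (v i - v j) * (2 * Rabs (eta i - eta j)))
          by (apply Rmult_le_compat_l; auto).
        destruct (classic (N i)) as [Hi|Hi]; [destruct (classic (N j)) as [Hj|Hj]|].
        - rewrite !ind_true by auto. unfold eta. rewrite !E1 by auto. rewrite !Rminus_diag, Rabs_R0. lra.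
        - rewrite (ind_false _ Hj). lra.
        - rewrite (ind_false _ Hi). lra. }
      assert (0 <= Rabs (v i - v j) * Rabs (eta i ^ 2 - eta j ^ 2)) by (apply Rmult_le_pos; apply Rabs_pos).
      rewrite (Rmult_comm hi). apply Rmult_le_compat; auto; try apply pow2_ge_0. apply Hexp. }
    assert (HQ2 : Q ^ 2 <= (energy Z' - energy Z) * (4 * area)).
    { unfold Q. eapply Rle_trans; [apply esum_CS|].
      assert (Eg : esum F Z' (fun i j => g i j ^ 2) + I <= energy Z').
      { unfold I. rewrite <- esum_plus. apply esum_le. intros i j _ _ _. unfold g.
        rewrite Rpow_mult_distr, pow2_abs.
        destruct (classic (N i)) as [Hi|Hi]; [destruct (classic (N j)) as [Hj|Hj]|].
        - rewrite !ind_true by auto. lra.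
        - rewrite (ind_false _ Hj). lra.
        - rewrite (ind_false _ Hi). lra. }
      assert (Eh : esum F Z' (fun i j => h i j ^ 2) <= 4 * area).
      { apply Rle_trans with (4 * W); [|lra]. unfold W. rewrite <- esum_scal. apply esum_le. intros i j _ _ _.
        unfold h. rewrite Rpow_mult_distr, pow2_abs. lra. }
      apply Rmult_le_compat; try lra;
        rewrite esum_list; apply lsum_nonneg; intros ij _; (apply Rmult_le_pos; [apply ind_bounds|apply pow2_ge_0]). }
    assert (H1 : 2 * lo * energy Z <= K * (hi * Q)).
    { apply Rle_trans with X; [|apply Rle_trans with (1 := Hc); apply Rmult_le_compat_l; lra].
      apply Rle_trans with (2 := HX). apply Rmult_le_compat_l; lra. }
    assert (H2 : (2 * lo * energy Z) ^ 2 <= (K * (hi * Q)) ^ 2).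
    { apply pow_incr. split; auto. apply Rmult_le_pos; lra. }
    apply Rmult_le_reg_l with (4 * lo ^ 2); [pose proof (pow_lt lo 2 Hlo); lra|].
    replace (4 * lo ^ 2 * (K ^ 2 * hi ^ 2 * area / lo ^ 2 * (energy Z' - energy Z)))
      with (K ^ 2 * hi ^ 2 * ((energy Z' - energy Z) * (4 * area))) by (field; lra).
    replace (4 * lo ^ 2 * energy Z ^ 2) with ((2 * lo * energy Z) ^ 2) by ring.
    apply Rle_trans with (1 := H2). replace ((K * (hi * Q)) ^ 2) with (K ^ 2 * hi ^ 2 * Q ^ 2) by ring.
    apply Rmult_le_compat_l; auto. apply Rmult_le_pos; apply pow2_ge_0.
Qed.

(** Apply the energy estimates to the discs of radius [(2 Cr)^n * len o a] about [o]. The energy of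
    the one for [n = 0], which contains the edge [oa], is then zero. *)
Theorem liouville : forall i j, v i = v j.
Proof.
  assert (Hedge : forall o a, is_edge F o a -> v o = v a).
  { intros o a [b Ho].
    assert (Hl : 0 < len o a) by exact (te_pos _ _ _ _ G _ _ _ Ho).
    set (r := fun n => (2 * Cr) ^ n * len o a).
    assert (Hball : forall n, exists Z, NoDup Z /\ forall i, In i Z <-> len o i <= r n)
      by (intros n; apply (ball_list psi Hfin)).
    set (Z := fun n => proj1_sig (constructive_indefinite_description _ (Hball n))).
    assert (HZ : forall n, NoDup (Z n) /\ forall i, In i (Z n) <-> len o i <= r n)
      by (intros n; unfold Z; destruct (constructive_indefinite_description _ (Hball n)); auto).
    assert (Hr : forall n, len o a <= r n).
    { intros n. unfold r. assert (1 <= (2 * Cr) ^ n) by (apply pow_R1_Rle; lra). nra. }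
    assert (Hest : forall n, energy (Z n) <= K ^ 2 * hi * area / lo /\
      energy (Z n) ^ 2 <= K ^ 2 * hi ^ 2 * area / lo ^ 2 * (energy (Z (n + 1)%nat) - energy (Z n))).
    { intros n. destruct (HZ n) as [Z1 Z2]. destruct (HZ (n + 1)%nat) as [Z3 Z4].
      apply (energy_estimates o a b (r n)); auto. intros i. rewrite Z4.
      replace (r (n + 1)%nat) with (2 * Cr * r n); [tauto|]. unfold r. rewrite pow_add. ring. }
    assert (Hen : forall n, 0 <= energy (Z n)).
    { intros n. rewrite esum_list. apply lsum_nonneg. intros ij _. apply Rmult_le_pos; [apply ind_bounds|apply pow2_ge_0]. }
    assert (H0 : energy (Z 0%nat) = 0).
    { set (KL := K ^ 2 * hi ^ 2 * area / lo ^ 2) in *.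
      assert (Hlo : 0 < lo ^ 2) by (apply pow_lt, pow_lt, exp_pos).
      assert (HKL : 0 < KL).
      { assert (0 < kappa ^ 6) by now apply pow_lt.
        assert (0 < hi ^ 2) by (apply pow_lt, pow_lt, exp_pos).
        assert (0 < area) by (apply Rmult_lt_0_compat; [apply Rdiv_lt_0_compat; lra|apply pow_lt; lra]).
        apply Rdiv_lt_0_compat; auto. pose proof (pow_lt K 2 Kp). apply Rmult_lt_0_compat; nra. }
      apply (bounded_growth (fun n => energy (Z n)) KL (K ^ 2 * hi * area / lo)); auto.
      - intros n. split; [apply Hen|apply Hest].
      - intros n. apply Hest. }
    assert (H1 : (v o - v a) ^ 2 <= energy (Z 0%nat)).
    { rewrite esum_list.
      set (g := fun ij : V * V => ind (is_edge F (fst ij) (snd ij)) * (v (fst ij) - v (snd ij)) ^ 2).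
      replace ((v o - v a) ^ 2) with (g (o, a)) by (unfold g; simpl fst; simpl snd; rewrite ind_true by (exists b; auto); ring).
      apply (lsum_In_le _ g).
      - intros ij _. apply Rmult_le_pos; [apply ind_bounds|apply pow2_ge_0].
      - apply in_prod_iff. split; apply HZ; [rewrite dst_refl; specialize (Hr 0%nat); lra|auto]. }
    pose proof (pow2_ge_0 (v o - v a)). nra. }
  pose proof HS as (_ & _ & _ & _ & _ & _ & Hconn).
  intros i j. induction (Hconn i j) as [|i k j He _ IH]; auto. now rewrite (Hedge _ _ He).
Qed.

End Liouville.

(** * Fatness from the angle bound *)

(** Twice the area is the product of two sides and the sine of the angle; the last hypothesis makes
    the angle at most [PI / 2], so its sine is at least [sin eps]. The argument works with squares,
    because the triangle is not yet known to be nondegenerate. *)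
Lemma corner_fat {V : Type} (psi : V -> C) (eps : R) (i j k : V) : 0 < eps <= 1 ->
  0 < dst (psi i) (psi j) -> 0 < dst (psi i) (psi k) ->
  eps <= angle (fun a b => dst (psi a) (psi b)) i j k ->
  0 <= dst (psi i) (psi j) ^ 2 + dst (psi i) (psi k) ^ 2 - dst (psi j) (psi k) ^ 2 ->
  sin eps * (dst (psi i) (psi j) * dst (psi i) (psi k)) <= Rabs (crs (psi i) (psi j) (psi k)).
Proof.
  intros He Hj Hk Ha Hd. unfold angle in Ha.
  pose proof (dst_sqr (psi i) (psi j)) as E1. pose proof (dst_sqr (psi i) (psi k)) as E2.
  pose proof (dst_sqr (psi j) (psi k)) as E3.
  set (X := crs (psi i) (psi j) (psi k)).
  assert (HX : 4 * X ^ 2 = 4 * (dst (psi i) (psi j) ^ 2 * dst (psi i) (psi k) ^ 2) -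
    (dst (psi i) (psi j) ^ 2 + dst (psi i) (psi k) ^ 2 - dst (psi j) (psi k) ^ 2) ^ 2).
  { rewrite E1, E2, E3. unfold X, crs. ring. }
  set (a := dst (psi i) (psi j)) in *. set (b := dst (psi i) (psi k)) in *. set (c := dst (psi j) (psi k)) in *.
  set (D := a ^ 2 + b ^ 2 - c ^ 2) in *. clear E1 E2 E3.
  assert (Hab : 0 < 2 * a * b) by nra.
  assert (HD : D <= 2 * a * b).
  { pose proof (pow2_ge_0 X). apply Rnot_lt_le. intros H1. nra. }
  assert (Hq : 0 <= D / (2 * a * b) <= 1).
  { split; [apply Rmult_le_pos; auto; left; now apply Rinv_0_lt_compat|].
    apply Rmult_le_reg_r with (2 * a * b); auto. replace (D / (2 * a * b) * (2 * a * b)) with D by (field; lra). lra. }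
  pose proof PI2_1 as Hpi.
  assert (Hcos : D / (2 * a * b) <= cos eps).
  { pose proof (acos_bound (D / (2 * a * b))).
    rewrite <- (cos_acos (D / (2 * a * b))) by lra. apply cos_decr_1; lra. }
  assert (Hc0 : 0 <= cos eps) by lra.
  assert (HD2 : D <= 2 * a * b * cos eps).
  { replace D with (2 * a * b * (D / (2 * a * b))) at 1 by (field; lra). apply Rmult_le_compat_l; lra. }
  assert (Hs : 0 < sin eps) by (apply sin_gt_0; lra).
  pose proof (sin2_cos2 eps) as Hsc. unfold Rsqr in Hsc.
  assert (HDq : D ^ 2 <= (2 * a * b * cos eps) ^ 2) by (apply pow_incr; lra).
  assert (Hsq : (sin eps * (a * b)) ^ 2 <= Rabs X ^ 2).
  { rewrite pow2_abs.
    assert ((sin eps * (a * b)) ^ 2 = (a * b) ^ 2 - (a * b) ^ 2 * (cos eps * cos eps)); [|nra].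
    replace ((sin eps * (a * b)) ^ 2) with ((sin eps * sin eps) * (a * b) ^ 2) by ring.
    replace (sin eps * sin eps) with (1 - cos eps * cos eps) by lra. ring. }
  pose proof (Rabs_pos X). apply Rnot_lt_le. intros H1. nra.
Qed.

(** Neither angle at the ends of the longest side is obtuse, so [corner_fat] applies to both; the
    two other sides add up to at least the longest. *)
Lemma longest_fat {V : Type} (psi : V -> C) (eps : R) (i j k : V) : 0 < eps <= 1 ->
  0 < dst (psi i) (psi j) -> 0 < dst (psi i) (psi k) -> 0 < dst (psi j) (psi k) ->
  eps <= angle (fun a b => dst (psi a) (psi b)) i j k ->
  eps <= angle (fun a b => dst (psi a) (psi b)) j k i ->
  dst (psi i) (psi k) <= dst (psi i) (psi j) -> dst (psi j) (psi k) <= dst (psi i) (psi j) ->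
  sin eps / 2 * dst (psi i) (psi j) ^ 2 <= Rabs (crs (psi i) (psi j) (psi k)).
Proof.
  intros He P1 P2 P3 A1 A2 L1 L2.
  pose proof (corner_fat psi eps i j k He P1 P2 A1) as C1.
  pose proof (corner_fat psi eps j k i He P3) as C2.
  rewrite (dst_sym (psi j) (psi i)), (dst_sym (psi k) (psi i)), crs_cyc in C2. specialize (C2 P1 A2).
  pose proof (dst_tri (psi i) (psi k) (psi j)) as T. rewrite (dst_sym (psi k)) in T.
  assert (Hs : 0 < sin eps) by (pose proof PI2_1; apply sin_gt_0; lra).
  set (a := dst (psi i) (psi j)) in *. set (b := dst (psi i) (psi k)) in *. set (c := dst (psi j) (psi k)) in *.
  specialize (C1 ltac:(nra)). specialize (C2 ltac:(nra)).
  assert (sin eps * (a * a) <= sin eps * (a * b + c * a)) by (apply Rmult_le_compat_l; nra). nra.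
Qed.

Section Fatness.
Context {V : Type} (F : V -> V -> V -> Prop) (phi : (V -> R) -> C) (eps : R).
Hypothesis HS : surface_triangulation F.
Hypothesis HE : geodesic_embedding F phi.
Hypothesis He : 0 < eps <= 1.
Hypothesis Ha : forall i j k, F i j k -> eps <= angle (induced_metric phi) i j k.

Let psi i := phi (vpt i).

Lemma embedding_edge_pos i j k : F i j k -> 0 < dst (psi i) (psi j).
Proof.
  intros Hf. apply dst_pos. intros E.
  assert (E' : vpt i = vpt j) by (apply (proj1 (proj2 HE)); auto; now apply vertex_in_realization).
  apply (proj1 (F_neq F HS i j k Hf)). pose proof (f_equal (fun x => x i) E') as E0. unfold vpt in E0. simpl in E0.
  destruct (excluded_middle_informative (i = i)); [|tauto]. destruct (excluded_middle_informative (i = j)); auto. lra.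
Qed.

Lemma embedding_fat i j k : F i j k ->
  sin eps / 2 * dst (psi i) (psi j) ^ 2 <= Rabs (crs (psi i) (psi j) (psi k)).
Proof.
  intros Hf.
  assert (Hc := F_cyc F HS i j k Hf). assert (Hc' := F_cyc F HS _ _ _ Hc).
  assert (P1 := embedding_edge_pos _ _ _ Hf). assert (P2 := embedding_edge_pos _ _ _ Hc).
  assert (P3 := embedding_edge_pos _ _ _ Hc').
  assert (A1 := Ha _ _ _ Hf). assert (A2 := Ha _ _ _ Hc). assert (A3 := Ha _ _ _ Hc').
  pose proof (longest_fat psi eps i j k He) as L1. pose proof (longest_fat psi eps j k i He) as L2.
  pose proof (longest_fat psi eps k i j He) as L3.
  rewrite crs_cyc in L2. rewrite <- (crs_cyc (psi k)) in L3.
  rewrite (dst_sym (psi k) (psi i)), (dst_sym (psi j) (psi i)), ?(dst_sym (psi k) (psi j)) in *.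
  specialize (L1 P1 P3 P2 A1 A2). specialize (L2 P2 P1 P3 A2 A3). specialize (L3 P3 P2 P1 A3 A1).
  assert (Hs : 0 < sin eps / 2) by (pose proof PI2_1; assert (0 < sin eps) by (apply sin_gt_0; lra); lra).
  set (a := dst (psi i) (psi j)) in *. set (b := dst (psi j) (psi k)) in *. set (c := dst (psi i) (psi k)) in *.
  assert (Hm : forall x, a <= x -> sin eps / 2 * a ^ 2 <= sin eps / 2 * x ^ 2)
    by (intros x Hx; apply Rmult_le_compat_l; [lra|apply pow_incr; lra]).
  pose proof (Hm b) as M1. pose proof (Hm c) as M2.
  destruct (Rle_lt_dec b a), (Rle_lt_dec c a), (Rle_lt_dec b c); lra.
Qed.

Lemma embedding_nondegenerate i j k : F i j k -> crs (psi i) (psi j) (psi k) <> 0.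
Proof.
  intros Hf E. pose proof (embedding_fat i j k Hf) as H. rewrite E, Rabs_R0 in H.
  pose proof (pow_lt _ 2 (embedding_edge_pos i j k Hf)).
  assert (0 < sin eps) by (pose proof PI2_1; apply sin_gt_0; lra). nra.
Qed.

(** The condition on second faces is combinatorial: it is derived from the homeomorphism [phi] and
    transferred to [phi']. *)
Lemma embedding_fat_triangulation : (forall i j k, F i j k -> exists m, m <> k /\ F i j m) ->
  fat_triangulation F psi (sin eps / 2) eps.
Proof.
  intros H2. constructor; auto.
  - assert (0 < sin eps) by (pose proof PI2_1; apply sin_gt_0; lra). lra.
  - exact embedding_fat.
  - exact embedding_edge_pos.
  - exact (triangles_meet_in_face F phi HS HE embedding_nondegenerate).
  - apply He.
Qed.

End Fatness.

Theorem mainTheorem1 (V : Type) (F : V -> V -> V -> Prop)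
  (phi phi' : (V -> R) -> C) (u : V -> R) :
  surface_triangulation F ->
  geodesic_homeomorphism F phi ->
  geodesic_embedding F phi' ->
  uniformly_nondegenerate F (induced_metric phi) ->
  uniformly_nondegenerate F (induced_metric phi') ->
  uniformly_delaunay F (induced_metric phi) ->
  delaunay F (induced_metric phi') ->
  (forall i j, is_edge F i j ->
     induced_metric phi' i j = conf_change u (induced_metric phi) i j) ->
  forall i j : V, u i = u j.
Proof.
  intros HS HH HE' (e1 & He1 & Ha1) (e2 & He2 & Ha2) (e0 & He0 & HUD) HD Hu.
  (* The cap at 1, which is less than [PI / 2], makes sine and cosine monotone where [corner_fat]
     needs it; a smaller [eps] only weakens the angle bounds. *)
  set (eps := Rmin 1 (Rmin e1 e2)).
  assert (He : 0 < eps <= 1) by (split; [repeat apply Rmin_glb_lt; lra|apply Rmin_l]).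
  assert (eps <= e1 /\ eps <= e2) as [L1 L2]
    by (split; (eapply Rle_trans; [apply Rmin_r|]); [apply Rmin_l|apply Rmin_r]).
  assert (Ha : forall i j k, F i j k -> eps <= angle (induced_metric phi) i j k)
    by (intros i j k Hf; specialize (Ha1 i j k Hf); lra).
  assert (Ha' : forall i j k, F i j k -> eps <= angle (induced_metric phi') i j k)
    by (intros i j k Hf; specialize (Ha2 i j k Hf); lra).
  pose proof (embedding_nondegenerate F phi eps HS (proj1 HH) He Ha) as Hnd.
  pose proof (edge_second_face F phi HS HH Hnd) as H2.
  pose proof (embedding_fat_triangulation F phi eps HS (proj1 HH) He Ha H2) as G.
  pose proof (embedding_fat_triangulation F phi' eps HS HE' He Ha' H2) as G'.
  set (psi := fun i => phi (vpt i)) in *. set (psi' := fun i => phi' (vpt i)) in *.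
  destruct (flux_exists F psi psi' _ eps e0 u G G' Hu He0 HUD HD) as (A & c1 & C1 & X1 & X2 & X3 & X4 & X5 & X6).
  assert (HL : elliptic F u A c1 C1 (ubound (sin eps / 2))).
  { constructor; auto; try (intros; now apply X5).
    intros i j [k Hf]. exact (u_diff_bound F psi psi' _ eps u G G' Hu i j k Hf). }
  pose proof (triangles_cover F phi HS HH Hnd) as Hcov.
  pose proof (vertices_locally_finite F phi HS HH) as Hfin.
  destruct (factor_bounded F psi psi' _ eps u A c1 C1 _ G G' Hcov Hfin HL Hu) as [Bd HB].
  exact (liouville F psi _ eps u A c1 C1 _ Bd G Hfin HL HB).
Qed.
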